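(* Let $\mathbb G=(A,\Delta_A,R)$ be a quasitriangular $C^*$-quantum group. The monoidal structure $\boxtimes_R$ on $\mathfrak{C^*alg}(\mathbb G)$ is braided monoidal (admits a braiding) if and only if it is symmetric monoidal (admits a symmetric braiding), if and only if $R$ is antisymmetric, that is, $R^*=\sigma(R)$. In that case, the braiding is the unique isomorphism of crossed products $(C\boxtimes_R D,\iota_C,\iota_D)\cong(D\boxtimes_R C,\iota_C,\iota_D)$, that is, the unique isomorphism $C\boxtimes_R D\cong D\boxtimes_R C$ intertwining the canonical embeddings of $C$ and of $D$.
   Context: Conventions: $\otimes$ is the minimal $C^*$-tensor product (or Hilbert space tensor product), $\mathcal U(A)$ the unitary group of the multiplier algebra $\mathcal M(A)$, $\sigma$ the flip; a morphism $A\to B$ is a nondegenerate $*$-homomorphism $A\to\mathcal M(B)$; $X\cdot Y$ is the closed linear span of products $xy$; leg numbering notation is used. A $C^*$-quantum group is a pair $(A,\Delta_A)$ obtained from a manageable (in Woronowicz's sense) multiplicative unitary $\mathbb W\in\mathcal U(\mathcal L\otimes\mathcal L)$, $\mathbb W_{23}\mathbb W_{12}=\mathbb W_{12}\mathbb W_{13}\mathbb W_{23}$, on a separable Hilbert space: $A$ is the closed linear span of $\{(\omega\otimes\mathrm{id})\mathbb W:\omega\in\mathbb B(\mathcal L)_*\}$, $\hat A$ the closed linear span of $\{(\mathrm{id}\otimes\omega)\mathbb W\}$; $\mathbb W$ viewed as $W\in\mathcal U(\hat A\otimes A)$ is the reduced bicharacter; $\Delta_A$, $\hat\Delta_A$ are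 the unique morphisms with $(\mathrm{id}\otimes\Delta_A)W=W_{12}W_{13}$, $(\hat\Delta_A\otimes\mathrm{id})W=W_{23}W_{13}$. A corepresentation of $\mathbb G$ on $\mathcal H$ is $U\in\mathcal U(\mathbb K(\mathcal H)\otimes A)$ with $(\mathrm{id}\otimes\Delta_A)U=U_{12}U_{13}$. A (continuous) $\mathbb G$-coaction on a $C^*$-algebra $C$ is an injective morphism $\gamma\colon C\to C\otimes A$ with $(\mathrm{id}_C\otimes\Delta_A)\gamma=(\gamma\otimes\mathrm{id}_A)\gamma$ and $\gamma(C)\cdot(1\otimes A)=C\otimes A$; then $(C,\gamma)$ is a $\mathbb G$-$C^*$-algebra. A morphism $f\colon(C,\gamma)\to(D,\delta)$ is $\mathbb G$-equivariant if $\delta\circ f=(f\otimes\mathrm{id}_A)\circ\gamma$. $\mathfrak{C^*alg}(\mathbb G)$ is the category of $\mathbb G$-$C^*$-algebras and $\mathbb G$-equivariant morphisms. A covariant representation of $(C,\gamma)$ on $\mathcal H$ is a pair $(\varphi,U)$ of a representation $\varphi\colon C\to\mathbb B(\mathcal H)$ and a corepresentation $U$ with $(\varphi\otimes\mathrm{id}_A)\gamma(c)=U(\varphi(c)\otimes1)U^*$; faithful ones always exist. Universal dual: $(\hat A^{u},\hat\Delta^{u})$ comes with $\tilde{\mathcal V}\in\mathcal U(\hat A^{u}\otimes A)$ such that for each corepresentation $U$ of $\mathbb G$ on $\mathcal H$ there is a unique representation $\rho^{\mathcal H}$ of $\hat A^{u}$ with $(\rho^{\mathcal H}\otimes\mathrm{id}_A)\tilde{\mathcal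 V}=U$; $\hat A^{u}$ is the closed linear span of the slices $(\mathrm{id}\otimes\omega)\tilde{\mathcal V}$, $\omega\in A'$; $(\hat\Delta^{u}\otimes\mathrm{id})\tilde{\mathcal V}=\tilde{\mathcal V}_{23}\tilde{\mathcal V}_{13}$; the reducing map $\hat\Lambda\colon\hat A^{u}\to\hat A$ satisfies $(\hat\Lambda\otimes\mathrm{id})\tilde{\mathcal V}=W$. Quasitriangular: we are given a unitary $R\in\mathcal U(\hat A\otimes\hat A)$ with $(\hat\Delta_A\otimes\mathrm{id})R=R_{23}R_{13}$, $(\mathrm{id}\otimes\hat\Delta_A)R=R_{12}R_{13}$ and $R\,(\sigma\circ\hat\Delta_A(x))\,R^*=\hat\Delta_A(x)$ for all $x\in\hat A$. Its universal lift is the unique $R^{u}\in\mathcal U(\hat A^{u}\otimes\hat A^{u})$ with $(\hat\Lambda\otimes\hat\Lambda)R^{u}=R$, $(\hat\Delta^{u}\otimes\mathrm{id})R^{u}=R^{u}_{23}R^{u}_{13}$, $(\mathrm{id}\otimes\hat\Delta^{u})R^{u}=R^{u}_{12}R^{u}_{13}$. Twisted tensor product: for faithful covariant representations $(\varphi,U^{\mathcal H})$, $(\psi,U^{\mathcal K})$ of $(C,\gamma)$, $(D,\delta)$ and $Z:=(\rho^{\mathcal H}\otimes\rho^{\mathcal K})(R^{u})^*$, put $\iota_C(c):=\varphi(c)\otimes1_{\mathcal K}$, $\iota_D(d):=Z(1_{\mathcal H}\otimes\psi(d))Z^*$ and $C\boxtimes_R D:=\iota_C(C)\cdot\iota_D(D)\subseteq\mathbb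 B(\mathcal H\otimes\mathcal K)$, a nondegenerate $C^*$-subalgebra independent, up to isomorphism intertwining $\iota_C,\iota_D$, of the choices. It carries the unique continuous $\mathbb G$-coaction for which $\iota_C,\iota_D$ are $\mathbb G$-equivariant. For equivariant $f,g$, the morphism $f\boxtimes g$ is the unique one with $(f\boxtimes g)\iota_{C_1}=\iota_{C_2}f$, $(f\boxtimes g)\iota_{D_1}=\iota_{D_2}g$. With the unique associators $C_1\boxtimes(C_2\boxtimes C_3)\cong(C_1\boxtimes C_2)\boxtimes C_3$ intertwining the embeddings of $C_1,C_2,C_3$ and unit $\mathbb C$ (trivial coaction, obvious isomorphisms), this is a monoidal structure on $\mathfrak{C^*alg}(\mathbb G)$. *)

(* Defs.v *)
From HB Require Import structures.
From mathcomp Require Import all_boot all_order all_algebra.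
From mathcomp Require Import complex.
From mathcomp Require Import boolp classical_sets functions cardinality reals.
From mathcomp Require Import topology normedtype sequences.

Set Implicit Arguments.
Unset Strict Implicit.
Unset Printing Implicit Defensive.

Import Order.TTheory GRing.Theory Num.Theory numFieldNormedType.Exports.

Local Open Scope classical_set_scope.
Local Open Scope ring_scope.

Definition cplx (R : realType) : numClosedFieldType := R[i].

Section ComplexComplete.
Context {R : realType}.
Local Open Scope complex_scope.

Lemma normc_le_ReIm (z : cplx R) :
  `|z| <= `|complex.Re z|%:C + `|complex.Im z|%:C.
Proof.
rewrite [X in `|X|](@complexE R z) (le_trans (ler_normD _ _))//.
rewrite normrM !normc_def /= !expr0n /= expr1n add0r addr0 sqrtr1 !addr0 mul1r.
by rewrite !sqrtr_sqr.
Qed.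

Lemma normc_ge_Im (z : cplx R) : `|complex.Im z|%:C <= `|z|.
Proof.
rewrite normc_def lecR -sqrtr_sqr ler_sqrt ?addr_ge0 ?sqr_ge0//.
by rewrite lerDr sqr_ge0.
Qed.

Lemma cplx_complete (F : set_system (cplx R)^o) :
  ProperFilter F -> cauchy F -> cvg F.
Proof.
move=> FF /cauchy_ballP Fc.
have part (p : cplx R -> R) : (forall x y, p (x - y) = p x - p y) ->
    (forall z, `|p z|%:C <= `|z|) -> cvg (p @ F).
  move=> pB ple; have pF := fmap_proper_filter p FF.
  suff pc : cauchy (p @ F) by exact: (R_complete pF pc).
  apply/(@cauchy_ballP R R (p @ F)) => e e0.
  have e0' : 0 < e%:C :> cplx R by rewrite ltcR.
  have [[A B] [/= FA FB] AB] := Fc _ e0'.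
  exists (p @` A, p @` B) => /=.
    split; [move: FA|move: FB]; apply: filterS => x ?; by exists x.
  move=> [_ _] [[x Ax <-] [y By <-]] /=.
  have := AB (x, y) (conj Ax By).
  rewrite /ball /= -pB => xy.
  by rewrite -ltcR (le_lt_trans (ple _)).
have [a Fa] : exists a : R, (@complex.Re R : (cplx R)^o -> R) @ F --> a.
  apply/cvg_ex; apply: (part (@complex.Re R)) => [[? ?] [? ?]//|z].
  exact: normc_ge_Re.
have [b Fb] : exists b : R, (@complex.Im R : (cplx R)^o -> R) @ F --> b.
  apply/cvg_ex; apply: (part (@complex.Im R)) => [[? ?] [? ?]//|z].
  exact: normc_ge_Im.
apply/cvg_ex; exists (a +i* b); apply/fcvg_ballP => -[e e'] e0.
have [e1 e2] : 0 < e /\ e' = 0 by move: e0; rewrite ltcE /= => /andP[/eqP-> ?].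
have he : 0 < e / 2 by rewrite divr_gt0.
move/cvg_ballP : Fa => /(_ _ he) Fa.
move/cvg_ballP : Fb => /(_ _ he) Fb.
near=> z.
have az : ball a (e / 2) (complex.Re z) by near: z.
have bz : ball b (e / 2) (complex.Im z) by near: z.
rewrite /ball /= (le_lt_trans (normc_le_ReIm _))//.
rewrite -rmorphD /= e2 ltcR (splitr e).
have -> : complex.Re (a +i* b - z) = a - complex.Re z by case: (z).
have -> : complex.Im (a +i* b - z) = b - complex.Im z by case: (z).
exact: ltrD.
Unshelve. all: by end_near. Qed.

End ComplexComplete.

(* An alias of (cplx R)^o: the key of the Complete instance of R^o is already
   taken by real scalars. *)
Definition cplx_line (R : realType) : Type := (cplx R)^o.

HB.instance Definition _ (R : realType) :=
  NormedModule.copy (cplx_line R) (cplx R)^o.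
HB.instance Definition _ (R : realType) :=
  Uniform_isComplete.Build (cplx_line R) (@cplx_complete R).

Section Basics.
Context {R : realType}.
Local Notation C := (cplx R).

Definition lspan (V : lmodType C) (S : set V) : set V :=
  [set v | exists n (a : 'I_n -> C) (s : 'I_n -> V),
     (forall i, S (s i)) /\ v = \sum_i a i *: s i].

Definition clspan (V : normedModType C) (S : set V) : set V :=
  closure (lspan S).

(* Closed linear span, in the operator norm, of a set of bounded operators. *)
Definition opspan (V : normedModType C) (S : set (V -> V)) : set (V -> V) :=
  [set T | forall e : C, 0 < e ->
     exists2 T', lspan S T' & forall x, `|T x - T' x| <= e * `|x|].

(* "The" element with a given property; d is never the intended value. *)
Definition the (T : Type) (d : T) (P : T -> Prop) : T :=
  match pselect (exists x, P x) with
  | left e => projT1 (cid e)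
  | right _ => d
  end.

(* As everywhere in the library's sesquilinear forms, the inner product is
   linear in its first variable; Woronowicz's (x|y) is ip y x. *)
Record hilbert := Hilbert {
  hspace :> completeNormedModType C;
  ip : {dot hspace for (Num.conj : C -> C)};
  ip_norm : forall x : hspace, `|x| ^+ 2 = ip x x }.

Definition separable (T : topologicalType) :=
  exists2 D : set T, countable D & dense D.

Definition unitary_op (H K : hilbert) (T : H -> K) :=
  [/\ linear T, forall x, `|T x| = `|x| & range T = setT].

Record htensor (H K : hilbert) := HTensor {
  hten :> hilbert;
  hpure : H -> K -> hten;
  hpure_ip : forall x y x' y',
    ip hten (hpure x y) (hpure x' y') = ip H x x' * ip K y y';
  hpure_total : clspan [set v | exists x y, v = hpure x y] = setT }.

Record cstar := CStar {
  cspace :> completeNormedModType C;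
  cmul : {bilinear cspace -> cspace -> cspace};
  star : cspace -> cspace;
  cmulA : forall x y z, cmul x (cmul y z) = cmul (cmul x y) z;
  starD : forall (a : C) x y, star (a *: x + y) = a^* *: star x + star y;
  starK : forall x, star (star x) = x;
  starM : forall x y, star (cmul x y) = cmul (star y) (star x);
  cnormM : forall x y, `|cmul x y| <= `|x| * `|y|;
  cnorm_star : forall x, `|cmul (star x) x| = `|x| ^+ 2 }.

Local Notation "x ** y" := (cmul _ x y) (at level 40, left associativity).

(* M(A) as the algebra of adjointable operators on the Hilbert A-module A;
   the adjoint is uniquely determined by the operator. *)
Record multiplier (A : cstar) := Multiplier {
  mact :> A -> A;
  madj : A -> A;
  mactP : forall x y, star (mact x) ** y = star x ** madj y }.

Section Multipliers.
Variable A : cstar.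

Lemma mof_subproof (a x y : A) : star (a ** x) ** y = star x ** (star a ** y).
Proof. by rewrite starM cmulA. Qed.
Definition mof (a : A) : multiplier A := Multiplier (@mof_subproof a).

Definition mone : multiplier A :=
  @Multiplier A id id (fun x y => erefl).

Lemma mmul_subproof (m n : multiplier A) (x y : A) :
  star (m (n x)) ** y = star x ** madj n (madj m y).
Proof. by rewrite !mactP. Qed.
Definition mmul (m n : multiplier A) : multiplier A :=
  Multiplier (@mmul_subproof m n).

Lemma mstar_subproof (m : multiplier A) (x y : A) :
  star (madj m x) ** y = star x ** m y.
Proof. by rewrite -[LHS]starK starM starK -mactP starM starK. Qed.
Definition mstar (m : multiplier A) : multiplier A :=
  Multiplier (@mstar_subproof m).

Lemma mscale_subproof (z : C) (m : multiplier A) (x y : A) :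
  star (z *: m x) ** y = star x ** (z^* *: madj m y).
Proof.
rewrite linearZr_LR /= -mactP -linearZl_LR /=; congr (_ ** _).
rewrite -[z *: _]addr0 starD.
suff -> : star (0 : A) = 0 by rewrite addr0.
by have := starD (-1) (0 : A) 0; rewrite scaler0 addr0 rmorphN rmorph1 scaleN1r addNr.
Qed.
Definition mscale (z : C) (m : multiplier A) : multiplier A :=
  Multiplier (@mscale_subproof z m).

Definition unitary (m : multiplier A) :=
  mmul m (mstar m) = mone /\ mmul (mstar m) m = mone.

End Multipliers.

Local Notation "m *M n" := (mmul m n) (at level 40, left associativity).

(* Morphisms A -> B are nondegenerate *-homomorphisms from A to M(B). *)
Definition is_mor (A B : cstar) (f : A -> multiplier B) :=
  [/\ forall (a : C) x y z, f (a *: x + y) z = a *: f x z + f y z,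
      forall x y, f (x ** y) = f x *M f y,
      forall x, f (star x) = mstar (f x) &
      clspan [set w : B | exists x y, w = f x y] = setT].

(* Extension of a morphism to multiplier algebras. *)
Definition ext (A B : cstar) (f : A -> multiplier B) (m : multiplier A) :
    multiplier B :=
  the (mone B) (fun n => forall x y, n (f x y) = f (m x) y).

(* Composition g o f of morphisms; mof is the identity morphism. *)
Definition mcomp (A B E : cstar) (g : B -> multiplier E)
    (f : A -> multiplier B) : A -> multiplier E :=
  fun x => ext g (f x).

Definition inverse_mor (A B : cstar) (f : A -> multiplier B)
    (g : B -> multiplier A) :=
  mcomp g f = @mof A /\ mcomp f g = @mof B.

Definition is_iso (A B : cstar) (f : A -> multiplier B) :=
  is_mor f /\ exists2 g : B -> multiplier A, is_mor g & inverse_mor f g.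

(* The C*-algebra K(H), given with its inclusion in B(H). *)
Record compacts (H : hilbert) := Compacts {
  kalg :> cstar;
  kop : kalg -> H -> H;
  kopD : forall (a : C) k l h, kop (a *: k + l) h = a *: kop k h + kop l h;
  kopM : forall k l h, kop (k ** l) h = kop k (kop l h);
  kop_star : forall k x y, ip H (kop k x) y = ip H x (kop (star k) y);
  kop_inj : injective kop;
  kop_range : range kop =
    opspan [set T | exists x y, T = fun z => ip H z y *: x] }.

End Basics.
Arguments hilbert : clear implicits.
Arguments cstar : clear implicits.
Notation "x ** y" := (cmul _ x y) (at level 40, left associativity).
Notation "m *M n" := (mmul m n) (at level 40, left associativity).

Section ComplexAlgebra.
Variable R : realType.
Local Notation C := (cplx R).
Local Notation L := (cplx_line R).

Definition cplx_mul (x y : L) : L := (x : C) * y.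

Lemma cplx_mul_bilinear :
  bilinear_for
    (GRing.Scale.Law.clone _ _ *:%R _) (GRing.Scale.Law.clone _ _ *:%R _)
    cplx_mul.
Proof.
split => [u a x y|u a x y]; rewrite /cplx_mul.
  by rewrite mulrDl -mulrA.
by rewrite mulrDr mulrCA.
Qed.
HB.instance Definition _ :=
  bilinear_isBilinear.Build C L L L _ _ cplx_mul cplx_mul_bilinear.

Definition cplx_star (x : L) : L := (x : C)^*.

Lemma cplx_starD (a : C) (x y : L) :
  cplx_star (a *: x + y) = a^* *: cplx_star x + cplx_star y.
Proof. by rewrite /cplx_star rmorphD rmorphM. Qed.

Definition cplx_cstar : cstar R.
Proof.
refine (@CStar R L cplx_mul cplx_star _ cplx_starD _ _ _ _).
- exact: mulrA.
- exact: conjCK.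
- by move=> x y; rewrite /cplx_star /cplx_mul rmorphM mulrC.
- by move=> x y; rewrite /cplx_mul [X in X <= _]normrM.
- move=> x; change (`|(x : C)^* * (x : C)| = `|x : C| ^+ 2).
  by rewrite normrM norm_conjC expr2.
Defined.

End ComplexAlgebra.

(* A choice of Hilbert space tensor products and of the algebras K(H); both
   are determined up to unique isomorphism. *)
Record hmodel (R : realType) := HModel {
  htens : forall H K : hilbert R, htensor H K;
  compact : forall H : hilbert R, compacts H }.

Section Spatial.
Variables (R : realType) (M : hmodel R).

(* M(K(H)) = B(H): the operator on H given by a multiplier of K(H). *)
Definition mop (H : hilbert R) (m : multiplier (compact M H)) : H -> H :=
  the id (fun T => forall k h, T (kop k h) = kop (m k) h).

(* A representation of C on H is a morphism from C to K(H). *)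
Definition rep (A : cstar R) (H : hilbert R) := A -> multiplier (compact M H).

(* Minimal tensor product: the norm is the one of B(H (x) K) under the tensor
   product of faithful representations of A on H and B on K. *)
Record mintensor (A B : cstar R) := MinTensor {
  mten :> cstar R;
  pure : {bilinear A -> B -> mten};
  pureM : forall a b a' b',
    pure a b ** pure a' b' = pure (a ** a') (b ** b');
  pure_star : forall a b, star (pure a b) = pure (star a) (star b);
  pure_total : clspan [set v | exists a b, v = pure a b] = setT;
  spatial : forall (H K : hilbert R) (phi : rep A H) (psi : rep B K),
    is_mor phi -> injective phi -> is_mor psi -> injective psi ->
    exists pi : rep mten (htens M H K),
      [/\ is_mor pi, injective pi &
          forall a b h k, mop (pi (pure a b)) (hpure _ h k) =
            hpure _ (mop (phi a) h) (mop (psi b) k)] }.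

End Spatial.

Record model (R : realType) := Model {
  hmod :> hmodel R;
  ctens : forall A B : cstar R, mintensor hmod A B }.

Section Tensor.
Variables (R : realType) (M : model R).
Local Notation C := (cplx R).
Local Notation "A ⊗ B" := (mten (ctens M A B))
  (at level 40, left associativity).
Local Notation K := (compact M).
Local Notation "x ⊙ y" := (hpure (htens M _ _) x y)
  (at level 40, left associativity).

Section Legs.
Variables A B E F : cstar R.

Definition mtens (m : multiplier A) (n : multiplier B) : multiplier (A ⊗ B) :=
  the (mone _) (fun p => forall a b, p (pure _ a b) = pure _ (m a) (n b)).

(* a |-> a (x) 1 and b |-> 1 (x) b *)
Definition inl_mor (a : A) : multiplier (A ⊗ B) := mtens (mof a) (mone B).
Definition inr_mor (b : B) : multiplier (A ⊗ B) := mtens (mone A) (mof b).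

(* The morphism a (x) b |-> f(a) g(b), for commuting f and g for which it
   exists; it is unique. *)
Definition pair_mor (f : A -> multiplier E) (g : B -> multiplier E) :
    A ⊗ B -> multiplier E :=
  the (fun=> mone E)
    (fun h => is_mor h /\ forall a b, h (pure _ a b) = f a *M g b).

End Legs.

Definition tensor_mor (A B A' B' : cstar R)
    (f : A -> multiplier A') (g : B -> multiplier B') :
    A ⊗ B -> multiplier (A' ⊗ B') :=
  pair_mor (mcomp (@inl_mor A' B') f) (mcomp (@inr_mor A' B') g).

Definition flip (A B : cstar R) : A ⊗ B -> multiplier (B ⊗ A) :=
  pair_mor (@inr_mor B A) (@inl_mor B A).

Section ThreeLegs.
Variables A B E : cstar R.

Definition leg1 : A -> multiplier (A ⊗ (B ⊗ E)) := @inl_mor A (B ⊗ E).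
Definition leg2 : B -> multiplier (A ⊗ (B ⊗ E)) :=
  mcomp (@inr_mor A (B ⊗ E)) (@inl_mor B E).
Definition leg3 : E -> multiplier (A ⊗ (B ⊗ E)) :=
  mcomp (@inr_mor A (B ⊗ E)) (@inr_mor B E).

Definition leg12 (X : multiplier (A ⊗ B)) : multiplier (A ⊗ (B ⊗ E)) :=
  ext (pair_mor leg1 leg2) X.
Definition leg13 (X : multiplier (A ⊗ E)) : multiplier (A ⊗ (B ⊗ E)) :=
  ext (pair_mor leg1 leg3) X.
Definition leg23 (X : multiplier (B ⊗ E)) : multiplier (A ⊗ (B ⊗ E)) :=
  ext (pair_mor leg2 leg3) X.

Definition reassoc : (A ⊗ B) ⊗ E -> multiplier (A ⊗ (B ⊗ E)) :=
  pair_mor (pair_mor leg1 leg2) leg3.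

End ThreeLegs.

(* (f (x) id)(X), (id (x) f)(X) and (f (x) g)(X) for a multiplier X *)
Definition amp_l (A A' B : cstar R) (f : A -> multiplier A')
    (X : multiplier (A ⊗ B)) : multiplier (A' ⊗ B) :=
  ext (tensor_mor f (@mof R B)) X.
Definition amp_r (A B B' : cstar R) (f : B -> multiplier B')
    (X : multiplier (A ⊗ B)) : multiplier (A ⊗ B') :=
  ext (tensor_mor (@mof R A) f) X.
Definition amp (A B A' B' : cstar R) (f : A -> multiplier A')
    (g : B -> multiplier B') (X : multiplier (A ⊗ B)) :
    multiplier (A' ⊗ B') :=
  ext (tensor_mor f g) X.

(* The canonical isomorphism of K(H) (x) K(H') with K(H (x) H'). *)
Definition compact_tensor (H H' : hilbert R) :
    K H ⊗ K H' -> multiplier (K (htens M H H')) :=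
  the (fun=> mone _) (fun kappa => is_mor kappa /\
    forall x y h h', mop (kappa (pure _ x y)) (h ⊙ h') = kop x h ⊙ kop y h').

Section MultiplicativeUnitary.
Variable H : hilbert R.
Local Notation HH := (htens M H H).
Local Notation HHH := (htens M H HH).

Definition the_operator (P : (HHH -> HHH) -> Prop) : HHH -> HHH :=
  the id (fun T => [/\ linear T, continuous (T : HHH -> HHH) & P T]).

Definition op12 (X : HH -> HH) : HHH -> HHH :=
  the_operator (fun T => forall x y z x' y' z',
    ip _ (T (x ⊙ (y ⊙ z))) (x' ⊙ (y' ⊙ z')) =
    ip _ (X (x ⊙ y)) (x' ⊙ y') * ip _ z z').
Definition op13 (X : HH -> HH) : HHH -> HHH :=
  the_operator (fun T => forall x y z x' y' z',
    ip _ (T (x ⊙ (y ⊙ z))) (x' ⊙ (y' ⊙ z')) =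
    ip _ (X (x ⊙ z)) (x' ⊙ z') * ip _ y y').
Definition op23 (X : HH -> HH) : HHH -> HHH :=
  the_operator (fun T => forall x y z x' y' z',
    ip _ (T (x ⊙ (y ⊙ z))) (x' ⊙ (y' ⊙ z')) =
    ip _ x x' * ip _ (X (y ⊙ z)) (y' ⊙ z')).

Definition multiplicative (W : HH -> HH) :=
  op23 W \o op12 W = op12 W \o op13 W \o op23 W.

(* An injective positive self-adjoint operator, given by its graph Q. *)
Definition positive_selfadjoint_injective (Q : set (H * H)) :=
  [/\ dense [set x | exists y, Q (x, y)],
      forall x y, Q (x, y) <->
        forall u v, Q (u, v) -> ip H v x = ip H u y,
      forall x y, Q (x, y) -> 0 <= ip H y x &
      forall x, Q (x, 0) -> x = 0].

Definition tensor_square (Q : set (H * H)) : set (HH * HH) :=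
  clspan [set p : HH * HH | exists x x' y y',
    [/\ Q (x, x'), Q (y, y') & p = (x ⊙ y, x' ⊙ y')]].

Definition conjugation (Hbar : hilbert R) (J : H -> Hbar) :=
  [/\ forall (a : C) x y, J (a *: x + y) = a^* *: J x + J y,
      forall x y, ip _ (J x) (J y) = ip _ y x & range J = setT].

(* (x (x) u | W | z (x) y) = (zbar (x) Q u | Wt | xbar (x) Q^-1 y), where
   u' = Q u, v = Q^-1 y and xbar = J x; moreover W* (Q (x) Q) W = Q (x) Q. *)
Definition manageable (W : HH -> HH) :=
  exists Q : set (H * H), exists Hbar : hilbert R, exists J : H -> Hbar,
  exists Wt : htens M Hbar H -> htens M Hbar H,
  [/\ positive_selfadjoint_injective Q, conjugation J, unitary_op Wt,
      forall xi eta, tensor_square Q (xi, eta) <->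
                     tensor_square Q (W xi, W eta) &
      forall x z u u' v y, Q (u, u') -> Q (v, y) ->
        ip _ (W (z ⊙ y)) (x ⊙ u) = ip _ (Wt (J x ⊙ v)) (J z ⊙ u')].

Definition square_summable (x : nat -> H) :=
  exists c : C, forall n, \sum_(i < n) `|x i| ^+ 2 <= c.

(* S = (omega (x) id) W, respectively (id (x) omega) W, for the normal
   functional omega = sum_n (x_n| . |y_n) on B(H). *)
Definition slice1 (W : HH -> HH) (S : H -> H) :=
  exists x y : nat -> H, [/\ square_summable x, square_summable y &
    forall h k, series (fun n => ip _ (W (y n ⊙ h)) (x n ⊙ k)) @ \oo -->
      (ip _ (S h) k : C)].
Definition slice2 (W : HH -> HH) (S : H -> H) :=
  exists x y : nat -> H, [/\ square_summable x, square_summable y &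
    forall h k, series (fun n => ip _ (W (h ⊙ y n)) (k ⊙ x n)) @ \oo -->
      (ip _ (S h) k : C)].

End MultiplicativeUnitary.

(* piA and piAhat are the inclusions of A and Ahat in B(L). *)
Record quantum_group := QuantumGroup {
  qL : hilbert R;
  qL_separable : separable qL;
  WW : htens M qL qL -> htens M qL qL;
  WW_unitary : unitary_op WW;
  WW_multiplicative : multiplicative WW;
  WW_manageable : manageable WW;
  qA : cstar R;
  qAhat : cstar R;
  piA : rep M qA qL;
  piAhat : rep M qAhat qL;
  piA_mor : is_mor piA;
  piAhat_mor : is_mor piAhat;
  piA_inj : injective piA;
  piAhat_inj : injective piAhat;
  piA_range : [set mop (piA a) | a in setT] = opspan (slice1 WW);
  piAhat_range : [set mop (piAhat a) | a in setT] = opspan (slice2 WW);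
  qW : multiplier (qAhat ⊗ qA);
  qW_unitary : unitary qW;
  qW_WW : mop (ext (@compact_tensor qL qL) (amp piAhat piA qW)) = WW;
  qDelta : qA -> multiplier (qA ⊗ qA);
  qDelta_mor : is_mor qDelta;
  qDelta_W : amp_r qDelta qW = leg12 _ qW *M leg13 _ qW;
  qDhat : qAhat -> multiplier (qAhat ⊗ qAhat);
  qDhat_mor : is_mor qDhat;
  qDhat_W : ext (@reassoc _ _ _) (amp_l qDhat qW) =
    leg23 _ qW *M leg13 _ qW }.

Section QuantumGroup.
Variable G : quantum_group.
Local Notation A := (qA G).
Local Notation Ahat := (qAhat G).

Definition corepresentation (H : hilbert R) (U : multiplier (K H ⊗ A)) :=
  unitary U /\ amp_r (@qDelta G) U = leg12 _ U *M leg13 _ U.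

Definition coaction (B : cstar R) (gamma : B -> multiplier (B ⊗ A)) :=
  [/\ is_mor gamma, injective gamma,
      mcomp (tensor_mor (@mof R B) (@qDelta G)) gamma =
        mcomp (@reassoc B A A) (mcomp (tensor_mor gamma (@mof R A)) gamma) &
      opspan [set T | exists b a, T = mact (gamma b *M inr_mor _ a)] =
        [set mact (mof x) | x in [set: B ⊗ A]]].

(* Objects and morphisms of C*alg(G). *)
Record gcstar := GCstar {
  galg :> cstar R;
  gco : galg -> multiplier (galg ⊗ A);
  gcoP : coaction gco }.

Definition is_gmor (X Y : gcstar) (f : X -> multiplier Y) :=
  is_mor f /\ mcomp (@gco Y) f = mcomp (tensor_mor f (@mof R A)) (@gco X).

Definition is_giso (X Y : gcstar) (f : X -> multiplier Y) :=
  is_gmor f /\ exists2 g : Y -> multiplier X, is_gmor g & inverse_mor f g.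

Definition covariant (X : gcstar) (H : hilbert R) (phi : rep M X H)
    (U : multiplier (K H ⊗ A)) :=
  [/\ is_mor phi, corepresentation U &
      forall c, amp_l phi (gco c) = U *M mtens (phi c) (mone A) *M mstar U].

(* S = (id (x) omega) X. By Cohen factorization every functional on A has the
   form x |-> omega (x a) used here, and (id (x) omega(- a)) X maps x to
   (id (x) omega) (X (x (x) a)), where sigma is id (x) omega on B (x) A. *)
Definition slice (B : cstar R) (X : multiplier (B ⊗ A)) (S : multiplier B) :=
  exists (omega : A -> C) (a : A) (sigma : B ⊗ A -> B),
    [/\ scalar omega /\ continuous omega,
        linear sigma /\ continuous sigma,
        forall x b, sigma (pure _ x b) = omega b *: x &
        forall x, S x = sigma (X (pure _ x a))].

(* (uV, uA) is the universal corepresentation of G. *)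
Record universal_dual := UniversalDual {
  uA : cstar R;
  uV : multiplier (uA ⊗ A);
  uV_unitary : unitary uV;
  uV_corep : amp_r (@qDelta G) uV = leg12 _ uV *M leg13 _ uV;
  uV_universal : forall (H : hilbert R) (U : multiplier (K H ⊗ A)),
    corepresentation U ->
    exists! rho : rep M uA H, is_mor rho /\ amp_l rho uV = U;
  uA_span : [set mact (mof x) | x in [set: uA]] =
    opspan [set mact S | S in slice uV];
  uDhat : uA -> multiplier (uA ⊗ uA);
  uDhat_mor : is_mor uDhat;
  uDhat_V : ext (@reassoc _ _ _) (amp_l uDhat uV) =
    leg23 _ uV *M leg13 _ uV;
  uLambda : uA -> multiplier Ahat;
  uLambda_mor : is_mor uLambda;
  uLambda_V : amp_l uLambda uV = @qW G }.

Definition bicharacter (B : cstar R) (D : B -> multiplier (B ⊗ B))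
    (X : multiplier (B ⊗ B)) :=
  [/\ unitary X,
      ext (@reassoc B B B) (amp_l D X) = leg23 _ X *M leg13 _ X &
      amp_r D X = leg12 _ X *M leg13 _ X].

Definition quasitriangular (X : multiplier (Ahat ⊗ Ahat)) :=
  bicharacter (@qDhat G) X /\
  forall x, X *M ext (@flip _ _) (qDhat x) *M mstar X = qDhat x.

(* R* = sigma(R) *)
Definition rmatrix_antisymmetric (X : multiplier (Ahat ⊗ Ahat)) :=
  mstar X = ext (@flip _ _) X.

Variable D : universal_dual.

Definition universal_lift (X : multiplier (Ahat ⊗ Ahat))
    (Xu : multiplier (uA D ⊗ uA D)) :=
  amp (@uLambda D) (@uLambda D) Xu = X /\ bicharacter (@uDhat D) Xu.

Variable Ru : multiplier (uA D ⊗ uA D).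

(* E, with embeddings i and j of X and Y, is the twisted tensor product
   X (x)_R Y: emb is the inclusion of E in B(H (x) H') = M(K(H) (x) K(H')). *)
Definition twisted_tensor (X Y : gcstar) (E : cstar R)
    (i : X -> multiplier E) (j : Y -> multiplier E) :=
  exists (H H' : hilbert R) (phi : rep M X H) (U : multiplier (K H ⊗ A))
    (psi : rep M Y H') (U' : multiplier (K H' ⊗ A))
    (rho : rep M (uA D) H) (rho' : rep M (uA D) H')
    (emb : E -> multiplier (K H ⊗ K H')),
  let Z := mstar (amp rho rho' Ru) in
  let iX c := mtens (phi c) (mone (K H')) in
  let iY d := Z *M mtens (mone (K H)) (psi d) *M mstar Z in
  [/\ covariant phi U /\ injective phi,
      covariant psi U' /\ injective psi,
      is_mor rho /\ amp_l rho (uV D) = U,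
      is_mor rho' /\ amp_l rho' (uV D) = U' &
    [/\ is_mor emb, injective emb,
        [set mact (emb e) | e in [set: E]] =
          opspan [set T | exists c d, T = mact (iX c *M iY d)],
        is_mor i /\ (forall c, ext emb (i c) = iX c) &
        is_mor j /\ (forall d, ext emb (j d) = iY d)]].

Definition trivial_coaction (z : cplx_cstar R) :
    multiplier (cplx_cstar R ⊗ A) := mscale z (mone _).

(* The monoidal structure: X (x)_R Y for all X and Y, and the morphisms
   determined by their values on the embedded factors. *)
Record boxtensor := Boxtensor {
  box : gcstar -> gcstar -> gcstar;
  iota1 : forall X Y : gcstar, X -> multiplier (box X Y);
  iota2 : forall X Y : gcstar, Y -> multiplier (box X Y);
  box_twisted : forall X Y, twisted_tensor (@iota1 X Y) (@iota2 X Y);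
  iota1_gmor : forall X Y, is_gmor (@iota1 X Y);
  iota2_gmor : forall X Y, is_gmor (@iota2 X Y);

  boxmap : forall X X' Y Y' : gcstar, (X -> multiplier X') ->
    (Y -> multiplier Y') -> box X Y -> multiplier (box X' Y');
  boxmapP : forall (X X' Y Y' : gcstar) (f : X -> multiplier X')
      (g : Y -> multiplier Y'), is_gmor f -> is_gmor g ->
    [/\ is_gmor (boxmap f g),
        mcomp (boxmap f g) (@iota1 X Y) = mcomp (@iota1 X' Y') f &
        mcomp (boxmap f g) (@iota2 X Y) = mcomp (@iota2 X' Y') g];

  assoc : forall X Y Z : gcstar, box X (box Y Z) -> multiplier (box (box X Y) Z);
  assocV : forall X Y Z : gcstar, box (box X Y) Z -> multiplier (box X (box Y Z));
  assoc_gmor : forall X Y Z, is_gmor (@assoc X Y Z);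
  assocV_gmor : forall X Y Z, is_gmor (@assocV X Y Z);
  assocK : forall X Y Z, inverse_mor (@assoc X Y Z) (@assocV X Y Z);
  assoc_iota : forall X Y Z,
    [/\ mcomp (@assoc X Y Z) (@iota1 X (box Y Z)) =
          mcomp (@iota1 (box X Y) Z) (@iota1 X Y),
        mcomp (@assoc X Y Z) (mcomp (@iota2 X (box Y Z)) (@iota1 Y Z)) =
          mcomp (@iota1 (box X Y) Z) (@iota2 X Y) &
        mcomp (@assoc X Y Z) (mcomp (@iota2 X (box Y Z)) (@iota2 Y Z)) =
          @iota2 (box X Y) Z];

  unitP : coaction trivial_coaction;
  gunit := GCstar unitP;
  lunit : forall X : gcstar, box gunit X -> multiplier X;
  runit : forall X : gcstar, box X gunit -> multiplier X;
  lunit_gmor : forall X, is_gmor (@lunit X);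
  runit_gmor : forall X, is_gmor (@runit X);
  lunitK : forall X, inverse_mor (@iota2 gunit X) (@lunit X);
  runitK : forall X, inverse_mor (@iota1 X gunit) (@runit X) }.

Section Braiding.
Variable T : boxtensor.
Local Notation "X ⊠ Y" := (box T X Y) (at level 40, left associativity).

Definition braiding (c : forall X Y : gcstar, X ⊠ Y -> multiplier (Y ⊠ X)) :=
  [/\ forall X Y, is_giso (c X Y),
      forall (X X' Y Y' : gcstar) (f : X -> multiplier X')
          (g : Y -> multiplier Y'), is_gmor f -> is_gmor g ->
        mcomp (c X' Y') (boxmap f g) = mcomp (boxmap g f) (c X Y),
      forall X Y Z,
        mcomp (@assocV T Y Z X) (mcomp (c X (Y ⊠ Z)) (@assocV T X Y Z)) =
        mcomp (boxmap (@mof R Y) (c X Z))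
          (mcomp (@assocV T Y X Z) (boxmap (c X Y) (@mof R Z))) &
      forall X Y Z,
        mcomp (@assoc T Z X Y) (mcomp (c (X ⊠ Y) Z) (@assoc T X Y Z)) =
        mcomp (boxmap (c X Z) (@mof R Y))
          (mcomp (@assoc T X Z Y) (boxmap (@mof R X) (c Y Z)))].

Definition symmetric_braiding
    (c : forall X Y : gcstar, X ⊠ Y -> multiplier (Y ⊠ X)) :=
  braiding c /\ forall X Y, mcomp (c Y X) (c X Y) = @mof R (X ⊠ Y).

(* Isomorphisms of the crossed products (X ⊠ Y, iota_X, iota_Y) and
   (Y ⊠ X, iota_X, iota_Y); equivariance is not required. *)
Definition crossed_iso (X Y : gcstar) (f : X ⊠ Y -> multiplier (Y ⊠ X)) :=
  [/\ is_iso f,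
      mcomp f (@iota1 T X Y) = @iota2 T Y X &
      mcomp f (@iota2 T X Y) = @iota1 T Y X].

End Braiding.
End QuantumGroup.
End Tensor.

(* Main.v *)
(* A braiding c has to exchange the two embeddings: naturality along the unit
   morphisms C -> X and the hexagons at (X, C, C) and (C, C, Y) force
   c iota_1 = iota_2 and c iota_2 = iota_1. Let A coact on itself by Delta. The
   embeddings i, j of A in F := A ⊠ A satisfy, for the universal V,
     V_{1i} V_{2j} = V_{2j} V_{1i} R^u_{12},
   so an automorphism of F exchanging i and j gives R^u_{21} R^u_{12} = 1, and
   R is antisymmetric.

   Conversely, let (a, b) be any pair of representations of A in M(F) with this
   relation. Conjugation by U_{1a} U'_{2b} turns X ⊠ Y, inside the operators on
   H ⊗ H', into a subalgebra of M((X ⊗ Y) ⊗ F), with iota_1 and iota_2 becoming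
   (id ⊗ a) gamma and (id ⊗ b) delta on the legs of X and Y. If R is
   antisymmetric then so is R^u, hence (j, i) also satisfies the relation. The
   embeddings of X ⊠ Y through (i, j) and of Y ⊠ X through (j, i) then have the
   same image up to the flip, which gives the crossed isomorphism; all axioms
   of a symmetric braiding can be checked on the embedded factors.

   The minimal tensor product is only specified through faithful
   representations, so morphisms out of it are constructed by comparing norms
   there; this is where positivity and the Gelfand-Naimark theorem enter. *)

From HB Require Import structures.
From mathcomp Require Import all_boot all_order all_algebra.
From mathcomp Require Import complex.
From mathcomp Require Import boolp classical_sets functions cardinality reals.
From mathcomp Require Import topology normedtype sequences.
From mathcomp Require Import ring lra.

Set Implicit Arguments.
Unset Strict Implicit.
Unset Printing Implicit Defensive.

Import Order.TTheory GRing.Theory Num.Theory numFieldNormedType.Exports.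

Local Open Scope classical_set_scope.
Local Open Scope ring_scope.
Require Import Defs.

(** * Norms and formal linear combinations *)

(** The overview leaves two points open. Antisymmetry of $R$ concerns only legs seen through the
    representation of the universal dual on $\mathcal L$. Conjugation by [V], with one leg universal
    and the other in $A$ represented on $\mathcal L$, replaces such a leg by its comultiplication,
    and the bicharacter property then splits off a factor with a universal leg. Doing this for one
    leg and then for the other carries antisymmetry to $R^u$; the same formulas yield the relation
    between [i] and [j].

    Secondly, [ext], [mtens], [mop], [pair_mor] and [compact_tensor] choose an object with a given
    property and fall back on a default, so no equation about them is available before an existence
    theorem. Existence usually rests on a norm estimate between formal linear combinations. Since
    multipliers are bare adjointable maps, these estimates rest on a theory of positivity without
    spectra: $h$ is positive if it is self-adjoint and $\|t-h\|\le t$ for some $t\ge0$, and square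
    roots come from an iteration. *)

Section RealNorm.
Variable R : realType.
Local Notation C := (cplx R).

Definition rc (r : R) : C := real_complex R r.

Lemma rcD : {morph rc : r s / r + s}. Proof. by move=> r s; rewrite /rc rmorphD. Qed.
Lemma rcM : {morph rc : r s / r * s}. Proof. by move=> r s; rewrite /rc rmorphM. Qed.
Lemma rcN : {morph rc : r / - r}. Proof. by move=> r; rewrite /rc rmorphN. Qed.
Lemma rcB : {morph rc : r s / r - s}. Proof. by move=> r s; rewrite /rc rmorphB. Qed.
Lemma rcX n : {morph rc : r / r ^+ n}. Proof. by move=> r; rewrite /rc rmorphXn. Qed.
Lemma rc0 : rc 0 = 0. Proof. by []. Qed.
Lemma rc1 : rc 1 = 1. Proof. by []. Qed.
Lemma rc_nat n : rc n%:R = n%:R. Proof. by rewrite /rc rmorph_nat. Qed.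
Lemma rc_le r s : (rc r <= rc s) = (r <= s). Proof. exact: lecR. Qed.
Lemma rc_lt r s : (rc r < rc s) = (r < s). Proof. exact: ltcR. Qed.
Lemma rcge0 r : (0 <= rc r) = (0 <= r). Proof. by rewrite -rc_le rc0. Qed.
Lemma rcgt0 r : (0 < rc r) = (0 < r). Proof. by rewrite -rc_lt rc0. Qed.
Lemma rc_inj : injective rc. Proof. by move=> r s []. Qed.
Lemma rc_conj r : (rc r)^* = rc r. Proof. by apply: conj_Creal; rewrite realE -rc0 !rc_le; exact: le_total. Qed.

Lemma ge0_rc (z : C) : 0 <= z -> z = rc (complex.Re z).
Proof. by case: z => a b; rewrite lecE /= => /andP[/eqP-> _]. Qed.

Definition cn (z : C) : R := complex.Re `|z|.

Lemma cnE z : `|z| = rc (cn z). Proof. exact: ge0_rc. Qed.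
Lemma cn_ge0 z : 0 <= cn z. Proof. by rewrite -rcge0 -cnE. Qed.
Lemma cn_rc r : cn (rc r) = `|r|.
Proof.
apply: rc_inj; rewrite -cnE; case: (leP 0 r) => r0; first by rewrite !ger0_norm// rcge0.
by rewrite !ltr0_norm// ?rcN// -rc0 rc_lt.
Qed.
Lemma cnM z w : cn (z * w) = cn z * cn w.
Proof. by apply: rc_inj; rewrite rcM -!cnE; exact: normrM. Qed.
Lemma cn0 : cn 0 = 0. Proof. by rewrite -rc0 cn_rc normr0. Qed.
Lemma cn1 : cn 1 = 1. Proof. by rewrite -rc1 cn_rc normr1. Qed.
Lemma cnN z : cn (- z) = cn z. Proof. by rewrite /cn normrN. Qed.
Lemma cn_conj z : cn z^* = cn z. Proof. by rewrite /cn norm_conjC. Qed.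
Lemma cnD z w : cn (z + w) <= cn z + cn w.
Proof. by rewrite -rc_le rcD -!cnE ler_normD. Qed.
Lemma cn_eq0 z : (cn z == 0) = (z == 0).
Proof. by apply/eqP/eqP => [h|->]; [apply/eqP; rewrite -normr_eq0 cnE h|exact: cn0]. Qed.
Lemma cnB z w : cn (z - w) = cn (w - z). Proof. by rewrite -cnN opprB. Qed.

Section Normed.
Variable V : normedModType C.
Implicit Types x y : V.

(* The norms of Defs take values in the complex numbers; cn and rn are their real counterparts. *)
Definition rn x : R := complex.Re `|x|.

Lemma rnE x : `|x| = rc (rn x). Proof. exact: ge0_rc. Qed.
Lemma rn_ge0 x : 0 <= rn x. Proof. by rewrite -rcge0 -rnE. Qed.
Lemma rn0 : rn 0 = 0. Proof. by apply: rc_inj; rewrite -rnE normr0. Qed.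
Lemma rn_eq0 x : (rn x == 0) = (x == 0).
Proof. by apply/eqP/eqP => [h|->]; [apply/eqP; rewrite -normr_eq0 rnE h|exact: rn0]. Qed.
Lemma rn0_eq0 x : rn x = 0 -> x = 0. Proof. by move/eqP; rewrite rn_eq0 => /eqP. Qed.
Lemma rnN x : rn (- x) = rn x. Proof. by rewrite /rn normrN. Qed.
Lemma rnB x y : rn (x - y) = rn (y - x). Proof. by rewrite -rnN opprB. Qed.
Lemma rnD x y : rn (x + y) <= rn x + rn y.
Proof. by rewrite -rc_le rcD -!rnE ler_normD. Qed.
Lemma rnZ z x : rn (z *: x) = cn z * rn x.
Proof. by apply: rc_inj; rewrite rcM -rnE -cnE -rnE normrZ. Qed.
Lemma rnZr r x : rn (rc r *: x) = `|r| * rn x. Proof. by rewrite rnZ cn_rc. Qed.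
Lemma rn_tri y x z : rn (x - z) <= rn (x - y) + rn (y - z).
Proof. by rewrite -[x - z](subrKA y) rnD. Qed.
Lemma rn_le x y : rn x <= rn y + rn (x - y).
Proof. by rewrite addrC -{1}[x](subrK y) rnD. Qed.

Lemma rn_small x : (forall e : R, 0 < e -> rn x <= e) -> x = 0.
Proof.
move=> h; apply: rn0_eq0; apply/eqP; rewrite eq_le rn_ge0 andbT.
by apply/ler_addgt0Pr => e /h; rewrite add0r.
Qed.

Lemma eq_small x y : (forall e : R, 0 < e -> rn (x - y) <= e) -> x = y.
Proof. by move/rn_small/eqP; rewrite subr_eq0 => /eqP. Qed.

Lemma rc_gt0 (e : C) : 0 < e -> exists2 r : R, 0 < r & e = rc r.
Proof. by move=> e0; exists (complex.Re e); last exact/ge0_rc/ltW; rewrite -rcgt0 -ge0_rc// ltW. Qed.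

Definition adh (S : set V) x := forall e : R, 0 < e -> exists2 s, S s & rn (x - s) < e.

Lemma closureP (S : set V) x : closure S x <-> adh S x.
Proof.
split=> [h e e0|h B].
  have /h[y [Sy]] : nbhs x (ball x (rc e)) by apply: nbhsx_ballx; rewrite rcgt0.
  by rewrite -ball_normE /= rnE rc_lt; exists y.
move=> /nbhs_ballP[e /rc_gt0[r r0 ->]] xB; have [s Ss xs] := h r r0.
exists s; split=> //; apply: xB.
by rewrite -ball_normE /= rnE rc_lt.
Qed.

Definition tends (u : nat -> V) x := forall e : R, 0 < e -> exists N, forall n, (N <= n)%N -> rn (u n - x) < e.

Lemma tendsP (u : nat -> V) x : u @ \oo --> x <-> tends u x.
Proof.
split=> [/cvgrPdist_lt h e e0|h].
  have /h[N _ hN] : 0 < rc e by rewrite rcgt0.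
  by exists N => n /hN /=; rewrite rnE rc_lt rnB.
apply/cvgrPdist_lt => e /rc_gt0[r r0 ->]; have [N hN] := h r r0.
by exists N => // n /= /hN; rewrite rnE rc_lt rnB.
Qed.

Lemma tends_uniq (u : nat -> V) x y : tends u x -> tends u y -> x = y.
Proof.
move=> ux uy; apply: eq_small => e e0.
have e2 : 0 < e / 2 by rewrite divr_gt0.
have [N hN] := ux _ e2; have [N' hN'] := uy _ e2.
have := hN _ (leq_maxl N N'); have := hN' _ (leq_maxr N N').
have := rn_tri (u (maxn N N')) x y; rewrite (rnB x (u _)).
lra.
Qed.

Lemma rn_lim_le (u : nat -> V) x (t : R) : tends u x ->
  (exists N, forall n, (N <= n)%N -> rn (u n) <= t) -> rn x <= t.
Proof.
move=> ux [N h]; apply/ler_addgt0Pr => e /ux[N' h'].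
have := h _ (leq_maxl N N'); have := h' _ (leq_maxr N N').
have := rn_le x (u (maxn N N')); rewrite (rnB x); lra.
Qed.

Lemma tends_cst x : tends (fun=> x) x.
Proof. by move=> e e0; exists 0%N => n _; rewrite subrr rn0. Qed.

End Normed.

Lemma rn_line (z : cplx_line R) : rn z = cn (z : C). Proof. by []. Qed.

Lemma cauchy_tends (V : completeNormedModType C) (u : nat -> V) :
  (forall e : R, 0 < e -> exists N, forall m n, (N <= m)%N -> (N <= n)%N -> rn (u m - u n) < e) ->
  exists x, tends u x.
Proof.
move=> h; suff /cvg_ex[x ux] : cvg (u @ \oo) by exists x; apply/tendsP.
apply/cauchy_cvgP/cauchy_ballP => e /rc_gt0[r r0 ->].
have [N hN] := h r r0; exists (u @` [set n | (N <= n)%N], u @` [set n | (N <= n)%N]).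
  by split; exists N => // n Nn /=; exists n.
by move=> [_ _] [[m Nm <-] [n Nn <-]] /=; rewrite -ball_normE /= rnE rc_lt; apply: hN.
Qed.

Lemma inv_small (e : R) : 0 < e -> exists N, forall n, (N <= n)%N -> n.+1%:R^-1 < e.
Proof.
move=> e0; exists (Num.truncn e^-1) => n hn.
rewrite -[ltRHS]invrK ltf_pV2 ?posrE ?invr_gt0 ?ltr0n//.
by apply: (lt_le_trans (truncnS_gt _)); rewrite ler_nat ltnS.
Qed.

Lemma linD (V W : lmodType C) (T : V -> W) : linear T -> forall x y, T (x + y) = T x + T y.
Proof. by move=> Tl x y; rewrite -[x]scale1r Tl !scale1r. Qed.
Lemma lin0 (V W : lmodType C) (T : V -> W) : linear T -> T 0 = 0.
Proof. by move=> Tl; have := Tl (-1) 0 0; rewrite scaler0 addr0 scaleN1r addNr. Qed.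
Lemma linZ (V W : lmodType C) (T : V -> W) : linear T -> forall a x, T (a *: x) = a *: T x.
Proof. by move=> Tl a x; rewrite -[a *: x]addr0 Tl lin0// addr0. Qed.
Lemma linN (V W : lmodType C) (T : V -> W) : linear T -> forall x, T (- x) = - T x.
Proof. by move=> Tl x; rewrite -scaleN1r linZ// scaleN1r. Qed.
Lemma linB (V W : lmodType C) (T : V -> W) : linear T -> forall x y, T (x - y) = T x - T y.
Proof. by move=> Tl x y; rewrite linD// linN. Qed.

Lemma rc_scaleK (V : lmodType C) (r : R) (x : V) : r != 0 -> rc r^-1 *: (rc r *: x) = x.
Proof. by move=> r0; rewrite scalerA -rcM mulVf// rc1 scale1r. Qed.
Lemma rc_scaleVK (V : lmodType C) (r : R) (x : V) : r != 0 -> rc r *: (rc r^-1 *: x) = x.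
Proof. by move=> r0; rewrite scalerA -rcM mulfV// rc1 scale1r. Qed.
Lemma rc_double (V : lmodType C) (x : V) : rc 2 *: x = x + x.
Proof. by rewrite rc_nat scaler_nat mulr2n. Qed.
Lemma rc_2K (V : lmodType C) (x : V) : rc 2^-1 *: (rc 2 *: x) = x.
Proof. by rewrite rc_scaleK ?pnatr_eq0. Qed.
Lemma rc_2VK (V : lmodType C) (x : V) : rc 2 *: (rc 2^-1 *: x) = x.
Proof. by rewrite rc_scaleVK ?pnatr_eq0. Qed.
Lemma rc_half (V : lmodType C) (x : V) : rc 2^-1 *: (x + x) = x.
Proof. by rewrite -rc_double rc_2K. Qed.

(** Combinations are kept as lists of coefficients and indices so that one list can be evaluated
    along several families; comparing the norms of two evaluations is how maps get defined. *)
Definition comb (S : Type) (V : lmodType C) (s : S -> V) (l : seq (C * S)) : V :=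
  \sum_(p <- l) p.1 *: s p.2.

Lemma comb_cat S (V : lmodType C) (s : S -> V) l l' : comb s (l ++ l') = comb s l + comb s l'.
Proof. by rewrite /comb big_cat. Qed.
Lemma comb_cons S (V : lmodType C) (s : S -> V) p l : comb s (p :: l) = p.1 *: s p.2 + comb s l.
Proof. by rewrite /comb big_cons. Qed.
Definition scl S (a : C) (l : seq (C * S)) := [seq (a * p.1, p.2) | p <- l].
Lemma comb_scl S (V : lmodType C) (s : S -> V) a l : comb s (scl a l) = a *: comb s l.
Proof. by rewrite /comb big_map scaler_sumr; apply: eq_bigr => p _; rewrite scalerA. Qed.
Lemma comb_map S S' (V : lmodType C) (s : S' -> V) (f : S -> S') l :
  comb s [seq (p.1, f p.2) | p <- l] = comb (s \o f) l.
Proof. by rewrite /comb big_map. Qed.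
Lemma comb_lin S (V W : lmodType C) (s : S -> V) (T : V -> W) l :
  linear T -> T (comb s l) = comb (T \o s) l.
Proof.
move=> Tl; have T0 : T 0 = 0 by have := Tl (-1) 0 0; rewrite scaler0 addr0 scaleN1r addNr.
by rewrite /comb; elim: l => [|p l IH]; rewrite ?big_nil// !big_cons Tl IH.
Qed.
Lemma eq_comb S (V : lmodType C) (s s' : S -> V) l : s =1 s' -> comb s l = comb s' l.
Proof. by move=> e; apply: eq_bigr => p _; rewrite e. Qed.

Lemma lspanP S (V : lmodType C) (s : S -> V) (v : V) :
  lspan [set v | exists x, v = s x] v <-> exists l, v = comb s l.
Proof.
split=> [[n [a [t [ts ->]]]]|[l ->]].
  have /choice[x hx] : forall i, exists x, t i = s x by [].
  exists [seq (a i, x i) | i <- index_enum 'I_n]; rewrite /comb big_map.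
  by apply: eq_bigr => i _; rewrite hx.
elim: l => [|[c x] l [n [a [t [ts h]]]]].
  by exists 0%N, (fun=> 0), (fun=> 0); split=> [[]//|]; rewrite /comb big_nil big_ord0.
exists n.+1, (fun i => if unlift ord0 i is Some j then a j else c),
  (fun i => if unlift ord0 i is Some j then t j else s x); split.
  by move=> i; case: (unlift _ _) => [j|]; [exact: ts|exists x].
rewrite comb_cons big_ord_recl unlift_none h; congr (_ + _).
by apply: eq_bigr => i _; rewrite liftK.
Qed.

(* Density of the span of a family, as a statement about formal combinations. *)
Definition total S (V : normedModType C) (s : S -> V) :=
  forall x (e : R), 0 < e -> exists l, rn (x - comb s l) < e.

Lemma clspan_total S (V : normedModType C) (s : S -> V) :
  clspan [set v | exists x, v = s x] = setT <-> total s.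
Proof.
split=> [h x e e0|h].
  have : clspan [set v | exists x, v = s x] x by rewrite h.
  by move/closureP => /(_ e e0)[y /lspanP[l ->]]; exists l.
apply/seteqP; split=> // x _; apply/closureP => e /(h x)[l hl].
by exists (comb s l) => //; apply/lspanP; exists l.
Qed.

Lemma clspan_total2 S S' (V : normedModType C) (s : S -> S' -> V) :
  clspan [set v | exists x y, v = s x y] = setT <-> total (fun p => s p.1 p.2).
Proof.
rewrite -clspan_total.
suff -> : [set v | exists x y, v = s x y] = [set v | exists p, v = s p.1 p.2] by [].
by apply/seteqP; split=> v /= => [[x [y ->]]|[[x y] ->]]; [exists (x, y)|exists x, y].
Qed.

Definition bdd (V W : normedModType C) (T : V -> W) (t : R) := forall x, rn (T x) <= t * rn x.

Lemma total_eq S (V W : normedModType C) (s : S -> V) (T T' : V -> W) t t' :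
  total s -> linear T -> linear T' -> bdd T t -> bdd T' t' ->
  (forall x, T (s x) = T' (s x)) -> forall v, T v = T' v.
Proof.
move=> st Tl Tl' Tb Tb' e v; apply: eq_small => d d0.
have t0 : 0 <= `|t| + `|t'| by rewrite addr_ge0.
have [l hl] := st v (d / (`|t| + `|t'| + 1)) ltac:(by rewrite divr_gt0// ltr_wpDl).
have Tc : T (comb s l) = T' (comb s l) by rewrite !comb_lin//; apply: eq_comb.
have h1 := Tb (v - comb s l); have h2 := Tb' (v - comb s l).
rewrite !linB// in h1 h2; rewrite (le_trans (rn_tri (T (comb s l)) _ _))// [X in _ + rn (X - _)]Tc.
rewrite (rnB (T' _)).
move: hl; rewrite ltr_pdivlMr ?ltr_wpDl// => hl.
have n0 := rn_ge0 (v - comb s l).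
have a1 : t * rn (v - comb s l) <= `|t| * rn (v - comb s l) by rewrite ler_wpM2r// ler_norm.
have a2 : t' * rn (v - comb s l) <= `|t'| * rn (v - comb s l) by rewrite ler_wpM2r// ler_norm.
nra.
Qed.

(** The graph of [T] is the closure of the pairs ([comb s l], [comb s' l]). The estimate makes it
    single-valued even when [s] is linearly dependent, so neither a quotient nor a basis enters. *)
Lemma extend S (V W : completeNormedModType C) (s : S -> V) (s' : S -> W) (t : R) :
  0 <= t -> total s -> (forall l, rn (comb s' l) <= t * rn (comb s l)) ->
  exists T : V -> W, [/\ linear T, bdd T t & forall x, T (s x) = s' x].
Proof.
move=> t0 st b.
have diff l l' : rn (comb s' l - comb s' l') <= t * rn (comb s l - comb s l').
  by have := b (l ++ scl (-1) l'); rewrite !comb_cat !comb_scl !scaleN1r.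
have ex x : exists y, forall e : R, 0 < e -> exists l, rn (x - comb s l) < e /\ rn (y - comb s' l) < e.
  have /choice[l hl] : forall n : nat, exists l, rn (x - comb s l) < n.+1%:R^-1.
    by move=> n; apply: st; rewrite invr_gt0 ltr0n.
  have [e e0|y hy] := @cauchy_tends W (fun n => comb s' (l n)).
    have [N hN] := @inv_small (e / (2 * (t + 1))) ltac:(by rewrite divr_gt0// mulr_gt0// ltr_wpDl).
    exists N => m n /hN hm /hN hn; apply: (le_lt_trans (diff _ _)).
    have := rn_tri x (comb s (l m)) (comb s (l n)); rewrite (rnB _ x).
    have := lt_trans (hl m) hm; have := lt_trans (hl n) hn.
    rewrite !ltr_pdivlMr ?mulr_gt0 ?ltr_wpDl//.
    have := rn_ge0 (x - comb s (l m)); have := rn_ge0 (x - comb s (l n)).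
    nra.
  exists y => e e0; have [N hN] := hy _ e0; have [N' hN'] := inv_small e0.
  exists (l (maxn N N')); split; last by rewrite rnB; apply: hN; rewrite leq_maxl.
  by apply: (lt_trans (hl _)); apply: hN'; rewrite leq_maxr.
have [T hT] := choice ex.
have key x y l : (forall e : R, 0 < e -> exists l, rn (x - comb s l) < e /\ rn (y - comb s' l) < e) ->
    rn (y - comb s' l) <= t * rn (x - comb s l).
  move=> h; apply/ler_addgt0Pr => e e0.
  have [l' [h1 h2]] := h (e / (t + 1)) ltac:(by rewrite divr_gt0// ltr_wpDl).
  have := rn_tri (comb s' l') y (comb s' l); have := diff l' l.
  have := rn_tri x (comb s l') (comb s l); rewrite (rnB _ x).
  move: h1 h2; rewrite !ltr_pdivlMr ?ltr_wpDl//.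
  have := rn_ge0 (x - comb s l'); have := rn_ge0 (y - comb s' l'); nra.
have uniq x y y' : (forall e : R, 0 < e -> exists l, rn (x - comb s l) < e /\ rn (y - comb s' l) < e) ->
   (forall e : R, 0 < e -> exists l, rn (x - comb s l) < e /\ rn (y' - comb s' l) < e) -> y = y'.
  move=> h h'; apply: eq_small => e e0.
  have [l [h1 h2]] := h (e / (t + 1)) ltac:(by rewrite divr_gt0// ltr_wpDl).
  have := rn_tri (comb s' l) y y'; have := key _ _ l h'; rewrite (rnB y').
  move: h1 h2; rewrite !ltr_pdivlMr ?ltr_wpDl//.
  have := rn_ge0 (x - comb s l); have := rn_ge0 (y - comb s' l); nra.
exists T; split.
- move=> a x y; apply: (uniq (a *: x + y)); first exact: hT.
  move=> e e0; have c0 := cn_ge0 a.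
  have p : 0 < e / (cn a + 1) by rewrite divr_gt0// ltr_wpDl.
  have [l [h1 h2]] := hT x (e / (cn a + 1) / 2) ltac:(by rewrite divr_gt0).
  have [l' [h1' h2']] := hT y (e / (cn a + 1) / 2) ltac:(by rewrite divr_gt0).
  exists (scl a l ++ l'); rewrite !comb_cat !comb_scl !opprD ![_ + (- (a *: _) - _)]addrACA -!scalerBr.
  have b1 := rnD (a *: (x - comb s l)) (y - comb s l').
  have b2 := rnD (a *: (T x - comb s' l)) (T y - comb s' l').
  rewrite !rnZ in b1 b2.
  set E := e / (cn a + 1) in p h1 h2 h1' h2' *.
  have Ee : E * (cn a + 1) = e by rewrite mulfVK// gt_eqF// ltr_wpDl.
  by split; [apply: (le_lt_trans b1)|apply: (le_lt_trans b2)]; nra.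
- move=> x; have := key x (T x) [::] (hT x); by rewrite /comb !big_nil !subr0.
- move=> x; apply: (uniq (s x)); first exact: hT.
  move=> e e0; exists [:: (1, x)]; rewrite /comb !big_seq1 !scale1r !subrr !rn0; by split.
Qed.

End RealNorm.

(** * The ring of multipliers *)

Section CstarBasics.
Variables (R : realType) (A : cstar R).
Local Notation C := (cplx R).
Implicit Types (x y z : A) (a : C).

Lemma cmulDl x y z : (x + y) ** z = x ** z + y ** z. Proof. exact: linearDl. Qed.
Lemma cmulDr x y z : x ** (y + z) = x ** y + x ** z. Proof. exact: linearDr. Qed.
Lemma cmulZl a x y : (a *: x) ** y = a *: (x ** y). Proof. exact: linearZl_LR. Qed.
Lemma cmulZr a x y : x ** (a *: y) = a *: (x ** y). Proof. exact: linearZr_LR. Qed.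
Lemma cmulBl x y z : (x - y) ** z = x ** z - y ** z. Proof. exact: linearBl. Qed.
Lemma cmulBr x y z : x ** (y - z) = x ** y - x ** z. Proof. exact: linearBr. Qed.
Lemma cmul0l x : 0 ** x = 0. Proof. exact: linear0l. Qed.
Lemma cmul0r x : x ** 0 = 0. Proof. exact: linear0r. Qed.

Lemma star0 : star (0 : A) = 0.
Proof. by have := starD (-1) (0 : A) 0; rewrite scaler0 addr0 rmorphN rmorph1 scaleN1r addNr. Qed.
Lemma starZ a x : star (a *: x) = a^* *: star x.
Proof. by rewrite -[a *: x]addr0 starD star0 addr0. Qed.
Lemma staradd x y : star (x + y) = star x + star y.
Proof. by rewrite -[x]scale1r starD rmorph1 !scale1r. Qed.
Lemma starN x : star (- x) = - star x.
Proof. by rewrite -scaleN1r starZ rmorphN rmorph1 scaleN1r. Qed.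
Lemma starB x y : star (x - y) = star x - star y. Proof. by rewrite staradd starN. Qed.

Lemma rnM x y : rn (x ** y) <= rn x * rn y.
Proof. by rewrite -rc_le rcM -!rnE cnormM. Qed.
Lemma rn_starM x : rn (star x ** x) = rn x ^+ 2.
Proof. by apply: rc_inj; rewrite rcX -!rnE cnorm_star. Qed.
Lemma rn_star x : rn (star x) = rn x.
Proof.
suff h y : rn y <= rn (star y) by apply/eqP; rewrite eq_le h -{2}[x]starK h.
have [->|y0] := eqVneq (rn y) 0; first exact: rn_ge0.
have yp : 0 < rn y by rewrite lt_neqAle eq_sym y0 rn_ge0.
by rewrite -(ler_pM2r yp) -expr2 -rn_starM rnM.
Qed.
Lemma starM_eq0 x : star x ** x = 0 -> x = 0.
Proof. by move=> h; apply: rn0_eq0; apply/eqP; rewrite -sqrf_eq0 -rn_starM h rn0. Qed.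
Lemma cmul_inj x y : (forall z, star x ** z = star y ** z) -> x = y.
Proof.
move=> h; apply/eqP; rewrite -subr_eq0; apply/eqP/starM_eq0.
by rewrite starB cmulBl h subrr.
Qed.

Implicit Types m n : multiplier A.

(** Adjointability alone forces linearity: moving [m] to the other factor turns the claim into
    bilinearity of the product, and products with all [z] separate elements. *)
Lemma mact_lin m : linear m.
Proof.
move=> a x y; apply: cmul_inj => z.
by rewrite mactP !starD !cmulDl !cmulZl !mactP.
Qed.
Lemma mactM m x y : m (x ** y) = m x ** y.
Proof. by apply: cmul_inj => z; rewrite mactP !starM -!cmulA mactP. Qed.
Lemma mactPr m x y : star x ** m y = star (madj m x) ** y.
Proof. by rewrite -[LHS]starK starM starK mactP starM starK. Qed.

Lemma multP m n : (forall x, m x = n x) -> m = n.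
Proof.
move=> h; have e : mact m = mact n by apply/funext.
have e' : madj m = madj n.
  apply/funext => y; apply: cmul_inj => z.
  by rewrite -!mactPr h.
case: m n e e' {h} => [f g p] [f' g' p'] /= ? ?; subst f' g'.
by congr Multiplier; exact: Prop_irrelevance.
Qed.

Lemma mzero_subproof x y : star (0 : A) ** y = star x ** 0.
Proof. by rewrite star0 cmul0l cmul0r. Qed.
Definition mzero : multiplier A := @Multiplier _ A (fun=> 0) (fun=> 0) mzero_subproof.
Lemma madd_subproof m n x y : star (m x + n x) ** y = star x ** (madj m y + madj n y).
Proof. by rewrite staradd cmulDl cmulDr !mactP. Qed.
Definition madd m n : multiplier A := Multiplier (@madd_subproof m n).
Lemma mopp_subproof m x y : star (- m x) ** y = star x ** (- madj m y).
Proof. by rewrite starN linearNl linearNr mactP. Qed.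
Definition mopp m : multiplier A := Multiplier (@mopp_subproof m).
End CstarBasics.

HB.instance Definition _ (R : realType) (A : cstar R) := gen_eqMixin (multiplier A).
HB.instance Definition _ (R : realType) (A : cstar R) := gen_choiceMixin (multiplier A).

Section MultRing.
Variables (R : realType) (A : cstar R).
Local Notation C := (cplx R).
Implicit Types m p : multiplier A.
Lemma maddA : associative (@madd R A). Proof. by move=> m n p; apply: multP => x /=; rewrite addrA. Qed.
Lemma maddC : commutative (@madd R A). Proof. by move=> m n; apply: multP => x /=; rewrite addrC. Qed.
Lemma madd0 : left_id (mzero A) (@madd R A). Proof. by move=> m; apply: multP => x /=; rewrite add0r. Qed.
Lemma maddN : left_inverse (mzero A) (@mopp R A) (@madd R A).
Proof. by move=> m; apply: multP => x /=; rewrite addNr. Qed.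
HB.instance Definition _ := GRing.isZmodule.Build (multiplier A) maddA maddC madd0 maddN.
Lemma mmulA : associative (@mmul R A). Proof. by move=> m n p; apply: multP. Qed.
Lemma mmul1 : left_id (mone A) (@mmul R A). Proof. by move=> m; apply: multP. Qed.
Lemma mmulr1 : right_id (mone A) (@mmul R A). Proof. by move=> m; apply: multP. Qed.
Lemma mmulDl : left_distributive (@mmul R A) (@madd R A). Proof. by move=> m n p; apply: multP. Qed.
Lemma mmulDr : right_distributive (@mmul R A) (@madd R A).
Proof. by move=> m n p; apply: multP => x /=; rewrite (linD (mact_lin m)). Qed.
HB.instance Definition _ := GRing.Zmodule_isPzRing.Build (multiplier A) mmulA mmul1 mmulr1 mmulDl mmulDr.
Lemma mscaleA (a b : C) m : mscale a (mscale b m) = mscale (a * b) m.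
Proof. by apply: multP => x /=; rewrite scalerA. Qed.
Lemma mscale1 : left_id (1 : C) (@mscale R A). Proof. by move=> m; apply: multP => x /=; rewrite scale1r. Qed.
Lemma mscaleDr : right_distributive (@mscale R A) +%R.
Proof. by move=> a m n; apply: multP => x /=; rewrite scalerDr. Qed.
Lemma mscaleDl m : {morph (@mscale R A)^~ m : a b / a + b}.
Proof. by move=> a b; apply: multP => x /=; rewrite scalerDl. Qed.
HB.instance Definition _ := GRing.Zmodule_isLmodule.Build C (multiplier A) mscaleA mscale1 mscaleDr mscaleDl.

Lemma mmulE m n : m *M n = m * n. Proof. by []. Qed.
Lemma mulmE m n x : (m * n) x = m (n x). Proof. by []. Qed.
Lemma addmE m n x : (m + n) x = m x + n x. Proof. by []. Qed.
Lemma oppmE m x : (- m) x = - m x. Proof. by []. Qed.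
Lemma submE m n x : (m - n) x = m x - n x. Proof. by []. Qed.
Lemma scalemE (a : C) m x : (a *: m) x = a *: m x. Proof. by []. Qed.
Lemma zeromE x : (0 : multiplier A) x = 0. Proof. by []. Qed.
Lemma onemE x : (1 : multiplier A) x = x. Proof. by []. Qed.
Lemma mofE (x y : A) : mof x y = x ** y. Proof. by []. Qed.

Lemma scalemAl (a : C) m n : (a *: m) * n = a *: (m * n). Proof. exact: multP. Qed.
Lemma scalemAr (a : C) m n : m * (a *: n) = a *: (m * n).
Proof. by apply: multP => x; rewrite scalemE !mulmE scalemE (linZ (mact_lin m)). Qed.

Local Notation adj := (@mstar R A).
Lemma adjK m : adj (adj m) = m. Proof. exact: multP. Qed.
Lemma adjD m n : adj (m + n) = adj m + adj n. Proof. exact: multP. Qed.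
Lemma adjN m : adj (- m) = - adj m. Proof. exact: multP. Qed.
Lemma adjB m n : adj (m - n) = adj m - adj n. Proof. exact: multP. Qed.
Lemma adjM m n : adj (m * n) = adj n * adj m. Proof. exact: multP. Qed.
Lemma adjZ (a : C) m : adj (a *: m) = a^* *: adj m. Proof. exact: multP. Qed.
Lemma adj1 : adj 1 = 1. Proof. exact: multP. Qed.
Lemma adj0 : adj 0 = 0. Proof. exact: multP. Qed.
Lemma adjX m (n : nat) : adj (m ^+ n) = adj m ^+ n.
Proof. by elim: n => [|n IH]; [rewrite !expr0 adj1|rewrite exprS exprSr adjM IH]. Qed.
Lemma adjZr (r : R) m : adj (rc r *: m) = rc r *: adj m.
Proof. by rewrite adjZ rc_conj. Qed.

Lemma mofD (x y : A) : mof (x + y) = mof x + mof y.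
Proof. by apply: multP => z; rewrite addmE !mofE cmulDl. Qed.
Lemma mofZ (a : C) (x : A) : mof (a *: x) = a *: mof x.
Proof. by apply: multP => z; rewrite scalemE !mofE cmulZl. Qed.
Lemma mofM (x y : A) : mof (x ** y) = mof x * mof y.
Proof. by apply: multP => z; rewrite mulmE !mofE cmulA. Qed.
Lemma mof_star (x : A) : mof (star x) = adj (mof x). Proof. exact: multP. Qed.
Lemma mof_mact m (x : A) : mof (m x) = m * mof x.
Proof. by apply: multP => z; rewrite mulmE !mofE mactM. Qed.
Lemma mof_inj : injective (@mof R A).
Proof.
move=> x y h; rewrite -[x]starK -[y]starK; congr star; apply: cmul_inj => z.
by rewrite !starK -!mofE h.
Qed.

(** Multipliers carry no norm here; upper bounds for the action on [A] take its place. *)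
Definition bd m (t : R) := forall x, rn (m x) <= t * rn x.

Lemma bdD m n s t : bd m s -> bd n t -> bd (m + n) (s + t).
Proof. by move=> hm hn x; rewrite addmE (le_trans (rnD _ _))// mulrDl lerD. Qed.
Lemma bdN m t : bd m t -> bd (- m) t.
Proof. by move=> h x; rewrite oppmE rnN. Qed.
Lemma bdB m n s t : bd m s -> bd n t -> bd (m - n) (s + t).
Proof. by move=> hm hn; apply: bdD => //; apply: bdN. Qed.
Lemma bdM m n s t : 0 <= s -> bd m s -> bd n t -> bd (m * n) (s * t).
Proof. by move=> s0 hm hn x; rewrite mulmE (le_trans (hm _))// -mulrA ler_wpM2l. Qed.
Lemma bdZ m t (a : C) : bd m t -> bd (a *: m) (cn a * t).
Proof. by move=> h x; rewrite scalemE rnZ -mulrA ler_wpM2l// cn_ge0. Qed.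
Lemma bdZr (r : R) m t : 0 <= r -> bd m t -> bd (rc r *: m) (r * t).
Proof. by move=> r0 h; have := bdZ (rc r) h; rewrite cn_rc ger0_norm. Qed.
Lemma bd1 : bd 1 1. Proof. by move=> x; rewrite mul1r. Qed.
Lemma bd0 t : 0 <= t -> bd 0 t. Proof. by move=> t0 x; rewrite zeromE rn0 mulr_ge0// rn_ge0. Qed.
Lemma bd_le m s t : s <= t -> bd m s -> bd m t.
Proof. by move=> st h x; rewrite (le_trans (h x))// ler_wpM2r// rn_ge0. Qed.
Lemma bd_mof (x : A) : bd (mof x) (rn x). Proof. by move=> y; exact: rnM. Qed.
Lemma mof_bd (x : A) t : 0 <= t -> bd (mof x) t -> rn x <= t.
Proof.
move=> t0 h; have [->//|x0] := eqVneq (rn x) 0.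
have xp : 0 < rn x by rewrite lt_neqAle eq_sym x0 rn_ge0.
have := h (star x); rewrite mofE rn_star -{1}[x]starK rn_starM rn_star expr2.
by rewrite ler_pM2r.
Qed.
Lemma bd_sq m t : 0 <= t -> bd (adj m * m) (t ^+ 2) -> bd m t.
Proof.
move=> t0 h x; rewrite -(@ler_pXn2r _ 2) ?nnegrE ?mulr_ge0 ?rn_ge0// -rn_starM mactP.
apply: (le_trans (rnM _ _)); rewrite rn_star.
have := h x; rewrite mulmE /=; have := rn_ge0 x; nra.
Qed.
Lemma bd_small m : (forall e : R, 0 < e -> bd m e) -> m = 0.
Proof.
move=> h; apply: multP => x; rewrite zeromE; apply: rn_small => e e0.
have p : 0 < rn x + 1 by rewrite ltr_wpDl// rn_ge0.
have := h (e / (rn x + 1)) ltac:(by rewrite divr_gt0) x.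
move/le_trans; apply; rewrite mulrAC ler_pdivrMr//; have := rn_ge0 x; nra.
Qed.
Lemma bd_adj m t : 0 <= t -> bd m t -> bd (adj m) t.
Proof.
move=> t0 h x; have [->|x0] := eqVneq (rn (adj m x)) 0; first by rewrite mulr_ge0// rn_ge0.
have xp : 0 < rn (adj m x) by rewrite lt_neqAle eq_sym x0 rn_ge0.
rewrite -(ler_pM2r xp) -expr2 -rn_starM mactP /= (le_trans (rnM _ _))// rn_star.
by have := h (madj m x); have := rn_ge0 x; rewrite /=; nra.
Qed.

(* Sokal's argument for the uniform boundedness principle, applied to the
   functionals x |-> (m y_n)^* x = y_n^* (m^* x). *)
Lemma bounded m : exists2 t : R, 0 <= t & bd m t.
Proof.
apply: contrapT => nb.
(* The growth $4^n$ has to win against the step size $3^{-n}$ chosen below: the images then grow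
   like $(4/3)^n$. *)
have /choice[y hy] : forall n : nat, exists y, rn y <= 1 /\ 4 ^+ n < rn (m y).
  move=> n; apply: contrapT => h; apply: nb; exists (4 ^+ n) => [|x]; first exact: exprn_ge0.
  have [->|x0] := eqVneq x 0; first by rewrite (lin0 (mact_lin m)) rn0 mulr0.
  have xp : 0 < rn x by rewrite lt_neqAle eq_sym rn_eq0 x0 rn_ge0.
  rewrite leNgt; apply/negP => hx; apply: h; exists (rc (rn x)^-1 *: x).
  rewrite rnZr ger0_norm ?invr_ge0 ?rn_ge0// mulVf ?gt_eqF//; split=> //.
  by rewrite (linZ (mact_lin m)) rnZr ger0_norm ?invr_ge0 ?rn_ge0// mulrC ltr_pdivlMr.
pose z (n : nat) := m (y n).
have zp (n : nat) : 0 < rn (z n) by apply: lt_trans (proj2 (hy n)); rewrite exprn_gt0.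
have T (n : nat) x : rn (star (z n) ** x) <= rn (madj m x).
  rewrite mactP (le_trans (rnM _ _))// rn_star ler_piMl ?rn_ge0//; by case: (hy n).
(* Sokal's dichotomy: the images of [x + d] and [x - d] differ by twice the image of [d], so one of
   them is large. *)
have Tz (n : nat) x : exists x', rn (x' - x) <= 3^-1 ^+ n /\ 3^-1 ^+ n * rn (z n) <= rn (star (z n) ** x').
  pose d := rc (3^-1 ^+ n / rn (z n)) *: z n.
  have dn : rn d = 3^-1 ^+ n.
    by rewrite rnZr ger0_norm ?divr_ge0 ?exprn_ge0 ?invr_ge0 ?ler0n ?rn_ge0// mulfVK// gt_eqF.
  have zd : rn (star (z n) ** d) = 3^-1 ^+ n * rn (z n).
    rewrite cmulZr rnZr ger0_norm ?divr_ge0 ?exprn_ge0 ?invr_ge0 ?ler0n ?rn_ge0// rn_starM.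
    by rewrite expr2 mulrA mulfVK// gt_eqF.
  have [h|h] := leP (3^-1 ^+ n * rn (z n)) (rn (star (z n) ** (x + d))).
    by exists (x + d); rewrite addrC addKr dn.
  exists (x - d); rewrite addrAC subrr add0r rnN dn; split=> //.
  have := rnB (star (z n) ** (x + d)) (star (z n) ** (x - d)).
  have := rnD (star (z n) ** (x + d)) (- (star (z n) ** (x - d))).
  rewrite -cmulBr opprD opprK addrACA subrr add0r rnN cmulDr.
  have -> : star (z n) ** d + star (z n) ** d = rc 2 *: (star (z n) ** d).
    by rewrite rc_nat scaler_nat mulr2n.
  by rewrite rnZr normr_nat zd; lra.
have [f hf] : exists f : nat -> A -> A, forall n x, rn (f n x - x) <= 3^-1 ^+ n /\
    3^-1 ^+ n * rn (z n) <= rn (star (z n) ** f n x).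
  have /choice[f hf] : forall p : nat * A, exists x', rn (x' - p.2) <= 3^-1 ^+ p.1 /\
    3^-1 ^+ p.1 * rn (z p.1) <= rn (star (z p.1) ** x') by move=> [n x]; apply: Tz.
  by exists (fun n x => f (n, x)) => n x; apply: (hf (n, x)).
pose u := fix u n : A := if n is k.+1 then f k.+1 (u k) else 0.
have du (n k : nat) : rn (u (n + k)%N - u n) <= (3 : R)^-1 ^+ n / 2 - 3^-1 ^+ (n + k) / 2.
  elim: k => [|k IH]; first by rewrite addn0 !subrr rn0.
  rewrite addnS; have := (hf (n + k).+1 (u (n + k)%N)).1.
  have := rn_tri (u (n + k)%N) (f (n + k).+1 (u (n + k)%N)) (u n) => /=.
  rewrite exprS; lra.
have pw (n : nat) : 0 < 3^-1 ^+ n :> R by rewrite exprn_gt0// invr_gt0.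
have small (e : R) : 0 < e -> exists N, forall n, (N <= n)%N -> 3^-1 ^+ n < e :> R.
  move=> /inv_small[N hN]; exists N => n /hN; apply: le_lt_trans.
  rewrite exprVn lef_pV2 ?posrE ?exprn_gt0 ?ltr0n// -natrX ler_nat.
  exact: ltn_expl.
have [e e0|x hx] := @cauchy_tends R A u.
  have [N hN] := small e e0; exists N.
  have key i j : (N <= i)%N -> (i <= j)%N -> rn (u j - u i) < e.
    move=> Ni ij; have := du i (j - i)%N; rewrite subnKC//.
    have := hN i Ni; have := pw i; have := pw j; lra.
  move=> i j Ni Nj; have [ij|/ltnW ji] := leqP i j; last exact: key.
  by rewrite rnB key.
(* The tail $\sum_{k>n}3^{-k}=3^{-n}/2$ costs half of the gain at stage [n], so the other half
   survives in the limit. *)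
have xu (n : nat) : rn (x - u n) <= 3^-1 ^+ n / 2.
  rewrite rnB; apply/ler_addgt0Pr => e e0; have [N hN] := hx e e0.
  have := hN (n + N)%N (leq_addl _ _); have := du n N; have := pw (n + N)%N.
  have := rn_tri (u (n + N)%N) (u n) x; rewrite (rnB (u n) (u _)); lra.
have fin (n : nat) : (4 / 3) ^+ n <= 2 * rn (madj m x) + 1.
  case: n => [|n]; first by rewrite expr0; have := rn_ge0 (madj m x); lra.
  have := (hf n.+1 (u n)).2; rewrite -[f _ _]/(u n.+1) => h1.
  have h2 := rn_le (star (z n.+1) ** u n.+1) (star (z n.+1) ** x); rewrite -cmulBr in h2.
  have h3 := rnM (star (z n.+1)) (u n.+1 - x); rewrite rn_star (rnB (u _)) in h3.
  have h4 : rn (z n.+1) * rn (x - u n.+1) <= rn (z n.+1) * (3^-1 ^+ n.+1 / 2) by rewrite ler_wpM2l ?rn_ge0.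
  have h5 : 3^-1 ^+ n.+1 * 4 ^+ n.+1 <= 3^-1 ^+ n.+1 * rn (z n.+1) by rewrite ler_wpM2l ?(ltW (pw _))// ltW//; case: (hy n.+1).
  have h6 := T n.+1 x.
  by rewrite exprMn [4 ^+ _ * _]mulrC; lra.
have [N hN] : exists N, forall n, (N <= n)%N -> 2 * rn (madj m x) + 1 < n%:R / 3.
  exists (Num.truncn (3 * (2 * rn (madj m x) + 1))).+1 => n hn.
  by rewrite ltr_pdivlMr// mulrC (lt_le_trans (truncnS_gt _))// ler_nat.
have ber (n : nat) : 1 + n%:R / 3 <= (4 / 3) ^+ n :> R.
  elim: n => [|n IH]; first by rewrite expr0 mul0r addr0.
  rewrite exprS -natr1; have := ler0n R n; nra.
have := fin N; have := hN N (leqnn _); have := ber N; lra.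
Qed.

End MultRing.

(** * Positive multipliers *)

Section Positivity.
Variables (R : realType) (A : cstar R).
Local Notation C := (cplx R).
Local Notation M := (multiplier A).
Local Notation adj := (@mstar R A).
Local Notation ms r := (rc r *: (1 : multiplier A)).
Implicit Types m p h k b c d u y : M.

Lemma madj_eq m x : adj m = m -> madj m x = m x.
Proof. by move=> e; rewrite -[in RHS]e. Qed.

(** Completeness for the bound [bd], restricted to self-adjoint sequences because the pointwise
    limit has to come with an adjoint, which is then the limit itself. *)
Lemma msa_lim (s : nat -> M) : (forall n, adj (s n) = s n) ->
  (forall e : R, 0 < e -> exists N, forall i j, (N <= i)%N -> (N <= j)%N -> bd (s i - s j) e) ->
  exists b, adj b = b /\ forall e : R, 0 < e -> exists N, forall n, (N <= n)%N -> bd (b - s n) e.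
Proof.
move=> sa h.
have /choice[f hf] : forall x : A, exists z : A, tends (fun n => s n x) z.
  move=> x.
  apply: cauchy_tends => e e0; have p : 0 < rn x + 1 by rewrite ltr_wpDl// rn_ge0.
  have [N hN] := h (e / (rn x + 1)) ltac:(by rewrite divr_gt0).
  exists N => i j /hN hi /hi /(_ x) /le_lt_trans; apply.
  by rewrite mulrAC ltr_pdivrMr//; have := rn_ge0 x; nra.
have rate (e : R) : 0 < e -> exists N, forall n, (N <= n)%N -> forall x, rn (f x - s n x) <= e * rn x.
  move=> /h[N hN]; exists N => n Nn x; apply/ler_addgt0Pr => d /(hf x)[N' hN'].
  have := hN' _ (leq_maxr N N'); have := hN _ _ (leq_maxl N N') Nn x.
  have := rn_tri (s (maxn N N') x) (f x) (s n x); rewrite (rnB (f x) (s (maxn N N') x)) submE; lra.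
have fP (x y : A) : star (f x) ** y = star x ** f y.
  apply: eq_small => e e0.
  pose E := e / (2 * (rn x * rn y + 1)).
  have p : 0 < rn x * rn y + 1 by rewrite ltr_wpDl// mulr_ge0 ?rn_ge0.
  have E0 : 0 < E by rewrite divr_gt0// mulr_gt0.
  have [N /(_ N (leqnn _)) hN] := rate E E0.
  have := rn_tri (star (s N x) ** y) (star (f x) ** y) (star x ** f y).
  rewrite -cmulBl -starB (mactP (s N)) madj_eq// (rnB (star x ** _)) -cmulBr.
  have := rnM (star (f x - s N x)) y; have := rnM (star x) (f y - s N y); rewrite !rn_star.
  have := hN x; have := hN y; have := rn_ge0 x; have := rn_ge0 y => y0 x0 hy hx a b.
  have a' : rn x * rn (f y - s N y) <= rn x * (E * rn y) by rewrite ler_wpM2l.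
  have b' : rn (f x - s N x) * rn y <= E * rn x * rn y by rewrite ler_wpM2r.
  have : E * (2 * (rn x * rn y + 1)) = e by rewrite mulfVK// gt_eqF// mulr_gt0.
  nra.
exists (Multiplier fP); split; first exact: multP.
by move=> e /rate[N hN]; exists N => n /hN.
Qed.

(** A fixed point of $b\mapsto(k+b^2)/2$ satisfies $(1-b)^2=1-k$. The scalar sequence [betaseq] is
    the same iteration at $k=1$; it majorises the norms of the iterates and of their increments, and
    increases to 1. *)
Fixpoint bseq k (n : nat) : M := if n is n'.+1 then rc 2^-1 *: (k + bseq k n' ^+ 2) else 0.
Fixpoint betaseq (n : nat) : R := if n is n'.+1 then (1 + betaseq n' ^+ 2) / 2 else 0.

Lemma betaseqS n : betaseq n.+1 = (1 + betaseq n ^+ 2) / 2. Proof. by []. Qed.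

Lemma betaseq_bounds n : 0 <= betaseq n <= 1.
Proof. by elim: n => [|n /andP[h1 h2]] /=; [rewrite lexx ler01|apply/andP; split; nra]. Qed.
Lemma betaseq_le n : betaseq n <= betaseq n.+1.
Proof. by rewrite /=; have := sqr_ge0 (betaseq n - 1); nra. Qed.
(** The gap $D=1-\beta$ evolves by $D\mapsto D-D^2/2$, which decays like $2/n$. An explicit rate
    lets the limits below be taken by choosing an index. *)
Lemma betaseq_rate n : 1 - betaseq n <= 2 / n.+2%:R.
Proof.
elim: n => [|n IH]; first by rewrite /= subr0 divff ?lexx ?pnatr_eq0.
have /andP[h1 h2] := betaseq_bounds n.
set t := n.+2%:R in IH; have t2 : 2 <= t by rewrite ler_nat.
have t0 : 0 < t by apply: lt_le_trans t2.
have -> : n.+3%:R = t + 1 by rewrite natr1.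
rewrite /= -/(betaseq n); set be := betaseq n in IH h1 h2 *.
have IH' : (1 - be) * t <= 2 by rewrite -ler_pdivlMr.
rewrite ler_pdivlMr ?ltr_wpDl ?ltW//.
set D := 1 - be in IH' *.
have -> : (1 - (1 + be ^+ 2) / 2) * (t + 1) = (D - D ^+ 2 / 2) * (t + 1).
  by rewrite /D; field.
have D0 : 0 <= D by rewrite subr_ge0.
have D1 : D <= 1 by rewrite /D; lra.
have := mulr_ge0 (ltac:(lra) : 0 <= 2 - D * t) (ltac:(lra) : 0 <= 1 - D / 2); nra.
Qed.

Lemma comm_scale (a : C) m k : GRing.comm m k -> GRing.comm m (a *: k).
Proof. by rewrite /GRing.comm scalemAl scalemAr => ->. Qed.

Lemma bseq_comm k m n : GRing.comm m k -> GRing.comm m (bseq k n).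
Proof.
move=> c; elim: n => [|n IH] /=; first exact: commr0.
by apply: comm_scale; apply: commrD => //; apply: commrX.
Qed.

Lemma bseq_adj k n : adj k = k -> adj (bseq k n) = bseq k n.
Proof. by move=> e; elim: n => [|n IH] /=; rewrite ?adj0// adjZr adjD adjX IH e. Qed.

Lemma bseq_bd k n : bd k 1 -> bd (bseq k n) (betaseq n).
Proof.
move=> hk; elim: n => [|n IH] /=; first exact: bd0.
have /andP[h1 h2] := betaseq_bounds n.
rewrite [_ / 2]mulrC; apply: bdZr; first by rewrite invr_ge0.
by apply: bdD => //; rewrite !expr2; apply: bdM.
Qed.

Lemma bseq_step k n : bd k 1 -> bd (bseq k n.+1 - bseq k n) (betaseq n.+1 - betaseq n).
Proof.
move=> hk; elim: n => [|n IH].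
  by rewrite /= !expr0n /= !addr0 !subr0 mulrC; apply: bdZr => //; rewrite invr_ge0.
have -> : bseq k n.+2 - bseq k n.+1 =
    rc 2^-1 *: ((bseq k n.+1 - bseq k n) * (bseq k n.+1 + bseq k n)).
  rewrite [bseq k n.+2]/= -[in X in _ - X]/(rc 2^-1 *: (k + bseq k n ^+ 2)) -/(bseq k n.+1).
  rewrite -scalerBr opprD addrACA subrr add0r mulrBl !mulrDr -!expr2.
  congr (_ *: _); have -> : bseq k n * bseq k n.+1 = bseq k n.+1 * bseq k n.
    by symmetry; apply: bseq_comm; apply/commr_sym/bseq_comm.
  by rewrite opprD addrA addrK.
have /andP[h1 h2] := betaseq_bounds n; have /andP[h3 h4] := betaseq_bounds n.+1.
have -> : betaseq n.+2 - betaseq n.+1 = 2^-1 * ((betaseq n.+1 - betaseq n) * (betaseq n.+1 + betaseq n)).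
  by rewrite [betaseq n.+2]betaseqS; have := betaseqS n; nra.
apply: bdZr; first by rewrite invr_ge0.
apply: bdM => //; first by rewrite subr_ge0 betaseq_le.
by apply: bdD; apply: bseq_bd.
Qed.

Lemma bseq_diff k n i : bd k 1 -> bd (bseq k (n + i) - bseq k n) (betaseq (n + i) - betaseq n).
Proof.
move=> hk; elim: i => [|i IH]; first by rewrite addn0 !subrr; apply: bd0.
rewrite addnS -(subrKA (bseq k (n + i))) -[X in bd _ X](subrKA (betaseq (n + i))).
by apply: bdD => //; apply: bseq_step.
Qed.

Lemma bd_closed m t : (forall e : R, 0 < e -> bd m (t + e)) -> bd m t.
Proof.
move=> h x; apply/ler_addgt0Pr => e e0.
have p : 0 < rn x + 1 by rewrite ltr_wpDl// rn_ge0.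
have := h (e / (rn x + 1)) ltac:(by rewrite divr_gt0) x.
move/le_trans; apply; rewrite mulrDl lerD2l mulrAC ler_pdivrMr//.
by have := rn_ge0 x; nra.
Qed.

(* [1 - b] is the square root of [1 - k]. *)
Lemma sqrt_one_minus k : adj k = k -> bd k 1 -> exists b,
  [/\ adj b = b, k = b + b - b * b, bd b 1,
      forall m, GRing.comm m k -> GRing.comm m b &
      forall n, bd (b - bseq k n) (1 - betaseq n)].
Proof.
move=> ka hk.
have near1 (e : R) : 0 < e -> exists N, forall n, (N <= n)%N -> 1 - betaseq n < e.
  move=> e0; have [N hN] := @inv_small R (e / 2) ltac:(by rewrite divr_gt0).
  exists N => n /hN h; apply: (le_lt_trans (betaseq_rate n)).
  have : n.+2%:R^-1 <= n.+1%:R^-1 :> R by rewrite lef_pV2 ?posrE ?ltr0n// ler_nat.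
  rewrite -(ler_pM2l (ltr0n R 2)) => /le_lt_trans; apply.
  by rewrite mulrC -ltr_pdivlMr.
have [||b [ba hb]] := @msa_lim (bseq k); first by move=> n; apply: bseq_adj.
  move=> e /near1[N hN]; exists N.
  have key i j : (N <= i)%N -> (i <= j)%N -> bd (bseq k j - bseq k i) e.
    move=> Ni ij; have := bseq_diff i (j - i) hk; rewrite subnKC//.
    apply: bd_le; have := hN i Ni; have /andP[_] := betaseq_bounds j; lra.
  move=> i j Ni Nj; have [ij|/ltnW ji] := leqP i j; last exact: key.
  by rewrite -opprB; apply: bdN; apply: key.
have rate n : bd (b - bseq k n) (1 - betaseq n).
  apply: bd_closed => e /hb[N hN]; have := hN (n + N)%N (leq_addl _ _).
  have := bseq_diff n N hk => h1 /bdD/(_ h1); rewrite subrKA => h2.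
  by apply: bd_le h2; have /andP[_] := betaseq_bounds (n + N); lra.
have b1 : bd b 1.
  by have := rate 0%N; rewrite /= !subr0.
exists b; split=> //.
- apply/eqP; rewrite -subr_eq0; apply/eqP/bd_small => e e0.
  have [N hN] := near1 (e / 4) ltac:(by rewrite divr_gt0).
  have -> : k - (b + b - b * b) =
     rc 2 *: (bseq k N.+1 - b) + ((b - bseq k N) * b + bseq k N * (b - bseq k N)).
    rewrite /= scalerBr rc_2VK rc_double.
    rewrite mulrBl mulrBr subrKA -expr2 opprB addrCA.
    by rewrite -!expr2 [RHS]addrC (addrC k (_ ^+ 2)) -(addrA (_ ^+ 2) k) [RHS]addrA subrK.
  have h1 : bd (bseq k N.+1 - b) (1 - betaseq N.+1) by rewrite -opprB; apply: bdN.
  have h2 := bdZr (ler0n R 2) h1.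
  have /andP[_ h3] := betaseq_bounds N.
  have h4 : bd ((b - bseq k N) * b) ((1 - betaseq N) * 1) by apply: bdM; rewrite ?subr_ge0.
  have h5 : bd (bseq k N * (b - bseq k N)) (betaseq N * (1 - betaseq N)).
    by apply: bdM; [case/andP: (betaseq_bounds N)|apply: bseq_bd|].
  apply: bd_le (bdD h2 (bdD h4 h5)).
  have := hN N (leqnn _); have := hN N.+1 (leqnSn _); have /andP[] := betaseq_bounds N; nra.
- move=> m mk; apply/eqP; rewrite -subr_eq0; apply/eqP/bd_small => e e0.
  have [t t0 mt] := bounded m.
  have [N /(_ N (leqnn _)) hN] := near1 (e / (2 * (t + 1))) ltac:(by rewrite divr_gt0// mulr_gt0// ltr_wpDl).
  have -> : m * b - b * m = m * (b - bseq k N) - (b - bseq k N) * m.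
    by rewrite mulrBr mulrBl (bseq_comm N mk) opprB addrA subrK.
  have h1 : bd (m * (b - bseq k N)) (t * (1 - betaseq N)) by apply: bdM.
  have h2 : bd ((b - bseq k N) * m) ((1 - betaseq N) * t).
    by apply: bdM => //; rewrite subr_ge0; case/andP: (betaseq_bounds N).
  apply: bd_le (bdB h1 h2).
  move: hN; rewrite ltr_pdivlMr ?mulr_gt0 ?ltr_wpDl//.
  case/andP: (betaseq_bounds N); nra.
Qed.

Lemma one_minus_sq b k : k = b + b - b * b -> (1 - b) * (1 - b) = 1 - k.
Proof. by move=> ->; rewrite mulrBl !mulrBr !mul1r mulr1 !opprB opprD (addrCA (b * b)) [RHS]addrA. Qed.

(** For self-adjoint [h] this is the norm form of the condition that the spectrum lies in $[0,2t]$.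
    With it, sums of positive elements are positive by the triangle inequality alone. *)
Definition pos h := adj h = h /\ exists2 t : R, 0 <= t & bd (ms t - h) t.

Lemma pos_big h t s : bd (ms t - h) t -> t <= s -> bd (ms s - h) s.
Proof.
move=> b ts; have -> : ms s - h = ms (s - t) + (ms t - h).
  by rewrite addrA -scalerDl -rcD subrK.
have s0 : 0 <= s - t by rewrite subr_ge0.
by apply: bd_le (bdD (bdZr s0 (@bd1 R A)) b); rewrite mulr1 subrK.
Qed.

Lemma posD h k : pos h -> pos k -> pos (h + k).
Proof.
move=> [ha [t t0 ht]] [ka [s s0 ks]]; split; first by rewrite adjD ha ka.
exists (t + s); first exact: addr_ge0.
by rewrite rcD scalerDl opprD addrACA; apply: bdD.
Qed.

Lemma posZ (r : R) h : 0 <= r -> pos h -> pos (rc r *: h).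
Proof.
move=> r0 [ha [t t0 ht]]; split; first by rewrite adjZr ha.
exists (r * t); first exact: mulr_ge0.
by rewrite rcM -scalerA -scalerBr; apply: bdZr.
Qed.

Lemma pos0 : pos 0.
Proof. by split; [exact: adj0|exists 0 => //; rewrite scale0r subr0; apply: bd0]. Qed.

Lemma cn_imag : cn ('i : C) = 1.
Proof. by apply: rc_inj; rewrite -cnE normCi. Qed.

Lemma imag_sq : ('i : C) * 'i = -1. Proof. by rewrite -expr2 sqrCi. Qed.

(** For $v=c+id$ both $v^*v$ and $vv^*$ equal $c^2+d^2$, so [v] and its adjoint are bounded by [t],
    and [c] is their mean. *)
Lemma commuting_bd c d t : 0 <= t -> adj c = c -> adj d = d -> GRing.comm c d ->
  bd (c * c + d * d) (t ^+ 2) -> bd c t.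
Proof.
move=> t0 ca da cd h.
pose v := c + ('i : C) *: d; pose w := c - ('i : C) *: d.
have av : adj v = w by rewrite adjD adjZ conjCi ca da scaleNr.
have aw : adj w = v by rewrite -av adjK.
have wv : w * v = c * c + d * d.
  rewrite mulrBl !mulrDr !scalemAl !scalemAr scalerA imag_sq scaleN1r cd opprD opprK.
  by rewrite addrA addrK.
have vw : v * w = c * c + d * d.
  rewrite mulrDl !mulrBr !scalemAl !scalemAr scalerA imag_sq scaleN1r cd opprK.
  by rewrite addrA subrK.
have hv : bd v t by apply: bd_sq => //; rewrite av wv.
have hw : bd w t by apply: bd_sq => //; rewrite aw vw.
have -> : c = rc 2^-1 *: (v + w).
  by rewrite addrACA subrr addr0 rc_half.
have h2 : 0 <= 2^-1 :> R by rewrite invr_ge0.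
by apply: bd_le (bdZr h2 (bdD hv hw)); lra.
Qed.

(** [mof] is isometric, so approximants form a Cauchy sequence in [A]; this keeps square roots of
    elements of [A] inside [A]. *)
Lemma mof_closed m : (forall e : R, 0 < e -> exists a : A, bd (m - mof a) e) -> exists a : A, m = mof a.
Proof.
move=> h; have /choice[a ha] : forall n : nat, exists a : A, bd (m - mof a) n.+1%:R^-1.
  by move=> n; apply: h; rewrite invr_gt0 ltr0n.
have [e e0|x hx] := @cauchy_tends R A a.
  have [N hN] := @inv_small R (e / 2) ltac:(by rewrite divr_gt0).
  exists N => i j /hN hi /hN hj.
  have : bd (mof (a i - a j)) (j.+1%:R^-1 + i.+1%:R^-1).
    rewrite -scaleN1r mofD mofZ scaleN1r -(subrKA m) addrC -[mof (a i) - m]opprB.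
    by apply: bdB; apply: ha.
  move/mof_bd => b; apply: (le_lt_trans (b _)); first by rewrite addr_ge0// invr_ge0.
  by rewrite (splitr e) ltrD.
exists x; apply/eqP; rewrite -subr_eq0; apply/eqP/bd_small => e e0.
have [N hN] := @inv_small R (e / 2) ltac:(by rewrite divr_gt0).
have [N' hN'] := hx (e / 2) ltac:(by rewrite divr_gt0).
rewrite -(subrKA (mof (a (maxn N N')))).
have := @bd_mof _ _ (a (maxn N N') - x); rewrite -scaleN1r mofD mofZ !scaleN1r => /(bdD (ha (maxn N N'))).
by apply: bd_le; rewrite (splitr e) lerD// ltW// (hN, hN')// (leq_maxl, leq_maxr).
Qed.

(** Each iterate is a scalar plus an element of [A], the scalar being [betaseq n]. As this tends to
    1, the root [1 - b] ends up in [A]. *)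
Lemma bseq_mof k (h : A) : k = 1 - mof h -> forall n, exists a : A, bseq k n = ms (betaseq n) + mof a.
Proof.
move=> ->; elim=> [|n [a IH]]; first by exists 0; rewrite /= scale0r add0r -[0 in RHS](scale0r (0 : A)) mofZ scale0r.
exists (rc 2^-1 *: (rc (betaseq n) *: (a + a) + a ** a - h)).
rewrite [bseq _ _]/= IH betaseqS mulrC rcM -scalerA mofZ -scalerDr; congr (_ *: _).
rewrite expr2 mulrDl !mulrDr rcD scalerDl rc1 scale1r -!addrA (addrC (- _)) -!addrA; congr (_ + _).
rewrite !scalemAl !scalemAr !mul1r !mulr1 scalerA -rcM -expr2; congr (_ + _).
by rewrite -[- h]scaleN1r !mofD !mofZ !mofD mofM scaleN1r scalerDr !addrA.
Qed.

(** After scaling by some $s>0$, $k=1-h/s$ is a contraction and $\sqrt s\,(1-b)$ squares to [h]. The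
    bound [t] may be 0, hence the passage to [t + 1]. *)
Lemma pos_sqrt_in h : pos h -> exists c,
  [/\ adj c = c, c * c = h, pos c, forall m, GRing.comm m h -> GRing.comm m c &
      forall h0 : A, h = mof h0 -> exists c0 : A, c = mof c0].
Proof.
move=> [ha [t t0 ht]].
have [s s0 hs] : exists2 s, 0 < s & bd (ms s - h) s.
  by exists (t + 1); [rewrite ltr_wpDl|apply: pos_big ht _; rewrite lerDl].
have si : 0 <= s^-1 by rewrite invr_ge0 ltW.
pose k := rc s^-1 *: (ms s - h).
have ka : adj k = k by rewrite adjZr adjB adjZr adj1 ha.
have hk : bd k 1 by have := bdZr si hs; rewrite mulVf// gt_eqF.
have [b [ba bk b1 bc rate]] := sqrt_one_minus ka hk.
have rs : Num.sqrt s * Num.sqrt s = s by rewrite -expr2 sqr_sqrtr// ltW.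
exists (rc (Num.sqrt s) *: (1 - b)); split.
- by rewrite adjZr adjB adj1 ba.
- rewrite scalemAl scalemAr scalerA -rcM rs (one_minus_sq bk).
  by rewrite /k scalerBr rc_scaleVK ?gt_eqF// subKr.
- apply: posZ; first exact: sqrtr_ge0.
  split; first by rewrite adjB adj1 ba.
  by exists 1 => //; rewrite scale1r opprB addrC subrK.
- move=> m mh; apply: comm_scale; apply: commrB; first exact: commr1.
  by apply: bc; apply: comm_scale; apply: commrB => //; apply: comm_scale; exact: commr1.
- move=> h0 hh0; have kh : k = 1 - mof (rc s^-1 *: h0).
    by rewrite /k scalerBr rc_scaleK ?gt_eqF// hh0 mofZ.
  suff [c0 hc0] : exists c0 : A, 1 - b = mof c0.
    by exists (rc (Num.sqrt s) *: c0); rewrite mofZ hc0.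
  apply: mof_closed => e e0; have [N hN] := @inv_small R (e / 4) ltac:(by rewrite divr_gt0).
  have [a aE] := bseq_mof kh N; exists (- a).
  have -> : 1 - b - mof (- a) = ms (1 - betaseq N) - (b - bseq k N).
    rewrite aE rcB scalerBl rc1 scale1r -[- a]scaleN1r mofZ scaleN1r opprK opprB.
    by rewrite -(addrA (ms _) (mof a)) [RHS]addrA subrK addrAC [RHS]addrA.
  have /andP[_ be1] := betaseq_bounds N.
  have be0 : 0 <= 1 - betaseq N by rewrite subr_ge0.
  apply: bd_le (bdB (bdZr be0 (@bd1 R A)) (rate N)).
  have := hN N (leqnn _); have := betaseq_rate N.
  have : N.+2%:R^-1 <= N.+1%:R^-1 :> R by rewrite lef_pV2 ?posrE ?ltr0n// ler_nat.
  set i1 := N.+2%:R^-1; set i2 := N.+1%:R^-1; lra.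
Qed.

Lemma pos_sqrt h : pos h -> exists c,
  [/\ adj c = c, c * c = h, pos c & forall m, GRing.comm m h -> GRing.comm m c].
Proof. by move=> /pos_sqrt_in[c [? ? ? ? _]]; exists c. Qed.

(** For a self-adjoint contraction [c'] put $d=1-b$, so that $d^2=1-c'^2$ and [d] commutes with
    [c']. Since $d^2+c'^2=1$, [commuting_bd] bounds [d] by 1, and $\|1-c'^2\|=\|d^2\|\le1$ is what
    [pos] asks of $c'^2$. *)
Lemma pos_sq c : adj c = c -> pos (c * c).
Proof.
move=> ca; have [t t0 ct] := bounded c.
have T0 : 0 < t + 1 by rewrite ltr_wpDl.
pose c' := rc (t + 1)^-1 *: c.
have Ti : 0 <= (t + 1)^-1 by rewrite invr_ge0 ltW.
have c'a : adj c' = c' by rewrite adjZr ca.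
have c'1 : bd c' 1 by apply: bd_le (bdZr Ti ct); rewrite mulrC ler_pdivrMr// mul1r lerDl.
have c'2 : bd (c' * c') 1 by have := bdM ler01 c'1 c'1; rewrite mul1r.
have [|b [ba bk b1 bc _]] := @sqrt_one_minus (c' * c') _ c'2; first by rewrite adjM c'a.
have e := one_minus_sq bk.
have cc : GRing.comm (1 - b) c'.
  apply/commr_sym/commrB; first exact: commr1.
  by apply: bc; apply: commrM; exact: commr_refl.
have d1 : bd (1 - b) 1.
  apply: (@commuting_bd _ c') => //; first by rewrite adjB adj1 ba.
  by rewrite e subrK expr1n; apply: bd1.
have -> : c * c = rc ((t + 1) ^+ 2) *: (c' * c').
  by rewrite expr2 rcM -scalerA -scalemAl -scalemAr /c' !rc_scaleVK ?gt_eqF.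
apply: posZ; first exact: sqr_ge0.
split; first by rewrite adjM c'a.
by exists 1 => //; rewrite scale1r -e -[X in bd _ X]mulr1; apply: bdM.
Qed.

Lemma sa_sq0 c : adj c = c -> c * c = 0 -> c = 0.
Proof.
move=> ca h; apply: bd_small => e e0.
by apply: bd_sq; rewrite ?ltW// ca h; apply: bd0; rewrite sqr_ge0.
Qed.

(** The roots of [h] and [- h] commute and their squares add up to 0. *)
Lemma pos_anti h : pos h -> pos (- h) -> h = 0.
Proof.
move=> /pos_sqrt[c [ca ch _ cc]] /pos_sqrt[d [da dh _ dc]].
have cd : GRing.comm c d.
  apply: dc; rewrite -ch; apply: commrN; apply: commrM; exact: commr_refl.
suff c0 : c = 0 by rewrite -ch c0 mul0r.
apply: bd_small => e e0; apply: (@commuting_bd _ d) => //; first exact: ltW.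
by rewrite ch dh subrr; apply: bd0; rewrite sqr_ge0.
Qed.

(** Cauchy-Schwarz in [A], $\|hx\|^2\le\|x\|\,\|h^2x\|$, applied once for each doubling of the
    exponent. *)
Lemma sa_grow (n : nat) h (r : R) (x : A) : adj h = h -> 0 <= r ->
  r * rn x <= rn (h x) -> r ^+ (2 ^ n) * rn x <= rn ((h ^+ (2 ^ n)) x).
Proof.
elim: n h r => [|n IH] h r ha r0 hr; first by rewrite expn0 !expr1.
rewrite expnS !exprM; apply: IH; first by rewrite adjX ha.
  exact: sqr_ge0.
have [->|x0] := eqVneq (rn x) 0; first by rewrite mulr0 rn_ge0.
have xp : 0 < rn x by rewrite lt_neqAle eq_sym x0 rn_ge0.
rewrite -(ler_pM2l xp) expr2 (expr2 h).
have : rn (h x) ^+ 2 <= rn x * rn ((h * h) x).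
  by rewrite -rn_starM mactP madj_eq// (le_trans (rnM _ _))// rn_star.
apply: le_trans; rewrite [leLHS](_ : _ = (r * rn x) ^+ 2); last by ring.
by rewrite ler_pXn2r ?nnegrE ?mulr_ge0 ?rn_ge0.
Qed.

(** Replaces the spectral radius formula. If $\|hx\|\ge(1+d)\|x\|$ with $d>0$, then [sa_grow] makes
    $h^{2^n}x$ grow exponentially in the exponent. Bernoulli's inequality, squared, already gives a
    quadratic lower bound, which beats the linear upper one. *)
Lemma power_bd h (K : R) : adj h = h -> 0 <= K -> (forall n, bd (h ^+ n) (1 + n%:R * K)) -> bd h 1.
Proof.
move=> ha K0 H x; rewrite mul1r leNgt; apply/negP => hx.
have [x0|x0] := eqVneq (rn x) 0.
  by move: hx; have /eqP := x0; rewrite rn_eq0 => /eqP->; rewrite (lin0 (mact_lin h)) ltxx.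
have xp : 0 < rn x by rewrite lt_neqAle eq_sym x0 rn_ge0.
pose d := rn (h x) / rn x - 1.
have d0 : 0 < d by rewrite subr_gt0 ltr_pdivlMr// mul1r.
have dx : (1 + d) * rn x <= rn (h x) by rewrite /d addrC subrK mulfVK.
have g n : (1 + d) ^+ (2 ^ n) <= 1 + (2 ^ n)%:R * K.
  rewrite -(ler_pM2r xp); apply: le_trans (H (2 ^ n)%N x).
  by apply: sa_grow => //; rewrite addr_ge0// ltW.
have ber n : 1 + n%:R * d <= (1 + d) ^+ n.
  elim: n => [|n IH]; first by rewrite expr0 mul0r addr0.
  by rewrite exprS -natr1; have := ler0n R n; have := mulr_ge0 (ler0n R n) (ltW d0); nra.
have [n hn] : exists n : nat, 2 * K < n%:R * d ^+ 2.
  exists (Num.truncn (2 * K / d ^+ 2)).+1; rewrite -ltr_pdivrMr ?exprn_gt0//.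
  exact: truncnS_gt.
have hn' : 2 * K < (2 ^ n)%:R * d ^+ 2.
  by apply: (lt_le_trans hn); rewrite ler_wpM2r ?sqr_ge0// ler_nat ltnW// ltn_expl.
have := g n.+1; have := ber (2 ^ n)%N; rewrite expnS mulnC exprM natrM.
set N := (2 ^ n)%:R in hn' *; set P := (1 + d) ^+ _.
have N0 : 0 < N by rewrite ltr0n expn_gt0.
have Nd := mulr_gt0 N0 d0.
rewrite expr2 => h1 h2; have h3 : (1 + N * d) * (1 + N * d) <= P * P by apply: ler_pM => //; lra.
have : N * (2 * K) < N * (N * d ^+ 2) by rewrite ltr_pM2l.
nra.
Qed.

(* With q = - y* y and r = - y y*, (1 - r)^n = 1 + y (sum_(j < n) (1 - q)^j) y* has norm O(n). *)
Lemma pos_swap y : pos (- (adj y * y)) -> pos (- (y * adj y)).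
Proof.
move=> [_ [t t0 ht]]; split; first by rewrite adjN adjM adjK.
pose T := t + 1; have T0 : 0 < T by rewrite ltr_wpDl.
have Ti : 0 <= T^-1 by rewrite invr_ge0 ltW.
pose Q := rc T^-1 *: (ms T - (- (adj y * y))).
pose P := rc T^-1 *: (ms T - (- (y * adj y))).
have hQ : bd Q 1.
  have := bdZr Ti (pos_big ht (ltac:(by rewrite lerDl) : t <= T)).
  by rewrite mulVf// gt_eqF.
have one m : rc T^-1 *: (ms T - - m) = 1 + rc T^-1 *: m.
  by rewrite opprK scalerDr rc_scaleK ?gt_eqF.
have Py n : P ^+ n * y = y * Q ^+ n.
  elim: n => [|n IH]; first by rewrite !expr0 mul1r mulr1.
  rewrite exprSr -mulrA [P * y](_ : _ = y * Q) ?mulrA ?IH -?mulrA -?exprSr//.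
  by rewrite /P /Q !one mulrDl mulrDr mul1r mulr1 scalemAl scalemAr mulrA.
have [s s0 ys] := bounded y.
exists T; first exact: ltW.
suff hP : bd P 1.
  by have := bdZr (ltW T0) hP; rewrite mulr1 /P rc_scaleVK ?gt_eqF.
apply: (@power_bd _ (T^-1 * (s * 1 * s))).
- by rewrite /P !adjZr adjB adjZr adj1 adjN adjM adjK.
- by rewrite mulr_ge0// mulr1 mulr_ge0.
move=> n; elim: n => [|n IH]; first by rewrite mul0r addr0 expr0; apply: bd1.
have -> : P ^+ n.+1 = P ^+ n + rc T^-1 *: (y * Q ^+ n * adj y).
  by rewrite exprSr {2}/P one mulrDr mulr1 scalemAr mulrA Py.
rewrite -natr1 mulrDl mul1r addrA; apply: bdD => //.
apply: bdZr => //; apply: bdM; first by rewrite mulr1.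
  apply: bdM => //; elim: (n) => [|k IHk]; first by rewrite expr0; apply: bd1.
  by rewrite exprS -[X in bd _ X]mulr1; apply: bdM.
exact: bd_adj.
Qed.

(** [e] is the absolute value of [h], [g] the square root of [e] and [n] the negative part of [h].
    The identities give $nh=-n^2$ and exhibit $n^3$ as the square of a self-adjoint element, so that
    $n=0$ can be derived from signs. *)
Lemma abs_parts h : adj h = h -> exists e g n,
  [/\ adj e = e, e * e = h * h, pos e, e - h = n + n & (e + h) * n = 0] /\
  [/\ adj n = n, n * h = - (n * n), n * n * n = (g * n) * (g * n), adj (g * n) = g * n &
   forall m, GRing.comm m h -> GRing.comm m e].
Proof.
move=> ha; have [e [ea ee ep ec]] := pos_sqrt (pos_sq ha).
have [g [ga gg gp gc]] := pos_sqrt ep.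
pose n := rc 2^-1 *: (e - h).
have he : GRing.comm h e by apply: ec; apply: commrM; exact: commr_refl.
have nn : n + n = e - h.
  by rewrite -rc_double rc_2VK.
have na : adj n = n by rewrite adjZr adjB ea ha.
have en : (e + h) * n = 0.
  by rewrite scalemAr mulrBr !mulrDl ee he opprD addrA addrK subrr scaler0.
have ne : GRing.comm e n by apply: comm_scale; apply: commrB => //; exact: commr_sym.
have hn : GRing.comm h n by apply: comm_scale; apply: commrB; last exact: commr_refl.
have eh : e * n = - (h * n) by apply/eqP; rewrite -addr_eq0 -mulrDl en.
have nh : n * h = - (n * n).
  rewrite {3}/n scalemAr mulrBr -(ne : e * n = n * e) eh -opprD.
  by rewrite scalerN (hn : h * n = n * h) rc_half opprK.
have gn : GRing.comm g n.
  apply: comm_scale; apply: commrB; first by rewrite -gg; apply: commrM; exact: commr_refl.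
  by apply/commr_sym; apply: gc.
exists e, g, n; split; split=> //.
  have : n * n = e * n by rewrite eh (hn : h * n = n * h) nh opprK.
  move=> n2; rewrite n2 -gg -!mulrA; congr (_ * _).
  by rewrite !mulrA (gn : g * n = n * g).
  by rewrite adjM na ga -gn.
by move=> m mh; apply: ec; apply: commrM.
Qed.

(** Kaplansky's argument. With [n] the negative part of $u^*u$ and $y=un$, the element $y^*y=-n^3$
    is negative, hence so is $yy^*$ by [pos_swap]. But $y^*y+yy^*$ is half a sum of two squares of
    self-adjoint elements, so $y^*y$ is positive as well; it vanishes, and so does [n]. *)
Lemma pos_starM u : pos (adj u * u).
Proof.
have ha : adj (adj u * u) = adj u * u by rewrite adjM adjK.
have [e [g [n [[ea ee ep en en0] [na nh n3 gna _]]]]] := abs_parts ha.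
pose y := u * n.
have yy : adj y * y = - (g * n * (g * n)).
  by rewrite /y adjM na mulrA -(mulrA n (adj u)) nh mulNr n3.
have gp : pos (g * n * (g * n)) by apply: pos_sq.
have sw : pos (- (y * adj y)) by apply: pos_swap; rewrite yy opprK.
pose a := y + adj y; pose b := ('i : C) *: (y - adj y).
have aa : adj a = a by rewrite adjD adjK addrC.
have ba : adj b = b by rewrite adjZ conjCi adjB adjK scaleNr -scalerN opprB.
have ab : a * a + b * b = rc 2 *: (adj y * y + y * adj y).
  rewrite scalemAl scalemAr scalerA imag_sq scaleN1r rc_double.
  rewrite /a mulrBl !mulrBr mulrDl !mulrDr !opprB.
  rewrite -(addrA (y * y + _)) [_ + (_ - _ + _)]addrA (addrACA (adj y * y)) subrr addr0.
  by rewrite [LHS]addrC !addrA subrK; congr (_ + _); rewrite addrAC.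
have yp : pos (adj y * y).
  have -> : adj y * y = rc 2^-1 *: (a * a + b * b) + - (y * adj y).
    by rewrite ab rc_2K addrK.
  by apply: posD => //; apply: posZ; [rewrite invr_ge0|apply: posD; apply: pos_sq].
have y0 : adj y * y = 0 by apply: pos_anti => //; rewrite yy opprK.
have n0 : n = 0.
  have n30 : n * n * n = 0 by rewrite n3 -[LHS]opprK -yy y0 oppr0.
  by apply: sa_sq0 => //; apply: sa_sq0; rewrite ?adjM ?na// mulrA n30 mul0r.
by have := en; rewrite n0 addr0 => /eqP; rewrite subr_eq0 => /eqP <-.
Qed.

Lemma pos_conj m h : pos h -> pos (adj m * h * m).
Proof.
move=> /pos_sqrt[c [ca <- _ _]]; have := pos_starM (c * m).
by rewrite adjM ca !mulrA.
Qed.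

(** For $w=p-q$ one has $w(p+q)=0$, so $wpw=-wqw$ with both $wpw$ and $wqw$ positive. Both vanish,
    and $w^3=0$. *)
Lemma pos_sq_inj p q : pos p -> pos q -> GRing.comm p q -> p * p = q * q -> p = q.
Proof.
move=> pp pq pqc e; have [w wE] : exists w, w = p - q by eexists.
have wa : adj w = w by rewrite wE adjB pp.1 pq.1.
have w0 : w * (p + q) = 0 by rewrite wE mulrBl !mulrDr e pqc opprD addrA addrK subrr.
have h1 : w * p * w = - (w * q * w).
  by apply/eqP; rewrite -addr_eq0 -mulrDl -mulrDr w0 mul0r.
have p1 : pos (w * p * w) by have := pos_conj w pp; rewrite wa.
have p2 : pos (w * q * w) by have := pos_conj w pq; rewrite wa.
have h2 : w * q * w = 0 by apply: pos_anti => //; rewrite -h1.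
have w3 : w * w * w = 0 by rewrite {2}wE mulrBr mulrBl h1 h2 !oppr0 addr0.
apply/eqP; rewrite -subr_eq0 -wE; apply/eqP/sa_sq0 => //.
by apply: sa_sq0; rewrite ?adjM ?wa// mulrA w3 mul0r.
Qed.

(** [w = e + h] is shown to equal its absolute value [d]. As $w^2=2ew$, the square $(dz)^*(dz)$ with
    $z=d-w$ equals $2z(ew)z$, which is at once positive and negative. *)
Lemma pos_abs_add h e : adj h = h -> pos e -> GRing.comm e h -> e * e = h * h -> pos (e + h).
Proof.
move=> ha ep eh ee; have [w wE] : exists w, w = e + h by eexists.
rewrite -wE; have wa : adj w = w by rewrite wE adjD ep.1 ha.
have [d [da dd dp dc]] := pos_sqrt (pos_sq wa).
have [g [ga gg gp gc]] := pos_sqrt dp.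
have ew : e * w = w * e by rewrite wE; apply: commrD => //; exact: commr_refl.
have de : e * d = d * e by apply: dc; apply: commrM.
have ge : e * g = g * e by apply: gc.
have wd : w * d = d * w by apply: dc; apply: commrM; exact: commr_refl.
have gw : w * g = g * w by apply: gc.
have w2 : w * w = e * w + e * w.
  by rewrite {1}wE mulrDl; congr (_ + _); rewrite wE !mulrDr -ee (eh : e * h = h * e) addrC.
have [z zE] : exists z, z = d - w by eexists.
have za : adj z = z by rewrite zE adjB da wa.
have zd : z * d = - (z * w).
  by apply/eqP; rewrite -addr_eq0 -mulrDr zE mulrBl !mulrDr dd -wd opprD addrA addrK subrr.
have ze : e * z = z * e by rewrite zE mulrBr mulrBl de ew.
have zw : w * z = z * w by rewrite zE mulrBr mulrBl wd.
have dg : g * d = d * g by rewrite -gg mulrA.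
have zg : g * z = z * g by rewrite zE mulrBr mulrBl dg gw.
have zdc : d * z = z * d by rewrite zE mulrBr mulrBl wd.
have gza : adj (g * z) = g * z by rewrite adjM za ga -zg.
have pn : - (z * (e * w) * z) = adj (g * z) * e * (g * z).
  rewrite gza -[in RHS]mulrA [in RHS](mulrA e) ge -(mulrA g e) ze.
  rewrite -(mulrA g z) (mulrA z g) -zg -!mulrA (mulrA g g) gg.
  by rewrite (mulrA d z) zdc zd mulNr -!mulrA (mulrA e w) ew -!mulrA ze.
have p1 : pos (- (z * (e * w) * z)) by rewrite pn; apply: pos_conj.
have dz : adj (d * z) * (d * z) = z * (e * w) * z + z * (e * w) * z.
  by rewrite adjM da za mulrA -(mulrA z) dd w2 mulrDr mulrDl.
have dz0 : adj (d * z) * (d * z) = 0.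
  apply: pos_anti; first exact: pos_starM.
  by rewrite dz opprD; apply: posD.
have dz1 : d * z = 0 by apply: bd_small => s s0; apply: bd_sq; rewrite ?ltW// dz0; apply: bd0; rewrite sqr_ge0.
have zz : z * z = 0 by rewrite {2}zE mulrBr -[z * w]opprK -zd opprK -zdc dz1 addr0.
have z0 := sa_sq0 za zz.
by move: z0; rewrite zE => /eqP; rewrite subr_eq0 => /eqP <-.
Qed.

(** $h=c^2$ and $t-h=d^2$ with commuting roots, so [commuting_bd] bounds [c] by $\sqrt t$. *)
Lemma pos_bd h t : 0 <= t -> pos h -> pos (ms t - h) -> bd h t.
Proof.
move=> t0 /pos_sqrt[c [ca ch _ cc]] /pos_sqrt[d [da dh _ dc]].
have cd : GRing.comm c d.
  apply: dc; apply: commrB; first by apply: comm_scale; exact: commr1.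
  by rewrite -ch; apply: commrM; exact: commr_refl.
have st : Num.sqrt t ^+ 2 = t by rewrite sqr_sqrtr.
have hc : bd c (Num.sqrt t).
  apply: (@commuting_bd _ d) => //; first exact: sqrtr_ge0.
  rewrite ch dh addrC subrK st; have := bdZr t0 (@bd1 R A); by rewrite mulr1.
by rewrite -ch -st expr2; apply: bdM => //; exact: sqrtr_ge0.
Qed.

Lemma bd_pos h t : 0 <= t -> adj h = h -> bd h t -> pos (ms t - h).
Proof.
move=> t0 ha ht; split; first by rewrite adjB adjZr adj1 ha.
by exists t => //; rewrite opprB addrC subrK.
Qed.

Lemma bd_of_sum u p t : 0 <= t -> pos p -> bd (adj u * u + p) (t ^+ 2) -> bd u t.
Proof.
move=> t0 pp h; apply: bd_sq => //.
apply: pos_bd; [exact: sqr_ge0|exact: pos_starM|].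
have up := pos_starM u.
have -> : ms (t ^+ 2) - adj u * u = ms (t ^+ 2) - (adj u * u + p) + p.
  by rewrite opprD addrA subrK.
apply: posD => //; apply: bd_pos => //; first exact: sqr_ge0.
by rewrite adjD up.1 pp.1.
Qed.

End Positivity.

Lemma rn_of_sum (R : realType) (A : cstar R) (u z y : A) :
  star y ** y = star u ** u + star z ** z -> rn u <= rn y.
Proof.
move=> h; apply: mof_bd; first exact: rn_ge0.
apply: (@bd_of_sum _ _ _ (mof (star z ** z))); first exact: rn_ge0.
  by rewrite mofM mof_star; apply: pos_starM.
by rewrite -mof_star -mofM -mofD -h -rn_starM; apply: bd_mof.
Qed.

(** * Extension of morphisms *)

Section SpanClosure.
Variable R : realType.
Local Notation C := (cplx R).

Definition inspan S (V : normedModType C) (s : S -> V) (v : V) :=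
  forall e : R, 0 < e -> exists l, rn (v - comb s l) < e.

Variables (S : Type) (V : normedModType C) (s : S -> V).

Lemma inspan_gen x : inspan s (s x).
Proof. by move=> e e0; exists [:: (1, x)]; rewrite /comb big_seq1 scale1r subrr rn0. Qed.

Lemma inspan0 : inspan s 0.
Proof. by move=> e e0; exists [::]; rewrite /comb big_nil subrr rn0. Qed.

Lemma inspan_lin a x y : inspan s x -> inspan s y -> inspan s (a *: x + y).
Proof.
move=> hx hy e e0; have p : 0 < cn a + 1 by rewrite ltr_wpDl// cn_ge0.
have [l hl] := hx (e / 2 / (cn a + 1)) ltac:(by rewrite !divr_gt0).
have [l' hl'] := hy (e / 2) ltac:(by rewrite divr_gt0).
exists (scl a l ++ l'); rewrite comb_cat comb_scl opprD addrACA -scalerBr.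
apply: (le_lt_trans (rnD _ _)); rewrite (splitr e) ltrD// rnZ.
move: hl; rewrite ltr_pdivlMr//; have := rn_ge0 (x - comb s l); lra.
Qed.
Lemma inspanD x y : inspan s x -> inspan s y -> inspan s (x + y).
Proof. by move=> hx hy; rewrite -[x]scale1r; apply: inspan_lin. Qed.
Lemma inspanZ a x : inspan s x -> inspan s (a *: x).
Proof. by move=> hx; rewrite -[_ *: _]addr0; apply: inspan_lin => //; apply: inspan0. Qed.
Lemma inspanB x y : inspan s x -> inspan s y -> inspan s (x - y).
Proof. by move=> hx hy; rewrite -scaleN1r addrC; apply: inspan_lin. Qed.
Lemma inspan_comb T (t : T -> V) l : (forall i, inspan s (t i)) -> inspan s (comb t l).
Proof.
move=> h; elim: l => [|p l IH]; first by rewrite /comb big_nil; apply: inspan0.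
by rewrite comb_cons; apply: inspan_lin.
Qed.
Lemma inspan_closed x : (forall e : R, 0 < e -> exists2 y, inspan s y & rn (x - y) < e) -> inspan s x.
Proof.
move=> h e e0; have [y hy xy] := h (e / 2) ltac:(by rewrite divr_gt0).
have [l yl] := hy (e / 2) ltac:(by rewrite divr_gt0).
by exists l; apply: (le_lt_trans (rn_tri y _ _)); rewrite (splitr e) ltrD.
Qed.
Lemma total_trans T (t : T -> V) : total t -> (forall i, inspan s (t i)) -> total s.
Proof.
move=> ht h x; apply: inspan_closed => e /(ht x)[l hl].
by exists (comb t l) => //; apply: inspan_comb.
Qed.
End SpanClosure.

Lemma inspan_img (R : realType) S T (V W : normedModType (cplx R)) (s : S -> V) (t : T -> W)
  (F : V -> W) (k : R) x : linear F -> bdd F k -> (forall i, inspan t (F (s i))) ->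
  inspan s x -> inspan t (F x).
Proof.
move=> Fl Fb h hx; apply: inspan_closed => e e0.
have [l hl] := hx (e / (`|k| + 1)) ltac:(by rewrite divr_gt0// ltr_wpDl).
exists (F (comb s l)); first by rewrite comb_lin//; apply: inspan_comb => i; apply: h.
rewrite -linB//; apply: (le_lt_trans (Fb _)); move: hl; rewrite ltr_pdivlMr ?ltr_wpDl//.
have := ler_norm k; have := rn_ge0 (x - comb s l); nra.
Qed.

Section Products.
Variables (R : realType) (A : cstar R).
Local Notation C := (cplx R).
Local Notation adj := (@mstar R A).

Lemma mulA_lin (x : A) : linear (fun y : A => x ** y).
Proof. by move=> a y z; rewrite cmulDr cmulZr. Qed.
Lemma mulA_linl (x : A) : linear (fun y : A => y ** x).
Proof. by move=> a y z; rewrite cmulDl cmulZl. Qed.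
Lemma mulA_bdd (x : A) : bdd (fun y : A => x ** y) (rn x). Proof. by move=> y; exact: rnM. Qed.

(** Stands in for an approximate unit: a positive element is the square of its root, a self-adjoint
    one is half the difference of $|h|+h$ and $|h|-h$, and real and imaginary parts do the rest. *)
Lemma products_total : total (fun p : A * A => p.1 ** p.2).
Proof.
pose P := inspan (fun p : A * A => p.1 ** p.2).
suff PA : forall x, P x by move=> x; apply: PA.
have Ppos h : pos (mof h) -> P h.
  move=> /pos_sqrt_in[c [_ ch _ _ /(_ h erefl)[c0 cE]]].
  have -> : h = c0 ** c0 by apply: mof_inj; rewrite mofM -cE.
  exact: (inspan_gen _ (c0, c0)).
have Psa h : star h = h -> P h.
  move=> ha; have ma : adj (mof h) = mof h by rewrite -mof_star ha.
  have [e [ea ee ep ec /(_ (h ** h) ltac:(by rewrite mofM))[e0 eE]]] := pos_sqrt_in (pos_sq ma).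
  have eh : GRing.comm e (mof h) by apply/commr_sym/ec/commrM; exact: commr_refl.
  have p1 : pos (mof (e0 + h)) by rewrite mofD -eE; apply: pos_abs_add.
  have p2 : pos (mof (e0 - h)).
    rewrite -scaleN1r mofD mofZ scaleN1r -eE; apply: pos_abs_add => //.
    - by rewrite adjN ma.
    - exact: commrN.
    - by rewrite mulrNN.
  have -> : h = rc 2^-1 *: ((e0 + h) - (e0 - h)) by rewrite opprB addrC addrA subrK rc_half.
  by apply/inspanZ/inspanB; apply: Ppos.
move=> x.
have -> : x = rc 2^-1 *: ((x + star x) + - 'i *: ('i *: (x - star x))).
  by rewrite scalerA mulNr imag_sq opprK scale1r addrACA subrr addr0 rc_half.
apply/inspanZ/inspanD; first by apply: Psa; rewrite staradd starK addrC.
by apply/inspanZ/Psa; rewrite starZ starB starK conjCi scaleNr -scalerN opprB.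
Qed.
End Products.

Section Extension.
Variables (R : realType).
Local Notation C := (cplx R).

Lemma theP (T : Type) (d : T) (P : T -> Prop) : (exists x, P x) -> P (the d P).
Proof. by rewrite /the => h; case: pselect => // e; case: (cid e). Qed.

Lemma star_comb (B : cstar R) S (f : S -> B) l (y : B) :
  star (comb f l) ** y = \sum_(p <- l) (p.1)^* *: (star (f p.2) ** y).
Proof.
elim: l => [|p l IH]; first by rewrite /comb !big_nil star0 cmul0l.
by rewrite comb_cons big_cons starD cmulDl cmulZl IH.
Qed.

Lemma mul_comb (B : cstar R) S (f : S -> B) l (y : B) : y ** comb f l = comb (fun s => y ** f s) l.
Proof. exact: (comb_lin f l (mulA_lin y)). Qed.

Lemma star_comb_eq (B : cstar R) S (f g f' g' : S -> B) l l' :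
  (forall p q, star (f p) ** g q = star (f' p) ** g' q) ->
  star (comb f l) ** comb g l' = star (comb f' l) ** comb g' l'.
Proof.
move=> h; rewrite !star_comb; apply: eq_bigr => p _; rewrite !mul_comb.
by congr (_ *: _); apply: eq_comb => q; rewrite h.
Qed.

(** [be x s] stands for [f x s] or for an elementary tensor. For a contraction [m] write
    $1-m^*m=(1-b)^2$. The combinations then satisfy $\langle f_1,f_1\rangle=\langle
    f_m,f_m\rangle+\langle f_{1-b},f_{1-b}\rangle$, so letting [m] act on [x] does not increase the
    norm of a combination. *)
Lemma multiplier_extension (A B : cstar R) (S : Type) (be : A -> S -> B) :
  (forall s, linear (be^~ s)) -> total (fun p : A * S => be p.1 p.2) ->
  (forall (m : multiplier A) x s x' s',
     star (be (m x) s) ** be x' s' = star (be x s) ** be (madj m x') s') ->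
  forall m : multiplier A, exists n : multiplier B, forall x s, n (be x s) = be (m x) s.
Proof.
move=> bl bt H m0.
pose f (m : multiplier A) (p : A * S) := be (m p.1) p.2.
have f1 : f 1 = fun p => be p.1 p.2 by [].
have inner m m' l l' : star (comb (f m) l) ** comb (f m') l' = star (comb (f 1) l) ** comb (f (mstar m * m')) l'.
  by apply: star_comb_eq => p q; rewrite /f H.
have fD m m' l : comb (f (m + m')) l = comb (f m) l + comb (f m') l.
  rewrite /comb -big_split /=; apply: eq_bigr => p _; rewrite -scalerDr; congr (_ *: _).
  by rewrite /f addmE (linD (bl _)).
have contr m l : bd m 1 -> rn (comb (f m) l) <= rn (comb (f 1) l).
  move=> m1; have ka : mstar (mstar m * m) = mstar m * m by rewrite adjM adjK.
  have k1 : bd (mstar m * m) 1 by have := bdM ler01 (bd_adj ler01 m1) m1; rewrite mul1r.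
  have [b [ba bk _ _ _]] := sqrt_one_minus ka k1.
  apply: (@rn_of_sum _ _ _ (comb (f (1 - b)) l)); rewrite (inner m) (inner (1 - b)) -cmulDr -fD.
  by rewrite adjB adj1 ba (one_minus_sq bk) addrC subrK.
have scale (m : multiplier A) : exists N : B -> B, [/\ linear N, (exists t, bdd N t) & forall x s, N (be x s) = be (m x) s].
  have [t t0 mt] := bounded m; have T0 : 0 < t + 1 by rewrite ltr_wpDl.
  have Ti : 0 <= (t + 1)^-1 by rewrite invr_ge0 ltW.
  have m1 : bd (rc (t + 1)^-1 *: m) 1.
    by apply: bd_le (bdZr Ti mt); rewrite mulrC ler_pdivrMr// mul1r lerDl.
  have [|N [Nl Nb NE]] := @extend R _ B B (f 1) (f (rc (t + 1)^-1 *: m)) 1 ler01 bt.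
    by move=> l; rewrite mul1r; apply: contr.
  exists (fun y => rc (t + 1) *: N y); split.
  - by move=> a x y; rewrite Nl scalerDr !scalerA mulrC.
  - exists (t + 1) => y; rewrite rnZr ger0_norm ?(ltW T0)// ler_wpM2l ?(ltW T0)//.
    by have := Nb y; rewrite mul1r.
  - move=> x s; rewrite (NE (x, s)) /f scalemE /= (linZ (bl s)) rc_scaleVK// gt_eqF//.
have [N [Nl [t Nb] NE]] := scale m0; have [N' [Nl' [t' Nb'] NE']] := scale (mstar m0).
have P1 u x s : star (be x s) ** N u = star (N' (be x s)) ** u.
  apply: (@total_eq _ _ _ _ _ (fun u => star (be x s) ** N u) (fun u => star (N' (be x s)) ** u)
     (rn (star (be x s)) * t) (rn (star (N' (be x s)))) bt).
  - by move=> a y z; rewrite Nl cmulDr cmulZr.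
  - exact: mulA_lin.
  - by move=> y; rewrite (le_trans (rnM _ _))// -mulrA ler_wpM2l ?rn_ge0.
  - exact: mulA_bdd.
  - by move=> [x' s'] /=; rewrite NE NE' H.
have P u v : star (N u) ** v = star u ** N' v.
  apply: (@total_eq _ _ _ _ _ (fun v => star (N u) ** v) (fun v => star u ** N' v)
     (rn (star (N u))) (rn (star u) * t') bt).
  - exact: mulA_lin.
  - by move=> a y z; rewrite Nl' cmulDr cmulZr.
  - exact: mulA_bdd.
  - by move=> y; rewrite (le_trans (rnM _ _))// -mulrA ler_wpM2l ?rn_ge0.
  - move=> [x s] /=; have := P1 u x s => /(congr1 (@star _ _)).
    by rewrite !starM !starK.
by exists (Multiplier P).
Qed.
End Extension.

Section Morphisms.
Variable R : realType.
Local Notation C := (cplx R).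
Implicit Types A B E F : cstar R.

Section One.
Variables (A B : cstar R) (f : A -> multiplier B).
Hypothesis fm : is_mor f.

Lemma mor_lin : linear f.
Proof. by case: fm => h _ _ _ a x y; apply: multP => z; rewrite h. Qed.
Lemma morM x y : f (x ** y) = f x * f y. Proof. by case: fm. Qed.
Lemma mor_star x : f (star x) = mstar (f x). Proof. by case: fm. Qed.
Lemma mor_total : total (fun p : A * B => f p.1 p.2).
Proof. by case: fm => _ _ _ /clspan_total2. Qed.

Lemma mor_ip x y z : star (f x y) ** z = star y ** f (star x) z.
Proof. by rewrite mactP mor_star. Qed.
Lemma morMv x y z : f x (f y z) = f (x ** y) z.
Proof. by rewrite morM. Qed.

Lemma extE m x y : ext f m (f x y) = f (m x) y.
Proof.
move: x y; apply: (@theP (multiplier B) (mone B) (fun n => forall x y, n (f x y) = f (m x) y)).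
apply: (multiplier_extension (be := fun x y => f x y)); last 1 first.
- by move=> n x y x' y'; rewrite !mor_ip !morMv mactP.
- by move=> y a x x'; rewrite mor_lin.
- exact: mor_total.
Qed.

Lemma ext_uniq (m : multiplier A) (n : multiplier B) : (forall x y, n (f x y) = f (m x) y) -> n = ext f m.
Proof.
move=> h; apply: multP => y; have [t _ nt] := bounded n; have [t' _ et] := bounded (ext f m).
apply: (total_eq mor_total (mact_lin n) (mact_lin _) nt et).
by move=> [x z] /=; rewrite h extE.
Qed.

Lemma ext_mof a : ext f (mof a) = f a.
Proof. by symmetry; apply: ext_uniq => x y; rewrite mofE morM. Qed.
Lemma extM m n : ext f (m * n) = ext f m * ext f n.
Proof. by symmetry; apply: ext_uniq => x y; rewrite !mulmE !extE. Qed.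
Lemma ext1 : ext f 1 = 1. Proof. by symmetry; apply: ext_uniq. Qed.
Lemma ext_lin : linear (ext f).
Proof.
move=> a m n; symmetry; apply: ext_uniq => x y.
by rewrite !addmE !scalemE !extE mor_lin.
Qed.
Lemma ext_mul_mor m x : ext f m * f x = f (m x).
Proof. by apply: multP => y; rewrite mulmE extE. Qed.
Lemma ext_adj m : ext f (mstar m) = mstar (ext f m).
Proof.
symmetry; apply: ext_uniq => x y; apply: cmul_inj => z.
rewrite mactP -[madj _ z]/(ext f m z).
have [t _ et] := bounded (ext f m).
apply: (@total_eq _ _ _ _ _ (fun z => star (f x y) ** ext f m z) (fun z => star (f (mstar m x) y) ** z)
   (rn (star (f x y)) * t) (rn (star (f (mstar m x) y))) mor_total).
- by move=> a u v; rewrite (mact_lin (ext f m)) cmulDr cmulZr.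
- exact: mulA_lin.
- by move=> u; rewrite (le_trans (rnM _ _))// -mulrA ler_wpM2l ?rn_ge0.
- exact: mulA_bdd.
by move=> [x' z'] /=; rewrite extE !mor_ip !morMv (mactPr m).
Qed.
Lemma ext_unitary m : unitary m -> unitary (ext f m).
Proof.
move=> [h1 h2]; split; rewrite !mmulE in h1 h2 *; rewrite -ext_adj -extM ?h1 ?h2; exact: ext1.
Qed.
Lemma ext_pos h : pos h -> pos (ext f h).
Proof. by move=> /pos_sqrt[c [ca <- _ _]]; rewrite extM; apply: pos_sq; rewrite -ext_adj ca. Qed.
Lemma ext_ms (r : R) : ext f (rc r *: (1 : multiplier A)) = rc r *: (1 : multiplier B).
Proof. by rewrite (linZ ext_lin) ext1. Qed.
(** Contractivity follows from positivity: $t^2-m^*m$ is a square and stays one. *)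
Lemma ext_bd m t : 0 <= t -> bd m t -> bd (ext f m) t.
Proof.
move=> t0 mt; apply: bd_sq => //; apply: pos_bd; [exact: sqr_ge0|exact: pos_starM|].
rewrite -ext_adj -extM -ext_ms -(linB ext_lin); apply/ext_pos/bd_pos; first exact: sqr_ge0.
  by rewrite adjM adjK.
by rewrite expr2; apply: bdM => //; apply: bd_adj.
Qed.
Lemma mor_bd x : bd (f x) (rn x).
Proof. by rewrite -ext_mof; apply: ext_bd; [exact: rn_ge0|exact: bd_mof]. Qed.
Lemma mor_bdd y : bdd (fun x => f x y) (rn y).
Proof. by move=> x; rewrite mulrC; apply: mor_bd. Qed.
Lemma mor_linr y : linear (fun x => f x y).
Proof. by move=> a u v; rewrite mor_lin. Qed.
End One.

Lemma mor_eq A B S (s : S -> A) (f g : A -> multiplier B) :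
  is_mor f -> is_mor g -> total s -> (forall i, f (s i) = g (s i)) -> f = g.
Proof.
move=> fm gm st h; apply/funext => x; apply: multP => y.
by apply: (total_eq st (mor_linr fm y) (mor_linr gm y) (mor_bdd fm y) (mor_bdd gm y)) => i; rewrite h.
Qed.

Lemma mof_mor A : is_mor (@mof R A).
Proof.
split.
- by move=> a x y z; rewrite /= cmulDl cmulZl.
- exact: mofM.
- exact: mof_star.
- by apply/clspan_total2; apply: products_total.
Qed.

Lemma ext_mof_id A (m : multiplier A) : ext (@mof R A) m = m.
Proof. by symmetry; apply: ext_uniq; [exact: mof_mor|move=> x y; rewrite /= mactM]. Qed.

Lemma mcomp_mor A B E (g : B -> multiplier E) (f : A -> multiplier B) :
  is_mor g -> is_mor f -> is_mor (mcomp g f).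
Proof.
move=> gm fm; rewrite /mcomp; split.
- by move=> a x y z; rewrite (mor_lin fm) (ext_lin gm).
- by move=> x y; rewrite (morM fm) (extM gm).
- by move=> x; rewrite (mor_star fm) (ext_adj gm).
apply/clspan_total2; apply: (total_trans (mor_total gm)) => -[y e] /=.
apply: (inspan_img (F := fun y => g y e) (mor_linr gm e) (mor_bdd gm e) _ (mor_total fm y)).
move=> [x y'] /=; rewrite -(extE gm).
exact: (inspan_gen _ (x, g y' e)).
Qed.

Lemma ext_mcomp A B E (g : B -> multiplier E) (f : A -> multiplier B) m :
  is_mor g -> is_mor f -> ext (mcomp g f) m = ext g (ext f m).
Proof.
move=> gm fm; symmetry; apply: ext_uniq; first exact: mcomp_mor.
by move=> x y; rewrite /mcomp -!mulmE -(extM gm) (ext_mul_mor fm).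
Qed.

Lemma mcompA A B E F (h : E -> multiplier F) (g : B -> multiplier E) (f : A -> multiplier B) :
  is_mor h -> is_mor g -> mcomp h (mcomp g f) = mcomp (mcomp h g) f.
Proof. by move=> hm gm; apply/funext => x; rewrite /mcomp -(ext_mcomp _ hm gm). Qed.

Lemma mcomp_mofl A B (f : A -> multiplier B) : mcomp (@mof R B) f = f.
Proof. by apply/funext => x; rewrite /mcomp ext_mof_id. Qed.
Lemma mcomp_mofr A B (f : A -> multiplier B) : is_mor f -> mcomp f (@mof R A) = f.
Proof. by move=> fm; apply/funext => x; rewrite /mcomp ext_mof. Qed.
Lemma mcompE A B E (g : B -> multiplier E) (f : A -> multiplier B) x : mcomp g f x = ext g (f x).
Proof. by []. Qed.

Lemma conj_mor A B (f : A -> multiplier B) (u : multiplier B) :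
  is_mor f -> unitary u -> is_mor (fun x => u * f x * mstar u).
Proof.
move=> fm [u1 u2]; have {}u2 : mstar u * u = 1 := u2; have {}u1 : u * mstar u = 1 := u1; split.
- move=> a x y z; rewrite (mor_lin fm) mulrDr mulrDl scalemAr scalemAl //.
- by move=> x y; rewrite (morM fm) mmulE !mulrA -(mulrA _ (mstar u)) u2 mulr1.
- by move=> x; rewrite (mor_star fm) !adjM adjK mulrA.
apply/clspan_total2 => z; have [t _ ut] := bounded u; have [t' _ ut'] := bounded (mstar u).
rewrite -[z]onemE -[1]u1 mulmE.
apply: (inspan_img (F := mact u) (mact_lin u) ut _ (mor_total fm (mstar u z))).
move=> [x y] /=; have -> : u (f x y) = (u * f x * mstar u) (u y) by rewrite !mulmE -(mulmE (mstar u)) u2.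
exact: (inspan_gen _ (x, u y)).
Qed.

Section Injective.
Variables (A B : cstar R) (f : A -> multiplier B).
Hypotheses (fm : is_mor f) (fi : injective f).

Lemma ext_inj : injective (ext f).
Proof.
move=> m n h; apply: multP => x; apply: fi; by rewrite -!(ext_mul_mor fm) h.
Qed.

(** With $m=x^*x-t^2$ the image of [m] is negative, so by uniqueness of positive roots the image of
    $|m|$ is minus the image of [m]. Injectivity gives $|m|=-m$, that is, $x^*x\le t^2$. *)
Lemma mor_inj_le x t : 0 <= t -> bd (f x) t -> rn x <= t.
Proof.
move=> t0 ft; pose h := mof (star x ** x); pose m : multiplier A := h - rc (t ^+ 2) *: (1 : multiplier A).
have ha : mstar h = h by rewrite /h mofM mof_star adjM adjK.
have ma : mstar m = m by rewrite adjB adjZr adj1 ha.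
have [e [ea ee ep ec]] := pos_sqrt (pos_sq ma).
have em : GRing.comm e m by apply/commr_sym/ec/commrM; exact: commr_refl.
have fneg : pos (- ext f m).
  rewrite /m (linB (ext_lin fm)) opprB ext_ms// ext_mof//.
  apply: bd_pos; first exact: sqr_ge0.
    by rewrite -(mor_star fm) starM starK.
  by rewrite (morM fm) (mor_star fm) expr2; apply: bdM => //; apply: bd_adj.
have fe : ext f e = - ext f m.
  apply: pos_sq_inj => //; first exact: ext_pos.
    by apply: commrN; rewrite /GRing.comm -!extM// em.
  by rewrite mulrNN -!extM// ee.
have e0 : e = - m by apply: ext_inj; rewrite fe (linN (ext_lin fm)).
have hb : bd h (t ^+ 2).
  apply: pos_bd; first exact: sqr_ge0.
    by rewrite /h mofM mof_star; apply: pos_starM.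
  by rewrite -opprB -/m -e0.
have := mof_bd (sqr_ge0 t) hb; rewrite rn_starM ler_pXn2r// nnegrE; exact: rn_ge0.
Qed.

Lemma ext_inj_bd m t : 0 <= t -> bd (ext f m) t -> bd m t.
Proof.
move=> t0 h x; apply: mor_inj_le; first by rewrite mulr_ge0// rn_ge0.
by rewrite -(ext_mul_mor fm); apply: bdM => //; apply: mor_bd.
Qed.
End Injective.

Lemma mcomp_inj A B E (g : B -> multiplier E) (f : A -> multiplier B) :
  is_mor g -> injective g -> injective f -> injective (mcomp g f).
Proof. by move=> gm gi fi x y /(ext_inj gm gi)/fi. Qed.

End Morphisms.

(** * Hilbert spaces and compact operators *)

Section HilbertBasics.
Variables (R : realType) (H : hilbert R).
Local Notation C := (cplx R).
Implicit Types x y z : H.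

Lemma ipDl x y z : ip H (x + y) z = ip H x z + ip H y z. Proof. exact: linearDl. Qed.
Lemma ipDr x y z : ip H x (y + z) = ip H x y + ip H x z. Proof. exact: linearDr. Qed.
Lemma ipZl a x y : ip H (a *: x) y = a * ip H x y. Proof. exact: linearZl_LR. Qed.
Lemma ipZr a x y : ip H x (a *: y) = a^* * ip H x y. Proof. by rewrite linearZr_LR. Qed.
Lemma ip0l y : ip H 0 y = 0. Proof. exact: linear0l. Qed.
Lemma ip0r y : ip H y 0 = 0. Proof. exact: linear0r. Qed.
Lemma ipBl x y z : ip H (x - y) z = ip H x z - ip H y z. Proof. exact: linearBl. Qed.
Lemma ipNl x y : ip H (- x) y = - ip H x y. Proof. exact: linearNl. Qed.
Lemma ipBr x y z : ip H x (y - z) = ip H x y - ip H x z. Proof. exact: linearBr. Qed.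
Lemma ipC x y : ip H x y = (ip H y x)^*.
Proof. by rewrite [LHS]hermitian_subproof expr0 mul1r. Qed.
Lemma ip_rn x : ip H x x = rc (rn x ^+ 2).
Proof. by rewrite -ip_norm rnE rcX. Qed.

Lemma cauchy_schwarz x y : cn (ip H x y) <= rn x * rn y.
Proof.
have [->|y0] := eqVneq y 0; first by rewrite ip0r cn0 mulr_ge0 ?rn_ge0.
have yp : 0 < rn y by rewrite lt_neqAle eq_sym rn_eq0 y0 rn_ge0.
set c := ip H x y; have cc : c * c^* = rc (cn c ^+ 2) by rewrite -normCK cnE rcX.
have : 0 <= rc (rn (rc (rn y ^+ 2) *: x - c *: y) ^+ 2) by rewrite rcge0 sqr_ge0.
rewrite -ip_rn ipBl !ipBr !ipZl !ipZr rc_conj !ip_rn (ipC y x) -/c.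
rewrite (_ : _ - _ = rc (rn y ^+ 2 * (rn y ^+ 2 * rn x ^+ 2 - cn c ^+ 2))).
  rewrite rcge0 pmulr_rge0 ?exprn_gt0// subr_ge0 -exprMn mulrC ler_pXn2r// ?nnegrE ?cn_ge0//.
  by rewrite mulr_ge0 ?rn_ge0.
rewrite (rcM (rn y ^+ 2) (_ - _)) rcB (rcM (rn y ^+ 2)) -cc; ring.
Qed.

Lemma ip_ext S (s : S -> H) x y : total s -> (forall p, ip H x (s p) = ip H y (s p)) -> x = y.
Proof.
move=> st h; apply/eqP; rewrite -subr_eq0; apply/eqP; apply: rn_small => e e0.
have [l hl] := st (x - y) e e0.
have c0 : ip H (x - y) (comb s l) = 0.
  rewrite /comb; elim: l {hl} => [|p l IH]; first by rewrite big_nil ip0r.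
  by rewrite big_cons ipDr ipZr IH ipBl h subrr mulr0 addr0.
have : rc (rn (x - y) ^+ 2) = ip H (x - y) (x - y - comb s l) by rewrite ipBr c0 subr0 ip_rn.
move/(congr1 (@cn R)); rewrite cn_rc ger0_norm ?sqr_ge0// => h2.
have := cauchy_schwarz (x - y) (x - y - comb s l); rewrite -h2 expr2.
have [n0|n0] := eqVneq (rn (x - y)) 0; first by rewrite n0 => _; exact: ltW.
by rewrite ler_pM2l ?lt_neqAle 1?eq_sym ?n0 ?rn_ge0// => /le_trans; apply; apply: ltW.
Qed.
Lemma ip_ext1 x y : (forall z, ip H x z = ip H y z) -> x = y.
Proof. by apply: (@ip_ext H id) => z e e0; exists [:: (1, z)]; rewrite /comb big_seq1 scale1r subrr rn0. Qed.

Lemma ip_comb S (s t : S -> H) S' (s' t' : S' -> H) l l' :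
  (forall p q, ip H (s p) (s' q) = ip H (t p) (t' q)) ->
  ip H (comb s l) (comb s' l') = ip H (comb t l) (comb t' l').
Proof.
move=> h; rewrite /comb; elim: l => [|p l IH]; first by rewrite !big_nil !ip0l.
rewrite !big_cons !ipDl {}IH !ipZl; congr (_ * _ + _).
elim: l' => [|q l' IH]; first by rewrite !big_nil !ip0r.
by rewrite !big_cons !ipDr {}IH !ipZr h.
Qed.
End HilbertBasics.

Lemma ip_comb2 (R : realType) (H H' : hilbert R) S (s : S -> H) (t : S -> H') S' (s' : S' -> H) (t' : S' -> H') l l' :
  (forall p q, ip H (s p) (s' q) = ip H' (t p) (t' q)) ->
  ip H (comb s l) (comb s' l') = ip H' (comb t l) (comb t' l').
Proof.
move=> h; rewrite /comb; elim: l => [|p l IH]; first by rewrite !big_nil !ip0l.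
rewrite !big_cons !ipDl {}IH !ipZl; congr (_ * _ + _).
elim: l' => [|q l' IH]; first by rewrite !big_nil !ip0r.
by rewrite !big_cons !ipDr {}IH !ipZr h.
Qed.

Lemma rn_comb_eq (R : realType) (H H' : hilbert R) S (s : S -> H) (t : S -> H') l :
  (forall p q, ip H (s p) (s q) = ip H' (t p) (t q)) -> rn (comb s l) = rn (comb t l).
Proof.
move=> /(ip_comb2 l l) h; apply/eqP; rewrite -(@eqrXn2 _ 2) ?rn_ge0//; apply/eqP.
by apply: rc_inj; rewrite -!ip_rn.
Qed.

Lemma isometry_ex (R : realType) (H H' : hilbert R) S (s : S -> H) (t : S -> H') :
  total s -> (forall p q, ip H (s p) (s q) = ip H' (t p) (t q)) ->
  exists J : H -> H', [/\ linear J, forall x, rn (J x) = rn x & forall p, J (s p) = t p].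
Proof.
move=> st h; have [|J [Jl Jb JE]] := @extend R S H H' s t 1 ler01 st.
  by move=> l; rewrite mul1r (rn_comb_eq l h).
exists J; split=> // x; apply/eqP; rewrite eq_le; apply/andP; split.
  by have := Jb x; rewrite mul1r.
apply/ler_addgt0Pr => e e0; have [l hl] := st x (e / 2) ltac:(by rewrite divr_gt0).
have h1 : rn (J (comb s l)) = rn (comb s l).
  by rewrite comb_lin// (rn_comb_eq l h); congr rn; apply: eq_comb.
have := Jb (x - comb s l); rewrite mul1r linB// => h2.
have := rn_le x (comb s l); have := rn_le (J (comb s l)) (J x).
by rewrite (rnB (J _)) h1; lra.
Qed.

Section Adjoint.
Variables (R : realType) (H : hilbert R) (T T' : H -> H).
Hypothesis adjT : forall x y, ip H (T x) y = ip H x (T' y).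
Lemma adj_lin : linear T.
Proof.
move=> a x y; apply: ip_ext1 => z; by rewrite adjT ipDl ipZl ipDl ipZl !adjT.
Qed.
Lemma adjointC x y : ip H (T' x) y = ip H x (T y).
Proof. by rewrite ipC -adjT -ipC. Qed.
Lemma adj_bdd t : 0 <= t -> bdd T t -> bdd T' t.
Proof.
move=> t0 b x; have [->|x0] := eqVneq (rn (T' x)) 0; first by rewrite mulr_ge0 ?rn_ge0.
have xp : 0 < rn (T' x) by rewrite lt_neqAle eq_sym x0 rn_ge0.
rewrite -(ler_pM2r xp) -expr2.
have : rn (T' x) ^+ 2 = cn (ip H x (T (T' x))).
  by rewrite -adjointC ip_rn cn_rc ger0_norm ?sqr_ge0.
move=> ->; apply: (le_trans (cauchy_schwarz _ _)); have := b (T' x); have := rn_ge0 x; nra.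
Qed.
End Adjoint.

Section Compacts.
Variables (R : realType) (M : hmodel R) (H : hilbert R).
Local Notation C := (cplx R).
Local Notation K := (compact M H).
Implicit Types (x y z h : H) (k l : K).

Lemma kop_ext k l : (forall h, kop k h = kop l h) -> k = l.
Proof. by move=> e; apply: (@kop_inj _ _ K); apply/funext. Qed.
Lemma kop_lin k : linear (kop k).
Proof. by apply: (@adj_lin _ _ _ (kop (star k))) => x y; rewrite kop_star. Qed.
Lemma kop_starr k x y : ip H x (kop k y) = ip H (kop (star k) x) y.
Proof. by rewrite kop_star starK. Qed.
Lemma kop0 h : kop (0 : K) h = 0.
Proof. by have := kopD (-1) (0 : K) 0 h; rewrite scaler0 addr0 scaleN1r addNr. Qed.
Lemma kop_linl h : linear (fun k : K => kop k h).
Proof. by move=> a k l; rewrite kopD. Qed.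

Lemma fcomb S (V W : lmodType C) (s : S -> V -> W) (l : seq (C * S)) (z : V) : comb s l z = comb (fun p => s p z) l.
Proof. by rewrite /comb; elim: l => [|p l IH]; rewrite ?big_nil// !big_cons -IH. Qed.

Lemma opspan_gen (V : normedModType C) (S : set (V -> V)) T : S T -> opspan S T.
Proof.
move=> ST e e0; exists T; last by move=> x; rewrite subrr normr0 mulr_ge0// ltW.
by exists 1%N, (fun=> 1), (fun=> T); split=> //; rewrite big_ord1 scale1r.
Qed.

Lemma rank_one x y : exists k : K, forall z, kop k z = ip H z y *: x.
Proof.
have : range (@kop _ _ K) (fun z => ip H z y *: x).
  by rewrite kop_range; apply: opspan_gen; exists x, y.
by move=> [k _ kE]; exists k => z; rewrite kE.
Qed.
(** The rank-one operator $|x\rangle\langle y|$. With a unit vector [e], [tk x e] lets vectors of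
    [H] be handled as elements of the algebra. *)
Definition tk x y : K := projT1 (cid (rank_one x y)).
Lemma tkE x y z : kop (tk x y) z = ip H z y *: x.
Proof. exact: (projT2 (cid (rank_one x y))). Qed.
Lemma mul_tk k x y : k ** tk x y = tk (kop k x) y.
Proof. by apply: kop_ext => z; rewrite kopM !tkE (linZ (kop_lin k)). Qed.
Lemma star_tk x y : star (tk x y) = tk y x.
Proof.
apply: kop_ext => z; apply: ip_ext1 => w.
by rewrite kop_star starK !tkE ipZr ipZl -ipC mulrC.
Qed.
Lemma tk_lin y : linear (tk^~ y).
Proof. by move=> a x x'; apply: kop_ext => z; rewrite kopD !tkE scalerDr !scalerA mulrC. Qed.
Lemma tk_tk x y x' y' : tk x y ** tk x' y' = ip H x' y *: tk x y'.
Proof. by rewrite mul_tk tkE (linZ (tk_lin _)). Qed.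

Lemma rn_tk_diag y : rn (tk y y) = rn y ^+ 2.
Proof.
have e : rn (tk y y) ^+ 2 = rn y ^+ 2 * rn (tk y y).
  by rewrite -rn_starM star_tk tk_tk ip_rn rnZr ger0_norm ?sqr_ge0.
have [n0|n0] := eqVneq (rn (tk y y)) 0; last by move: e; rewrite expr2; apply: mulIf.
have /rn0_eq0 k0 := n0; have := tkE y y y; rewrite k0 kop0 rn0 ip_rn => /esym /eqP.
rewrite scaler_eq0 => /orP[/eqP/(congr1 (@cn R))|/eqP->]; last by rewrite rn0 expr0n.
by rewrite cn_rc cn0 ger0_norm ?sqr_ge0.
Qed.
Lemma rn_tk x y : rn (tk x y) = rn x * rn y.
Proof.
apply/eqP; rewrite -(@eqrXn2 _ 2) ?mulr_ge0 ?rn_ge0//; apply/eqP.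
by rewrite -rn_starM star_tk tk_tk rnZ ip_rn cn_rc ger0_norm ?sqr_ge0// rn_tk_diag exprMn.
Qed.

Lemma kop_bd k h : rn (kop k h) <= rn k * rn h.
Proof.
have [->|h0] := eqVneq h 0; first by rewrite (lin0 (kop_lin k)) rn0 mulr0.
have hp : 0 < rn h by rewrite lt_neqAle eq_sym rn_eq0 h0 rn_ge0.
rewrite -(ler_pM2r hp) -rn_tk -mul_tk; apply: (le_trans (rnM _ _)).
by rewrite rn_tk mulrA.
Qed.

(** The rank-one technique needs a unit vector, so the zero space has to be treated apart. *)
Lemma unit_or_zero : (exists e : H, rn e = 1) \/ (forall h, h = 0).
Proof.
have [h0|] := pselect (exists h, h != 0); last first.
  by move=> n; right=> h; apply: contrapT => hn; apply: n; exists h; apply/eqP.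
left; case: h0 => h hn; exists (rc (rn h)^-1 *: h).
by rewrite rnZr ger0_norm ?invr_ge0 ?rn_ge0// mulVf// rn_eq0.
Qed.

Lemma tk_unit e h : rn e = 1 -> kop (tk h e) e = h.
Proof. by move=> e1; rewrite tkE ip_rn e1 expr1n scale1r. Qed.

Lemma kop_cover h : exists k e, h = kop k e.
Proof.
have [[e e1]|z] := unit_or_zero; first by exists (tk h e), e; rewrite tk_unit.
by exists (0 : K), h; rewrite kop0; exact: z.
Qed.

Implicit Types m n : multiplier K.

Lemma mop_kop m k h : mop m (kop k h) = kop (m k) h.
Proof.
move: k h; apply: (@theP (H -> H) id (fun T => forall k h, T (kop k h) = kop (m k) h)).
have [[e e1]|z] := unit_or_zero; last by exists id => k h; rewrite [LHS]z [RHS]z.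
(* Forced by [h = kop (tk h e) e]. *)
exists (fun h => kop (m (tk h e)) e) => k h.
by rewrite -mul_tk mactM kopM tk_unit.
Qed.

Lemma mop_adj m x y : ip H (mop m x) y = ip H x (mop (mstar m) y).
Proof.
have [k [e ->]] := kop_cover x; have [l [e' ->]] := kop_cover y.
by rewrite !mop_kop !kop_starr -!kopM mactPr.
Qed.
Lemma mop_lin m : linear (mop m).
Proof. exact: (adj_lin (mop_adj m)). Qed.
Lemma mopM m n h : mop (m * n) h = mop m (mop n h).
Proof. by have [k [e ->]] := kop_cover h; rewrite !mop_kop. Qed.
Lemma mopD m n h : mop (m + n) h = mop m h + mop n h.
Proof. by have [k [e ->]] := kop_cover h; rewrite !mop_kop addmE (linD (kop_linl e)). Qed.
Lemma mopZ a m h : mop (a *: m) h = a *: mop m h.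
Proof. by have [k [e ->]] := kop_cover h; rewrite !mop_kop scalemE (linZ (kop_linl e)). Qed.
Lemma mopN m h : mop (- m) h = - mop m h.
Proof. by rewrite -scaleN1r mopZ scaleN1r. Qed.
Lemma mop1 h : mop (1 : multiplier K) h = h.
Proof. by have [k [e ->]] := kop_cover h; rewrite !mop_kop. Qed.
Lemma mop0 h : mop (0 : multiplier K) h = 0.
Proof. by have [k [e ->]] := kop_cover h; rewrite !mop_kop zeromE kop0. Qed.
Lemma mop_mof k h : mop (mof k) h = kop k h.
Proof. by have [l [e ->]] := kop_cover h; rewrite !mop_kop mofE kopM. Qed.
Lemma mop_linl h : linear (fun m => mop m h).
Proof. by move=> a m n; rewrite mopD mopZ. Qed.
Lemma mop_inj m n : (forall h, mop m h = mop n h) -> m = n.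
Proof. by move=> e; apply: multP => k; apply: kop_ext => h; rewrite -!mop_kop e. Qed.
Lemma mop_tk m x y : m (tk x y) = tk (mop m x) y.
Proof. by apply: kop_ext => z; rewrite -mop_kop !tkE (linZ (mop_lin m)). Qed.

Lemma mop_bd m t : bd m t -> bdd (mop m) t.
Proof.
move=> b h; have [[e e1]|z] := unit_or_zero; last first.
  by rewrite [mop m h]z [h]z rn0 mulr0.
rewrite -{1}(tk_unit h e1) mop_kop; apply: (le_trans (kop_bd _ _)); rewrite e1 mulr1.
by apply: (le_trans (b _)); rewrite rn_tk e1 mulr1.
Qed.

(** An inequality between vectors has to become positivity in the sense of [pos]. Let [n] be the
    negative part of $w=t^2-m^*m$. At vectors in the range of [n] the form of [w] is nonnegative by
    the bound, and it equals $-\|gnh\|^2$ by the choice of [n]; hence [n = 0]. *)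
Lemma bd_mop m t : 0 <= t -> bdd (mop m) t -> bd m t.
Proof.
move=> t0 b; pose w : multiplier K := rc (t ^+ 2) *: (1 : multiplier K) - mstar m * m.
have wa : mstar w = w by rewrite adjB adjZr adj1 adjM adjK.
have [e [g [n [[ea ee ep en en0] [na nw n3 gna _]]]]] := abs_parts wa.
have gn0 : g * n = 0.
  apply: mop_inj => h; rewrite mop0.
  apply/eqP; rewrite -rn_eq0 -sqrf_eq0; apply/eqP.
  have h1 : ip H (mop (n * w * n) h) h = rc (t ^+ 2 * rn (mop n h) ^+ 2 - rn (mop m (mop n h)) ^+ 2).
    rewrite -mulrA mopM mop_adj na mopM mopD mopZ mop1 -scaleN1r mopZ scaleN1r mopM ipBl ipZl.
    by rewrite (mop_adj (mstar m)) adjK !ip_rn rcB (rcM (t ^+ 2)).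
  have h2 : ip H (mop (n * w * n) h) h = rc (- rn (mop (g * n) h) ^+ 2).
    by rewrite nw mulNr n3 mopN ipNl mopM mop_adj gna ip_rn rcN.
  have h3 := b (mop n h).
  have := rc_inj (etrans (esym h1) h2).
  have h4 : rn (mop m (mop n h)) ^+ 2 <= (t * rn (mop n h)) ^+ 2.
    by rewrite ler_pXn2r ?nnegrE ?mulr_ge0 ?rn_ge0.
  rewrite exprMn in h4; have := sqr_ge0 (rn (mop (g * n) h)); lra.
have n0 : n = 0.
  have n30 : n * n * n = 0 by rewrite n3 gn0 mul0r.
  by apply: sa_sq0 => //; apply: sa_sq0; rewrite ?adjM ?na// mulrA n30 mul0r.
have wp : pos w by move: en; rewrite n0 addr0 => /eqP; rewrite subr_eq0 => /eqP <-.
by apply: bd_sq => //; apply: pos_bd; [exact: sqr_ge0|exact: pos_starM|].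
Qed.

Lemma tk_total : total (fun p : H * H => tk p.1 p.2).
Proof.
move=> k e e0; have : range (@kop _ _ K) (kop k) by exists k.
rewrite kop_range => /(_ (rc (e / 2))); rewrite rcgt0 divr_gt0// => /(_ isT)[T' [N [a [s [sS ->]]]] hT].
have /choice[p hp] : forall i, exists p : H * H, s i = fun z => ip H z p.2 *: p.1.
  by move=> i; have [x [y ->]] := sS i; exists (x, y).
exists [seq (a i, p i) | i <- index_enum 'I_N].
apply: (@le_lt_trans _ _ (e / 2)); last by lra.
apply: mof_bd; first by rewrite ltW// divr_gt0.
apply: bd_mop => [|z]; first by rewrite ltW// divr_gt0.
rewrite mop_mof (linB (kop_linl z)) -rc_le rcM -!rnE (comb_lin _ _ (kop_linl z)).
have := hT z; congr (`|_ - _| <= _).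
rewrite fct_sumE /comb big_map; apply: eq_bigr => i _ /=.
by rewrite hp tkE.
Qed.

(** Composition with a bounded adjointable operator preserves rank-one operators, hence their closed
    span. Doing this for [T] and for [T'] gives the two halves of a multiplier. *)
Lemma mop_surj (T T' : H -> H) t : 0 <= t -> (forall x y, ip H (T x) y = ip H x (T' y)) ->
  bdd T t -> exists m, forall h, mop m h = T h.
Proof.
move=> t0 adjT b.
have aux (U U' : H -> H) : (forall x y, ip H (U x) y = ip H x (U' y)) -> bdd U t ->
    forall k : K, exists k' : K, forall h, kop k' h = U (kop k h).
  move=> adjU bU k; have Ul := adj_lin adjU.
  suff : range (@kop _ _ K) (U \o kop k) by move=> [k' _ kE]; exists k' => h; rewrite kE.
  rewrite kop_range => e /rc_gt0[r r0 ->].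
  have [l hl] := @tk_total k (r / (t + 1)) ltac:(by rewrite divr_gt0// ltr_wpDl).
  exists (fun h => U (kop (comb (fun p => tk p.1 p.2) l) h)).
    rewrite (_ : (fun h => _) = comb (fun p z => ip H z p.2 *: U p.1) l); last first.
      apply/funext => h; rewrite fcomb (comb_lin _ _ (kop_linl h)) comb_lin//.
      by apply: eq_comb => p; rewrite /= tkE (linZ Ul).
    set S := [set T | _]; have -> : S = [set T | exists p, T = (fun p z => ip H z p.2 *: p.1) p].
      by apply/seteqP; split=> T0 /= => [[x [y ->]]|[[x y] ->]]; [exists (x, y)|exists x, y].
    apply/lspanP; exists [seq (p.1, (U p.2.1, p.2.2)) | p <- l].
    by rewrite (comb_map (fun p z => ip H z p.2 *: p.1) (fun p => (U p.1, p.2))).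
  move=> h; rewrite /= -linB// -(linB (kop_linl h)) !rnE -rcM rc_le.
  apply: (le_trans (bU _)); have := kop_bd (k - comb (fun p => tk p.1 p.2) l) h.
  move: hl; rewrite ltr_pdivlMr ?ltr_wpDl//.
  set d := rn (k - _); have := rn_ge0 h; have := rn_ge0 (k - comb (fun p => tk p.1 p.2) l); rewrite -/d.
  set q := rn (kop _ _); move=> d0 h0 h1 h2.
  have : t * q <= t * (d * rn h) by rewrite ler_wpM2l.
  have : d * (t + 1) * rn h <= r * rn h by rewrite ler_wpM2r// ltW.
  have := mulr_ge0 d0 h0; nra.
have [f hf] := choice (aux T T' adjT b).
have [f' hf'] := choice (aux T' T (adjointC adjT) (adj_bdd adjT t0 b)).
have P k l : star (f k) ** l = star k ** f' l.
  apply: kop_ext => h; apply: ip_ext1 => z.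
  by rewrite !kopM (kop_star (star (f k))) (kop_star (star k)) !starK hf hf' (adjointC adjT).
by exists (Multiplier P) => h; have [k [e ->]] := kop_cover h; rewrite mop_kop /= hf.
Qed.
End Compacts.

Section Reps.
Variables (R : realType) (M : hmodel R) (A : cstar R) (H : hilbert R).
Local Notation K := (compact M H).

Lemma rep_total (phi : rep M A H) : is_mor phi -> total (fun p : A * H => mop (phi p.1) p.2).
Proof.
move=> pm h; have [k [e ->]] := kop_cover M h.
suff : inspan (fun p : A * H => mop (phi p.1) p.2) (kop k e) by [].
have kb : bdd (fun k : K => kop k e) (rn e) by move=> l; rewrite mulrC; apply: kop_bd.
apply: (inspan_img (kop_linl e) kb _ (mor_total pm k)).
move=> [a l] /=; rewrite -mop_kop; exact: (inspan_gen _ (a, kop l e)).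
Qed.

Lemma rep_of (r : A -> H -> H) :
  (forall h, linear (r^~ h)) -> (forall a b h, r (a ** b) h = r a (r b h)) ->
  (forall a x y, ip H (r a x) y = ip H x (r (star a) y)) ->
  (forall a, bdd (r a) (rn a)) -> total (fun p : A * H => r p.1 p.2) ->
  exists phi : rep M A H, is_mor phi /\ forall a h, mop (phi a) h = r a h.
Proof.
move=> rl rM ra rb rt.
have /choice[phi pE] : forall a, exists m : multiplier K, forall h, mop m h = r a h.
  by move=> a; apply: (mop_surj M (rn_ge0 a) (ra a) (rb a)).
exists phi; split=> //; split.
- move=> a x y z; rewrite -[RHS]/((a *: phi x + phi y) z); congr (mact _ z).
  by apply: mop_inj => h; rewrite mopD mopZ !pE rl.
- by move=> x y; apply: mop_inj => h; rewrite mopM !pE rM.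
- move=> x; apply: mop_inj => h; apply: ip_ext1 => z.
  by rewrite pE mop_adj adjK pE ra starK.
apply/clspan_total2; apply: (total_trans (@tk_total R M H)) => -[x y] /=.
apply: (inspan_img (F := fun x => tk M x y) (tk_lin M y) _ _ (rt x)).
  by move=> z; rewrite rn_tk mulrC.
move=> [a h] /=; rewrite -pE -mop_tk; exact: (inspan_gen _ (a, tk M h y)).
Qed.

Lemma rep_bdd (phi : rep M A H) a : is_mor phi -> bdd (mop (phi a)) (rn a).
Proof. by move=> pm; apply: mop_bd; apply: mor_bd. Qed.
End Reps.

(** * The Hilbert space of a positive semidefinite kernel *)

Section Limits.
Variable R : realType.
Local Notation C := (cplx R).

(** Completeness is required for Cauchy filters; points chosen in members of diameter about
    $1/(n+1)$ reduce it to sequences. *)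
Lemma seq_complete (V : normedModType C) :
  (forall u : nat -> V,
    (forall e : R, 0 < e -> exists N, forall m n, (N <= m)%N -> (N <= n)%N -> rn (u m - u n) < e) ->
    exists x, tends u x) ->
  forall F : set_system V, ProperFilter F -> cauchy F -> cvg F.
Proof.
move=> h F FF /cauchy_ballP Fc.
have /choice[A hA] : forall n : nat, exists A : set V, F A /\ forall a b, A a -> A b -> rn (a - b) < n.+1%:R^-1.
  move=> n; have [|[A B] /= [FA FB] AB] := Fc (rc n.+1%:R^-1); first by rewrite rcgt0 invr_gt0 ltr0n.
  exists (A `&` B); split=> [|a b [Aa _] [_ Bb]]; first exact: filterI.
  by have := AB (a, b) (conj Aa Bb); rewrite -ball_normE /= rnE rc_lt.
have /choice[x hx] : forall n, exists x, A n x.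
  by move=> n; have [FA _] := hA n; exact: (filter_ex FA).
have close m a n b : A m a -> A n b -> rn (a - b) < m.+1%:R^-1 + n.+1%:R^-1.
  move=> Aa Ab; have [c [Ac Ac']] : exists c, A m c /\ A n c.
    by have [c [h1 h2]] := filter_ex (filterI (hA m).1 (hA n).1); exists c.
  apply: (le_lt_trans (rn_tri c _ _)); rewrite ltrD//; first by apply: (proj2 (hA m)).
  by apply: (proj2 (hA n)).
have [e e0|l hl] := h x.
  have [N hN] := @inv_small R (e / 2) ltac:(by rewrite divr_gt0).
  exists N => m n /hN hm /hN hn; apply: (lt_trans (close _ _ _ _ (hx m) (hx n))).
  by rewrite (splitr e) ltrD.
apply/cvg_ex; exists l; apply/fcvg_ballP => e /rc_gt0[r r0 ->].
have [N hN] := hl (r / 2) ltac:(by rewrite divr_gt0).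
have [N' hN'] := @inv_small R (r / 2) ltac:(by rewrite divr_gt0).
apply: filterS (proj1 (hA (maxn N N'))) => y Ay; rewrite -ball_normE /= rnE rc_lt.
apply: (le_lt_trans (rn_tri (x (maxn N N')) _ _)); rewrite (splitr r) ltrD//.
  by rewrite rnB hN// leq_maxl.
by apply: (lt_trans (proj2 (hA _) _ _ (hx _) Ay)); rewrite hN'// leq_maxr.
Qed.

Lemma tends_lin (V : normedModType C) (u v : nat -> V) x y a :
  tends u x -> tends v y -> tends (fun n => a *: u n + v n) (a *: x + y).
Proof.
move=> ux vy e e0; have p : 0 < cn a + 1 by rewrite ltr_wpDl// cn_ge0.
have [N hN] := ux (e / 2 / (cn a + 1)) ltac:(by rewrite !divr_gt0).
have [N' hN'] := vy (e / 2) ltac:(by rewrite divr_gt0).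
exists (maxn N N') => n; rewrite geq_max => /andP[/hN h1 /hN' h2].
rewrite opprD addrACA -scalerBr; apply: (le_lt_trans (rnD _ _)).
rewrite (splitr e) ltrD// rnZ; move: h1; rewrite ltr_pdivlMr//.
have := rn_ge0 (u n - x); lra.
Qed.

Lemma conjD (a b : C) : (a + b)^* = a^* + b^*. Proof. exact: rmorphD. Qed.
Lemma conjM (a b : C) : (a * b)^* = a^* * b^*. Proof. exact: rmorphM. Qed.
Lemma conjN (a : C) : (- a)^* = - a^*. Proof. exact: rmorphN. Qed.
Lemma conjB (a b : C) : (a - b)^* = a^* - b^*. Proof. exact: rmorphB. Qed.
Lemma conj0 : (0 : C)^* = 0. Proof. exact: rmorph0. Qed.
Lemma conj1 : (1 : C)^* = 1. Proof. exact: rmorph1. Qed.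
Lemma conj_term (a b c : C) : (a * b^* * c)^* = b * a^* * c^*.
Proof. by rewrite !conjM conjCK (mulrC b). Qed.

Definition tc (u : nat -> C) (z : C) := @tends R (cplx_line R) u z.

Lemma tc_uniq u z w : tc u z -> tc u w -> z = w. Proof. exact: tends_uniq. Qed.
Lemma tc_lin (u v : nat -> C) z w a : tc u z -> tc v w -> tc (fun n => a * u n + v n) (a * z + w).
Proof. exact: (@tends_lin (cplx_line R)). Qed.
Lemma tc_cst z : tc (fun=> z) z. Proof. exact: tends_cst. Qed.
Lemma tc_conj (u : nat -> C) z : tc u z -> tc (fun n => (u n)^*) z^*.
Proof. by move=> h e /h[N hN]; exists N => n /hN; rewrite !rn_line -conjB cn_conj. Qed.
Lemma tc_close (u v : nat -> C) z : tc u z ->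
  (forall e : R, 0 < e -> exists N, forall n, (N <= n)%N -> cn (v n - u n) < e) -> tc v z.
Proof.
move=> h h' e e0; have [N hN] := h (e / 2) ltac:(by rewrite divr_gt0).
have [N' hN'] := h' (e / 2) ltac:(by rewrite divr_gt0).
exists (maxn N N') => n; rewrite geq_max => /andP[/hN h1 /hN' h2].
by apply: (le_lt_trans (rn_tri (u n : cplx_line R) _ _)); rewrite (splitr e) addrC ltrD.
Qed.
Lemma tc_le (u : nat -> C) z (t : R) : tc u z -> (exists N, forall n, (N <= n)%N -> cn (u n) <= t) -> cn z <= t.
Proof. by move=> uz h; rewrite -rn_line; apply: (rn_lim_le uz). Qed.
Lemma tc_ge0 (u : nat -> C) z : tc u z -> (forall n, 0 <= u n) -> 0 <= z.
Proof.
move=> uz u0; suff -> : z = rc (cn z) by rewrite rcge0 cn_ge0.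
apply: (tc_uniq uz) => e /uz[N hN]; exists N => n /hN; rewrite !rn_line.
have wE : u n = rc (cn (u n)) by rewrite -cnE ger0_norm.
rewrite {2}wE -rcB cn_rc; apply: le_lt_trans; move: (u n) => w.
rewrite ler_norml; apply/andP; split.
  by have := cnD (z - w) w; rewrite subrK cnB; lra.
by have := cnD (w - z) z; rewrite subrK; lra.
Qed.
Lemma tc_cauchy (u : nat -> C) :
  (forall e : R, 0 < e -> exists N, forall m n, (N <= m)%N -> (N <= n)%N -> cn (u m - u n) < e) ->
  exists z, tc u z.
Proof. exact: (@cauchy_tends R (cplx_line R)). Qed.
End Limits.

Record kernel (R : realType) := Kernel {
  kpt : Type;
  kfn : kpt -> kpt -> cplx R;
  kherm : forall x y, kfn y x = (kfn x y)^*;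
  kpos : forall l : seq (cplx R * kpt),
    0 <= \sum_(p <- l) \sum_(q <- l) p.1 * (q.1)^* * kfn p.2 q.2 }.

Section KernelSpace.
Variables (R : realType) (k : kernel R).
Local Notation C := (cplx R).
Local Notation S := (kpt k).
Local Notation K := (@kfn _ k).
Implicit Types l : seq (C * S).

Definition kf l l' : C := \sum_(p <- l) \sum_(q <- l') p.1 * (q.1)^* * K p.2 q.2.

Lemma kf_catl l1 l2 l : kf (l1 ++ l2) l = kf l1 l + kf l2 l.
Proof. by rewrite /kf big_cat. Qed.
Lemma kf_scll a l l' : kf (scl a l) l' = a * kf l l'.
Proof.
rewrite /kf big_map mulr_sumr; apply: eq_bigr => p _.
by rewrite mulr_sumr; apply: eq_bigr => q _; rewrite !mulrA.
Qed.
Lemma kf_conj l l' : kf l' l = (kf l l')^*.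
Proof.
rewrite /kf exchange_big rmorph_sum; apply: eq_bigr => p _ /=.
rewrite rmorph_sum; apply: eq_bigr => q _ /=.
by rewrite kherm conj_term.
Qed.
Lemma kf_catr l l1 l2 : kf l (l1 ++ l2) = kf l l1 + kf l l2.
Proof. by rewrite kf_conj kf_catl conjD -!kf_conj. Qed.
Lemma kf_sclr a l l' : kf l (scl a l') = a^* * kf l l'.
Proof. by rewrite kf_conj kf_scll conjM -kf_conj. Qed.

Definition kn l : R := Num.sqrt (complex.Re (kf l l)).
Lemma kn_ge0 l : 0 <= kn l. Proof. exact: sqrtr_ge0. Qed.
Lemma kf_diag l : kf l l = rc (kn l ^+ 2).
Proof.
have h : 0 <= kf l l by apply: kpos.
by rewrite {1}(ge0_rc h) sqr_sqrtr// -rcge0 -ge0_rc.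
Qed.

Lemma kf_cs l l' : cn (kf l l') <= kn l * kn l'.
Proof.
set c := kf l l'; have cc : c * c^* = rc (cn c ^+ 2) by rewrite -normCK cnE rcX.
(* The form may be degenerate, so the square of [kn l'] is replaced by a strictly positive [b], and
   [e] then tends to 0. *)
suff h : forall e : R, 0 < e -> cn c ^+ 2 <= (kn l' ^+ 2 + e) * kn l ^+ 2.
  rewrite -(@ler_pXn2r _ 2) ?nnegrE ?mulr_ge0 ?kn_ge0 ?cn_ge0// exprMn.
  apply/ler_addgt0Pr => e e0.
  have p : 0 < kn l ^+ 2 + 1 by rewrite ltr_wpDl ?sqr_ge0.
  have := h (e / (kn l ^+ 2 + 1)) ltac:(by rewrite divr_gt0).
  have e1 : e / (kn l ^+ 2 + 1) * (kn l ^+ 2 + 1) = e by rewrite mulfVK// gt_eqF.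
  have e2 : 0 < e / (kn l ^+ 2 + 1) by rewrite divr_gt0.
  nra.
move=> e e0; set b := kn l' ^+ 2 + e.
have b0 : 0 < b by rewrite ltr_wpDl ?sqr_ge0.
pose w := scl (rc b) l ++ scl (- c) l'.
have : 0 <= kf w w by apply: kpos.
rewrite kf_catl !kf_catr !kf_scll !kf_sclr rc_conj conjN (kf_conj l l') -/c.
rewrite [_ + _](_ : _ = rc (b ^+ 2 * kn l ^+ 2 - (2 * b - kn l' ^+ 2) * cn c ^+ 2)); last first.
  rewrite (rcB (b ^+ 2 * _)) (rcM (b ^+ 2)) (rcM (_ - _)) -cc (rcB (2 * b)) (rcM 2 b) rc_nat !kf_diag (rcX 2 b).
  ring.
rewrite rcge0 subr_ge0 => h.
rewrite -(ler_pM2l b0); apply: le_trans (_ : (2 * b - kn l' ^+ 2) * cn c ^+ 2 <= _).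
  by rewrite ler_wpM2r ?sqr_ge0// /b; lra.
by apply: (le_trans h); rewrite (expr2 b) -mulrA lexx.
Qed.

Lemma kn_scl a l : kn (scl a l) = cn a * kn l.
Proof.
apply/eqP; rewrite -(@eqrXn2 _ 2) ?mulr_ge0 ?cn_ge0 ?kn_ge0//; apply/eqP/rc_inj.
rewrite -kf_diag kf_scll kf_sclr mulrA -normCK cnE kf_diag -!rcX -!rcM.
by rewrite exprMn.
Qed.
Lemma kn_cat l l' : kn (l ++ l') <= kn l + kn l'.
Proof.
rewrite -(@ler_pXn2r _ 2) ?nnegrE ?addr_ge0 ?kn_ge0// -rc_le -kf_diag.
rewrite kf_catl !kf_catr !kf_diag (kf_conj l l').
have h : cn (kf l l' + (kf l l')^*) <= 2 * (kn l * kn l').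
  by rewrite (le_trans (cnD _ _))// cn_conj; have := kf_cs l l'; lra.
have r : kf l l' + (kf l l')^* = rc (complex.Re (kf l l' + (kf l l')^*)).
  by case: (kf l l') => a b; rewrite /rc /=; apply/eqP; rewrite eq_complex /= subrr !eqxx.
rewrite addrA -(addrA (rc _)) r; move: h; rewrite r cn_rc => h.
rewrite -!rcD rc_le; have := ler_norm (complex.Re (kf l l' + (kf l l')^*)).
move: h; rewrite -r; nra.
Qed.

Definition ksub l l' := l ++ scl (-1) l'.
Lemma kf_subl l l' l2 : kf (ksub l l') l2 = kf l l2 - kf l' l2.
Proof. by rewrite kf_catl kf_scll mulN1r. Qed.
Lemma kf_subr l l' l2 : kf l2 (ksub l l') = kf l2 l - kf l2 l'.
Proof. by rewrite kf_catr kf_sclr conjN conj1 mulN1r. Qed.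
Lemma kn_ext l l' : (forall x, kf l x = kf l' x) -> kn l = kn l'.
Proof. by move=> h; rewrite /kn h kf_conj h -kf_conj. Qed.
Lemma kn_le l l' : kn l <= kn l' + kn (ksub l l').
Proof.
rewrite (_ : kn l = kn (l' ++ ksub l l')) ?kn_cat//.
by apply: kn_ext => x; rewrite kf_catl kf_subl addrC subrK.
Qed.

Definition kcauchy (u : nat -> seq (C * S)) := forall e : R, 0 < e ->
  exists N, forall m n, (N <= m)%N -> (N <= n)%N -> kn (ksub (u m) (u n)) < e.
Definition represents u (f : S -> C) := kcauchy u /\ forall x, tc (fun n => kf (u n) [:: (1, x)]) (f x).

Lemma kcauchy_bound u : kcauchy u -> exists2 B, 0 < B & exists N, forall n, (N <= n)%N -> kn (u n) <= B.
Proof.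
move=> /(_ 1 ltr01)[N hN]; exists (kn (u N) + 1); first by rewrite ltr_wpDl ?kn_ge0.
exists N => n Nn; apply: (le_trans (kn_le _ (u N))); rewrite lerD2l ltW//.
exact: hN.
Qed.

Lemma kf_pt l l' : kf l l' = \sum_(q <- l') (q.1)^* * kf l [:: (1, q.2)].
Proof.
rewrite {1}/kf exchange_big; apply: eq_bigr => q _ /=.
rewrite /kf mulr_sumr; apply: eq_bigr => p _ /=.
by rewrite big_seq1 conj1 mulr1 /= mulrA [p.1 * _]mulrC.
Qed.

Lemma tc_kf u f l : represents u f -> tc (fun n => kf (u n) l) (\sum_(q <- l) (q.1)^* * f q.2).
Proof.
move=> [_ h]; elim: l => [|q l IH].
  rewrite big_nil; have := tc_cst (0 : C); congr tc; apply/funext => n.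
  by rewrite kf_pt big_nil.
rewrite big_cons; have := tc_lin (q.1)^* (h q.2) IH; congr tc.
by apply/funext => n; rewrite [RHS]kf_pt big_cons -kf_pt.
Qed.

(** $\|w_n\|^2=\langle w_n,w_n-w_N\rangle+\langle w_n,w_N\rangle$: the first term is small for a
    bounded Cauchy sequence, the second tends to 0 since [w N] is a finite combination of points.
    This is what makes the inner product independent of the representing sequences. *)
Lemma represents0_small w : represents w (fun=> 0) ->
  forall e : R, 0 < e -> exists N, forall n, (N <= n)%N -> kn (w n) < e.
Proof.
move=> hw e e0; have [cw _] := hw; have [B B0 [N0 hB]] := kcauchy_bound cw.
have [N1 h1] := cw (e ^+ 2 / (4 * B)) ltac:(by rewrite divr_gt0 ?exprn_gt0 ?mulr_gt0).
have := tc_kf (w N1) hw; rewrite big1 => [|q _]; last by rewrite mulr0.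
move=> /(_ (e ^+ 2 / 4)); rewrite divr_gt0 ?exprn_gt0// => /(_ isT)[N2 h2].
exists (maxn N0 (maxn N1 N2)) => n; rewrite !geq_max => /and3P[/hB hb n1 /h2].
rewrite rn_line subr0 => h3.
have h4 := kf_cs (w n) (ksub (w n) (w N1)); rewrite kf_subr kf_diag in h4.
have h5 := cnD (rc (kn (w n) ^+ 2) - kf (w n) (w N1)) (kf (w n) (w N1)).
rewrite subrK cn_rc ger0_norm ?sqr_ge0// in h5.
have h6 := h1 n N1 n1 (leqnn _).
have h7 : kn (w n) * kn (ksub (w n) (w N1)) <= B * (e ^+ 2 / (4 * B)).
  by apply: ler_pM; [exact: kn_ge0|exact: kn_ge0|exact: hb|exact: ltW].
have h8 : B * (e ^+ 2 / (4 * B)) = e ^+ 2 / 4 by field; rewrite gt_eqF.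
have : kn (w n) ^+ 2 < e ^+ 2 by have := exprn_gt0 2 e0; lra.
by rewrite ltr_pXn2r// nnegrE ?kn_ge0 ?ltW.
Qed.

Lemma represents_lin a u v f g : represents u f -> represents v g ->
  represents (fun n => scl a (u n) ++ v n) (fun x => a * f x + g x).
Proof.
move=> [cu hu] [cv hv]; split=> [e e0|x]; last first.
  by have := tc_lin a (hu x) (hv x); congr tc; apply/funext => n; rewrite kf_catl kf_scll.
have p : 0 < cn a + 1 by rewrite ltr_wpDl// cn_ge0.
have [N hN] := cu (e / 2 / (cn a + 1)) ltac:(by rewrite !divr_gt0).
have [N' hN'] := cv (e / 2) ltac:(by rewrite divr_gt0).
exists (maxn N N') => m n; rewrite !geq_max => /andP[Nm N'm] /andP[Nn N'n].
rewrite (_ : kn _ = kn (scl a (ksub (u m) (u n)) ++ ksub (v m) (v n))); last first.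
  by apply: kn_ext => x; rewrite !(kf_catl, kf_subl, kf_scll); ring.
apply: (le_lt_trans (kn_cat _ _)); rewrite (splitr e) ltrD ?hN'// kn_scl.
have := hN m n Nm Nn; rewrite ltr_pdivlMr//; have := kn_ge0 (ksub (u m) (u n)); lra.
Qed.

Lemma represents_same u v f : represents u f -> represents v f ->
  forall e : R, 0 < e -> exists N, forall n, (N <= n)%N -> kn (ksub (u n) (v n)) < e.
Proof.
move=> hu hv e e0.
have := represents_lin (-1) hv hu; rewrite (_ : (fun x => _) = fun=> 0); last first.
  by apply/funext => x; rewrite mulN1r addNr.
move=> /represents0_small/(_ e e0)[N hN]; exists N => n /hN.
by rewrite (_ : kn (ksub _ _) = kn (scl (-1) (v n) ++ u n)) //; apply: kn_ext => x; rewrite !(kf_catl, kf_subl, kf_scll); ring.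
Qed.

Lemma kf_diff u v u' v' : cn (kf u v - kf u' v') <= kn (ksub u u') * kn v + kn u' * kn (ksub v v').
Proof.
have -> : kf u v - kf u' v' = kf (ksub u u') v + kf u' (ksub v v') by rewrite kf_subl kf_subr addrA subrK.
by apply: (le_trans (cnD _ _)); rewrite lerD// kf_cs.
Qed.

Lemma small_prod (B e : R) : 0 < B -> 0 < e -> exists2 d, 0 < d & B * d + B * d < e.
Proof. by move=> B0 e0; exists (e / (4 * B)); [rewrite divr_gt0// mulr_gt0|rewrite (_ : _ + _ = e / 2); [lra|field; rewrite gt_eqF]]. Qed.

Lemma kf_limit u v f g : represents u f -> represents v g -> exists z,
  forall u' v', represents u' f -> represents v' g -> tc (fun n => kf (u' n) (v' n)) z.
Proof.
move=> hu hv; have [B B0 [N0 hB]] := kcauchy_bound hu.1; have [B' B'0 [N0' hB']] := kcauchy_bound hv.1.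
have BB0 : 0 < B + B' by rewrite addr_gt0.
have [e e0|z hz] := @tc_cauchy R (fun n => kf (u n) (v n)).
  have [d d0 hd] := small_prod BB0 e0.
  have [N1 h1] := hu.1 d d0; have [N2 h2] := hv.1 d d0.
  exists (maxn (maxn N0 N0') (maxn N1 N2)) => m n.
  rewrite !geq_max => /andP[/andP[m0 m0'] /andP[m1 m2]] /andP[/andP[n0 n0'] /andP[n1 n2]].
  apply: (le_lt_trans (kf_diff _ _ _ _)); apply: le_lt_trans hd; rewrite addrC.
  apply: lerD; [|rewrite mulrC]; apply: ler_pM; rewrite ?kn_ge0 ?(ltW (h1 _ _ _ _)) ?(ltW (h2 _ _ _ _))//.
    by rewrite (le_trans (hB _ n0))// lerDl ltW.
  by rewrite (le_trans (hB' _ m0'))// lerDr ltW.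
exists z => u' v' hu' hv'; apply: (tc_close hz) => e e0.
have [C1 C10 [N3 hC1]] := kcauchy_bound hv'.1.
have BC0 : 0 < B + C1 by rewrite addr_gt0.
have [d d0 hd] := small_prod BC0 e0.
have [N1 h1] := represents_same hu' hu d0; have [N2 h2] := represents_same hv' hv d0.
exists (maxn (maxn N0 N3) (maxn N1 N2)) => n.
rewrite !geq_max => /andP[/andP[n0 n3] /andP[n1 n2]].
apply: (le_lt_trans (kf_diff _ _ _ _)); apply: le_lt_trans hd; rewrite addrC.
apply: lerD; [|rewrite mulrC]; apply: ler_pM; rewrite ?kn_ge0 ?(ltW (h1 _ _)) ?(ltW (h2 _ _))//.
  by rewrite (le_trans (hB _ n0))// lerDl ltW.
by rewrite (le_trans (hC1 _ n3))// lerDr ltW.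
Qed.
End KernelSpace.

Record kspace (R : realType) (k : kernel R) := KSpace {
  kval : kpt k -> cplx R;
  kvalP : exists u, represents u kval }.

HB.instance Definition _ (R : realType) (k : kernel R) := gen_eqMixin (kspace k).
HB.instance Definition _ (R : realType) (k : kernel R) := gen_choiceMixin (kspace k).

Section KernelHilbert.
Variables (R : realType) (k : kernel R).
Local Notation C := (cplx R).
Local Notation S := (kpt k).
Local Notation V := (kspace k).
Implicit Types f g h : V.

Lemma kval_inj f g : (forall x, kval f x = kval g x) -> f = g.
Proof.
case: f g => [f fP] [g gP] /= e; have e' : f = g by apply/funext.
by subst g; congr KSpace; exact: Prop_irrelevance.
Qed.

Lemma klin_subproof (a : C) f g : exists u, represents u (fun x => a * kval f x + kval g x).
Proof.
have [u hu] := kvalP f; have [v hv] := kvalP g.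
by exists (fun n => scl a (u n) ++ v n); apply: represents_lin.
Qed.
Definition klin (a : C) f g : V := KSpace (klin_subproof a f g).
Lemma kpoint_subproof (x : S) : exists u, @represents R k u (fun y => kfn x y).
Proof.
exists (fun=> [:: (1, x)]); split=> [e e0|y].
  exists 0%N => m n _ _; rewrite (_ : kn _ = kn ([::] : seq (C * S))); last first.
    by apply: kn_ext => z; rewrite kf_subl subrr /kf big_nil.
  by rewrite /kn /kf big_nil sqrtr0.
have := tc_cst (kfn x y); congr tc; apply/funext => n.
by rewrite /kf !big_seq1 /= conj1 !mul1r.
Qed.
Definition kpoint (x : S) : V := KSpace (kpoint_subproof x).
Lemma kzero_subproof : exists u, @represents R k u (fun=> 0).
Proof.
exists (fun=> [::]); split=> [e e0|y].
  by exists 0%N => m n _ _; rewrite /ksub /= /kn /kf big_nil sqrtr0.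
by have := tc_cst (0 : C); congr tc; apply/funext => n; rewrite /kf big_nil.
Qed.
Definition kzero : V := KSpace kzero_subproof.

Definition kadd f g := klin 1 f g.
Definition kopp f := klin (-1) f kzero.
Definition kscale (a : C) f := klin a f kzero.
Lemma kaddA : associative kadd. Proof. by move=> f g h; apply: kval_inj => x /=; rewrite !mul1r addrA. Qed.
Lemma kaddC : commutative kadd. Proof. by move=> f g; apply: kval_inj => x /=; rewrite !mul1r addrC. Qed.
Lemma kadd0 : left_id kzero kadd. Proof. by move=> f; apply: kval_inj => x /=; rewrite !mul1r add0r. Qed.
Lemma kaddN : left_inverse kzero kopp kadd.
Proof. by move=> f; apply: kval_inj => x /=; rewrite !mul1r addr0 mulN1r addNr. Qed.
HB.instance Definition _ := GRing.isZmodule.Build V kaddA kaddC kadd0 kaddN.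
Lemma kscaleA (a b : C) f : kscale a (kscale b f) = kscale (a * b) f.
Proof. by apply: kval_inj => x /=; rewrite !addr0 mulrA. Qed.
Lemma kscale1 : left_id (1 : C) kscale. Proof. by move=> f; apply: kval_inj => x /=; rewrite addr0 mul1r. Qed.
Lemma kscaleDr : right_distributive kscale +%R.
Proof. by move=> a f g; apply: kval_inj => x /=; rewrite !addr0 !mul1r mulrDr. Qed.
Lemma kscaleDl f : {morph kscale^~ f : a b / a + b}.
Proof. by move=> a b; apply: kval_inj => x /=; rewrite !addr0 mul1r mulrDl. Qed.
HB.instance Definition _ := GRing.Zmodule_isLmodule.Build C V kscaleA kscale1 kscaleDr kscaleDl.

Lemma kvalD f g x : kval (f + g) x = kval f x + kval g x. Proof. by rewrite /= mul1r. Qed.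
Lemma kvalZ a f x : kval (a *: f) x = a * kval f x. Proof. by rewrite /= addr0. Qed.
Lemma kval0 x : kval (0 : V) x = 0. Proof. by []. Qed.
Lemma kvalB f g x : kval (f - g) x = kval f x - kval g x.
Proof. by rewrite -scaleN1r kvalD kvalZ mulN1r. Qed.

Definition kip f g : C := the 0 (fun z => forall u v, represents u (kval f) -> represents v (kval g) ->
  tc (fun n => kf (u n) (v n)) z).
Lemma kipP f g u v : represents u (kval f) -> represents v (kval g) -> tc (fun n => kf (u n) (v n)) (kip f g).
Proof.
move: u v; apply: (@theP C 0 (fun z => forall u v, represents u (kval f) -> represents v (kval g) ->
  tc (fun n => kf (u n) (v n)) z)).
have [u hu] := kvalP f; have [v hv] := kvalP g; exact: kf_limit hu hv.
Qed.

Lemma kip_lin a f g h : kip (a *: f + g) h = a * kip f h + kip g h.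
Proof.
have [u hu] := kvalP f; have [v hv] := kvalP g; have [w hw] := kvalP h.
have e : kval (a *: f + g) = fun x => a * kval f x + kval g x by apply/funext => x; rewrite kvalD kvalZ.
have hs : represents (fun n => scl a (u n) ++ v n) (kval (a *: f + g)) by rewrite e; apply: represents_lin.
apply: (tc_uniq (kipP hs hw)).
have := tc_lin a (kipP hu hw) (kipP hv hw); congr tc.
by apply/funext => n; rewrite kf_catl kf_scll.
Qed.
Lemma kip_conj f g : kip g f = (kip f g)^*.
Proof.
have [u hu] := kvalP f; have [v hv] := kvalP g; apply: (tc_uniq (kipP hv hu)).
have := tc_conj (kipP hu hv); congr tc; apply/funext => n; by rewrite -kf_conj.
Qed.
Lemma kip_ge0 f : 0 <= kip f f.
Proof. by have [u hu] := kvalP f; apply: (tc_ge0 (kipP hu hu)) => n; apply: kpos. Qed.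

Definition knm f : R := Num.sqrt (complex.Re (kip f f)).
Lemma knm_ge0 f : 0 <= knm f. Proof. exact: sqrtr_ge0. Qed.
Lemma kip_diag f : kip f f = rc (knm f ^+ 2).
Proof.
have h := kip_ge0 f.
by rewrite {1}(ge0_rc h) sqr_sqrtr// -rcge0 -ge0_rc.
Qed.

Lemma knm_rate f u : represents u (kval f) -> forall e : R, 0 < e ->
  exists N, forall n, (N <= n)%N -> `|kn (u n) - knm f| < e.
Proof.
move=> hu e e0; have [N hN] := kipP hu hu (exprn_gt0 2 e0); exists N => n /hN.
rewrite rn_line kf_diag kip_diag -rcB cn_rc => h.
have := kn_ge0 (u n); have := knm_ge0 f; set a := kn _ in h *; set b := knm _ in h *.
move=> b0 a0; move: h; rewrite !ltr_norml => /andP[h1 h2]; apply/andP; split; nra.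
Qed.

Lemma knmZ (a : C) f : knm (a *: f) = cn a * knm f.
Proof.
apply/eqP; rewrite -(@eqrXn2 _ 2) ?mulr_ge0 ?cn_ge0 ?knm_ge0//; apply/eqP/rc_inj.
rewrite -kip_diag -[a *: f]addr0 kip_lin kip_conj kip_lin kip_diag.
have -> : kip 0 f = 0 by have := kip_lin (-1) 0 0 f; rewrite scaler0 addr0 mulN1r addNr.
have -> : kip 0 (a *: f + 0) = 0.
  by have := kip_lin (-1) 0 0 (a *: f + 0); rewrite scaler0 addr0 mulN1r addNr.
by rewrite !addr0 conjM rc_conj mulrA -normCK cnE -rcX -rcM exprMn.
Qed.

Lemma knmD f g : knm (f + g) <= knm f + knm g.
Proof.
have [u hu] := kvalP f; have [v hv] := kvalP g.
have hs : represents (fun n => scl 1 (u n) ++ v n) (kval (f + g)) by apply: represents_lin.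
apply/ler_addgt0Pr => e e0; have e3 : 0 < e / 3 by rewrite divr_gt0.
have [N1 h1] := knm_rate hu e3; have [N2 h2] := knm_rate hv e3; have [N3 h3] := knm_rate hs e3.
pose n := maxn N1 (maxn N2 N3).
have := h1 n (leq_maxl _ _); have := h2 n (leq_trans (leq_maxl _ _) (leq_maxr _ _)).
have := h3 n (leq_trans (leq_maxr _ _) (leq_maxr _ _)).
have := kn_cat (scl 1 (u n)) (v n); rewrite kn_scl cn1 mul1r.
rewrite !ltr_norml => h /andP[a b] /andP[c d] /andP[p q]; lra.
Qed.

Lemma knm_val f x : cn (kval f x) <= knm f * kn [:: (1 : C, x)].
Proof.
have [u hu] := kvalP f; apply/ler_addgt0Pr => e e0.
have p : 0 < kn [:: (1 : C, x)] + 1 by rewrite ltr_wpDl ?kn_ge0.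
have [N hN] := knm_rate hu (divr_gt0 e0 p).
apply: (tc_le (hu.2 x)); exists N => n /hN; rewrite ltr_norml => /andP[_ h].
apply: (le_trans (kf_cs _ _)); move: h p; set q := kn [:: (1 : C, x)] => h p.
have e1 : e / (q + 1) * (q + 1) = e by rewrite mulfVK// gt_eqF.
have q0 : 0 <= q by exact: kn_ge0.
have ep : 0 < e / (q + 1) by rewrite divr_gt0.
nra.
Qed.

Lemma knm_eq0 f : knm f = 0 -> f = 0.
Proof.
move=> f0; apply: kval_inj => x; apply/eqP; rewrite kval0 -cn_eq0 eq_le cn_ge0 andbT.
by have := knm_val f x; rewrite f0 mul0r.
Qed.

Definition knorm f : C := rc (knm f).
Lemma knormD f g : knorm (f + g) <= knorm f + knorm g.
Proof. by rewrite /knorm -rcD rc_le knmD. Qed.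
Lemma knormZ (a : C) f : knorm (a *: f) = `|a| * knorm f.
Proof. by rewrite /knorm knmZ rcM -cnE. Qed.
Lemma knorm_eq0 f : knorm f = 0 -> f = 0.
Proof. by move=> h; apply: knm_eq0; apply: rc_inj. Qed.
HB.instance Definition _ := Lmodule_isNormed.Build C V knormD knormZ knorm_eq0.

Lemma rn_knm f : rn f = knm f. Proof. by []. Qed.

Lemma kcomb l x : kval (comb kpoint l) x = kf l [:: (1, x)].
Proof.
elim: l => [|p l IH]; first by rewrite /comb /kf !big_nil.
rewrite comb_cons kvalD kvalZ IH -[p :: l]cat1s kf_catl; congr (_ + _).
by rewrite /kf !big_seq1 /= conj1 mulr1.
Qed.

Lemma represents_comb l : represents (fun=> l) (kval (comb kpoint l)).
Proof.
split=> [e e0|x]; last by have := tc_cst (kf l [:: (1, x)]); rewrite kcomb.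
exists 0%N => m n _ _; rewrite (_ : kn _ = kn ([::] : seq (C * S))); last first.
  by apply: kn_ext => z; rewrite kf_subl subrr /kf big_nil.
by rewrite /kn /kf big_nil sqrtr0.
Qed.

Lemma kpoint_total : total kpoint.
Proof.
move=> f e e0; have [u hu] := kvalP f; have [N hN] := hu.1 (e / 2) ltac:(by rewrite divr_gt0).
exists (u N); rewrite rn_knm.
have hr := represents_lin (-1) (represents_comb (u N)) hu.
have e1 : (fun x => -1 * kval (comb kpoint (u N)) x + kval f x) = kval (f - comb kpoint (u N)).
  by apply/funext => x; rewrite kvalB mulN1r addrC.
rewrite e1 in hr; have [N' hN'] := knm_rate hr (divr_gt0 e0 (ltr0n R 4)).
have := hN' (maxn N N') (leq_maxr _ _); have := hN (maxn N N') N (leq_maxl _ _) (leqnn _).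
rewrite (_ : kn (ksub _ _) = kn (scl (-1) (u N) ++ u (maxn N N'))); last first.
  by apply: kn_ext => x; rewrite !(kf_catl, kf_subl, kf_scll); ring.
rewrite ltr_norml => h1 /andP[h2 h3]; lra.
Qed.

Lemma kspace_seq_complete (u : nat -> V) :
  (forall e : R, 0 < e -> exists N, forall m n, (N <= m)%N -> (N <= n)%N -> rn (u m - u n) < e) ->
  exists x, tends u x.
Proof.
move=> cu.
have /choice[l hl] : forall n : nat, exists l, rn (u n - comb kpoint l) < n.+1%:R^-1.
  by move=> n; apply: kpoint_total; rewrite invr_gt0 ltr0n.
have kn_rn l1 l2 : kn (ksub l1 l2) = rn (comb kpoint l1 - comb kpoint l2).
  apply/eqP; rewrite -(@eqrXn2 _ 2) ?kn_ge0 ?rn_ge0//; apply/eqP/rc_inj.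
  rewrite -kf_diag rn_knm -kip_diag.
  have -> : comb kpoint l1 - comb kpoint l2 = comb kpoint (ksub l1 l2).
    by rewrite comb_cat comb_scl scaleN1r.
  by have := tc_uniq (tc_cst _) (kipP (represents_comb (ksub l1 l2)) (represents_comb (ksub l1 l2))).
have cl : kcauchy l.
  move=> e e0; have [N hN] := cu (e / 2) ltac:(by rewrite divr_gt0).
  have [N' hN'] := @inv_small R (e / 4) ltac:(by rewrite divr_gt0).
  exists (maxn N N') => m n; rewrite !geq_max => /andP[Nm N'm] /andP[Nn N'n].
  rewrite kn_rn; have := rn_tri (u m) (comb kpoint (l m)) (comb kpoint (l n)).
  have := rn_tri (u n) (u m) (comb kpoint (l n)); rewrite (rnB _ (u m)).
  have := lt_trans (hl m) (hN' m N'm); have := lt_trans (hl n) (hN' n N'n).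
  have := hN m n Nm Nn; lra.
have /choice[f hf] : forall x, exists z, tc (fun n => kf (l n) [:: (1, x)]) z.
  move=> x; apply: tc_cauchy => e e0.
  have p : 0 < kn [:: (1 : C, x)] + 1 by rewrite ltr_wpDl ?kn_ge0.
  have [N hN] := cl (e / (kn [:: (1 : C, x)] + 1)) ltac:(by rewrite divr_gt0).
  exists N => m n Nm Nn; rewrite -kf_subl; apply: (le_lt_trans (kf_cs _ _)).
  have := hN m n Nm Nn; rewrite ltr_pdivlMr//; have := kn_ge0 (ksub (l m) (l n)); lra.
have fP : exists w, represents w f by exists l.
exists (KSpace fP) => e e0.
have [N hN] := cl (e / 4) ltac:(by rewrite divr_gt0).
have [N' hN'] := @inv_small R (e / 4) ltac:(by rewrite divr_gt0).
exists (maxn N N') => n; rewrite !geq_max => /andP[Nn N'n].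
apply: (le_lt_trans (rn_tri (comb kpoint (l n)) _ _)).
have h1 := lt_trans (hl n) (hN' n N'n).
have hr := represents_lin (-1) (conj cl hf : represents l (kval (KSpace fP))) (represents_comb (l n)).
have e1 : (fun x => -1 * kval (KSpace fP) x + kval (comb kpoint (l n)) x) = kval (comb kpoint (l n) - KSpace fP).
  by apply/funext => x; rewrite kvalB mulN1r addrC.
rewrite e1 in hr; have [N2 h2] := knm_rate hr (divr_gt0 e0 (ltr0n R 4)).
have := h2 (maxn N N2) (leq_maxr _ _); have := hN n (maxn N N2) Nn (leq_maxl _ _).
rewrite (_ : kn (ksub _ _) = kn (scl (-1) (l (maxn N N2)) ++ l n)); last first.
  by apply: kn_ext => x; rewrite !(kf_catl, kf_subl, kf_scll); ring.
have r1 : rn (comb kpoint (l n) - KSpace fP) = knm (comb kpoint (l n) - KSpace fP) by [].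
rewrite ltr_norml r1 => h3 /andP[h4 h5]; lra.
Qed.

HB.instance Definition _ := Uniform_isComplete.Build V (seq_complete kspace_seq_complete).

Lemma kip_bilinear : bilinear_for
    (GRing.Scale.Law.clone _ _ *%R _) (GRing.Scale.Law.clone _ _ (Num.conj \; *%R) _) kip.
Proof.
split=> [h a f g|f a g h] /=; first by rewrite kip_lin.
by rewrite kip_conj kip_lin conjD conjM -!kip_conj.
Qed.
HB.instance Definition _ := bilinear_isBilinear.Build C V V C _ _ kip kip_bilinear.
Lemma kip_hermitian f g : kip f g = (-1) ^+ false * (kip g f)^*.
Proof. by rewrite expr0 mul1r -kip_conj. Qed.
HB.instance Definition _ := isHermitianSesquilinear.Build C V false Num.conj kip kip_hermitian.
Lemma kip_gt0 f : f != 0 -> 0 < kip f f.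
Proof.
move=> f0; rewrite kip_diag rcgt0 exprn_gt0// lt_neqAle knm_ge0 andbT eq_sym.
by apply/eqP => /knm_eq0/eqP; apply/negP.
Qed.
HB.instance Definition _ := isDotProduct.Build C V kip kip_gt0.

Lemma kip_norm (f : V) : `|f| ^+ 2 = kip f f.
Proof. by rewrite kip_diag -rn_knm rnE rcX. Qed.

Definition khilbert : hilbert R := @Hilbert R V kip kip_norm.

Lemma kip_point x y : ip khilbert (kpoint x) (kpoint y) = kfn x y.
Proof.
have h z : represents (fun=> [:: (1, z)]) (kval (kpoint z)).
  by have := represents_comb [:: (1, z)]; rewrite /comb big_seq1 scale1r.
rewrite -[LHS]/(kip (kpoint x) (kpoint y)) -(tc_uniq (tc_cst _) (kipP (h x) (h y))).
by rewrite /kf !big_seq1 /= conj1 !mul1r.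
Qed.
End KernelHilbert.

Lemma kernel_hilbert (R : realType) (S : Type) (K : S -> S -> cplx R) :
  (forall x y, K y x = (K x y)^*) ->
  (forall l : seq (cplx R * S), 0 <= \sum_(p <- l) \sum_(q <- l) p.1 * (q.1)^* * K p.2 q.2) ->
  exists (H : hilbert R) (s : S -> H), total s /\ forall x y, ip H (s x) (s y) = K x y.
Proof.
move=> Kh Kp; pose k := Kernel Kh Kp.
by exists (khilbert k), (@kpoint R k); split; [exact: kpoint_total|exact: (@kip_point R k)].
Qed.

(** * The Gelfand-Naimark theorem *)

Lemma inf_lower (R : realType) (E : set R) (b : R) : lbound E b -> (exists x, E x) ->
  (forall x, E x -> inf E <= x) /\ (forall c, lbound E c -> c <= inf E).
Proof.
move=> lb [x0 Ex0]; split=> [x Ex|c lc]; first by apply: ge_inf => //; exists b.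
by apply: lb_le_inf => //; exists x0.
Qed.

Lemma mof0 (R : realType) (A : cstar R) : mof (0 : A) = 0.
Proof. by have := mofZ 0 (0 : A); rewrite !scale0r. Qed.

(** * The Hahn-Banach theorem through minimal sublinear functionals *)

Section HahnBanach.
Variables (R : realType) (V : lmodType (cplx R)).
Local Notation C := (cplx R).
Implicit Types (p q : V -> R) (x y h : V).

Definition sublinear p := (forall x y, p (x + y) <= p x + p y) /\
  (forall (r : R) x, 0 <= r -> p (rc r *: x) = r * p x).

Lemma sublinear0 p : sublinear p -> p 0 = 0.
Proof. by move=> [_ h]; rewrite -(scale0r (0 : V)) -rc0 h// mul0r. Qed.
Lemma sublinear_opp p x : sublinear p -> - p (- x) <= p x.
Proof. by move=> sp; have := sp.1 x (- x); rewrite subrr sublinear0//; lra. Qed.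

(** Take $q'(x)=\inf_{t\ge0}\,q(x+ty)-tq(y)$. A minimal sublinear functional equals its [q'] for
    every [y] and is therefore additive. *)
Lemma sublinear_step q y : sublinear q -> exists q', [/\ sublinear q',
  forall x, q' x <= q x & forall x, q' x <= q (x + y) - q y].
Proof.
move=> sq; pose E x : set R := [set r | exists2 t : R, 0 <= t & r = q (x + rc t *: y) - t * q y].
have lb x : lbound (E x) (- q (- x)).
  move=> _ [t t0 ->]; have := sq.1 (x + rc t *: y) (- x); rewrite addrAC subrr add0r sq.2//; lra.
have ne x : exists r, E x r by exists (q (x + rc 0 *: y) - 0 * q y), 0.
have lo x := inf_lower (lb x) (ne x).
exists (fun x => inf (E x)); split=> [|x|x]; last 2 first.
- apply: (lo x).1; exists 0 => //; by rewrite rc0 scale0r addr0 mul0r subr0.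
- apply: (lo x).1; exists 1 => //; by rewrite rc1 scale1r mul1r.
split=> [x1 x2|r x r0].
  rewrite -lerBlDr; apply: (lo x1).2 => _ [t1 t10 ->].
  rewrite lerBlDr -lerBlDl; apply: (lo x2).2 => _ [t2 t20 ->].
  rewrite lerBlDr; apply: (@le_trans _ _ (q (x1 + x2 + rc (t1 + t2) *: y) - (t1 + t2) * q y)).
    by apply: (lo (x1 + x2)).1; exists (t1 + t2) => //; apply: addr_ge0.
  rewrite rcD scalerDl addrACA; have := sq.1 (x1 + rc t1 *: y) (x2 + rc t2 *: y); lra.
have scl_le (a : R) z : 0 < a -> a * inf (E z) <= inf (E (rc a *: z)).
  move=> a0; apply: (lo _).2 => _ [t t0 ->].
  have -> : q (rc a *: z + rc t *: y) - t * q y = a * (q (z + rc (t / a) *: y) - t / a * q y).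
    have ta : a * (t / a) = t by rewrite mulrCA divff ?mulr1 ?gt_eqF.
    by rewrite mulrBr mulrA ta -(sq.2 a) ?ltW// scalerDr scalerA -rcM ta.
  by rewrite ler_pM2l//; apply: (lo z).1; exists (t / a) => //; rewrite divr_ge0// ltW.
have [->|rn0] := eqVneq r 0.
  rewrite rc0 scale0r mul0r; apply/eqP; rewrite eq_le; apply/andP; split.
    apply: (lo 0).1; exists 0 => //; by rewrite rc0 scale0r addr0 mul0r subr0 sublinear0.
  by apply: (lo 0).2 => _ [t t0 ->]; rewrite add0r sq.2// subrr.
have rp : 0 < r by rewrite lt_neqAle eq_sym rn0.
apply/eqP; rewrite eq_le scl_le// andbT -(@ler_pM2l _ r^-1) ?invr_gt0//.
rewrite mulKf// -[in leRHS](rc_scaleK x rn0); apply: scl_le; by rewrite invr_gt0.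
Qed.

(** [mn_at] is an upper bound at [- h], so it passes to smaller functionals; yet by sublinearity it
    pins the value at [h] to [p h]. *)
Record minorant p h := Minorant {
  mnf : V -> R;
  mn_sub : sublinear mnf;
  mn_le : forall x, mnf x <= p x;
  mn_at : mnf (- h) <= - p h }.

Lemma hahn_banach p h : sublinear p -> exists f : V -> R,
  [/\ forall x y, f (x + y) = f x + f y, forall (r : R) x, f (rc r *: x) = r * f x,
      forall x, f x <= p x & f h = p h].
Proof.
move=> sp; pose rel (m n : minorant p h) := `[<forall x, mnf n x <= mnf m x>].
have [m0 _] : exists m : minorant p h, True.
  have [q [sq qp qh]] := sublinear_step h sp.
  have qa : q (- h) <= - p h by have := qh (- h); rewrite addNr sublinear0// sub0r.
  by exists (Minorant sq qp qa).
have ext (m n : minorant p h) : (forall x, mnf m x = mnf n x) -> m = n.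
  case: m n => [f a b c] [g a' b' c'] /= e; have fg : f = g by apply/funext.
  by subst g; congr Minorant; exact: Prop_irrelevance.
have [||||m mmax] := @Zorn _ rel.
- by move=> m; apply/asboolP.
- by move=> m n k /asboolP h1 /asboolP h2; apply/asboolP => x; apply: le_trans (h2 x) (h1 x).
- by move=> m n /asboolP h1 /asboolP h2; apply: ext => x; apply/eqP; rewrite eq_le h1 h2.
- move=> A tot; have [[a Aa]|nA] := pselect (exists a, A a); last by exists m0 => s As; exfalso; apply: nA; exists s.
  pose E x : set R := [set r | exists2 m, A m & r = mnf m x].
  have lb x : lbound (E x) (- p (- x)).
    move=> _ [m Am ->]; have := sublinear_opp x (mn_sub m); have := mn_le m (- x); lra.
  have ne x : exists r, E x r by exists (mnf a x), a.
  have lo x := inf_lower (lb x) (ne x).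
  have sE : sublinear (fun x => inf (E x)).
    split=> [x1 x2|r x r0].
      rewrite -lerBlDr; apply: (lo x1).2 => _ [m Am ->].
      rewrite lerBlDr -lerBlDl; apply: (lo x2).2 => _ [n An ->].
      rewrite lerBlDr; have [/asboolP mn|/asboolP nm] := tot m n Am An.
        apply: (@le_trans _ _ (mnf n (x1 + x2))); first by apply: (lo _).1; exists n.
        by have := (mn_sub n).1 x1 x2; have := mn x1; lra.
      apply: (@le_trans _ _ (mnf m (x1 + x2))); first by apply: (lo _).1; exists m.
      by have := (mn_sub m).1 x1 x2; have := nm x2; lra.
    have [->|rn0] := eqVneq r 0.
      rewrite rc0 scale0r mul0r; apply/eqP; rewrite eq_le; apply/andP; split.
        by apply: (lo 0).1; exists a => //; rewrite (sublinear0 (mn_sub a)).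
      by apply: (lo 0).2 => _ [m Am ->]; rewrite (sublinear0 (mn_sub m)).
    have rp : 0 < r by rewrite lt_neqAle eq_sym rn0.
    apply/eqP; rewrite eq_le; apply/andP; split.
      rewrite mulrC -ler_pdivrMr//; apply: (lo x).2 => _ [m Am ->].
      rewrite ler_pdivrMr// mulrC -(mn_sub m).2//; by apply: (lo _).1; exists m.
    apply: (lo _).2 => _ [m Am ->]; rewrite (mn_sub m).2// ler_pM2l//.
    by apply: (lo x).1; exists m.
  have hE x : inf (E x) <= p x by apply: (le_trans ((lo x).1 (mnf a x) _)); [exists a|exact: mn_le].
  have aE : inf (E (- h)) <= - p h by apply: (le_trans ((lo _).1 (mnf a (- h)) _)); [exists a|exact: mn_at].
  exists (Minorant sE hE aE) => s As; apply/asboolP => x /=.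
  by apply: (lo x).1; exists s.
have sm := mn_sub m.
have add x y : mnf m (x + y) = mnf m x + mnf m y.
  apply/eqP; rewrite eq_le sm.1 /=.
  have [q [sq qm qy]] := sublinear_step y sm.
  have qp z : q z <= p z by apply: le_trans (qm z) (mn_le m z).
  have qa : q (- h) <= - p h by apply: le_trans (qm _) (mn_at m).
  have e : Minorant sq qp qa = m by apply: mmax; apply/asboolP.
  by rewrite -lerBrDr; have := qy x; rewrite -[q]/(mnf (Minorant sq qp qa)) e.
have opp x : mnf m (- x) = - mnf m x.
  by apply/eqP; rewrite -addr_eq0 -add addNr sublinear0.
exists (mnf m); split=> //.
- move=> r x; have [r0|r0] := leP 0 r; first exact: sm.2.
  rewrite -[rc r *: x]opprK opp -scaleNr -rcN sm.2 ?oppr_ge0 ?ltW//.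
  by rewrite mulNr opprK.
- exact: mn_le.
- apply/eqP; rewrite eq_le mn_le /=; have := mn_at m; rewrite opp; lra.
Qed.
End HahnBanach.

(** * Positive functionals *)

Section States.
Variables (R : realType) (A : cstar R).
Local Notation C := (cplx R).
Local Notation ms r := (rc r *: (1 : multiplier A)).

Definition re_part (x : A) : A := rc 2^-1 *: (x + star x).
Lemma re_partD x y : re_part (x + y) = re_part x + re_part y.
Proof. by rewrite /re_part staradd addrACA scalerDr. Qed.
Lemma re_partZ (r : R) x : re_part (rc r *: x) = rc r *: re_part x.
Proof. by rewrite /re_part starZ rc_conj -scalerDr !scalerA mulrC. Qed.
Lemma re_part_sa x : star (re_part x) = re_part x.
Proof. by rewrite /re_part starZ rc_conj staradd starK addrC. Qed.
Lemma re_part_id x : star x = x -> re_part x = x.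
Proof. by move=> e; rewrite /re_part e rc_half. Qed.
Lemma re_part_imag x : star x = x -> re_part ('i *: x) = 0.
Proof. by move=> e; rewrite /re_part starZ e conjCi scaleNr subrr scaler0. Qed.
Lemma rn_re_part x : rn (re_part x) <= rn x.
Proof.
rewrite rnZr ger0_norm ?invr_ge0//; have := rnD x (star x); rewrite rn_star; lra.
Qed.

Lemma mof_re_sa x : mstar (mof (re_part x)) = mof (re_part x).
Proof. by rewrite -mof_star re_part_sa. Qed.

Definition upper (x : A) : set R := [set t | 0 <= t /\ pos (ms t - mof (re_part x))].
Lemma upper_rn x t : rn x <= t -> upper x t.
Proof.
move=> xt; have t0 : 0 <= t by apply: le_trans (rn_ge0 x) xt.
split=> //; apply: bd_pos => //; first exact: mof_re_sa.
by apply: bd_le (@bd_mof _ _ (re_part x)); apply: le_trans (rn_re_part x) xt.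
Qed.
(** For self-adjoint [x] this is the norm of the positive part of [x]. A real functional below it is
    nonpositive on negative elements, hence positive, and it is contractive at the same time. *)
Definition upnorm (x : A) : R := inf (upper x).
Lemma upper_lb x : lbound (upper x) 0. Proof. by move=> t []. Qed.
Lemma upper_ne x : exists t, upper x t. Proof. by exists (rn x); apply: upper_rn. Qed.
Let lo x := inf_lower (@upper_lb x) (upper_ne x).

Lemma upnorm_sublinear : sublinear upnorm.
Proof.
have ms0 : ms 0 = 0 by rewrite scale0r.
split=> [x y|r x r0].
  rewrite -lerBlDr; apply: (lo x).2 => s [s0 ps].
  rewrite lerBlDr -lerBlDl; apply: (lo y).2 => t [t0 pt].
  rewrite lerBlDl; apply: (lo _).1; split; first exact: addr_ge0.
  by rewrite re_partD mofD rcD scalerDl opprD addrACA; apply: posD.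
have key (a : R) z : 0 < a -> a * upnorm z <= upnorm (rc a *: z).
  move=> a0; apply: (lo _).2 => t [t0 pt].
  rewrite mulrC -ler_pdivlMr//; apply: (lo z).1; split; first by rewrite divr_ge0// ltW.
  have ai : 0 <= a^-1 by rewrite invr_ge0 ltW.
  have := posZ ai pt; rewrite re_partZ mofZ scalerBr scalerA -rcM.
  by rewrite rc_scaleK ?gt_eqF// mulrC.
have [->|rn0] := eqVneq r 0.
  rewrite rc0 scale0r mul0r; apply/eqP; rewrite eq_le; apply/andP; split.
    by apply: (lo 0).1; apply: upper_rn; rewrite rn0.
  by apply: (lo 0).2; exact: upper_lb.
have rp : 0 < r by rewrite lt_neqAle eq_sym rn0.
apply/eqP; rewrite eq_le key// andbT -(@ler_pM2l _ r^-1) ?invr_gt0//.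
rewrite mulKf// -[in leRHS](rc_scaleK x rn0); apply: key; by rewrite invr_gt0.
Qed.

Record state := State {
  stf :> A -> C;
  st_lin : forall (a : C) x y, stf (a *: x + y) = a * stf x + stf y;
  st_star : forall x, stf (star x) = (stf x)^*;
  st_pos : forall x, 0 <= stf (star x ** x);
  st_bd : exists2 t : R, 0 <= t & forall x, cn (stf x) <= t * rn x }.

Lemma complexE' (a : C) : a = rc (complex.Re a) + 'i * rc (complex.Im a).
Proof. by rewrite -complexiE; exact: complexE. Qed.

(** Hahn-Banach at [star a ** a] yields a real functional [f] with value [upnorm (star a ** a)],
    which vanishes only if [a] does. Its complexification $f(x)-if(ix)$ is hermitian because [f]
    kills ['i *: x] for self-adjoint [x]. *)
Lemma state_ex (a : A) : a != 0 -> exists tau : state, tau (star a ** a) != 0.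
Proof.
move=> a0; have [f [fD fZ fp fa]] := hahn_banach (star a ** a) upnorm_sublinear.
have fN x : f (- x) = - f x.
  by have := fZ (-1) x; rewrite rcN rc1 scaleN1r mulN1r.
have f_le x : upper x 0 -> f x <= 0 by move=> h; apply: le_trans (fp x) ((lo x).1 _ h).
have fi x : star x = x -> f ('i *: x) = 0.
  move=> sx; apply/eqP; rewrite eq_le; apply/andP; split.
    by apply: f_le; split=> //; rewrite re_part_imag// scale0r sub0r mof0 oppr0; apply: pos0.
  rewrite -oppr_le0 -fN; apply: f_le; split=> //.
  rewrite -scalerN re_part_imag ?starN ?sx// scale0r sub0r mof0 oppr0; exact: pos0.
have fpos x : 0 <= f (star x ** x).
  rewrite -oppr_le0 -fN; apply: f_le; split=> //.
  rewrite re_part_id ?starN ?starM ?starK// scale0r sub0r -scaleN1r mofZ scaleN1r opprK mofM mof_star.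
  exact: pos_starM.
have fstar x : f (star x) = f x.
  have sa : star ('i *: (x - star x)) = 'i *: (x - star x).
    by rewrite starZ conjCi starB starK scaleNr -scalerN opprB.
  have := fi _ sa; rewrite scalerA imag_sq scaleN1r opprB fD fN => /eqP.
  by rewrite subr_eq0 => /eqP.
have f_bd x : `|f x| <= rn x.
  rewrite ler_norml; apply/andP; split.
    by rewrite -lerNl -fN -rnN; apply: le_trans (fp _) ((lo _).1 _ _); apply: upper_rn.
  by apply: le_trans (fp _) ((lo _).1 _ _); apply: upper_rn.
pose tau x : C := rc (f x) - 'i * rc (f ('i *: x)).
have fim x : f ('i *: ('i *: x)) = - f x by rewrite scalerA imag_sq scaleN1r fN.
have tlin (c : C) x y : tau (c *: x + y) = c * tau x + tau y.
  have hc z : f (c *: z) = complex.Re c * f z + complex.Im c * f ('i *: z).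
    by rewrite {1}(complexE' c) scalerDl fD fZ ['i * _]mulrC -scalerA fZ.
  have hic : f ('i *: (c *: x)) = complex.Re c * f ('i *: x) - complex.Im c * f x.
    by rewrite scalerA mulrC -scalerA hc fim mulrN.
  rewrite /tau !fD scalerDr fD hc hic [c in RHS]complexE' !rcD rcN !rcM.
  have ii := imag_sq R; set i := ('i : C) in ii *.
  set u := rc (f x); set v := rc (f (i *: x)); set p := rc _; set q := rc (complex.Im c).
  have -> : (p + i * q) * (u - i * v) = p * u - i * (p * v) + i * (q * u) - (i * i) * (q * v) by ring.
  rewrite ii; ring.
have tstar x : tau (star x) = (tau x)^*.
  have e : f ('i *: star x) = - f ('i *: x).
    rewrite -[RHS]fN -[in RHS]fstar starN starZ conjCi scaleNr opprK; by [].
  by rewrite /tau fstar e conjB conjM conjCi !rc_conj rcN mulrN mulNr.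
have tpos x : 0 <= tau (star x ** x).
  rewrite /tau fi ?starM ?starK// rc0 mulr0 subr0 rcge0; exact: fpos.
have tbd : exists2 t : R, 0 <= t & forall x, cn (tau x) <= t * rn x.
  exists 2 => // x; apply: (le_trans (cnD _ _)); rewrite cnN cnM cn_imag mul1r !cn_rc.
  have := f_bd x; have := f_bd ('i *: x); rewrite rnZ cn_imag mul1r; lra.
exists (State tlin tstar tpos tbd) => /=.
rewrite /tau fi ?starM ?starK// rc0 mulr0 subr0.
apply/eqP => /(@rc_inj R) h0; move: fa; rewrite h0 => /esym u0.
have h1 : rn (star a ** a) = 0.
  apply/eqP; rewrite eq_le rn_ge0 andbT; apply/ler_addgt0Pr => e e0; rewrite add0r.
  have [t [t0 pt] te] : exists2 t, upper (star a ** a) t & t < e.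
    have [] := @inf_adherent R (upper (star a ** a)) e e0.
      by split; [exact: upper_ne|exists 0; exact: upper_lb].
    by move=> t ut; rewrite -/(upnorm _) u0 add0r; exists t.
  apply: le_trans (ltW te); apply: mof_bd => //; apply: pos_bd => //.
    by rewrite mofM mof_star; apply: pos_starM.
  by rewrite re_part_id ?starM ?starK in pt.
by move: a0; rewrite (starM_eq0 (rn0_eq0 h1)) eqxx.
Qed.
End States.

Section ActionRep.
Variables (R : realType) (M : hmodel R) (A : cstar R) (H : hilbert R).
Local Notation C := (cplx R).

Lemma sqrt_one_minus_in (k0 : A) : star k0 = k0 -> rn k0 <= 1 ->
  exists b, star b = b /\ k0 = b + b - b ** b.
Proof.
move=> ks k1; have ka : mstar (mof k0) = mof k0 by rewrite -mof_star ks.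
have kb : bd (mof k0) 1 by apply: bd_le (@bd_mof _ _ k0).
have [b [ba bk _ _ rate]] := sqrt_one_minus ka kb.
have bm n : exists a : A, bseq (mof k0) n = mof a.
  elim: n => [|n [a IH]]; first by exists 0; rewrite /= mof0.
  by exists (rc 2^-1 *: (k0 + a ** a)); rewrite /= IH mofZ mofD mofM expr2.
have [b0 bE] : exists b0 : A, b = mof b0.
  apply: mof_closed => e e0; have [N hN] := @inv_small R (e / 2) ltac:(by rewrite divr_gt0).
  have [a aE] := bm N; exists a; rewrite -aE; apply: bd_le (rate N).
  have := hN N (leqnn _); have := betaseq_rate R N.
  have : N.+2%:R^-1 <= N.+1%:R^-1 :> R by rewrite lef_pV2 ?posrE ?ltr0n// ler_nat.
  set i1 := N.+2%:R^-1; set i2 := N.+1%:R^-1; lra.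
exists b0; split; first by apply: mof_inj; rewrite mof_star -bE.
by apply: mof_inj; rewrite bk bE -mofM -mofD -[- mof _]scaleN1r -mofZ -mofD scaleN1r.
Qed.

(** Boundedness is automatic: for $\|a\|\le1$ there is [b] in [A] with $(1-b)^2=1-a^*a$ formally,
    and $\|v\|^2-\|av\|^2=\|v-bv\|^2$ for every combination [v]. *)
Lemma action_rep S (s : S -> H) (act : A -> S -> S) : total s ->
  (forall a p q, ip H (s (act a p)) (s q) = ip H (s p) (s (act (star a) q))) ->
  (forall (c : C) a b p, s (act (c *: a + b) p) = c *: s (act a p) + s (act b p)) ->
  (forall a b p, s (act (a ** b) p) = s (act a (act b p))) ->
  total (fun q : A * S => s (act q.1 q.2)) ->
  exists phi : rep M A H, is_mor phi /\ forall a p, mop (phi a) (s p) = s (act a p).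
Proof.
move=> st adj lin mul tot.
pose T a l := comb (fun p => s (act a p)) l.
have TD c a b l : T (c *: a + b) l = c *: T a l + T b l.
  rewrite /T /comb scaler_sumr -big_split; apply: eq_bigr => p _ /=.
  by rewrite lin scalerDr !scalerA [c * _]mulrC.
have T1 a b l l' : ip H (T a l) (T b l') = ip H (comb s l) (T (star a ** b) l').
  apply: ip_comb => p q; by rewrite adj mul.
have T2 a l l' : ip H (T a l) (comb s l') = ip H (comb s l) (T (star a) l').
  by apply: ip_comb => p q; rewrite adj.
have contr a l : rn a <= 1 -> rn (T a l) <= rn (comb s l).
  move=> a1; have [||b [bs bk]] := @sqrt_one_minus_in (star a ** a).
  - by rewrite starM starK.
  - by rewrite rn_starM expr2; have := rn_ge0 a; nra.
  rewrite -(@ler_pXn2r _ 2) ?nnegrE ?rn_ge0// -subr_ge0.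
  have : 0 <= rn (comb s l - T b l) ^+ 2 by rewrite sqr_ge0.
  rewrite -!rcge0 rcB -!ip_rn ipBl !ipBr !T1 T2 bs.
  have -> : T (star a ** a) l = T b l + T b l - T (b ** b) l.
    have e := TD 1 b b l; rewrite !scale1r in e; have e2 := TD (-1) (b ** b) (b + b) l.
    by rewrite !scaleN1r in e2; rewrite bk [b + b - _]addrC e2 addrC e.
  by rewrite ipBr ipDr !opprB !addrA; congr (0 <= _); ring.
have bound a l : rn (T a l) <= rn a * rn (comb s l).
  have [a0|a0] := eqVneq (rn a) 0.
    have -> : T a l = 0.
      rewrite (rn0_eq0 a0) -[0](scale0r (0 : A)) -[_ *: _]addr0; have := TD (-1) 0 0 l.
      by rewrite scaler0 addr0 scaleN1r addNr scale0r addr0.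
    by rewrite rn0 a0 mul0r.
  have ap : 0 < rn a by rewrite lt_neqAle eq_sym a0 rn_ge0.
  have := contr (rc (rn a)^-1 *: a) l.
  rewrite rnZr ger0_norm ?invr_ge0 ?rn_ge0// mulVf// lexx => /(_ isT).
  have -> : T (rc (rn a)^-1 *: a) l = rc (rn a)^-1 *: T a l.
    rewrite -[_ *: a]addr0 TD; have := TD (-1) 0 0 l.
    by rewrite scaler0 addr0 scaleN1r addNr => ->; rewrite addr0.
  by rewrite rnZr ger0_norm ?invr_ge0 ?rn_ge0// mulrC ler_pdivrMr// mulrC.
have /choice[r hr] a : exists r : H -> H, [/\ linear r, bdd r (rn a) & forall p, r (s p) = s (act a p)].
  by apply: extend; [exact: rn_ge0|exact: st|exact: bound].
have [|||||phi [pm pE]] := @rep_of R M A H r; last by exists phi; split=> // a p; rewrite pE; case: (hr a).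
- move=> h c a b; have [l1 b1 e1] := hr a; have [l2 b2 e2] := hr b; have [l3 b3 e3] := hr (c *: a + b).
  apply: (@total_eq _ _ _ _ s (fun h => r (c *: a + b) h) (fun h => c *: r a h + r b h) (rn (c *: a + b)) (cn c * rn a + rn b)) => //.
  - by move=> d x y; rewrite l1 l2 !scalerDr addrACA !scalerA [c * d]mulrC.
  - by move=> x; apply: (le_trans (rnD _ _)); rewrite rnZ mulrDl -mulrA lerD// ler_wpM2l// cn_ge0.
  - by move=> p; rewrite e1 e2 e3 lin.
- move=> a b h; have [l1 b1 e1] := hr a; have [l2 b2 e2] := hr b; have [l3 b3 e3] := hr (a ** b).
  apply: (@total_eq _ _ _ _ s (r (a ** b)) (fun h => r a (r b h)) (rn (a ** b)) (rn a * rn b)) => //.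
  - by move=> d x y; rewrite l2 l1.
  - by move=> x; apply: (le_trans (b1 _)); rewrite -mulrA ler_wpM2l// rn_ge0.
  - by move=> p; rewrite e2 e1 e3 mul.
- move=> a x y; have [l1 b1 e1] := hr a; have [l2 b2 e2] := hr (star a).
  have step1 p y' : ip H (r a (s p)) y' = ip H (s p) (r (star a) y').
    rewrite ipC [RHS]ipC; congr (_^*).
    pose f1 y : cplx_line R := ip H y (r a (s p)).
    pose f2 y : cplx_line R := ip H (r (star a) y) (s p).
    suff : f1 y' = f2 y' by [].
    apply: (@total_eq _ _ _ _ s f1 f2 (rn (r a (s p))) (rn (star a) * rn (s p))) => //.
    - by move=> d u v; rewrite /f1 /f2 ?l2 ipDl ipZl.
    - by move=> d u v; rewrite /f2 l2 ipDl ipZl.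
    - by move=> u; rewrite rn_line mulrC cauchy_schwarz.
    - move=> u; rewrite rn_line; apply: (le_trans (cauchy_schwarz _ _)); have := b2 u; have := rn_ge0 (s p); nra.
    - by move=> q; rewrite /f1 /f2 e1 e2 ipC [RHS]ipC adj.
  pose f1 x : cplx_line R := ip H (r a x) y.
  pose f2 x : cplx_line R := ip H x (r (star a) y).
  suff : f1 x = f2 x by [].
  apply: (@total_eq _ _ _ _ s f1 f2 (rn a * rn y) (rn (r (star a) y))) => //.
  - by move=> d u v; rewrite /f1 l1 ipDl ipZl.
  - by move=> d u v; rewrite /f1 /f2 ?l2 ipDl ipZl.
  - move=> u; rewrite rn_line; apply: (le_trans (cauchy_schwarz _ _)); have := b1 u; have := rn_ge0 y; nra.
  - by move=> u; rewrite rn_line mulrC cauchy_schwarz.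
  - by move=> p; exact: step1.
- by move=> a; case: (hr a).
- apply: (total_trans tot) => -[a p] /=; have [_ _ <-] := hr a; exact: (inspan_gen _ (a, s p)).
Qed.
End ActionRep.

Section BlockKernel.
Variables (R : realType) (I : eqType) (X : Type).
Local Notation C := (cplx R).

Definition psd (S : Type) (K : S -> S -> C) :=
  forall l : seq (C * S), 0 <= \sum_(p <- l) \sum_(q <- l) p.1 * (q.1)^* * K p.2 q.2.

Lemma psd_form (V : lmodType C) (B : V -> V -> C) (s : X -> V) :
  (forall y, scalar (B^~ y)) -> (forall x a y y', B x (a *: y + y') = a^* * B x y + B x y') ->
  (forall x, 0 <= B x x) -> psd (fun x y => B (s x) (s y)).
Proof.
move=> Bl Br Bp l.
have B0l y : B 0 y = 0 by have := Bl y (-1) 0 0; rewrite scaler0 addr0 mulN1r addNr.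
have B0r x : B x 0 = 0.
  by have := Br x (-1) 0 0; rewrite scaler0 addr0 conjN conj1 mulN1r addNr.
have h1 (l' : seq (C * X)) y : \sum_(p <- l') p.1 * B (s p.2) y = B (comb s l') y.
  rewrite /comb; elim: l' => [|p l' IH]; first by rewrite !big_nil B0l.
  by rewrite !big_cons Bl IH.
have h2 (l' : seq (C * X)) x : \sum_(p <- l') (p.1)^* * B x (s p.2) = B x (comb s l').
  rewrite /comb; elim: l' => [|p l' IH]; first by rewrite !big_nil B0r.
  by rewrite !big_cons Br IH.
suff -> : \sum_(p <- l) \sum_(q <- l) p.1 * (q.1)^* * B (s p.2) (s q.2) = B (comb s l) (comb s l) by [].
rewrite -h1; apply: eq_bigr => p _; rewrite -h2 mulr_sumr; apply: eq_bigr => q _.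
by rewrite mulrA.
Qed.

(** The kernel of an orthogonal direct sum: points with different indices are orthogonal. *)
Definition block (k : I -> X -> X -> C) (p q : I * X) : C :=
  (p.1 == q.1)%:R * k p.1 p.2 q.2.

Lemma eq_big_all (S : Type) (P : pred S) (F G : S -> C) l : all P l ->
  (forall x, P x -> F x = G x) -> \sum_(x <- l) F x = \sum_(x <- l) G x.
Proof.
move=> + h; elim: l => [|x l IH]; first by rewrite !big_nil.
by move=> /= /andP[px pl]; rewrite !big_cons IH// h.
Qed.

Lemma psd_block k : (forall i, psd (k i)) -> psd (block k).
Proof.
move=> kp l; pose u := undup [seq p.2.1 | p <- l].
have e : \sum_(p <- l) \sum_(q <- l) p.1 * (q.1)^* * block k p.2 q.2 =
    \sum_(i <- u) \sum_(p <- l | p.2.1 == i) \sum_(q <- l | q.2.1 == i) p.1 * (q.1)^* * k i p.2.2 q.2.2.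
  under [RHS]eq_bigr => i _ do rewrite big_mkcond.
  rewrite [RHS]exchange_big; apply: (@eq_big_all _ (fun p => p.2.1 \in u)) => [|p pu] /=.
    have {}ub : all [in u] [seq p.2.1 | p <- l] by apply/allP => i; rewrite mem_undup.
    by rewrite all_map in ub.
  rewrite (bigD1_seq p.2.1) ?undup_uniq//= eqxx [X in _ + X]big1 => [|i ni]; last by rewrite eq_sym (negPf ni).
  rewrite addr0 [RHS]big_mkcond; apply: eq_bigr => q _.
  by rewrite /block eq_sym; case: eqP => _; rewrite ?mul1r// mul0r mulr0.
rewrite e; apply: sumr_ge0 => i _.
have := kp i [seq (p.1, p.2.2) | p <- l & p.2.1 == i].
by rewrite big_map big_filter; congr (0 <= _); apply: eq_bigr => p _; rewrite big_map big_filter.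
Qed.
End BlockKernel.

Section GelfandNaimark.
Variables (R : realType) (M : hmodel R) (A : cstar R).
Local Notation C := (cplx R).

Lemma ip_rn_eq (H H' : hilbert R) (x : H) (y : H') : ip H x x = ip H' y y -> rn x = rn y.
Proof.
rewrite !ip_rn => /rc_inj h; apply/eqP; rewrite -(@eqrXn2 _ 2) ?rn_ge0//; exact/eqP.
Qed.

Section Plus.
Variables (H0 : hilbert R) (phi0 : rep M A H0).
Hypothesis phi0m : is_mor phi0.

(** [None] indexes the summand [phi0], [Some tau] the GNS space of [tau]; [classic] supplies the
    equality test in [block]. A point carries data for both kinds of summand, and [gn_block] reads
    the half that its index calls for. *)
Definition gn_index := {classic option (state A)}.
Definition gn_block (i : gn_index) (p q : A * H0) : C :=
  match i : option (state A) with
  | Some tau => tau (star q.1 ** p.1)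
  | None => ip H0 p.2 q.2
  end.
Definition gn_kernel := block gn_block.
Definition gn_act (a : A) (p : gn_index * (A * H0)) : gn_index * (A * H0) :=
  (p.1, (a ** p.2.1, mop (phi0 a) p.2.2)).

Lemma st_linr (tau : state A) x (a : C) y y' :
  tau (star (a *: y + y') ** x) = a^* * tau (star y ** x) + tau (star y' ** x).
Proof. by rewrite starD cmulDl cmulZl st_lin. Qed.

Lemma gn_herm p q : gn_kernel q p = (gn_kernel p q)^*.
Proof.
rewrite /gn_kernel /block conjM eq_sym; case: eqP => [->|_]; last by rewrite conj0 !mul0r.
rewrite conj1 !mul1r; case: (q.1 : option _) => [tau|] /=; last by rewrite ipC.
by rewrite -st_star starM starK.
Qed.

Lemma gn_psd : psd gn_kernel.
Proof.
apply: psd_block => -[tau|].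
  apply: (@psd_form R _ A (fun x y => tau (star y ** x)) fst) => [y a x x'|x a y y'|x].
  - by rewrite cmulDr cmulZr st_lin.
  - exact: st_linr.
  - exact: st_pos.
apply: (@psd_form R _ H0 (ip H0) snd) => [y a x x'|x a y y'|x].
- by rewrite ipDl ipZl.
- by rewrite ipDr ipZr.
- by rewrite ip_rn rcge0 sqr_ge0.
Qed.

(* The faithful representation is phi0 plus the GNS representations of all states,
   with phi0 kept as a direct summand: criterion compares norms along J. *)
Lemma gelfand_naimark_ext : exists (H : hilbert R) (phi : rep M A H) (J : H0 -> H),
  [/\ is_mor phi, injective phi, linear J, forall h h', ip H (J h) (J h') = ip H0 h h' &
      forall a h, mop (phi a) (J h) = J (mop (phi0 a) h)].
Proof.
have [H [s [st sK]]] := kernel_hilbert gn_herm gn_psd.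
have act_lin (c : C) a b p : s (gn_act (c *: a + b) p) = c *: s (gn_act a p) + s (gn_act b p).
  apply: (ip_ext st) => q; rewrite ipDl ipZl !sK /gn_kernel /block /=.
  case: eqP => _; last by rewrite !mul0r mulr0 addr0.
  rewrite !mul1r; case: p => -[tau|] [x h] /=; first by rewrite cmulDl cmulZl cmulDr cmulZr st_lin.
  by rewrite (mor_lin phi0m) mopD mopZ ipDl ipZl.
have act_mul a b p : s (gn_act (a ** b) p) = s (gn_act a (gn_act b p)).
  by rewrite /gn_act /= (morM phi0m) mopM cmulA.
have act_adj a p q : ip H (s (gn_act a p)) (s q) = ip H (s p) (s (gn_act (star a) q)).
  rewrite !sK /gn_kernel /block /=; congr (_ * _).
  case: p => -[tau|] [x h] /=; first by rewrite starM starK cmulA.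
  by rewrite mop_adj (mor_star phi0m).
have sN (tau : state A) x h h' : s ((Some tau : gn_index), (x, h)) = s ((Some tau : gn_index), (x, h')).
  by apply: (ip_ext st) => q; rewrite !sK.
have sN' x x' h : s ((None : gn_index), (x, h)) = s ((None : gn_index), (x', h)).
  by apply: (ip_ext st) => q; rewrite !sK.
pose J h := s ((None : gn_index), (0, h)).
have Jl : linear J.
  move=> c h h'; apply: (ip_ext st) => q; rewrite ipDl ipZl !sK /gn_kernel /block /=.
  case: eqP => _; last by rewrite !mul0r mulr0 addr0.
  by rewrite !mul1r ipDl ipZl.
have Ji h h' : ip H (J h) (J h') = ip H0 h h' by rewrite sK /gn_kernel /block eqxx mul1r.
have Jn h : rn (J h) = rn h by exact: ip_rn_eq.
have [|phi [pm pE]] := @action_rep R M A H _ s gn_act st act_adj act_lin act_mul.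
  apply: (total_trans st) => -[[tau|] [x h]].
    pose F y := s ((Some tau : gn_index), (y, 0)).
    have Fl : linear F.
      move=> c y y'; apply: (ip_ext st) => q; rewrite ipDl ipZl !sK /gn_kernel /block /=.
      case: eqP => _; last by rewrite !mul0r mulr0 addr0.
      by rewrite !mul1r cmulDr cmulZr st_lin.
    have [t t0 tb] := st_bd tau.
    have Fb : bdd F (t + 1).
      move=> y; rewrite -(@ler_pXn2r _ 2) ?nnegrE ?mulr_ge0 ?addr_ge0 ?rn_ge0//.
      have : rn (F y) ^+ 2 = cn (tau (star y ** y)).
        have : cn (ip H (F y) (F y)) = cn (tau (star y ** y)) by rewrite sK /gn_kernel /block eqxx mul1r.
        by rewrite ip_rn cn_rc ger0_norm ?sqr_ge0.
      move=> ->; apply: (le_trans (tb _)); rewrite rn_starM.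
      by have := sqr_ge0 (rn y); rewrite exprMn; nra.
    rewrite -[X in inspan _ X]/(s ((Some tau : gn_index), (x, h))) (sN tau x h 0) -/(F x).
    apply: (inspan_img Fl Fb _ (@products_total R A x)) => -[a b] /=.
    have -> : F (a ** b) = s (gn_act a (Some tau, (b, 0))) by exact: sN.
    exact: (inspan_gen _ (a, (Some tau, (b, 0)))).
  rewrite -[X in inspan _ X]/(s ((None : gn_index), (x, h))) (sN' x 0 h) -/(J h).
  have Jb : bdd J 1 by move=> y; rewrite mul1r Jn.
  apply: (inspan_img Jl Jb _ (rep_total phi0m h)) => -[a b] /=.
  have -> : J (mop (phi0 a) b) = s (gn_act a (None, (0, b))) by exact: sN'.
  exact: (inspan_gen _ (a, (None, (0, b)))).
exists H, phi, J; split=> //; last by move=> a h; rewrite pE; exact: sN'.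
move=> a b ab; apply/eqP; rewrite -subr_eq0; apply/negPn/negP.
set c := a - b => c0.
have pc : phi c = 0.
  by rewrite /c addrC -scaleN1r (mor_lin pm) ab scaleN1r addNr.
pose d := c ** star c.
have d0 : d != 0.
  apply/eqP => d0; move: c0; rewrite -[c]starK.
  by rewrite (@starM_eq0 _ _ (star c)) ?starK// -/d ?star0 ?eqxx.
have [tau] := state_ex d0; case/negP; apply/eqP.
pose v : gn_index * (A * H0) := (Some tau, (star c, 0)).
have : ip H (mop (phi c) (s v)) (s (Some tau, (d, 0))) = 0 by rewrite pc mop0 ip0l.
by rewrite pE sK /gn_kernel /block eqxx mul1r.
Qed.
End Plus.

(** The construction is started from the zero representation, on the Hilbert space of a kernel over
    the empty type [False]. *)
Lemma gelfand_naimark : exists (H : hilbert R) (phi : rep M A H), is_mor phi /\ injective phi.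
Proof.
have [||H0 [s [st _]]] := @kernel_hilbert R False (fun _ _ => 0).
- by [].
- by move=> l; apply: sumr_ge0 => p _; case: p.2.
have H00 (h : H0) : h = 0.
  apply: rn0_eq0; apply/eqP; rewrite eq_le rn_ge0 andbT; apply/ler_addgt0Pr => e e0.
  have [l] := st h e e0; rewrite add0r; case: l => [|[c []]].
  by rewrite /comb big_nil subr0; apply: ltW.
have [|||||phi0 [pm _]] := @rep_of R M A H0 (fun _ _ => 0).
- by move=> h c x y; rewrite scaler0 addr0.
- by [].
- by move=> a x y; rewrite ip0l ip0r.
- by move=> a h; rewrite rn0 mulr_ge0 ?rn_ge0.
- by move=> h; rewrite (H00 h); exact: inspan0.
by have [H [phi [J []]]] := gelfand_naimark_ext pm; exists H, phi.
Qed.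
End GelfandNaimark.

(** * Morphisms out of minimal tensor products *)

(** The argument of [ext_bd], for maps such as $m\mapsto m\otimes1$ that are not yet known to extend
    a morphism. *)
Lemma unital_bd (R : realType) (A B : cstar R) (F : multiplier A -> multiplier B) m t :
  linear F -> (forall m n, F (m * n) = F m * F n) -> (forall m, F (mstar m) = mstar (F m)) -> F 1 = 1 ->
  0 <= t -> bd m t -> bd (F m) t.
Proof.
move=> Fl FM Fa F1 t0 mt; apply: bd_sq => //; apply: pos_bd; [exact: sqr_ge0|exact: pos_starM|].
have [|c [ca cc _ _]] := @pos_sqrt _ _ (rc (t ^+ 2) *: (1 : multiplier A) - mstar m * m).
  apply: bd_pos; [exact: sqr_ge0|by rewrite adjM adjK|rewrite expr2; apply: bdM => //; exact: bd_adj].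
have -> : rc (t ^+ 2) *: (1 : multiplier B) - mstar (F m) * F m = F c * F c.
  by rewrite -FM cc (linB Fl) (linZ Fl) F1 FM Fa.
by apply: pos_sq; rewrite -Fa ca.
Qed.

Section HilbertTensor.
Variables (R : realType) (H H' : hilbert R) (X : htensor H H').
Local Notation "x ⊙ y" := (hpure X x y) (at level 40, left associativity).

Lemma hpure_tot : total (fun p : H * H' => p.1 ⊙ p.2).
Proof. by apply/clspan_total2; exact: hpure_total. Qed.
Lemma hpure_linl y : linear (fun x => x ⊙ y).
Proof.
by move=> a x x'; apply: (ip_ext hpure_tot) => p; rewrite ipDl ipZl !hpure_ip ipDl ipZl mulrDl mulrA.
Qed.
Lemma hpure_linr x : linear (fun y => x ⊙ y).
Proof.
by move=> a y y'; apply: (ip_ext hpure_tot) => p; rewrite ipDl ipZl !hpure_ip ipDl ipZl mulrDr mulrCA.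
Qed.
Lemma rn_hpure x y : rn (x ⊙ y) = rn x * rn y.
Proof.
apply/eqP; rewrite -(@eqrXn2 _ 2) ?mulr_ge0 ?rn_ge0//; apply/eqP; apply: rc_inj.
by rewrite -ip_rn hpure_ip !ip_rn exprMn (rcM (rn x ^+ 2)).
Qed.
Lemma hpure_bddl y : bdd (fun x => x ⊙ y) (rn y).
Proof. by move=> x; rewrite rn_hpure mulrC. Qed.
Lemma hpure_bddr x : bdd (fun y => x ⊙ y) (rn x).
Proof. by move=> y; rewrite rn_hpure. Qed.
Lemma hpure_total_of S S' (s : S -> H) (t : S' -> H') :
  total s -> total t -> total (fun p : S * S' => s p.1 ⊙ t p.2).
Proof.
move=> st tt; apply: (total_trans hpure_tot) => -[x y] /=.
apply: (inspan_img (hpure_linl y) (hpure_bddl y) _ (st x)) => p.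
apply: (inspan_img (hpure_linr (s p)) (hpure_bddr (s p)) _ (tt y)) => q.
exact: (inspan_gen _ (p, q)).
Qed.
End HilbertTensor.
Arguments hpure_tot {R H H'} X.

Section CstarTensor.
Variables (R : realType) (M : model R).
Local Notation C := (cplx R).
Local Notation "A ⊗ B" := (mten (ctens M A B)) (at level 40, left associativity).
Local Notation K := (compact M).
Local Notation "x ⊙ y" := (hpure (htens M _ _) x y) (at level 40, left associativity).
Local Notation pu := (pure (ctens M _ _)).
Implicit Types A B E : cstar R.

Section Two.
Variables A B : cstar R.
Implicit Types (a x : A) (b y : B).

Lemma pure_tot : total (fun p : A * B => pu p.1 p.2).
Proof. by apply/clspan_total2; exact: pure_total. Qed.
Lemma pureDl a a' b : pu (a + a') b = pu a b + pu a' b. Proof. exact: linearDl. Qed.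
Lemma pureZl (c : C) a b : pu (c *: a) b = c *: pu a b. Proof. exact: linearZl_LR. Qed.
Lemma pureDr a b b' : pu a (b + b') = pu a b + pu a b'. Proof. exact: linearDr. Qed.
Lemma pureZr (c : C) a b : pu a (c *: b) = c *: pu a b. Proof. exact: linearZr_LR. Qed.
Lemma pure_linl b : linear (fun a => pu a b).
Proof. by move=> c x y; rewrite pureDl pureZl. Qed.
Lemma pure_linr a : linear (fun b => pu a b).
Proof. by move=> c x y; rewrite pureDr pureZr. Qed.

Lemma ten_multP (m n : multiplier (A ⊗ B)) : (forall a b, m (pu a b) = n (pu a b)) -> m = n.
Proof.
move=> h; apply: multP => z; have [t _ mt] := bounded m; have [t' _ nt] := bounded n.
by apply: (total_eq pure_tot (mact_lin m) (mact_lin n) mt nt) => -[a b] /=.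
Qed.

(** The two legs are extended separately with [multiplier_extension]; the product of the two
    extensions has the required values. *)
Lemma mtensE (m : multiplier A) (n : multiplier B) a b : mtens M m n (pu a b) = pu (m a) (n b).
Proof.
move: a b; apply: (@theP (multiplier (A ⊗ B)) (mone _) (fun p => forall a b, p (pu a b) = pu (m a) (n b))).
have [|l hl] := @multiplier_extension R A (A ⊗ B) B (fun a b => pu a b) (@pure_linl) pure_tot _ m.
  by move=> p x s x' s'; rewrite !pure_star !pureM mactP.
have [||r hr] := @multiplier_extension R B (A ⊗ B) A (fun b a => pu a b) (@pure_linr) _ _ n.
- apply: (total_trans pure_tot) => -[a b]; exact: (inspan_gen _ (b, a)).
- by move=> p x s x' s'; rewrite !pure_star !pureM mactP.
by exists (l * r) => a b; rewrite mulmE hr hl.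
Qed.

Lemma mtens_uniq (p : multiplier (A ⊗ B)) (m : multiplier A) (n : multiplier B) :
  (forall a b, p (pu a b) = pu (m a) (n b)) -> p = mtens M m n.
Proof. by move=> h; apply: ten_multP => a b; rewrite h mtensE. Qed.
Lemma mtensM (m m' : multiplier A) (n n' : multiplier B) :
  mtens M (m * m') (n * n') = mtens M m n * mtens M m' n'.
Proof. by symmetry; apply: mtens_uniq => a b; rewrite mulmE !mtensE. Qed.
Lemma mtens1 : mtens M (1 : multiplier A) (1 : multiplier B) = 1.
Proof. by symmetry; apply: mtens_uniq. Qed.
Lemma mtens_linl (n : multiplier B) : linear (fun m : multiplier A => mtens M m n).
Proof.
by move=> c m m'; symmetry; apply: mtens_uniq => a b; rewrite !addmE !scalemE !mtensE pure_linl.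
Qed.
Lemma mtens_linr (m : multiplier A) : linear (fun n : multiplier B => mtens M m n).
Proof.
by move=> c n n'; symmetry; apply: mtens_uniq => a b; rewrite !addmE !scalemE !mtensE pure_linr.
Qed.
Lemma mtens_adj (m : multiplier A) (n : multiplier B) : mstar (mtens M m n) = mtens M (mstar m) (mstar n).
Proof.
apply: mtens_uniq => a b; apply: cmul_inj => z; rewrite mactP -[madj _ z]/(mtens M m n z).
have [t _ bt] := bounded (mtens M m n).
apply: (@total_eq _ _ _ _ _ (fun z => star (pu a b) ** mtens M m n z)
  (fun z => star (pu (mstar m a) (mstar n b)) ** z) (rn (star (pu a b)) * t)
  (rn (star (pu (mstar m a) (mstar n b)))) pure_tot).
- by move=> c u v; rewrite (mact_lin (mtens M m n)) cmulDr cmulZr.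
- exact: mulA_lin.
- by move=> u; rewrite (le_trans (rnM _ _))// -mulrA ler_wpM2l ?rn_ge0.
- exact: mulA_bdd.
by move=> [x y] /=; rewrite mtensE !pure_star !pureM; congr (pu _ _); rewrite -mactPr.
Qed.
Lemma mtens_mof a b : mtens M (mof a) (mof b) = mof (pu a b).
Proof. by symmetry; apply: mtens_uniq => x y; rewrite !mofE pureM. Qed.
Lemma bd_mtens m n s t : 0 <= s -> 0 <= t -> bd (m : multiplier A) s -> bd (n : multiplier B) t ->
  bd (mtens M m n) (s * t).
Proof.
move=> s0 t0 ms nt; have -> : mtens M m n = mtens M m 1 * mtens M 1 n by rewrite -mtensM mulr1 mul1r.
apply: bdM => //.
  apply: (unital_bd (F := fun m => mtens M m (1 : multiplier B))) => //.
  - exact: mtens_linl.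
  - by move=> p q; rewrite -mtensM mulr1.
  - by move=> p; rewrite mtens_adj adj1.
  - exact: mtens1.
apply: (unital_bd (F := fun m => mtens M (1 : multiplier A) m)) => //.
- exact: mtens_linr.
- by move=> p q; rewrite -mtensM mulr1.
- by move=> p; rewrite mtens_adj adj1.
- exact: mtens1.
Qed.
Lemma rn_pure a b : rn (pu a b) <= rn a * rn b.
Proof.
apply: mof_bd; first by rewrite mulr_ge0 ?rn_ge0.
by rewrite -mtens_mof; apply: bd_mtens; rewrite ?rn_ge0//; apply: bd_mof.
Qed.
Lemma pure_bddl b : bdd (fun a => pu a b) (rn b).
Proof. by move=> a; rewrite mulrC rn_pure. Qed.
Lemma pure_bddr a : bdd (fun b => pu a b) (rn a).
Proof. by move=> b; rewrite rn_pure. Qed.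
Lemma pure_total_of S S' (s : S -> A) (t : S' -> B) :
  total s -> total t -> total (fun p : S * S' => pu (s p.1) (t p.2)).
Proof.
move=> st tt; apply: (total_trans pure_tot) => -[x y] /=.
apply: (inspan_img (pure_linl y) (pure_bddl y) _ (st x)) => p.
apply: (inspan_img (pure_linr (s p)) (pure_bddr (s p)) _ (tt y)) => q.
exact: (inspan_gen _ (p, q)).
Qed.

Local Notation inl := (@inl_mor R M A B).
Local Notation inr := (@inr_mor R M A B).

Lemma total_id (V : normedModType C) : total (fun v : V => v).
Proof. by move=> z e e0; exists [:: (1, z)]; rewrite /comb big_seq1 scale1r subrr rn0. Qed.

Lemma inl_is_mor : is_mor inl.
Proof.
split.
- move=> c x y z; rewrite -[RHS]/((c *: inl x + inl y) z); congr (mact _ z).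
  by rewrite /inl_mor mofD mofZ mtens_linl.
- by move=> x y; rewrite /inl_mor -[RHS]mtensM mofM -/(1 : multiplier B) mulr1.
- by move=> x; rewrite /inl_mor mtens_adj mof_star -[mone B]/(1 : multiplier B) adj1.
apply/clspan_total2; apply: (total_trans (pure_total_of (@products_total R A) (@total_id B))).
move=> [[x y] b] /=; have -> : pu (x ** y) b = inl x (pu y b) by rewrite mtensE.
exact: (inspan_gen _ (x, pu y b)).
Qed.
Lemma inr_is_mor : is_mor inr.
Proof.
split.
- move=> c x y z; rewrite -[RHS]/((c *: inr x + inr y) z); congr (mact _ z).
  by rewrite /inr_mor mofD mofZ mtens_linr.
- by move=> x y; rewrite /inr_mor -[RHS]mtensM mofM -/(1 : multiplier A) mulr1.
- by move=> x; rewrite /inr_mor mtens_adj mof_star -[mone A]/(1 : multiplier A) adj1.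
apply/clspan_total2; apply: (total_trans (pure_total_of (@total_id A) (@products_total R B))).
move=> [a [x y]] /=; have -> : pu a (x ** y) = inr x (pu a y) by rewrite mtensE.
exact: (inspan_gen _ (x, pu a y)).
Qed.
Lemma ext_inl m : ext inl m = mtens M m 1.
Proof.
symmetry; apply: ext_uniq; first exact: inl_is_mor.
move=> x y; rewrite -!mulmE; congr (mact _ y).
by rewrite /inl_mor -mtensM mof_mact -[mone B]/(1 : multiplier B) mulr1.
Qed.
Lemma ext_inr m : ext inr m = mtens M 1 m.
Proof.
symmetry; apply: ext_uniq; first exact: inr_is_mor.
move=> x y; rewrite -!mulmE; congr (mact _ y).
by rewrite /inr_mor -mtensM mof_mact -[mone A]/(1 : multiplier A) mulr1.
Qed.
Lemma mtensE2 m n : mtens M m n = ext inl m * ext inr n.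
Proof. by rewrite ext_inl ext_inr -mtensM mulr1 mul1r. Qed.
Lemma inl_inr a b : inl a * inr b = mof (pu a b).
Proof. by rewrite -mtens_mof /inl_mor /inr_mor -mtensM mulr1 mul1r. Qed.
Lemma inlC m n : ext inl m * ext inr n = ext inr n * ext inl m.
Proof. by rewrite ext_inl ext_inr -!mtensM !mulr1 !mul1r. Qed.
End Two.

Section SpatialRep.
Variables (A B : cstar R) (H H' : hilbert R) (phi : rep M A H) (psi : rep M B H').
Variable pi : rep M (A ⊗ B) (htens M H H').
Hypotheses (phim : is_mor phi) (psim : is_mor psi) (pim : is_mor pi).
Hypothesis piE : forall a b h k, mop (pi (pu a b)) (h ⊙ k) = mop (phi a) h ⊙ mop (psi b) k.

Lemma bounded_mop (L : hilbert R) (m : multiplier (K L)) : exists t, bdd (mop m) t.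
Proof. by have [t _ mt] := bounded m; exists t; apply: mop_bd. Qed.

Lemma spatial_mtens m n h k :
  mop (ext pi (mtens M m n)) (h ⊙ k) = mop (ext phi m) h ⊙ mop (ext psi n) k.
Proof.
have [t bt] := bounded_mop (ext pi (mtens M m n)).
have [t1 bt1] := bounded_mop (ext phi m); have [t2 bt2] := bounded_mop (ext psi n).
apply: (@total_eq _ _ _ _ _ (fun h => mop (ext pi (mtens M m n)) (h ⊙ k))
  (fun h => mop (ext phi m) h ⊙ mop (ext psi n) k) (`|t| * rn k) (t1 * rn (mop (ext psi n) k)) (rep_total phim)).
- by move=> c x y; rewrite hpure_linl mop_lin.
- by move=> c x y; rewrite mop_lin hpure_linl.
- move=> x; apply: (le_trans (bt _)); rewrite rn_hpure -mulrA [rn k * _]mulrC.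
  by rewrite ler_wpM2r ?mulr_ge0 ?rn_ge0// ler_norm.
- by move=> x; rewrite rn_hpure mulrAC ler_wpM2r ?rn_ge0.
move=> [a h'] /=.
apply: (@total_eq _ _ _ _ _ (fun k => mop (ext pi (mtens M m n)) (mop (phi a) h' ⊙ k))
  (fun k => mop (ext phi m) (mop (phi a) h') ⊙ mop (ext psi n) k) (`|t| * rn (mop (phi a) h'))
  (rn (mop (ext phi m) (mop (phi a) h')) * t2) (rep_total psim)).
- by move=> c x y; rewrite hpure_linr mop_lin.
- by move=> c x y; rewrite mop_lin hpure_linr.
- move=> x; apply: (le_trans (bt _)); rewrite rn_hpure mulrA.
  by rewrite ler_wpM2r ?rn_ge0// ler_wpM2r ?rn_ge0// ler_norm.
- by move=> x; rewrite rn_hpure -mulrA ler_wpM2l ?rn_ge0.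
move=> [b k'] /=; rewrite -piE -!mopM !(ext_mul_mor _) //.
by rewrite mtensE piE.
Qed.
End SpatialRep.
End CstarTensor.
Arguments pure_tot {R} M A B.

Lemma ext_uniq_tot (R : realType) (A B : cstar R) (h : A -> multiplier B) S (s : S -> A)
  (m : multiplier A) (n : multiplier B) :
  is_mor h -> total s -> (forall i, n * h (s i) = h (m (s i))) -> n = ext h m.
Proof.
move=> hm st e; apply: ext_uniq => // z w.
have [t _ nt] := bounded n; have [u _ mu] := bounded m.
apply: (@total_eq _ _ _ _ _ (fun z => n (h z w)) (fun z => h (m z) w) (`|t| * rn w) (rn w * u) st).
- by move=> c x y; rewrite (mor_linr hm) mact_lin.
- by move=> c x y; rewrite mact_lin (mor_linr hm).
- move=> x; apply: (le_trans (nt _)); have := mor_bdd hm w x.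
  have := ler_norm t; have := rn_ge0 (h x w); have := normr_ge0 t; nra.
- move=> x; apply: (le_trans (mor_bdd hm w _)); rewrite -mulrA ler_wpM2l ?rn_ge0//; exact: mu.
by move=> i; rewrite -mulmE e.
Qed.

Section Compatible.
Variables (R : realType) (M : model R).
Local Notation C := (cplx R).
Local Notation "A ⊗ B" := (mten (ctens M A B)) (at level 40, left associativity).
Local Notation K := (compact M).
Local Notation "x ⊙ y" := (hpure (htens M _ _) x y) (at level 40, left associativity).
Local Notation pu := (pure (ctens M _ _)).
Local Notation inl A B := (@inl_mor R M A B).
Local Notation inr A B := (@inr_mor R M A B).
Local Notation pair f g := (@pair_mor R M _ _ _ f g).
Implicit Types A B E F : cstar R.

(** Commuting morphisms combine on the maximal tensor product in general; on the minimal one the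
    existence of the combined morphism is a condition, and [pair_mor] is meaningful exactly under
    it. *)
Definition compat A B E (f : A -> multiplier E) (g : B -> multiplier E) :=
  exists h : A ⊗ B -> multiplier E, is_mor h /\ forall a b, h (pu a b) = f a * g b.

Lemma ten_mor_eq A B E (h k : A ⊗ B -> multiplier E) : is_mor h -> is_mor k ->
  (forall a b, h (pu a b) = k (pu a b)) -> h = k.
Proof. by move=> hm km e; apply: (mor_eq hm km (pure_tot M A B)) => -[a b]. Qed.

Section Basic.
Variables (A B E : cstar R) (f : A -> multiplier E) (g : B -> multiplier E).
Hypothesis fg : compat f g.
Lemma pair_is_mor : is_mor (pair f g).
Proof. by case: (theP (fun=> mone E) fg). Qed.
Lemma pairE a b : pair f g (pu a b) = f a * g b.
Proof. by case: (theP (fun=> mone E) fg) => _; exact. Qed.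
Lemma pair_uniq h : is_mor h -> (forall a b, h (pu a b) = f a * g b) -> h = pair f g.
Proof. by move=> hm e; apply: ten_mor_eq => //; [exact: pair_is_mor|move=> a b; rewrite e pairE]. Qed.
Hypotheses (fm : is_mor f) (gm : is_mor g).
Lemma compatC a b : f a * g b = g b * f a.
Proof.
have := mor_star pair_is_mor (pu (star a) (star b)).
by rewrite pure_star !starK !pairE adjM (mor_star fm) (mor_star gm) !adjK.
Qed.
Lemma pair_inl : mcomp (pair f g) (inl A B) = f.
Proof.
apply/funext => a; symmetry; apply: (ext_uniq_tot pair_is_mor (pure_tot M A B)) => -[x y] /=.
by rewrite mtensE !pairE /= (morM fm) mulrA.
Qed.
Lemma pair_inr : mcomp (pair f g) (inr A B) = g.
Proof.
apply/funext => b; symmetry; apply: (ext_uniq_tot pair_is_mor (pure_tot M A B)) => -[x y] /=.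
by rewrite mtensE !pairE /= (morM gm) !mulrA -(compatC x b).
Qed.
Lemma pair_mtens m n : ext (pair f g) (mtens M m n) = ext f m * ext g n.
Proof.
rewrite mtensE2 (extM pair_is_mor) -!ext_mcomp ?pair_inl ?pair_inr //;
  by [exact: pair_is_mor|exact: inl_is_mor|exact: inr_is_mor].
Qed.
Lemma compat_extC m n : ext f m * ext g n = ext g n * ext f m.
Proof.
have := congr1 (@mstar _ _) (pair_mtens (mstar m) (mstar n)).
by rewrite -(ext_adj pair_is_mor) mtens_adj !adjK pair_mtens adjM -(ext_adj fm) -(ext_adj gm) !adjK.
Qed.
End Basic.

Section Split.
Variables (A B E : cstar R) (h : A ⊗ B -> multiplier E).
Hypothesis hm : is_mor h.
Lemma split_mor a b : h (pu a b) = mcomp h (inl A B) a * mcomp h (inr A B) b.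
Proof. by rewrite /mcomp -(extM hm) inl_inr (ext_mof hm). Qed.
Lemma split_compat : compat (mcomp h (inl A B)) (mcomp h (inr A B)).
Proof. by exists h; split=> //; exact: split_mor. Qed.
Lemma split_pair : h = pair (mcomp h (inl A B)) (mcomp h (inr A B)).
Proof. apply: pair_uniq => //; [exact: split_compat|exact: split_mor]. Qed.
End Split.

Lemma compat_of A B E (f : A -> multiplier E) (g : B -> multiplier E) h :
  is_mor h -> mcomp h (inl A B) = f -> mcomp h (inr A B) = g -> compat f g.
Proof. by move=> hm <- <-; exact: split_compat. Qed.

Section Post.
Variables (A B E F : cstar R) (f : A -> multiplier E) (g : B -> multiplier E) (k : E -> multiplier F).
Hypotheses (fg : compat f g) (fm : is_mor f) (gm : is_mor g) (km : is_mor k).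
Lemma mcomp_pair_split : mcomp (mcomp k (pair f g)) (inl A B) = mcomp k f /\
  mcomp (mcomp k (pair f g)) (inr A B) = mcomp k g.
Proof. by rewrite -!mcompA ?pair_inl ?pair_inr //; exact: pair_is_mor. Qed.
Lemma compat_post : compat (mcomp k f) (mcomp k g).
Proof.
apply: (compat_of (h := mcomp k (pair f g))); [|exact: mcomp_pair_split.1|exact: mcomp_pair_split.2].
by apply: mcomp_mor => //; exact: pair_is_mor.
Qed.
Lemma mcomp_pair : mcomp k (pair f g) = pair (mcomp k f) (mcomp k g).
Proof.
rewrite (@split_pair _ _ _ (mcomp k (pair f g))); last by apply: mcomp_mor => //; exact: pair_is_mor.
by have [-> ->] := mcomp_pair_split.
Qed.
End Post.

Section Criterion.
Variables (A B E : cstar R) (f : A -> multiplier E) (g : B -> multiplier E).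
Hypotheses (fm : is_mor f) (gm : is_mor g) (fgC : forall a b, f a * g b = g b * f a).
Variables (H H' : hilbert R) (theta : rep M E H) (pi : rep M (A ⊗ B) H') (J : H -> H').
Hypotheses (thetam : is_mor theta) (thetai : injective theta) (pim : is_mor pi).
Hypotheses (Jl : linear J) (Jn : forall x, rn (J x) = rn x).
Hypothesis JE : forall a b x, J (mop (ext theta (f a * g b)) x) = mop (pi (pu a b)) (J x).

Let fgp (p : A * B) := f p.1 * g p.2.
Let pup (p : A * B) := pu p.1 p.2.

Let comb_bd l : bd (comb fgp l) (rn (comb pup l)).
Proof.
apply: (ext_inj_bd thetam thetai); first exact: rn_ge0.
apply: bd_mop => [|x]; first exact: rn_ge0.
have L1 : linear (fun m : multiplier E => J (mop (ext theta m) x)).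
  by move=> c u v; rewrite (ext_lin thetam) mop_linl Jl.
have L2 : linear (fun z : A ⊗ B => mop (pi z) (J x)).
  by move=> c u v; rewrite (mor_lin pim) mop_linl.
have e : J (mop (ext theta (comb fgp l)) x) = mop (pi (comb pup l)) (J x).
  rewrite (comb_lin fgp l L1) (comb_lin pup l L2).
  by apply: eq_comb => -[a b]; exact: JE.
rewrite -Jn e -[rn x]Jn; exact: rep_bdd.
Qed.

(* Through J, theta (sum of the f a g b) is a restriction of pi (sum of the a (x) b),
   so the former has the smaller norm. *)
Lemma criterion : compat f g.
Proof.
have /choice[T hT] y : exists T : A ⊗ B -> E, [/\ linear T, bdd T (rn y) & forall p, T (pup p) = fgp p y].
  apply: extend; [exact: rn_ge0|exact: pure_tot|] => l.
  by have := @comb_bd l y; rewrite mulrC -[comb fgp l y]/((fun m : multiplier E => m y) _) comb_lin.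
have Tadj x y z : star (T y x) ** z = star y ** T z (star x).
  have [ly by' Ey] := hT y; have [lz bz Ez] := hT z.
  suff H0 : star z ** T y x = star (T z (star x)) ** y.
    by have := congr1 (@star _ _) H0; rewrite !starM !starK.
  apply: (@total_eq _ _ _ _ _ (fun x => star z ** T y x) (fun x => star (T z (star x)) ** y)
    (rn z * rn y) (rn z * rn y) (pure_tot M A B)).
  - by move=> c u v; rewrite ly cmulDr cmulZr.
  - by move=> c u v; rewrite starD lz starD cmulDl cmulZl conjCK.
  - move=> u; apply: (le_trans (rnM _ _)); rewrite rn_star -mulrA ler_wpM2l ?rn_ge0//; exact: by'.
  - move=> u; apply: (le_trans (rnM _ _)); rewrite rn_star; have := bz (star u); rewrite rn_star.
    by have := rn_ge0 y; nra.
  move=> [a b]; rewrite pure_star (Ey (a, b)) (Ez (star a, star b)) /fgp.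
  have hs : f a * g b = mstar (f (star a) * g (star b)).
    by rewrite adjM -(mor_star fm) -(mor_star gm) !starK fgC.
  by rewrite -[(a, b).1]/a -[(a, b).2]/b hs; symmetry; exact: mactP.
pose h x := @Multiplier R E (T^~ x) (T^~ (star x)) (Tadj x).
have hE a b : h (pu a b) = f a * g b.
  by apply: multP => y; have [_ _ Ey] := hT y; exact: (Ey (a, b)).
have hl : linear h.
  by move=> c u v; apply: multP => y; have [ly _ _] := hT y; rewrite addmE scalemE; exact: ly.
have hb y : bdd (fun x => h x y) (rn y) by have [_ yb _] := hT y.
have hJ x xi : J (mop (ext theta (h x)) xi) = mop (pi x) (J xi).
  apply: (@total_eq _ _ _ _ _ (fun x => J (mop (ext theta (h x)) xi)) (fun x => mop (pi x) (J xi))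
     (rn xi) (rn (J xi)) (pure_tot M A B)).
  - by move=> c u v; rewrite hl (ext_lin thetam) mop_linl Jl.
  - by move=> c u v; rewrite (mor_lin pim) mop_linl.
  - move=> u; rewrite Jn mulrC; apply: mop_bd; apply: (ext_bd thetam); first exact: rn_ge0.
    by move=> y; rewrite mulrC; exact: hb.
  - by move=> u; rewrite mulrC; apply: rep_bdd.
  by move=> [a b] /=; rewrite hE JE.
have Ji x y : J x = J y -> x = y.
  move=> e; apply/eqP; rewrite -subr_eq0 -rn_eq0 -Jn (linB Jl) e subrr rn0 //.
exists h; split=> //; split.
- by move=> c u v y; rewrite hl.
- move=> u v; apply: (ext_inj thetam thetai); apply: mop_inj => xi; apply: Ji.
  by rewrite hJ (extM thetam) mopM hJ hJ -mopM (morM pim).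
- by move=> u; apply: multP => y /=.
apply/clspan_total2; apply: (total_trans (mor_total fm)) => -[a y] /=.
have [t _ ft] := bounded (f a).
apply: (inspan_img (mact_lin (f a)) ft _ (mor_total gm y)) => -[b z] /=.
have -> : f a (g b z) = h (pu a b) z by rewrite hE.
exact: (inspan_gen _ (pu a b, z)).
Qed.
End Criterion.
End Compatible.

Section TensorFunctor.
Variables (R : realType) (M : model R).
Local Notation C := (cplx R).
Local Notation "A ⊗ B" := (mten (ctens M A B)) (at level 40, left associativity).
Local Notation K := (compact M).
Local Notation "x ⊙ y" := (hpure (htens M _ _) x y) (at level 40, left associativity).
Local Notation pu := (pure (ctens M _ _)).
Local Notation inl A B := (@inl_mor R M A B).
Local Notation inr A B := (@inr_mor R M A B).
Local Notation pair f g := (@pair_mor R M _ _ _ f g).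
Local Notation tensor f g := (@tensor_mor R M _ _ _ _ f g).
Local Notation compat := (compat M).
Implicit Types A B E F : cstar R.

Lemma compat_inl_inr A B : compat (inl A B) (inr A B).
Proof. by exists (@mof R _); split; [exact: mof_mor|move=> a b; rewrite inl_inr]. Qed.

Lemma inlE A B a : inl A B a = mtens M (mof a) 1. Proof. by []. Qed.
Lemma inrE A B b : inr A B b = mtens M 1 (mof b). Proof. by []. Qed.

Lemma isometry_pure (H H' L L' : hilbert R) (J : H -> L) (J' : H' -> L') :
  (forall x y, ip L (J x) (J y) = ip H x y) -> (forall x y, ip L' (J' x) (J' y) = ip H' x y) ->
  exists T : htens M H H' -> htens M L L',
    [/\ linear T, forall x, rn (T x) = rn x & forall x y, T (x ⊙ y) = J x ⊙ J' y].
Proof.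
move=> Ji Ji'; have [|T [Tl Tn TE]] := @isometry_ex R _ _ _ (fun p : H * H' => p.1 ⊙ p.2)
  (fun p => J p.1 ⊙ J' p.2) (hpure_tot _); first by move=> p q; rewrite !hpure_ip Ji Ji'.
by exists T; split=> // x y; exact: (TE (x, y)).
Qed.

Lemma op_eq S (H L : hilbert R) (s : S -> H) (J : H -> L) (m : multiplier (K H)) (n : multiplier (K L)) :
  total s -> linear J -> (forall x, rn (J x) = rn x) ->
  (forall i, J (mop m (s i)) = mop n (J (s i))) -> forall x, J (mop m x) = mop n (J x).
Proof.
move=> st Jl Jn e; have [t bt] := bounded_mop m; have [u bu] := bounded_mop n.
apply: (total_eq st _ _ _ _ e).
- by move=> c x y; rewrite mop_lin Jl.
- by move=> c x y; rewrite Jl mop_lin.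
- by move=> x; rewrite Jn; exact: bt.
- by move=> x; rewrite -[rn x]Jn; exact: bu.
Qed.

(** The composite of [be] and [g] need not be faithful, while [spatial] speaks of faithful
    representations only. So it is enlarged to a faithful [phi] of [B] that contains it along [J0],
    and [criterion] compares norms on that summand. *)
Lemma compat_inl_mcomp A B B' (g : B -> multiplier B') : is_mor g ->
  compat (inl A B') (mcomp (inr A B') g).
Proof.
move=> gm; have [HA [al [alm ali]]] := gelfand_naimark M A.
have [HB [be [bem bei]]] := gelfand_naimark M B'.
have [H [phi [J0 [phim phii J0l J0i J0E]]]] := gelfand_naimark_ext (mcomp_mor bem gm).
have [th [thm thi thE]] := spatial (ctens M A B') alm ali bem bei.
have [pi [pim pii piE]] := spatial (ctens M A B) alm ali phim phii.
have [J [Jl Jn JE]] := @isometry_pure HA HB HA H id J0 (fun _ _ => erefl) J0i.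
apply: (criterion _ _ _ thm thi pim Jl Jn).
- exact: inl_is_mor.
- by apply: mcomp_mor => //; exact: inr_is_mor.
- by move=> a b; rewrite -(ext_mof (@inl_is_mor R M A B') a) inlC.
move=> a b x; apply: (op_eq (hpure_tot (htens M HA HB)) Jl Jn) => -[h k] /=.
rewrite JE piE J0E /mcomp ext_inr inlE -mtensM mulr1 mul1r (spatial_mtens alm bem thm thE) JE.
by rewrite ext_mof.
Qed.

Lemma compat_flip A B : compat (inr B A) (inl B A).
Proof.
have [HA [al [alm ali]]] := gelfand_naimark M A.
have [HB [be [bem bei]]] := gelfand_naimark M B.
have [th [thm thi thE]] := spatial (ctens M B A) bem bei alm ali.
have [pi [pim pii piE]] := spatial (ctens M A B) alm ali bem bei.
have [|J [Jl Jn JE]] := @isometry_ex R _ _ _ (fun p : HB * HA => p.1 ⊙ p.2)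
  (fun p => p.2 ⊙ p.1) (hpure_tot _); first by move=> p q; rewrite !hpure_ip mulrC.
apply: (criterion _ _ _ thm thi pim Jl Jn).
- exact: inr_is_mor.
- exact: inl_is_mor.
- by move=> a b; rewrite -(ext_mof (@inl_is_mor R M B A) b) -(ext_mof (@inr_is_mor R M B A) a) inlC.
move=> a b x; apply: (op_eq (hpure_tot (htens M HB HA)) Jl Jn) => -[k h] /=.
rewrite (JE (k, h)) /= piE inlE inrE -mtensM mulr1 mul1r (spatial_mtens bem alm thm thE).
by rewrite (JE (_, _)) /= !ext_mof.
Qed.

Section Flip.
Variables A B : cstar R.
Lemma flip_is_mor : is_mor (@flip R M A B).
Proof. exact: pair_is_mor (compat_flip A B). Qed.
Lemma flip_inl : mcomp (@flip R M A B) (inl A B) = inr B A.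
Proof. by apply: pair_inl; [exact: compat_flip|exact: inr_is_mor]. Qed.
Lemma flip_inr : mcomp (@flip R M A B) (inr A B) = inl B A.
Proof. by apply: pair_inr; [exact: compat_flip|exact: inr_is_mor|exact: inl_is_mor]. Qed.
End Flip.

Lemma compat_sym A B E (f : A -> multiplier E) (g : B -> multiplier E) :
  is_mor f -> is_mor g -> compat f g -> compat g f.
Proof.
move=> fm gm fg; have pm := pair_is_mor fg; have fl := flip_is_mor B A.
apply: (compat_of (h := mcomp (pair f g) (@flip R M B A))); first exact: mcomp_mor.
  by rewrite -mcompA// flip_inl pair_inr.
by rewrite -mcompA// flip_inr pair_inl.
Qed.

(** [compat_inl_mcomp] is the universal case; the general one is its image under [pair f g]. *)
Lemma compat_prer A B B' E (f : A -> multiplier E) (g : B' -> multiplier E) (k : B -> multiplier B') :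
  is_mor f -> is_mor g -> is_mor k -> compat f g -> compat f (mcomp g k).
Proof.
move=> fm gm km fg; have := compat_post (compat_inl_mcomp A km) (@inl_is_mor R M A B') (mcomp_mor (@inr_is_mor R M A B') km) (pair_is_mor fg).
by rewrite mcompA ?pair_inl ?pair_inr//; [exact: pair_is_mor|exact: inr_is_mor].
Qed.

Lemma compat_pre A A' B B' E (f : A' -> multiplier E) (g : B' -> multiplier E)
  (k : A -> multiplier A') (l : B -> multiplier B') :
  is_mor f -> is_mor g -> is_mor k -> is_mor l -> compat f g -> compat (mcomp f k) (mcomp g l).
Proof.
move=> fm gm km lm fg; apply: compat_sym; [exact: mcomp_mor..|].
apply: compat_prer => //; first exact: mcomp_mor.
by apply: compat_sym => //; [exact: mcomp_mor|exact: compat_prer].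
Qed.

Section TensorMor.
Variables (A A' B B' : cstar R) (f : A -> multiplier A') (g : B -> multiplier B').
Hypotheses (fm : is_mor f) (gm : is_mor g).
Lemma compat_tensor : compat (mcomp (inl A' B') f) (mcomp (inr A' B') g).
Proof. by apply: compat_pre => //; [exact: inl_is_mor|exact: inr_is_mor|exact: compat_inl_inr]. Qed.
Lemma tensor_is_mor : is_mor (tensor f g).
Proof. exact: pair_is_mor compat_tensor. Qed.
Lemma tensor_inl : mcomp (tensor f g) (inl A B) = mcomp (inl A' B') f.
Proof. by apply: pair_inl; [exact: compat_tensor|apply: mcomp_mor => //; exact: inl_is_mor]. Qed.
Lemma tensor_inr : mcomp (tensor f g) (inr A B) = mcomp (inr A' B') g.
Proof.
by apply: pair_inr; [exact: compat_tensor|apply: mcomp_mor => //; exact: inl_is_mor|apply: mcomp_mor => //; exact: inr_is_mor].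
Qed.
Lemma tensor_pure a b : tensor f g (pu a b) = mtens M (f a) (g b).
Proof. by rewrite /tensor_mor (pairE compat_tensor) mtensE2. Qed.
Lemma tensor_mtens m n : ext (tensor f g) (mtens M m n) = mtens M (ext f m) (ext g n).
Proof.
rewrite mtensE2 (extM tensor_is_mor) -!ext_mcomp ?tensor_inl ?tensor_inr ?ext_mcomp -?mtensE2 //;
by [exact: inl_is_mor|exact: inr_is_mor|exact: tensor_is_mor].
Qed.
Lemma pair_tensor E (h : A' -> multiplier E) (k : B' -> multiplier E) : is_mor h -> is_mor k -> compat h k ->
  mcomp (pair h k) (tensor f g) = pair (mcomp h f) (mcomp k g).
Proof.
move=> hm km hk; have pm := pair_is_mor hk.
have im := @inl_is_mor R M A' B'; have rm := @inr_is_mor R M A' B'.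
rewrite /tensor_mor mcomp_pair ?mcompA ?pair_inl ?pair_inr//; [exact: compat_tensor|exact: mcomp_mor..].
Qed.
End TensorMor.

Lemma commute_total A E S (s : S -> A) (h : A -> multiplier E) (n : multiplier E) :
  is_mor h -> total s -> (forall i, n * h (s i) = h (s i) * n) -> forall x, n * h x = h x * n.
Proof.
move=> hm st e x; apply: multP => w; have [t t0 nt] := bounded n.
apply: (@total_eq _ _ _ _ _ (fun x => n (h x w)) (fun x => h x (n w)) (t * rn w) (rn (n w)) st).
- by move=> c u v; rewrite (mor_linr hm) mact_lin.
- by move=> c u v; rewrite (mor_linr hm).
- by move=> u; apply: (le_trans (nt _)); rewrite -mulrA ler_wpM2l//; exact: mor_bdd.
- exact: mor_bdd.
by move=> i; rewrite -!mulmE e.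
Qed.

(** Here [J] is the rebracketing $x\otimes(y\otimes z)\mapsto(x\otimes y)\otimes z$ of Hilbert
    spaces, which intertwines the two spatial representations. *)
Lemma compat_reassoc A B E : compat (pair (@leg1 R M A B E) (@leg2 R M A B E)) (@leg3 R M A B E).
Proof.
have im X Y := @inl_is_mor R M X Y; have rm X Y := @inr_is_mor R M X Y.
have l1m : is_mor (@leg1 R M A B E) by exact: im.
have l2m : is_mor (@leg2 R M A B E) by exact: mcomp_mor.
have l3m : is_mor (@leg3 R M A B E) by exact: mcomp_mor.
have c12 : compat (@leg1 R M A B E) (@leg2 R M A B E) by apply: compat_prer => //; exact: compat_inl_inr.
have c13 : compat (@leg1 R M A B E) (@leg3 R M A B E) by apply: compat_prer => //; exact: compat_inl_inr.
have c23 : compat (@leg2 R M A B E) (@leg3 R M A B E) by apply: compat_post => //; exact: compat_inl_inr.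
have pm := pair_is_mor c12.
have [HA [al [alm ali]]] := gelfand_naimark M A.
have [HB [be [bem bei]]] := gelfand_naimark M B.
have [HE [ep [epm epi]]] := gelfand_naimark M E.
have [th1 [th1m th1i th1E]] := spatial (ctens M B E) bem bei epm epi.
have [th [thm thi thE]] := spatial (ctens M A (B ⊗ E)) alm ali th1m th1i.
have [pi1 [pi1m pi1i pi1E]] := spatial (ctens M A B) alm ali bem bei.
have [pi [pim pii piE]] := spatial (ctens M (A ⊗ B) E) pi1m pi1i epm epi.
pose s (p : HA * (HB * HE)) := p.1 ⊙ (p.2.1 ⊙ p.2.2).
have st : total s by refine (@hpure_total_of R _ _ (htens M HA (htens M HB HE)) _ _ _ _ (@total_id R HA) (hpure_tot (htens M HB HE))).
have [|J [Jl Jn JE]] := @isometry_ex R _ _ _ s (fun p => (p.1 ⊙ p.2.1) ⊙ p.2.2) st.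
  by move=> p q; rewrite !hpure_ip mulrA.
have cm x e : pair (@leg1 R M A B E) (@leg2 R M A B E) x * @leg3 R M A B E e =
    @leg3 R M A B E e * pair (@leg1 R M A B E) (@leg2 R M A B E) x.
  symmetry; apply: (commute_total pm (pure_tot M A B)) => -[a b] /=.
  by rewrite !(pairE c12) mulrA -(compatC c13)// -mulrA -(compatC c23)// mulrA.
apply: (criterion pm l3m cm thm thi pim Jl Jn) => x e v.
have [t t0 lt] := bounded (@leg3 R M A B E e).
apply: (@total_eq _ _ _ _ _
   (fun x => J (mop (ext th (pair (@leg1 R M A B E) (@leg2 R M A B E) x * @leg3 R M A B E e)) v))
   (fun x => mop (pi (pu x e)) (J v)) (t * rn v) (rn e * rn (J v)) (pure_tot M A B)).
- by move=> c x1 x2; rewrite (mor_lin pm) mulrDl scalemAl (ext_lin thm) mop_linl Jl.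
- by move=> c x1 x2; rewrite pure_linl (mor_lin pim) mop_linl.
- move=> x1; rewrite Jn mulrAC [t * _]mulrC; apply: mop_bd; apply: (ext_bd thm); first by rewrite mulr_ge0 ?rn_ge0.
  by apply: bdM => //; [exact: rn_ge0|exact: mor_bd].
- move=> x1; rewrite mulrAC; apply: mop_bd; apply: bd_le (mor_bd pim _).
  by rewrite mulrC; exact: rn_pure.
move=> [a b] /=; apply: (op_eq st) => // -[h [k l]].
rewrite (pairE c12) (JE (h, (k, l))) piE pi1E /s /=.
have -> : @leg1 R M A B E a * @leg2 R M A B E b * @leg3 R M A B E e = mtens M (mof a) (mtens M (mof b) (mof e)).
  by rewrite /leg1 /leg2 /leg3 /mcomp !ext_inr !inlE !inrE -mtensM mulr1 mul1r -mtensM mulr1 -mtensM mulr1 mul1r.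
rewrite (spatial_mtens alm th1m thm thE) (spatial_mtens bem epm th1m th1E) !ext_mof//.
by rewrite (JE (_, (_, _))).
Qed.
End TensorFunctor.

(** * Leg notation *)

Section LegCalculus.
Variables (R : realType) (M : model R).
Local Notation C := (cplx R).
Local Notation "A ⊗ B" := (mten (ctens M A B)) (at level 40, left associativity).
Local Notation K := (compact M).
Local Notation "x ⊙ y" := (hpure (htens M _ _) x y) (at level 40, left associativity).
Local Notation pu := (pure (ctens M _ _)).
Local Notation inl A B := (@inl_mor R M A B).
Local Notation inr A B := (@inr_mor R M A B).
Local Notation pair f g := (@pair_mor R M _ _ _ f g).
Local Notation tensor f g := (@tensor_mor R M _ _ _ _ f g).
Local Notation compat := (compat M).
Local Notation "X @[ f , g ]" := (ext (pair f g) X) (at level 1, left associativity, format "X @[ f ,  g ]").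
Local Notation "g ∘ f" := (mcomp g f) (at level 45, right associativity).
Local Notation id_ A := (@mof R A).
Implicit Types A B E F : cstar R.

(* Leg numbering: X@[f, g] is X with its two legs placed by the commuting f and g. *)
Definition cp A B E (f : A -> multiplier E) (g : B -> multiplier E) :=
  [/\ is_mor f, is_mor g & compat f g].

Lemma cp_inlr A B : cp (inl A B) (inr A B).
Proof. by split; [exact: inl_is_mor|exact: inr_is_mor|exact: compat_inl_inr]. Qed.

Section Pair.
Variables (A B E : cstar R) (f : A -> multiplier E) (g : B -> multiplier E).
Hypothesis fg : cp f g.
Lemma cp1 : is_mor f. Proof. by case: fg. Qed.
Lemma cp2 : is_mor g. Proof. by case: fg. Qed.
Lemma cp_mor : is_mor (pair f g). Proof. by case: fg => _ _; exact: pair_is_mor. Qed.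
Lemma cp_inl : pair f g ∘ inl A B = f. Proof. by case: fg => fm gm c; exact: pair_inl. Qed.
Lemma cp_inr : pair f g ∘ inr A B = g. Proof. by case: fg => fm gm c; exact: pair_inr. Qed.
Lemma cp_sym : cp g f.
Proof. by case: fg => fm gm c; split=> //; exact: compat_sym. Qed.
Lemma cp_flip : pair f g ∘ @flip R M B A = pair g f.
Proof.
have [fm gm c] := fg; rewrite /flip mcomp_pair ?pair_inl ?pair_inr //;
  by [exact: compat_flip|exact: inr_is_mor|exact: inl_is_mor|exact: pair_is_mor].
Qed.
Lemma cp_mtens m n : (mtens M m n)@[f, g] = ext f m * ext g n.
Proof. by case: fg => fm gm c; exact: pair_mtens. Qed.
Lemma cpC m n : ext f m * ext g n = ext g n * ext f m.
Proof. by case: fg => fm gm c; exact: (compat_extC c). Qed.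
Lemma cp_eq h : is_mor h -> h ∘ inl A B = f -> h ∘ inr A B = g -> h = pair f g.
Proof. by move=> hm hf hg; rewrite (split_pair hm) hf hg. Qed.
Lemma at_amp A' B' (f' : A' -> multiplier A) (g' : B' -> multiplier B) X : is_mor f' -> is_mor g' ->
  (amp f' g' X)@[f, g] = X@[f ∘ f', g ∘ g'].
Proof.
move=> fm' gm'; have [fm gm c] := fg.
rewrite /amp -ext_mcomp ?pair_tensor //; [exact: pair_is_mor|exact: tensor_is_mor].
Qed.
Lemma cp_pre A' B' (f' : A' -> multiplier A) (g' : B' -> multiplier B) : is_mor f' -> is_mor g' ->
  cp (f ∘ f') (g ∘ g').
Proof.
by move=> fm' gm'; have [fm gm c] := fg; split; [exact: mcomp_mor..|exact: compat_pre].
Qed.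
Lemma cp_prel A' (f' : A' -> multiplier A) : is_mor f' -> cp (f ∘ f') g.
Proof. by move=> fm'; have := cp_pre fm' (mof_mor B); rewrite mcomp_mofr//; exact: cp2. Qed.
Lemma cp_prer B' (g' : B' -> multiplier B) : is_mor g' -> cp f (g ∘ g').
Proof. by move=> gm'; have := cp_pre (mof_mor A) gm'; rewrite mcomp_mofr//; exact: cp1. Qed.
Lemma at_ampl A' (f' : A' -> multiplier A) X : is_mor f' -> (amp_l f' X)@[f, g] = X@[f ∘ f', g].
Proof. by move=> fm'; rewrite [LHS]at_amp// ?mcomp_mofr//; [exact: cp2|exact: mof_mor]. Qed.
Lemma at_ampr B' (g' : B' -> multiplier B) X : is_mor g' -> (amp_r g' X)@[f, g] = X@[f, g ∘ g'].
Proof. by move=> gm'; rewrite [LHS]at_amp// ?mcomp_mofr//; [exact: cp1|exact: mof_mor]. Qed.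
Lemma cp_post F (k : E -> multiplier F) : is_mor k -> cp (k ∘ f) (k ∘ g).
Proof. by move=> km; have [fm gm c] := fg; split; [exact: mcomp_mor..|exact: compat_post]. Qed.
Lemma pair_post F (k : E -> multiplier F) : is_mor k -> k ∘ pair f g = pair (k ∘ f) (k ∘ g).
Proof. by move=> km; have [fm gm c] := fg; exact: mcomp_pair. Qed.
Lemma at_post F (k : E -> multiplier F) X : is_mor k -> ext k (X@[f, g]) = X@[k ∘ f, k ∘ g].
Proof. by move=> km; rewrite -pair_post// ext_mcomp//; exact: cp_mor. Qed.
Lemma at_flip X : (ext (@flip R M _ _) X)@[f, g] = X@[g, f].
Proof. by rewrite -cp_flip ext_mcomp//; [exact: cp_mor|exact: flip_is_mor]. Qed.
Lemma at_adj X : (mstar X)@[f, g] = mstar X@[f, g].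
Proof. by rewrite ext_adj//; exact: cp_mor. Qed.
Lemma at_unitary X : unitary X -> unitary X@[f, g].
Proof. by apply: ext_unitary; exact: cp_mor. Qed.
End Pair.

Lemma pair_inlr A B : pair (inl A B) (inr A B) = @mof R (A ⊗ B).
Proof.
symmetry; apply: cp_eq; first exact: mof_mor.
  by rewrite mcomp_mofl.
by rewrite mcomp_mofl.
Qed.
Lemma at_id A B (X : multiplier (A ⊗ B)) : X@[inl A B, inr A B] = X.
Proof. by rewrite pair_inlr ext_mof_id. Qed.

Lemma tensorE A B A' B' (f : A -> multiplier A') (g : B -> multiplier B') :
  tensor f g = pair (inl A' B' ∘ f) (inr A' B' ∘ g).
Proof. by []. Qed.
Lemma cp_tensor A B A' B' (f : A -> multiplier A') (g : B -> multiplier B') :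
  is_mor f -> is_mor g -> cp (inl A' B' ∘ f) (inr A' B' ∘ g).
Proof. by move=> fm gm; apply: cp_pre => //; exact: cp_inlr. Qed.

(** Asks for a morphism on the whole triple tensor product, bracketed to the right; the pairwise
    conditions and the permutations of the legs are derived from it below. *)
Definition cp3 A B E F (f : A -> multiplier F) (g : B -> multiplier F) (h : E -> multiplier F) :=
  cp g h /\ cp f (pair g h).

Section Legs.
Variables A B E : cstar R.
Local Notation l1 := (@leg1 R M A B E).
Local Notation l2 := (@leg2 R M A B E).
Local Notation l3 := (@leg3 R M A B E).
Lemma leg_cp23 : cp l2 l3.
Proof. by apply: cp_post; [exact: cp_inlr|exact: inr_is_mor]. Qed.
Lemma leg_pair23 : pair l2 l3 = inr A (B ⊗ E).
Proof.
rewrite /leg2 /leg3 -pair_post ?pair_inlr ?mcomp_mofr //;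
  by [exact: inr_is_mor|exact: cp_inlr].
Qed.
Lemma leg_cp3 : cp3 l1 l2 l3.
Proof. by split; [exact: leg_cp23|rewrite leg_pair23; exact: cp_inlr]. Qed.
Lemma leg_cp12 : cp l1 l2.
Proof. by apply: cp_prer; [exact: cp_inlr|exact: inl_is_mor]. Qed.
Lemma leg_cp13 : cp l1 l3.
Proof. by apply: cp_prer; [exact: cp_inlr|exact: inr_is_mor]. Qed.
Lemma leg_pair12 : pair l1 l2 = tensor (@mof R A) (inl B E).
Proof. by rewrite tensorE mcomp_mofr//; exact: inl_is_mor. Qed.
Lemma leg_pair13 : pair l1 l3 = tensor (@mof R A) (inr B E).
Proof. by rewrite tensorE mcomp_mofr//; exact: inl_is_mor. Qed.
Lemma leg_cp12_3 : cp (pair l1 l2) l3.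
Proof.
by split; [exact: cp_mor leg_cp12|exact: cp2 leg_cp23|exact: compat_reassoc].
Qed.
End Legs.

Section Triple.
Variables (A B E F : cstar R) (f : A -> multiplier F) (g : B -> multiplier F) (h : E -> multiplier F).
Hypothesis fgh : cp3 f g h.
Local Notation l1 := (@leg1 R M A B E).
Local Notation l2 := (@leg2 R M A B E).
Local Notation l3 := (@leg3 R M A B E).
Definition triple := pair f (pair g h).
Lemma cp3_mor : is_mor triple. Proof. exact: cp_mor fgh.2. Qed.
Lemma cp3_1 : triple ∘ l1 = f. Proof. exact: cp_inl fgh.2. Qed.
Lemma cp3_2 : triple ∘ l2 = g.
Proof. by rewrite mcompA ?(cp_inr fgh.2) ?(cp_inl fgh.1) //; [exact: cp3_mor|exact: inr_is_mor]. Qed.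
Lemma cp3_3 : triple ∘ l3 = h.
Proof. by rewrite mcompA ?(cp_inr fgh.2) ?(cp_inr fgh.1) //; [exact: cp3_mor|exact: inr_is_mor]. Qed.
Lemma cp3_23 : cp g h. Proof. exact: fgh.1. Qed.
Lemma cp3_12 : cp f g.
Proof. by rewrite -(cp_inl fgh.1); apply: (cp_prer fgh.2); exact: inl_is_mor. Qed.
Lemma cp3_13 : cp f h.
Proof. by rewrite -(cp_inr fgh.1); apply: (cp_prer fgh.2); exact: inr_is_mor. Qed.
Lemma cp3_pair12 : triple ∘ pair l1 l2 = pair f g.
Proof.
rewrite pair_post ?cp3_1 ?cp3_2 //; last exact: cp3_mor.
exact: leg_cp12.
Qed.
Lemma cp3_12_3 : cp (pair f g) h.
Proof. by rewrite -cp3_pair12 -[in X in cp _ X]cp3_3; apply: cp_post; [exact: leg_cp12_3|exact: cp3_mor]. Qed.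
Lemma cp3_swap23 : cp3 f h g.
Proof.
split; first exact: cp_sym cp3_23.
by rewrite -(cp_flip cp3_23); apply: (cp_prer fgh.2); exact: flip_is_mor.
Qed.
Lemma at_reassoc (X : multiplier ((A ⊗ B) ⊗ E)) : ext triple (ext (@reassoc R M A B E) X) = X@[pair f g, h].
Proof.
rewrite -(ext_mcomp _ cp3_mor); last exact: cp_mor (leg_cp12_3 A B E).
congr (ext _ X); rewrite pair_post ?cp3_pair12 ?cp3_3 //; [exact: leg_cp12_3|exact: cp3_mor].
Qed.
Lemma at_leg12 X : ext triple (leg12 E X) = X@[f, g].
Proof. by rewrite /leg12 at_post ?cp3_1 ?cp3_2 //; [exact: leg_cp12|exact: cp3_mor]. Qed.
Lemma at_leg13 X : ext triple (leg13 B X) = X@[f, h].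
Proof. by rewrite /leg13 at_post ?cp3_1 ?cp3_3 //; [exact: leg_cp13|exact: cp3_mor]. Qed.
Lemma at_leg23 X : ext triple (leg23 A X) = X@[g, h].
Proof. by rewrite /leg23 at_post ?cp3_2 ?cp3_3 //; [exact: leg_cp23|exact: cp3_mor]. Qed.
Lemma cp3_rot : cp3 h f g.
Proof. by split; [exact: cp3_12|exact: cp_sym cp3_12_3]. Qed.
End Triple.

Lemma cp3_of A B E F (f : A -> multiplier F) (g : B -> multiplier F) (h : E -> multiplier F) :
  cp f g -> cp (pair f g) h -> cp3 f g h.
Proof.
move=> fg fgh; have hfg : cp3 h f g by split=> //; exact: cp_sym.
exact: cp3_rot (cp3_rot hfg).
Qed.

Section TriplePre.
Variables (A B E F A' B' E' : cstar R).
Variables (f : A -> multiplier F) (g : B -> multiplier F) (h : E -> multiplier F).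
Variables (f' : A' -> multiplier A) (g' : B' -> multiplier B) (h' : E' -> multiplier E).
Hypothesis fgh : cp3 f g h.
Hypotheses (fm : is_mor f') (gm : is_mor g') (hm : is_mor h').
Lemma cp3_pre1 : cp3 (f ∘ f') g h.
Proof. by have [gh c] := fgh; split=> //; exact: cp_prel. Qed.
End TriplePre.
Lemma cp3_pre2 A B E F B' (f : A -> multiplier F) (g : B -> multiplier F) (h : E -> multiplier F)
  (g' : B' -> multiplier B) : is_mor g' -> cp3 f g h -> cp3 f (g ∘ g') h.
Proof. by move=> gm fgh; apply: cp3_rot; apply: cp3_pre1 => //; apply: cp3_rot; exact: cp3_rot. Qed.
Lemma cp3_pre3 A B E F E' (f : A -> multiplier F) (g : B -> multiplier F) (h : E -> multiplier F)
  (h' : E' -> multiplier E) : is_mor h' -> cp3 f g h -> cp3 f g (h ∘ h').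
Proof. by move=> gm fgh; apply: cp3_rot; apply: cp3_rot; apply: cp3_pre1 => //; exact: cp3_rot. Qed.

Section Bicharacter.
Variables (B E F : cstar R).
(** An equation between multipliers of a triple tensor product holds for any three compatible legs:
    apply [triple f g h] to both sides. Leg computations are done in this form, inside one
    algebra. *)
Lemma at_bi1 (D : B -> multiplier (B ⊗ B)) (X : multiplier (B ⊗ E))
  (f g : B -> multiplier F) (h : E -> multiplier F) : is_mor D ->
  ext (@reassoc R M B B E) (amp_l D X) = leg23 B X *M leg13 B X -> cp3 f g h ->
  X@[pair f g ∘ D, h] = X@[g, h] * X@[f, h].
Proof.
move=> Dm e fgh; have := congr1 (ext (triple f g h)) e.
by rewrite at_reassoc// at_ampl ?(extM (cp3_mor fgh)) ?at_leg23 ?at_leg13 //; exact: cp3_12_3.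
Qed.
Lemma at_bi2 (D : E -> multiplier (E ⊗ E)) (X : multiplier (B ⊗ E))
  (f : B -> multiplier F) (g h : E -> multiplier F) : is_mor D ->
  amp_r D X = leg12 E X *M leg13 E X -> cp3 f g h ->
  X@[f, pair g h ∘ D] = X@[f, g] * X@[f, h].
Proof.
move=> Dm e fgh; have := congr1 (ext (triple f g h)) e.
by rewrite {1}/triple at_ampr ?(extM (cp3_mor fgh)) ?at_leg12 ?at_leg13 //; exact: fgh.2.
Qed.
End Bicharacter.

(** The lower bound is read off in a spatial representation at elementary vectors, one factor at a
    time; [mor_inj_le] takes the place of the suprema. *)
Lemma rn_pureE A B (a : A) (b : B) : rn (pu a b) = rn a * rn b.
Proof.
apply/eqP; rewrite eq_le rn_pure /=.
have [HA [al [alm ali]]] := gelfand_naimark M A.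
have [HB [be [bem bei]]] := gelfand_naimark M B.
have [pi [pim pii piE]] := spatial (ctens M A B) alm ali bem bei.
set N := rn (pu a b); have N0 : 0 <= N by exact: rn_ge0.
have h1 h k : rn (mop (al a) h) * rn (mop (be b) k) <= N * (rn h * rn k).
  rewrite -!(rn_hpure (htens M HA HB)) -piE; exact: rep_bdd.
have h2 k : rn a * rn (mop (be b) k) <= N * rn k.
  have [k0|k0] := eqVneq (rn (mop (be b) k)) 0.
    by rewrite k0 mulr0 mulr_ge0 ?rn_ge0.
  have kp : 0 < rn (mop (be b) k) by rewrite lt_neqAle eq_sym k0 rn_ge0.
  have t0 : 0 <= N * rn k / rn (mop (be b) k) by rewrite divr_ge0 ?mulr_ge0 ?rn_ge0.
  rewrite -ler_pdivlMr//; apply: (mor_inj_le alm ali t0); apply: bd_mop => // h.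
  by rewrite mulrAC ler_pdivlMr// -mulrA [rn k * _]mulrC.
have [a0|a0] := eqVneq (rn a) 0; first by rewrite a0 mul0r.
have ap : 0 < rn a by rewrite lt_neqAle eq_sym a0 rn_ge0.
have t0 : 0 <= N / rn a by rewrite divr_ge0 ?rn_ge0.
rewrite mulrC -ler_pdivlMr//; apply: (mor_inj_le bem bei t0); apply: bd_mop => // k.
by rewrite mulrAC ler_pdivlMr// mulrC.
Qed.

Lemma pure_inj A B (a a' : A) (b : B) : b != 0 -> pu a b = pu a' b -> a = a'.
Proof.
rewrite -rn_eq0 => b0 e; have : pu (a - a') b = 0 by rewrite (linB (pure_linl M b)) e subrr.
move/(congr1 (@rn _ _)); rewrite rn_pureE rn0 => /eqP; rewrite mulf_eq0 (negPf b0) orbF rn_eq0 subr_eq0.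
by move/eqP.
Qed.
Lemma inl_inj A B (b : B) : b != 0 -> injective (inl A B).
Proof.
move=> b0 a a' e; apply: mof_inj; apply: multP => x; apply: (pure_inj b0).
by have := congr1 (fun m : multiplier (A ⊗ B) => m (pu x b)) e; rewrite /= !mtensE.
Qed.

(** [spatial], applied to the faithful representations [al ∘ f] and [be ∘ g], gives a faithful
    representation that factors through [tensor f g]. *)
Lemma tensor_inj A B A' B' (f : A -> multiplier A') (g : B -> multiplier B') :
  is_mor f -> is_mor g -> injective f -> injective g -> injective (tensor f g).
Proof.
move=> fm gm fi gi.
have [HA [al [alm ali]]] := gelfand_naimark M A'.
have [HB [be [bem bei]]] := gelfand_naimark M B'.
have [pi [pim pii piE]] := spatial (ctens M A' B') alm ali bem bei.
have alf := mcomp_mor alm fm; have beg := mcomp_mor bem gm.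
have [pi' [pim' pii' piE']] := spatial (ctens M A B) alf (mcomp_inj alm ali fi) beg (mcomp_inj bem bei gi).
have e : pi ∘ tensor f g = pi'.
  apply: (ten_mor_eq (mcomp_mor pim (tensor_is_mor M fm gm)) pim') => a b.
  apply: mop_inj; apply: (op_eq (J := id)) => //; first exact: (hpure_tot (htens M HA HB)).
  by move=> [h k] /=; rewrite /mcomp tensor_pure// (spatial_mtens alm bem pim piE) piE'.
by move=> x y xy; apply: pii'; rewrite -e /mcomp xy.
Qed.
End LegCalculus.

Section Bra.
Variables (R : realType) (H H' : hilbert R) (X : htensor H H').
Local Notation "x ⊙ y" := (hpure X x y) (at level 40, left associativity).

(** The operator $\langle\xi|\otimes\mathrm{id}$. Its bound on combinations comes from testing the
    image against itself. *)
Lemma bra_ex (xi : H) : exists B : X -> H',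
  [/\ linear B, bdd B (rn xi) & forall v k, ip H' (B v) k = ip X v (xi ⊙ k)].
Proof.
have key (l : seq (cplx R * (H * H'))) k :
    ip H' (comb (fun p => ip H p.1 xi *: p.2) l) k = ip X (comb (fun p => p.1 ⊙ p.2) l) (xi ⊙ k).
  rewrite /comb; elim: l => [|p l IH]; first by rewrite !big_nil !ip0l.
  by rewrite !big_cons !ipDl IH !ipZl hpure_ip.
have [|B [Bl Bb BE]] := @extend R _ _ _ (fun p : H * H' => p.1 ⊙ p.2) (fun p => ip H p.1 xi *: p.2)
    (rn xi) (rn_ge0 _) (hpure_tot X).
  move=> l; set u := comb _ l; set v := comb _ l.
  have [u0|u0] := eqVneq (rn u) 0; first by rewrite u0 mulr_ge0 ?rn_ge0.
  have up : 0 < rn u by rewrite lt_neqAle eq_sym u0 rn_ge0.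
  rewrite -(ler_pM2r up) -expr2.
  have -> : rn u ^+ 2 = cn (ip X v (xi ⊙ u)) by rewrite -key ip_rn cn_rc ger0_norm ?sqr_ge0.
  by apply: (le_trans (cauchy_schwarz _ _)); rewrite rn_hpure mulrA [rn v * _]mulrC.
exists B; split=> // v k.
pose f1 v : cplx_line R := ip H' (B v) k; pose f2 v : cplx_line R := ip X v (xi ⊙ k).
suff : f1 v = f2 v by [].
apply: (@total_eq _ _ _ _ _ f1 f2 (rn xi * rn k) (rn xi * rn k) (hpure_tot X)).
- by move=> c x y; rewrite /f1 Bl ipDl ipZl.
- by move=> c x y; rewrite /f2 ipDl ipZl.
- move=> x; rewrite rn_line; apply: (le_trans (cauchy_schwarz _ _)).
  by rewrite mulrAC ler_wpM2r ?rn_ge0//; exact: Bb.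
- by move=> x; rewrite rn_line; apply: (le_trans (cauchy_schwarz _ _)); rewrite rn_hpure mulrC.
by move=> p; rewrite /f1 /f2 BE ipZl hpure_ip.
Qed.
End Bra.

Lemma monotone_cauchy (R : realType) (s : nat -> R) (b : R) : (forall n, s n <= s n.+1) -> (forall n, s n <= b) ->
  forall e, 0 < e -> exists N, forall n, (N <= n)%N -> s n - s N <= e.
Proof.
move=> inc bnd e e0.
have hs : has_sup (range s) by split; [exists (s 0%N), 0%N|exists b => _ [n _ <-]].
have [_ [N _ <-] hN] := sup_adherent e0 hs.
exists N => n _; have : s n <= sup (range s) by apply: sup_upper_bound => //; exists n.
lra.
Qed.

Section CompactTensor.
Variables (R : realType) (M : model R) (H H' : hilbert R).
Local Notation "A ⊗ B" := (mten (ctens M A B)) (at level 40, left associativity).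
Local Notation K := (compact M).
Local Notation "x ⊙ y" := (hpure (htens M _ _) x y) (at level 40, left associativity).
Local Notation pu := (pure (ctens M _ _)).
Local Notation kappa := (@compact_tensor R M H H').

Lemma compact_tensor_spec : [/\ is_mor kappa, injective kappa &
  forall x y h h', mop (kappa (pu x y)) (h ⊙ h') = kop x h ⊙ kop y h'].
Proof.
have [pi [pim pii piE]] := spatial (ctens M (K H) (K H')) (@mof_mor R (K H)) (@mof_inj R (K H))
  (@mof_mor R (K H')) (@mof_inj R (K H')).
have [km kE] : is_mor kappa /\ forall x y h h', mop (kappa (pu x y)) (h ⊙ h') = kop x h ⊙ kop y h'.
  apply: (@theP (K H ⊗ K H' -> multiplier (K (htens M H H'))) (fun=> mone _) (fun kappa => is_mor kappa /\
    forall x y h h', mop (kappa (pu x y)) (h ⊙ h') = kop x h ⊙ kop y h')).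
  by exists pi; split=> // x y h h'; rewrite piE !mop_mof.
suff e : kappa = pi by split=> //; rewrite e.
apply: (ten_mor_eq km pim) => a b; apply: mop_inj.
apply: (op_eq (J := id)) => //; first exact: (hpure_tot (htens M H H')).
by move=> [h k] /=; rewrite kE piE !mop_mof.
Qed.
Lemma compact_mor : is_mor kappa. Proof. by case: compact_tensor_spec. Qed.
Lemma compact_inj : injective kappa. Proof. by case: compact_tensor_spec. Qed.
Lemma compact_mtens m n h k : mop (ext kappa (mtens M m n)) (h ⊙ k) = mop m h ⊙ mop n k.
Proof.
have [km ki kE] := compact_tensor_spec.
rewrite (spatial_mtens (@mof_mor R (K H)) (@mof_mor R (K H')) km) ?ext_mof_id//.
by move=> a b x y; rewrite kE !mop_mof.
Qed.
End CompactTensor.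

(** * Slices of the multiplicative unitary *)

Section Slices.
Variables (R : realType) (M : model R) (G : quantum_group M).
Local Notation C := (cplx R).
Local Notation "A ⊗ B" := (mten (ctens M A B)) (at level 40, left associativity).
Local Notation "x ⊙ y" := (hpure (htens M _ _) x y) (at level 40, left associativity).
Local Notation pu := (pure (ctens M _ _)).
Local Notation L := (qL G).
Local Notation K := (compact M L).
Local Notation A := (qA G).
Local Notation Ahat := (qAhat G).
Local Notation tk := (@tk R M L).
Local Notation WL := (@WW R M G).

Lemma WL_lin : linear WL.
Proof. by rewrite -(qW_WW G); exact: mop_lin. Qed.
Lemma WL_rn v : rn (WL v) = rn v.
Proof. by have [_ h _] := WW_unitary G; apply: rc_inj; rewrite -!rnE h. Qed.

(** The vector functional is written as a normal functional by sequences with a single nonzero term,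
    so that the slice belongs to [slice1] and hence to [A]. *)
Lemma slice_ex (xi eta : L) : exists a : A, forall h k,
  ip L (mop (piA a) h) k = ip _ (WL (eta ⊙ h)) (xi ⊙ k).
Proof.
have [B [Bl Bb BE]] := bra_ex (htens M L L) xi.
pose S h := B (WL (eta ⊙ h)).
have SS : slice1 WL S.
  pose d (z : L) n := if n is 0%N then z else 0.
  have sq z : square_summable (d z).
    exists (`|z| ^+ 2) => -[|n]; first by rewrite big_ord0 exprn_ge0.
    rewrite big_ord_recl /= big1 ?addr0// => i _; by rewrite normr0 expr0n.
  exists (d xi), (d eta); split=> // h k.
  apply: cvg_near_cst; exists 1%N => // n /= n1.
  rewrite /series /= big_ltn// big_nat big1 ?addr0 /S ?BE// => -[|i] //= _.
  by rewrite (lin0 (hpure_linl _ _)) (lin0 WL_lin) ip0l.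
have : opspan (slice1 WL) S.
  move=> e e0; exists S; last by move=> x; rewrite subrr normr0; apply: mulr_ge0; [exact: ltW|exact: normr_ge0].
  exists 1%N, (fun=> 1), (fun=> S); split=> //; by rewrite big_ord1 scale1r.
rewrite -piA_range => -[a _ aE]; exists a => h k; by rewrite aE /S BE.
Qed.

Definition sl (p : L * L) : A := projT1 (cid (slice_ex p.1 p.2)).
Lemma slE xi eta h k : ip L (mop (piA (sl (xi, eta))) h) k = ip _ (WL (eta ⊙ h)) (xi ⊙ k).
Proof. by rewrite /sl; case: (cid _) => a /= ->. Qed.

(** The partial sums of $\|x_n\|\,\|y_n\|$ are bounded through the two square sums, so a tail of the
    series contributes at most [e] in norm and a finite sum of rank-one slices remains. *)
Lemma slice1_approx S : slice1 WL S -> forall e : R, 0 < e ->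
  exists2 b : A, inspan sl b & forall h, rn (S h - mop (piA b) h) <= e * rn h.
Proof.
move=> [x [y [[cx hx] [cy hy] hS]]] e e0.
pose s n := \sum_(i < n) (rn (x i) * rn (y i)).
have sb n : s n <= complex.Re cx + complex.Re cy.
  have hr (z : nat -> L) c : (forall n, \sum_(i < n) `|z i| ^+ 2 <= c) -> \sum_(i < n) rn (z i) ^+ 2 <= complex.Re c.
    move=> /(_ n); under eq_bigr do rewrite rnE -rcX.
    have -> : \sum_(i < n) rc (rn (z i) ^+ 2) = rc (\sum_(i < n) rn (z i) ^+ 2).
      by elim/big_ind2: _ => [|? ? ? ? -> ->|]; rewrite ?rc0 ?rcD.
    by rewrite lecE /= => /andP[].
  apply: le_trans (lerD (hr _ _ hx) (hr _ _ hy)); rewrite -big_split /=; apply: ler_sum => i _.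
  have := sqr_ge0 (rn (x i) - rn (y i)); have := mulr_ge0 (rn_ge0 (x i)) (rn_ge0 (y i)).
  rewrite sqrrB; lra.
have sinc n : s n <= s n.+1 by rewrite /s big_ord_recr /= lerDl mulr_ge0 ?rn_ge0.
have [N hN] := monotone_cauchy sinc sb e0.
exists (\sum_(i < N) sl (x i, y i)).
  by elim/big_ind: _ => [|? ? ? ?|i _]; [exact: inspan0|exact: inspanD|exact: inspan_gen].
move=> h; set b := \sum_(i < N) _.
pose F h k n := series (fun n => ip _ (WL (y n ⊙ h)) (x n ⊙ k)) n.
have bE k : ip L (mop (piA b) h) k = F h k N.
  rewrite /F /series /= big_mkord /b; elim: (N) => [|n IH].
    by rewrite !big_ord0 (lin0 (mor_lin (@piA_mor R M G))) mop0 ip0l.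
  by rewrite !big_ord_recr /= (linD (mor_lin (@piA_mor R M G))) mopD ipDl IH slE.
have est k : cn (ip L (S h - mop (piA b) h) k) <= e * rn h * rn k.
  apply/ler_addgt0Pr => d d0.
  have /cvgrPdist_lt/(_ (rc d)) := hS h k; rewrite rcgt0 => /(_ d0)[N' _ hN'].
  pose n := maxn N N'; have := hN' n (leq_maxr _ _); rewrite cnE rc_lt => /ltW h1.
  have h2 : cn (F h k n - F h k N) <= e * rn h * rn k.
    have st m : (N <= m)%N -> cn (F h k m - F h k N) <= (s m - s N) * (rn h * rn k).
      move=> /subnKC <-; elim: (m - N)%N => [|j IH]; first by rewrite addn0 !subrr mul0r cn0.
      rewrite addnS /F /series /= big_nat_recr//= /s big_ord_recr /=.
      rewrite addrAC [_ + rn _ * _ - _]addrAC mulrDl; apply: (le_trans (cnD _ _)); apply: lerD; first exact: IH.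
      apply: (le_trans (cauchy_schwarz _ _)); rewrite WL_rn !rn_hpure.
      by rewrite le_eqVlt; apply/orP; left; apply/eqP; ring.
    apply: (le_trans (st n (leq_maxl _ _))); rewrite -mulrA ler_wpM2r ?mulr_ge0 ?rn_ge0//.
    by apply: hN; exact: leq_maxl.
  have -> : ip L (S h - mop (piA b) h) k = (ip L (S h) k - F h k n) + (F h k n - F h k N).
    by rewrite ipBl bE addrA subrK.
  by apply: (le_trans (cnD _ _)); rewrite addrC lerD.
have [u0|u0] := eqVneq (rn (S h - mop (piA b) h)) 0; first by rewrite u0 mulr_ge0 ?rn_ge0// ltW.
have up : 0 < rn (S h - mop (piA b) h) by rewrite lt_neqAle eq_sym u0 rn_ge0.
rewrite -(ler_pM2r up); apply: le_trans (est _).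
by rewrite ip_rn cn_rc ger0_norm ?sqr_ge0// expr2.
Qed.

Lemma sl_total : total sl.
Proof.
have pm := @piA_mor R M G.
suff H a : inspan sl a by [].
apply: inspan_closed => e e0.
have : [set mop (piA a) | a in setT] (mop (piA a)) by exists a.
rewrite piA_range => /(_ (rc (e / 4))); rewrite rcgt0 => /(_ ltac:(by rewrite divr_gt0))[T' [n [c [s [hs ->]]]] hT].
(* The tolerance [e / 4] is spread over the [n] terms; the successor and the [+ 1] prevent division
   by 0. *)
have /choice[b hb] i : exists b, inspan sl b /\ forall h, rn (s i h - mop (piA b) h) <= e / 4 / (n.+1%:R * (cn (c i) + 1)) * rn h.
  have [|b b1 b2] := slice1_approx (hs i) (e := e / 4 / (n.+1%:R * (cn (c i) + 1))); last by exists b.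
  by rewrite divr_gt0 ?divr_gt0 ?mulr_gt0 ?ltr0n// ltr_wpDl ?cn_ge0.
exists (\sum_(i < n) c i *: b i).
  by elim/big_ind: _ => [|? ? ? ?|i _]; [exact: inspan0|exact: inspanD|apply: inspanZ; case: (hb i)].
suff : rn (a - \sum_(i < n) c i *: b i) <= e / 2 by move=> h; apply: (le_lt_trans h); rewrite ltr_pdivrMr// ltr_pMr// ltr1n.
apply: (mor_inj_le pm (@piA_inj R M G)); first by rewrite divr_ge0// ltW.
apply: bd_mop => [|h]; first by rewrite divr_ge0// ltW.
have e1 : mop (piA (\sum_(i < n) c i *: b i)) h = \sum_(i < n) c i *: mop (piA (b i)) h.
  elim/big_ind2: _ => [|? ? ? ? <- <-|i _]; first by rewrite (lin0 (mor_lin pm)) mop0.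
    by rewrite (linD (mor_lin pm)) mopD.
  by rewrite (linZ (mor_lin pm)) mopZ.
rewrite (linB (mor_lin pm)) mopD mopN e1.
have h1 : rn (mop (piA a) h - \sum_(i < n) c i *: s i h) <= e / 4 * rn h.
  have := hT h; rewrite !rnE -rcM rc_le fct_sumE; exact.
have h2 : rn (\sum_(i < n) c i *: s i h - \sum_(i < n) c i *: mop (piA (b i)) h) <= e / 4 * rn h.
  rewrite -sumrB.
  apply: (@le_trans _ _ (\sum_(i < n) (e / 4 / n.+1%:R * rn h))).
    elim/big_ind2: _ => [|? ? ? ? h2 h3|i _]; first by rewrite rn0.
      by apply: (le_trans (rnD _ _)); apply: lerD.
    rewrite -scalerBr rnZ; have c0 : 0 < cn (c i) + 1 by rewrite ltr_wpDl ?cn_ge0.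
    apply: (@le_trans _ _ ((cn (c i) + 1) * (e / 4 / (n.+1%:R * (cn (c i) + 1)) * rn h))).
      apply: ler_pM; rewrite ?cn_ge0 ?rn_ge0 ?lerDl//; by case: (hb i).
    rewrite mulrA ler_wpM2r ?rn_ge0// le_eqVlt; apply/orP; left; apply/eqP.
    by rewrite invfM mulrC -!mulrA mulVf ?gt_eqF// mulr1.
  have -> : \sum_(i < n) (e / 4 / n.+1%:R * rn h) = n%:R * (e / 4 / n.+1%:R * rn h).
    by rewrite sumr_const card_ord mulr_natl.
  rewrite mulrA ler_wpM2r ?rn_ge0//.
  rewrite mulrCA -[leRHS]mulr1 ler_wpM2l ?divr_ge0 ?ltW//.
  by rewrite ltr_pdivrMr ?ltr0n// mul1r ltr_nat.
rewrite -(subrK (\sum_(i < n) c i *: s i h) (mop _ h)) -addrA.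
by apply: (le_trans (rnD _ _)); apply: (le_trans (lerD h1 h2)); have := rn_ge0 h; lra.
Qed.
End Slices.

(** * The pentagon equation *)

Section Continuity.
Variables (R : realType) (V W : normedModType (cplx R)) (T : V -> W).
Hypothesis Tl : linear T.
Lemma bdd_continuous t : bdd T t -> continuous T.
Proof.
move=> Tb x; apply/cvgrPdist_lt => e /rc_gt0[r r0 ->].
have t1 : 0 < `|t| + 1 by rewrite ltr_wpDl.
apply/nbhs_ballP; exists (rc (r / (`|t| + 1))) => /=; first by rewrite rcgt0 divr_gt0.
move=> y; rewrite -ball_normE /= -(linB Tl) !rnE !rc_lt ltr_pdivlMr// => h.
apply: (le_lt_trans (Tb _)); apply: le_lt_trans h.
by rewrite mulrC ler_wpM2l ?rn_ge0//; have := ler_norm t; lra.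
Qed.
Lemma continuous_bdd : continuous T -> exists2 t, 0 <= t & bdd T t.
Proof.
move=> Tc; have /cvgrPdist_lt/(_ 1 ltr01) := Tc 0.
move=> /nbhs_ballP[d /= /rc_gt0[r r0 ->]] hd.
exists (2 / r) => [|x]; first by rewrite divr_ge0// ltW.
have [->|x0] := eqVneq x 0; first by rewrite (lin0 Tl) !rn0 mulr0.
have xp : 0 < rn x by rewrite lt_neqAle eq_sym rn_eq0 x0 rn_ge0.
have cp : 0 < r / 2 / rn x by rewrite !divr_gt0.
have := hd (rc (r / 2 / rn x) *: x); rewrite -ball_normE /= sub0r normrN (lin0 Tl) sub0r normrN.
rewrite (linZ Tl) !rnE -rc1 !rc_lt !rnZr !gtr0_norm// divfK ?gt_eqF//.
have -> : (r / 2 < r) = true by rewrite ltr_pdivrMr// ltr_pMr// ltr1n.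
move=> /(_ isT) h; rewrite -(@ler_pM2l _ (r / 2 / rn x))//.
have -> : r / 2 / rn x * (2 / r * rn x) = 1 by field; rewrite !gt_eqF.
exact: ltW.
Qed.
End Continuity.

Section Operators.
Variables (R : realType) (M : model R).
Local Notation C := (cplx R).
Local Notation "A ⊗ B" := (mten (ctens M A B)) (at level 40, left associativity).
Local Notation "x ⊙ y" := (hpure (htens M _ _) x y) (at level 40, left associativity).
Local Notation pu := (pure (ctens M _ _)).
Local Notation K := (compact M).
Local Notation inl A B := (@inl_mor R M A B).
Local Notation inr A B := (@inr_mor R M A B).
Local Notation pair f g := (@pair_mor R M _ _ _ f g).
Local Notation tensor f g := (@tensor_mor R M _ _ _ _ f g).
Local Notation "g ∘ f" := (mcomp g f) (at level 45, right associativity).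
Local Notation "X @[ f , g ]" := (ext (pair f g) X) (at level 1, left associativity, format "X @[ f ,  g ]").
Variable L : hilbert R.
Local Notation KL := (K L).
Local Notation tk := (@tk R M L).
Local Notation L3 := (htens M L (htens M L L)).
Local Notation kappa := (@compact_tensor R M L L).

Lemma tk_mop (m : multiplier KL) x y : m * mof (tk x y) = mof (tk (mop m x) y).
Proof. by rewrite -mof_mact mop_tk. Qed.

Lemma op_coef_eq (P Q : htens M L L -> htens M L L) :
  linear P -> linear Q -> continuous P -> continuous Q ->
  (forall h k h' k', ip _ (P (h ⊙ k)) (h' ⊙ k') = ip _ (Q (h ⊙ k)) (h' ⊙ k')) -> P = Q.
Proof.
move=> Pl Ql /(continuous_bdd Pl)[s _ Ps] /(continuous_bdd Ql)[t _ Qt] h.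
apply/funext => v; apply: (total_eq (hpure_tot (htens M L L)) Pl Ql Ps Qt) => -[x y] /=.
by apply: (ip_ext (hpure_tot (htens M L L))) => -[x' y']; exact: h.
Qed.
Lemma op3_coef_eq (P Q : L3 -> L3) :
  linear P -> linear Q -> continuous P -> continuous Q ->
  (forall x y z x' y' z', ip _ (P (x ⊙ (y ⊙ z))) (x' ⊙ (y' ⊙ z')) = ip _ (Q (x ⊙ (y ⊙ z))) (x' ⊙ (y' ⊙ z'))) -> P = Q.
Proof.
move=> Pl Ql /(continuous_bdd Pl)[s _ Ps] /(continuous_bdd Ql)[t _ Qt] h.
have tot := @hpure_total_of R _ _ L3 _ _ _ _ (@total_id R L) (hpure_tot (htens M L L)).
apply/funext => v; apply: (total_eq tot Pl Ql Ps Qt) => -[x [y z]] /=.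
by apply: (ip_ext tot) => -[x' [y' z']]; exact: h.
Qed.
Lemma mop_continuous (H : hilbert R) (m : multiplier (K H)) : continuous (mop m).
Proof. by have [t bt] := bounded_mop m; exact: bdd_continuous (mop_lin m) _ bt. Qed.
Lemma mop_coef_eq (m n : multiplier (K (htens M L L))) :
  (forall h k h' k', ip _ (mop m (h ⊙ k)) (h' ⊙ k') = ip _ (mop n (h ⊙ k)) (h' ⊙ k')) -> m = n.
Proof.
move=> h; apply: mop_inj => v; congr (_ v); apply: op_coef_eq => //; try exact: mop_lin; exact: mop_continuous.
Qed.

Variable e : L.
Hypothesis e1 : rn e = 1.

Lemma ip_e : ip L e e = 1. Proof. by rewrite ip_rn e1 expr1n rc1. Qed.

Definition kappa3 : KL ⊗ (KL ⊗ KL) -> multiplier (K L3) :=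
  @compact_tensor R M L (htens M L L) ∘ tensor (@mof R KL) kappa.
Lemma kappa3_mor : is_mor kappa3.
Proof. by apply: mcomp_mor; [exact: compact_mor|apply: tensor_is_mor; [exact: mof_mor|exact: compact_mor]]. Qed.
Lemma kappa3_inj : injective kappa3.
Proof.
apply: mcomp_inj; [exact: compact_mor|exact: compact_inj|].
by apply: tensor_inj; [exact: mof_mor|exact: compact_mor|exact: mof_inj|exact: compact_inj].
Qed.
Lemma kappa3E m n x y : mop (ext kappa3 (mtens M m n)) (x ⊙ y) = mop m x ⊙ mop (ext kappa n) y.
Proof.
rewrite /kappa3 ext_mcomp; [|exact: compact_mor|apply: tensor_is_mor; [exact: mof_mor|exact: compact_mor]].
rewrite tensor_mtens ?compact_mtens ?ext_mof_id//; [exact: mof_mor|exact: compact_mor].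
Qed.

Lemma vec_pure x y : x ⊙ y = mop (kappa (pu (tk x e) (tk y e))) (e ⊙ e).
Proof. by have [_ _ ->] := compact_tensor_spec M L L; rewrite !tkE ip_e !scale1r. Qed.

Section LegOperators.
Variables (i j : KL -> multiplier (KL ⊗ (KL ⊗ KL))).
Variables (iv : L -> L -> L -> L3).
Hypothesis ij : cp M i j.
Hypothesis ivE : forall m n x y z, mop (ext kappa3 (ext i m * ext j n)) (iv x y z) = iv (mop m x) (mop n y) z.
Hypothesis iv_ip : forall x y z x' y' z', ip _ (iv x y z) (iv x' y' z') = ip L x x' * ip L y y' * ip L z z'.

Let im : is_mor i := cp1 ij.
Let jm : is_mor j := cp2 ij.
Let pm : is_mor (pair i j) := cp_mor ij.

Lemma leg_op_pure (w : KL ⊗ KL) z x' y' z' :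
  ip _ (mop (ext kappa3 (pair i j w)) (iv e e z)) (iv x' y' z') =
  ip _ (mop (kappa w) (e ⊙ e)) (x' ⊙ y') * ip L z z'.
Proof.
have km := compact_mor M L L; have k3m := kappa3_mor.
pose f1 w : cplx_line R := ip _ (mop (ext kappa3 (pair i j w)) (iv e e z)) (iv x' y' z').
pose f2 w : cplx_line R := ip _ (mop (kappa w) (e ⊙ e)) (x' ⊙ y') * ip L z z'.
suff : f1 w = f2 w by [].
apply: (@total_eq _ _ _ _ _ f1 f2 (rn (iv e e z) * rn (iv x' y' z'))
  (rn (e ⊙ e) * rn (x' ⊙ y') * cn (ip L z z')) (pure_tot M KL KL)).
- by move=> c u v; rewrite /f1 (mor_lin pm) (ext_lin k3m) mop_linl ipDl ipZl.
- by move=> c u v; rewrite /f2 (mor_lin km) mop_linl ipDl ipZl mulrDl -mulrA.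
- move=> u; rewrite rn_line; apply: (le_trans (cauchy_schwarz _ _)).
  rewrite mulrAC ler_wpM2r ?rn_ge0// mulrC; apply: mop_bd; apply: ext_bd => //; first exact: rn_ge0.
  exact: mor_bd.
- move=> u; rewrite rn_line cnM mulrAC ler_wpM2r ?cn_ge0//; apply: (le_trans (cauchy_schwarz _ _)).
  by rewrite mulrAC ler_wpM2r ?rn_ge0// mulrC; apply: rep_bdd.
move=> [k l]; rewrite /f1 /f2 /= (pairE (let: And3 _ _ c := ij in c)).
rewrite -(ext_mof im k) -(ext_mof jm l) ivE iv_ip.
by have [_ _ ->] := compact_tensor_spec M L L; rewrite hpure_ip !mop_mof.
Qed.

(** [iv] takes the vectors of the two active legs first and that of the idle leg last, so one
    computation serves the legs 12, 13 and 23. Vectors are produced from [e] by compact operators,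
    which replaces the multiplier [m] by an element of the tensor product. *)
Lemma leg_op (m : multiplier (KL ⊗ KL)) x y z x' y' z' :
  ip _ (mop (ext kappa3 (m@[i, j])) (iv x y z)) (iv x' y' z') =
  ip _ (mop (ext kappa m) (x ⊙ y)) (x' ⊙ y') * ip L z z'.
Proof.
have km := compact_mor M L L; have k3m := kappa3_mor.
have -> : iv x y z = mop (ext kappa3 (pair i j (pu (tk x e) (tk y e)))) (iv e e z).
  rewrite (pairE (let: And3 _ _ c := ij in c)) -(ext_mof im) -(ext_mof jm) ivE !mop_mof.
  by rewrite !tkE ip_e !scale1r.
rewrite vec_pure -!mopM -(extM k3m) !ext_mul_mor //; exact: leg_op_pure.
Qed.
End LegOperators.

(** Both operators have the same matrix coefficients at elementary vectors; the continuity required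
    by [the_operator] makes such an operator unique. *)
Lemma op12E m : op12 (mop (ext kappa m)) = mop (ext kappa3 (leg12 KL m)).
Proof.
pose P T := [/\ linear T, continuous (T : L3 -> L3) & forall x y z x' y' z',
    ip _ (T (x ⊙ (y ⊙ z))) (x' ⊙ (y' ⊙ z')) = ip _ (mop (ext kappa m) (x ⊙ y)) (x' ⊙ y') * ip _ z z'].
have h : P (mop (ext kappa3 (leg12 KL m))).
  split; [exact: mop_lin|exact: mop_continuous|move=> x y z x' y' z'].
  apply: (leg_op (iv := fun x y z => x ⊙ (y ⊙ z)) (leg_cp12 M KL KL KL)) => [m1 n1 x1 y1 z1|*].
    rewrite /leg2 ext_mcomp ?ext_inl ?ext_inr; [|exact: inr_is_mor|exact: inl_is_mor].
    by rewrite -mtensM mulr1 mul1r kappa3E compact_mtens mop1.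
  by rewrite !hpure_ip mulrA.
have [Ql Qc Qe] : P (op12 (mop (ext kappa m))) by apply: (@theP (L3 -> L3) id P); eexists; exact: h.
by have [Pl Pc Pe] := h; apply: op3_coef_eq => // *; rewrite Pe Qe.
Qed.
Lemma op13E m : op13 (mop (ext kappa m)) = mop (ext kappa3 (leg13 KL m)).
Proof.
pose P T := [/\ linear T, continuous (T : L3 -> L3) & forall x y z x' y' z',
    ip _ (T (x ⊙ (y ⊙ z))) (x' ⊙ (y' ⊙ z')) = ip _ (mop (ext kappa m) (x ⊙ z)) (x' ⊙ z') * ip _ y y'].
have h : P (mop (ext kappa3 (leg13 KL m))).
  split; [exact: mop_lin|exact: mop_continuous|move=> x y z x' y' z'].
  apply: (leg_op (iv := fun x z y => x ⊙ (y ⊙ z)) (leg_cp13 M KL KL KL)) => [m1 n1 x1 y1 z1|*].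
    rewrite /leg3 ext_mcomp ?ext_inl ?ext_inr; [|exact: inr_is_mor|exact: inr_is_mor].
    by rewrite -mtensM mulr1 mul1r kappa3E compact_mtens mop1.
  by rewrite !hpure_ip; ring.
have [Ql Qc Qe] : P (op13 (mop (ext kappa m))) by apply: (@theP (L3 -> L3) id P); eexists; exact: h.
by have [Pl Pc Pe] := h; apply: op3_coef_eq => // *; rewrite Pe Qe.
Qed.
Lemma op23E m : op23 (mop (ext kappa m)) = mop (ext kappa3 (leg23 KL m)).
Proof.
pose P T := [/\ linear T, continuous (T : L3 -> L3) & forall x y z x' y' z',
    ip _ (T (x ⊙ (y ⊙ z))) (x' ⊙ (y' ⊙ z')) = ip _ x x' * ip _ (mop (ext kappa m) (y ⊙ z)) (y' ⊙ z')].
have h : P (mop (ext kappa3 (leg23 KL m))).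
  split; [exact: mop_lin|exact: mop_continuous|move=> x y z x' y' z'].
  rewrite [RHS]mulrC.
  apply: (leg_op (iv := fun y z x => x ⊙ (y ⊙ z)) (leg_cp23 M KL KL KL)) => [m1 n1 x1 y1 z1|*].
    rewrite /leg2 /leg3 (ext_mcomp m1 (@inr_is_mor R M KL _) (@inl_is_mor R M KL KL)).
    rewrite (ext_mcomp n1 (@inr_is_mor R M KL _) (@inr_is_mor R M KL KL)) !ext_inl !ext_inr.
    by rewrite -mtensM mulr1 -mtensM mulr1 mul1r kappa3E compact_mtens mop1.
  by rewrite !hpure_ip; ring.
have [Ql Qc Qe] : P (op23 (mop (ext kappa m))) by apply: (@theP (L3 -> L3) id P); eexists; exact: h.
by have [Pl Pc Pe] := h; apply: op3_coef_eq => // *; rewrite Pe Qe.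
Qed.

Lemma pentagon m : multiplicative (mop (ext kappa m)) ->
  leg23 KL m * leg12 KL m = leg12 KL m * leg13 KL m * leg23 KL m.
Proof.
rewrite /multiplicative op12E op13E op23E => h.
apply: (ext_inj kappa3_mor kappa3_inj); apply: mop_inj => v.
by rewrite !(extM kappa3_mor) !mopM; exact: (congr1 (@^~ v) h).
Qed.
End Operators.

Section AmpComp.
Variables (R : realType) (M : model R) (A A' A2 B B' B2 : cstar R).
Variables (f : A -> multiplier A') (f' : A' -> multiplier A2) (g : B -> multiplier B') (g' : B' -> multiplier B2).
Hypotheses (fm : is_mor f) (fm' : is_mor f') (gm : is_mor g) (gm' : is_mor g').
Variable X : multiplier (mten (ctens M A B)).
Lemma amp_comp : amp f' g' (amp f g X) = amp (mcomp f' f) (mcomp g' g) X.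
Proof.
rewrite {1}/amp tensorE at_amp// ?/amp ?tensorE -?mcompA//; try by [exact: inl_is_mor|exact: inr_is_mor].
exact: cp_tensor.
Qed.
Lemma amp_lr : amp_l f (amp_r g X) = amp f g X.
Proof.
rewrite {1}/amp_l tensorE at_ampr ?/amp ?tensorE ?mcomp_mofr// ?mcomp_mofl//; try exact: inr_is_mor.
by apply: cp_prel => //; exact: cp_inlr.
Qed.
Lemma amp_rl : amp_r g (amp_l f X) = amp f g X.
Proof.
rewrite {1}/amp_r tensorE at_ampl ?/amp ?tensorE ?mcomp_mofr// ?mcomp_mofl//; try exact: inl_is_mor.
by apply: cp_prer => //; exact: cp_inlr.
Qed.
End AmpComp.

Section QuantumGroupBasics.
Variables (R : realType) (M : model R) (G : quantum_group M).
Local Notation C := (cplx R).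
Local Notation "A ⊗ B" := (mten (ctens M A B)) (at level 40, left associativity).
Local Notation "x ⊙ y" := (hpure (htens M _ _) x y) (at level 40, left associativity).
Local Notation pu := (pure (ctens M _ _)).
Local Notation L := (qL G).
Local Notation K := (compact M L).
Local Notation A := (qA G).
Local Notation Ahat := (qAhat G).
Local Notation tk := (@tk R M L).
Local Notation WL := (@WW R M G).
Local Notation W := (@qW R M G).
Local Notation al := (@piA R M G).
Local Notation be := (@piAhat R M G).
Local Notation inl A B := (@inl_mor R M A B).
Local Notation inr A B := (@inr_mor R M A B).
Local Notation pair f g := (@pair_mor R M _ _ _ f g).
Local Notation tensor f g := (@tensor_mor R M _ _ _ _ f g).
Local Notation "g ∘ f" := (mcomp g f) (at level 45, right associativity).
Local Notation "X @[ f , g ]" := (ext (pair f g) X) (at level 1, left associativity, format "X @[ f ,  g ]").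
Local Notation kappa := (@compact_tensor R M L L).
Local Notation mten m n := (mtens M m n).
Local Notation Delta := (@qDelta R M G).
Local Notation cp := (cp M).
Local Notation cp3 := (cp3 M).

Let alm : is_mor al := piA_mor G.
Let bem : is_mor be := piAhat_mor G.
Let Dm : is_mor Delta := qDelta_mor G.

Definition XW : multiplier (K ⊗ A) := amp_l be W.

Lemma XW_al : amp_r al XW = amp be al W.
Proof. exact: amp_rl. Qed.

Lemma pure_injr (B D : cstar R) (k : B) (x y : D) : k != 0 -> pu k x = pu k y -> x = y.
Proof.
rewrite -rn_eq0 => k0 h; have : pu k (x - y) = 0 by rewrite (linB (pure_linr M k)) h subrr.
move/(congr1 (@rn _ _)); rewrite rn_pureE rn0 => /eqP; rewrite mulf_eq0 (negPf k0) rn_eq0 subr_eq0.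
by move/eqP.
Qed.

Variable e : L.
Hypothesis e1 : rn e = 1.
Let p := tk e e.

Lemma p_idem : p ** p = p. Proof. by rewrite tk_tk ip_e// scale1r. Qed.
Lemma p_neq0 : p != 0. Proof. by rewrite -rn_eq0 rn_tk e1 mulr1 oner_eq0. Qed.

Lemma mtens_p_inj (D : cstar R) (m n : multiplier D) : mten (mof p) m = mten (mof p) n -> m = n.
Proof.
move=> h; apply: multP => x; apply: (pure_injr p_neq0).
by have := congr1 (fun z : multiplier (K ⊗ D) => z (pu p x)) h; rewrite /= !mtensE /= p_idem.
Qed.

(* Compressing the first leg to the line of e turns a multiplier of K (x) A into its slices. *)
Lemma XW_slice xi eta :
  mten (mof (tk e xi)) 1 * XW * mten (mof (tk eta e)) 1 = mten (mof p) (mof (sl (xi, eta))).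
Proof.
have tm : is_mor (tensor (@mof R K) al) by apply: tensor_is_mor => //; exact: mof_mor.
have ti : injective (tensor (@mof R K) al).
  by apply: tensor_inj => //; [exact: mof_mor|exact: mof_inj|exact: piA_inj].
have km := compact_mor M L L.
apply: (ext_inj tm ti); rewrite !(extM tm) -/(amp_r al XW) XW_al.
rewrite !(tensor_mtens M (@mof_mor R K) alm) !ext_mof_id !(ext_mof alm) (ext1 alm).
apply: (ext_inj km (@compact_inj R M L L)); rewrite !(extM km); apply: mop_coef_eq => h k h' k'.
rewrite !mopM !compact_mtens !mop1 !mop_mof !tkE mop_adj -(ext_adj km) mtens_adj adj1 -mof_star star_tk.
rewrite compact_mtens mop_mof mop1 tkE -/(amp be al W) (qW_WW G).
rewrite (linZ (hpure_linl _ _)) (linZ (@WL_lin R M G)) (linZ (hpure_linl _ _)) ipZl ipZr -slE hpure_ip ipZl.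
by rewrite -ipC mulrA.
Qed.

(** By [XW_slice], compressing the first leg of $(\mathrm{id}\otimes k)W$ gives [k] at a slice of
    [W], and the slices are total in [A]. *)
Lemma sep_A (B : cstar R) (f g : A -> multiplier B) : is_mor f -> is_mor g -> amp_r f W = amp_r g W -> f = g.
Proof.
move=> fm gm h; apply: (mor_eq fm gm (@sl_total R M G)) => -[xi eta].
suff H (k : A -> multiplier B) : is_mor k -> mten (mof p) (k (sl (xi, eta))) =
    mten (mof (tk e xi)) 1 * amp_l be (amp_r k W) * mten (mof (tk eta e)) 1.
  by apply: mtens_p_inj; rewrite !H// h.
move=> km; have tm : is_mor (tensor (@mof R K) k) by apply: tensor_is_mor => //; exact: mof_mor.
rewrite amp_lr// -amp_rl//; have := congr1 (ext (tensor (@mof R K) k)) (XW_slice xi eta).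
rewrite !(extM tm) !(tensor_mtens M (@mof_mor R K) km) !ext_mof_id (ext_mof km) (ext1 km).
by move=> <-.
Qed.

Lemma A_neq0 : exists a : A, a != 0.
Proof.
apply: contrapT => h; have a0 (a : A) : a = 0.
  by apply: contrapT => /eqP an; apply: h; exists a.
have := rep_total alm e ltr01 => -[l]; have -> : comb (fun q : A * L => mop (al q.1) q.2) l = 0.
  by apply: big1 => q _; rewrite (a0 q.2.1) (lin0 (mor_lin alm)) mop0 scaler0.
by rewrite subr0 e1 ltxx.
Qed.

Lemma at_W (E : cstar R) (f : Ahat -> multiplier E) (g h : A -> multiplier E) : cp3 f g h ->
  W@[f, pair g h ∘ Delta] = W@[f, g] * W@[f, h].
Proof. by move=> c; apply: at_bi2 => //; exact: qDelta_W. Qed.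

Lemma WK_unitary : unitary XW.
Proof. by apply: ext_unitary; [apply: tensor_is_mor => //; exact: mof_mor|exact: qW_unitary]. Qed.

(* [W_{1 al} W_13 W_{be 3} = W_{be 3} W_{1 al}] in [M(Ahat (x) (K (x) A))]: the pentagon. *)
Lemma pentagon_W :
  let l2 := @leg2 R M Ahat K A in let l3 := @leg3 R M Ahat K A in let l1 := @leg1 R M Ahat K A in
  W@[l2 ∘ be, l3] * W@[l1, l2 ∘ al] = W@[l1, l2 ∘ al] * W@[l1, l3] * W@[l2 ∘ be, l3].
Proof.
move=> l2 l3 l1.
have tm : is_mor (tensor (@mof R K) al) by apply: tensor_is_mor => //; exact: mof_mor.
have tm2 : is_mor (tensor be (tensor (@mof R K) al)) by apply: tensor_is_mor.
have ti2 : injective (tensor be (tensor (@mof R K) al)).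
  apply: tensor_inj => //; first exact: piAhat_inj.
  by apply: tensor_inj => //; [exact: mof_mor|exact: mof_inj|exact: piA_inj].
apply: (ext_inj tm2 ti2); rewrite !(extM tm2).
have c12 : cp l1 l2 := leg_cp12 M Ahat K A; have c13 : cp l1 l3 := leg_cp13 M Ahat K A.
have c23 : cp l2 l3 := leg_cp23 M Ahat K A.
have d12 := leg_cp12 M K K K; have d13 := leg_cp13 M K K K; have d23 := leg_cp23 M K K K.
have i1 X Y := @inl_is_mor R M X Y; have i2 X Y := @inr_is_mor R M X Y.
have t1 : tensor be (tensor (@mof R K) al) ∘ l1 = @leg1 R M K K K ∘ be by exact: tensor_inl.
have t2 : tensor be (tensor (@mof R K) al) ∘ l2 = @leg2 R M K K K.
  have mm := @mof_mor R K; have tm0 := tensor_is_mor M mm alm.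
  rewrite /l2 /leg2 mcompA// tensor_inr// -mcompA// tensor_inl//.
  by rewrite (mcomp_mofr (i1 K K)).
have t3 : tensor be (tensor (@mof R K) al) ∘ l3 = @leg3 R M K K K ∘ al.
  have mm := @mof_mor R K; have tm0 := tensor_is_mor M mm alm.
  by rewrite /l3 /leg3 mcompA// tensor_inr// -mcompA// tensor_inr// mcompA.
clearbody l1 l2 l3; rewrite !(at_post (cp_prer c12 alm) _ tm2) !(at_post (cp_prel c23 bem) _ tm2) !(at_post c13 _ tm2).
rewrite !mcompA ?t1 ?t2 ?t3//; try by [exact: cp1 c12|exact: cp2 c12].
rewrite -!(at_amp _ _ bem alm) //.
apply: (pentagon e1); rewrite qW_WW; exact: WW_multiplicative.
Qed.

(** Conjugation of [X] by [u] becomes a change of one leg as soon as [u] commutes with the other;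
    operator identities are thereby traded for identities of morphisms. *)
Lemma at_conj (A1 A2 E : cstar R) (f : A1 -> multiplier E) (g : A2 -> multiplier E) (u : multiplier E) X :
  cp f g -> unitary u -> (forall a, u * f a = f a * u) ->
  cp f (fun a => u * g a * mstar u) /\ X@[f, fun a => u * g a * mstar u] = u * X@[f, g] * mstar u.
Proof.
move=> c [uu vv] uf; have pm := cp_mor c; have hm := conj_mor pm (conj uu vv).
have {}uu : u * mstar u = 1 := uu; have {}vv : mstar u * u = 1 := vv.
have uf' a : f a * mstar u = mstar u * f a.
  by rewrite -[LHS]mul1r -vv -!mulrA; congr (_ * _); rewrite mulrA uf -mulrA uu mulr1.
set g' := fun a => _; have g'm : is_mor g' by apply: conj_mor => //; exact: cp2 c.
have hE a b : u * pair f g (pu a b) * mstar u = f a * g' b.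
  by rewrite (pairE (let: And3 _ _ k := c in k)) /g' !mulrA uf.
have cc : compat M f g' by exists (fun x => u * pair f g x * mstar u).
split; first by split=> //; exact: cp1 c.
have -> : pair f g' = fun x => u * pair f g x * mstar u by symmetry; apply: pair_uniq.
symmetry; apply: ext_uniq => // x y; rewrite -!mulmE; congr (mact _ y).
by rewrite -!mulrA (mulrA (mstar u)) vv mul1r !mulrA -(mulrA u) ext_mul_mor.
Qed.

Definition alD := tensor al (@mof R A) ∘ Delta.
(** Write $\alpha$ for [al]. After [sep_A] has moved the claim to [W], one side becomes
    $W_{1\alpha}W_{13}$ and the other a conjugate of $W_{1\alpha}$; that they agree is the pentagon
    equation. *)
Lemma covariant_al (a : A) : alD a = XW * mten (al a) 1 * mstar XW.
Proof.
have i1 X Y := @inl_is_mor R M X Y; have i2 X Y := @inr_is_mor R M X Y.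
have XU := WK_unitary; have mA := @mof_mor R A.
have tal := tensor_is_mor M alm mA.
pose g := inl K A ∘ al; have gm : is_mor g by exact: mcomp_mor.
have gE a' : g a' = mten (al a') 1 by rewrite /g /mcomp ext_inl.
rewrite -gE; suff -> : alD = (fun a => XW * g a * mstar XW) by [].
apply: sep_A; [exact: mcomp_mor|exact: conj_mor|].
pose l1 := @leg1 R M Ahat K A; pose l2 := @leg2 R M Ahat K A; pose l3 := @leg3 R M Ahat K A.
have c12 : cp l1 l2 := leg_cp12 M Ahat K A; have c13 : cp l1 l3 := leg_cp13 M Ahat K A.
have c23 : cp l2 l3 := leg_cp23 M Ahat K A.
have c123 : cp3 l1 l2 l3 := leg_cp3 M Ahat K A.
have ampE k : is_mor k -> amp_r k W = W@[l1, inr Ahat (K ⊗ A) ∘ k].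
  by move=> km; rewrite /amp_r tensorE mcomp_mofr.
rewrite !ampE; [|exact: conj_mor|exact: mcomp_mor].
have -> : inr Ahat (K ⊗ A) ∘ alD = pair (l2 ∘ al) l3 ∘ Delta.
  rewrite /alD (mcompA Delta (i2 _ _) tal) tensorE (mcomp_mofr (i2 K A)) pair_post//.
    by rewrite /l2 /leg2 (mcompA al (i2 Ahat (K ⊗ A)) (i1 K A)).
  by apply: cp_prel => //; exact: cp_inlr.
rewrite at_W; last by apply: cp3_pre2.
pose u := W@[l2 ∘ be, l3].
have uE : ext (inr Ahat (K ⊗ A)) XW = u.
  rewrite /u -at_ampl// /XW -/l2 -leg_pair23 //.
have uU : unitary u by rewrite -uE; apply: ext_unitary.
have -> : inr Ahat (K ⊗ A) ∘ (fun a => XW * g a * mstar XW) = fun a => u * (l2 ∘ al) a * mstar u.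
  by apply/funext => x; rewrite /mcomp !(extM (i2 _ _)) (ext_adj (i2 _ _)) uE /g /mcomp -(ext_mcomp (al x) (i2 Ahat (K ⊗ A)) (i1 K A)).
have c1al : cp l1 (l2 ∘ al) by apply: cp_prer.
have uf x : u * l1 x = l1 x * u.
  have c1r : cp l1 (inr Ahat (K ⊗ A)) := cp_inlr M Ahat (K ⊗ A).
  by rewrite -uE -(ext_mof (cp1 c1r) x) (cpC c1r).
have [_ ->] := at_conj W c1al uU uf.
have [_ vv] := uU; have {}uu : u * mstar u = 1 by case: uU.
by rewrite /u pentagon_W -/u -!mulrA uu mulr1.
Qed.
End QuantumGroupBasics.

Section OpspanMof.
Variables (R : realType) (D : cstar R).
Local Notation C := (cplx R).

Lemma opspan_approx (V : normedModType C) (S : Type) (s : S -> V -> V) T :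
  opspan [set T | exists i, T = s i] T <->
  forall r : R, 0 < r -> exists l : seq (C * S), forall x, rn (T x - \sum_(p <- l) p.1 *: s p.2 x) <= r * rn x.
Proof.
split=> [h r r0|h e /rc_gt0[r r0 ->]].
  have := h (rc r); rewrite rcgt0 => /(_ r0)[T' /lspanP[l ->] hT]; exists l => x.
  by have := hT x; rewrite !rnE -rcM rc_le /comb fct_sumE.
have [l hl] := h r r0; exists (comb s l); first by apply/lspanP; exists l.
by move=> x; rewrite !rnE -rcM rc_le /comb fct_sumE; exact: hl.
Qed.

(** Converts density in [D], the form in which it gets proved, into the equality of sets of
    operators that [coaction] demands. *)
Lemma opspan_mof S (s : S -> D) : total s ->
  opspan [set T | exists i, T = mact (mof (s i))] = [set mact (mof x) | x in [set: D]].
Proof.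
move=> st; have combE l x : \sum_(p <- l) p.1 *: mof (s p.2) x = comb s l ** x.
  by symmetry; exact: (comb_lin s l (mulA_linl x)).
apply/seteqP; split=> T.
  move=> /(opspan_approx (fun i => mact (mof (s i)))) h.
  have /choice[l hl] (n : nat) := h n.+1%:R^-1 ltac:(by rewrite invr_gt0 ltr0n).
  pose u n := comb s (l n).
  have ub m n : rn (u m - u n) <= m.+1%:R^-1 + n.+1%:R^-1.
    apply: mof_bd; first by rewrite addr_ge0 ?invr_ge0 ?ler0n.
    move=> x; rewrite mofE cmulBl -!combE.
    have := hl m x; have := hl n x; set a := \sum_(p <- l m) _; set b := \sum_(p <- l n) _.
    have := rn_tri (T x) a b; rewrite (rnB a (T x)) mulrDl.
    by set i := m.+1%:R^-1; set j := n.+1%:R^-1; lra.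
  have [y uy] : exists y, tends u y.
    apply: cauchy_tends => d d0; have [N hN] := @inv_small R (d / 2) ltac:(by rewrite divr_gt0).
    exists N => m n /hN hm /hN hn; apply: (le_lt_trans (ub m n)); rewrite (splitr d); exact: ltrD.
  exists y => //; apply/funext => x /=; apply: eq_small => d d0.
  have x1 : 0 < rn x + 1 by rewrite ltr_wpDl ?rn_ge0.
  have dx : 0 < d / (rn x + 1) / 2 by rewrite !divr_gt0.
  have [N hN] := uy _ dx; have [N' hN'] := inv_small dx.
  pose n := maxn N N'; have h1 := hN n (leq_maxl _ _); have h2 := hN' n (leq_maxr _ _).
  have h3 := hl n x; rewrite combE -/(u n) in h3.
  have h4 : rn (y ** x - u n ** x) <= rn (u n - y) * rn x by rewrite -cmulBl (rnB (u n)); exact: rnM.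
  have h5 := rn_tri (u n ** x) (y ** x) (T x); rewrite (rnB (u n ** x) (T x)) in h5.
  apply: (le_trans h5).
  have h6 : rn (u n - y) * rn x <= d / (rn x + 1) / 2 * rn x by rewrite ler_wpM2r ?rn_ge0// ltW.
  have h7 : n.+1%:R^-1 * rn x <= d / (rn x + 1) / 2 * rn x by rewrite ler_wpM2r ?rn_ge0// ltW.
  have h8 : d / (rn x + 1) * rn x < d by rewrite mulrAC ltr_pdivrMr// ltr_pM2l// ltrDl.
  set q := d / (rn x + 1) in h6 h7 h8; set i := n.+1%:R^-1 in h3 h7; lra.
move=> [y _ <-]; apply/(opspan_approx (fun i => mact (mof (s i)))) => r r0.
have [l hl] := st y r r0; exists l => x; rewrite combE /= -cmulBl; apply: (le_trans (rnM _ _)).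
by rewrite ler_wpM2r ?rn_ge0// ltW.
Qed.
End OpspanMof.

Lemma unitary_bd (R : realType) (B : cstar R) (u : multiplier B) : unitary u -> bd u 1.
Proof.
move=> [_ h]; apply: bd_sq => //; rewrite -[mstar u * u]/(mstar u *M u) h expr1n; exact: bd1.
Qed.

Section SplitPair.
Variables (R : realType) (M : model R).
Local Notation "A ⊗ B" := (mten (ctens M A B)) (at level 40, left associativity).
Lemma cp3_split (A B E F : cstar R) (f : A -> multiplier F) (h : B ⊗ E -> multiplier F) :
  cp M f h -> cp3 M f (mcomp h (@inl_mor R M B E)) (mcomp h (@inr_mor R M B E)).
Proof.
move=> c; have hm := cp2 c; split; first by apply: cp_post => //; exact: cp_inlr.
by rewrite -pair_post// ?pair_inlr ?mcomp_mofr//; exact: cp_inlr.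
Qed.
Lemma pair_split (B E F : cstar R) (h : B ⊗ E -> multiplier F) : is_mor h ->
  @pair_mor R M _ _ _ (mcomp h (@inl_mor R M B E)) (mcomp h (@inr_mor R M B E)) = h.
Proof. by move=> hm; rewrite -pair_post// ?pair_inlr ?mcomp_mofr//; exact: cp_inlr. Qed.
End SplitPair.

(** * The regular coaction *)

Section RegularCoaction.
Variables (R : realType) (M : model R) (G : quantum_group M).
Local Notation C := (cplx R).
Local Notation "A ⊗ B" := (mten (ctens M A B)) (at level 40, left associativity).
Local Notation pu := (pure (ctens M _ _)).
Local Notation L := (qL G).
Local Notation K := (compact M L).
Local Notation A := (qA G).
Local Notation Ahat := (qAhat G).
Local Notation tk := (@tk R M L).
Local Notation W := (@qW R M G).
Local Notation al := (@piA R M G).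
Local Notation be := (@piAhat R M G).
Local Notation inl A B := (@inl_mor R M A B).
Local Notation inr A B := (@inr_mor R M A B).
Local Notation pair f g := (@pair_mor R M _ _ _ f g).
Local Notation tensor f g := (@tensor_mor R M _ _ _ _ f g).
Local Notation "g ∘ f" := (mcomp g f) (at level 45, right associativity).
Local Notation "X @[ f , g ]" := (ext (pair f g) X) (at level 1, left associativity, format "X @[ f ,  g ]").
Local Notation mten m n := (mtens M m n).
Local Notation Delta := (@qDelta R M G).
Local Notation cp := (cp M).
Local Notation XW := (XW G).
Let alm : is_mor al := piA_mor G.
Let bem : is_mor be := piAhat_mor G.
Let Dm : is_mor Delta := qDelta_mor G.
Let i1 X Y : is_mor (inl X Y) := @inl_is_mor R M X Y.
Let i2 X Y : is_mor (inr X Y) := @inr_is_mor R M X Y.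

Variable e : L.
Hypothesis e1 : rn e = 1.
Let p := tk e e.

Lemma at_W_split (E : cstar R) (f : Ahat -> multiplier E) (h : A ⊗ A -> multiplier E) : cp f h ->
  W@[f, h ∘ Delta] = W@[f, h ∘ inl A A] * W@[f, h ∘ inr A A].
Proof. by move=> c; rewrite -(at_W (cp3_split c)) pair_split//; exact: cp2 c. Qed.

(** By covariance [Delta a] determines the conjugate of $\alpha(a)\otimes1$ by [XW], and a nonzero
    element of [A] makes $x\mapsto x\otimes1$ injective. *)
Lemma Delta_inj : injective Delta.
Proof.
have [a0 a00] := A_neq0 e1.
move=> a b h; apply: (@piA_inj R M G); apply: (ext_inj (i1 K A) (inl_inj a00)).
rewrite !ext_inl; have := covariant_al e1 a; have := covariant_al e1 b; rewrite /alD /mcomp h => ->.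
have [uu vv] := WK_unitary G; have {}vv : mstar XW * XW = 1 := vv.
move=> /(congr1 (fun z => mstar XW * z * XW)).
by rewrite -!mulrA vv !mulr1 !mulrA vv !mul1r => ->.
Qed.

(** Both sides send [W] to the product of its copies on the legs 12, 13 and 14, and [sep_A]
    concludes. *)
Lemma Delta_coassoc : tensor (@mof R A) Delta ∘ Delta = @reassoc R M A A A ∘ (tensor Delta (@mof R A) ∘ Delta).
Proof.
have mA := @mof_mor R A; have tD := tensor_is_mor M mA Dm; have Dt := tensor_is_mor M Dm mA.
have rm : is_mor (@reassoc R M A A A) := cp_mor (leg_cp12_3 M A A A).
have rl : @reassoc R M A A A ∘ inl _ _ = pair (@leg1 R M A A A) (@leg2 R M A A A) := cp_inl (leg_cp12_3 M A A A).
have rr : @reassoc R M A A A ∘ inr _ _ = @leg3 R M A A A := cp_inr (leg_cp12_3 M A A A).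
apply: (sep_A e1); [exact: mcomp_mor|by apply: mcomp_mor => //; exact: mcomp_mor|].
pose r := inr Ahat (A ⊗ (A ⊗ A)); pose q := inl Ahat (A ⊗ (A ⊗ A)).
have rm' : is_mor r by exact: i2.
have qr : cp q r := cp_inlr M _ _.
have ampE k : is_mor k -> amp_r k W = W@[q, r ∘ k].
  by move=> km; rewrite /amp_r tensorE mcomp_mofr.
clearbody r q.
rewrite !ampE; [|by apply: mcomp_mor => //; exact: mcomp_mor|exact: mcomp_mor].
rewrite (mcompA Delta rm' tD) (at_W_split (cp_prer qr tD)).
rewrite -!(mcompA _ rm' tD) tensor_inl// tensor_inr// (mcomp_mofr (i1 _ _)).
rewrite (mcompA Delta rm' (i2 A (A ⊗ A))) (at_W_split (cp_prer qr (i2 _ _))).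
rewrite (mcompA Delta rm Dt) (mcompA Delta rm' (mcomp_mor rm Dt)) (at_W_split (cp_prer qr (mcomp_mor rm Dt))).
rewrite -!(mcompA _ rm' (mcomp_mor rm Dt)) -!(mcompA _ rm Dt) tensor_inl// tensor_inr// (mcomp_mofr (i2 _ _)).
rewrite (mcompA Delta rm (i1 _ _)) rl rr (mcompA Delta rm' (cp_mor (leg_cp12 M A A A))).
rewrite (at_W_split (cp_prer qr (cp_mor (leg_cp12 M A A A)))).
rewrite -!(mcompA _ rm' (cp_mor (leg_cp12 M A A A))) (cp_inl (leg_cp12 M A A A)) (cp_inr (leg_cp12 M A A A)).
by rewrite mulrA -!(mcompA _ rm' (i2 _ _)).
Qed.

Section Density.
Variable xi : L.
Local Notation D := (A ⊗ A).
Local Notation l12 := (pair (@leg1 R M K A A) (@leg2 R M K A A)).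
Local Notation l13 := (pair (@leg1 R M K A A) (@leg3 R M K A A)).
Let l12m : is_mor l12 := cp_mor (leg_cp12 M K A A).
Let l13m : is_mor l13 := cp_mor (leg_cp13 M K A A).
Let mK := @mof_mor R K.

(** The matrix coefficient of $W_{12}w_{13}$ at $\xi$ and [e] in the first leg, carried by the
    projection [p]. At $w=|x\rangle\langle e|\otimes a$ it gives $s\otimes a$ with [s] a slice of
    [W]; at [XW] times such a [w] it gives $\Delta(s)(1\otimes a)$, because
    $W_{12}W_{13}=(\mathrm{id}\otimes\Delta)W$. As [XW] is invertible, both kinds have the same
    closed span, which is the density condition for $\Delta$. *)
Definition compress (w : K ⊗ A) : multiplier (K ⊗ D) :=
  mten (mof (tk e xi)) 1 * ext l12 XW * l13 w * mten (mof p) 1.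

Lemma compress_lin : linear compress.
Proof. by move=> c u v; rewrite /compress (mor_lin l13m) mulrDr mulrDl scalemAr scalemAl. Qed.

Lemma compress_bd w : bd (compress w) (rn xi * rn w).
Proof.
have b1 : bd (mten (mof (tk e xi)) (1 : multiplier D)) (rn xi).
  rewrite -[rn xi]mul1r -{1}e1 -(@rn_tk R M L) -[rn (tk _ _)]mulr1.
  by apply: bd_mtens; rewrite ?rn_ge0//; [exact: bd_mof|exact: bd1].
have b4 : bd (mten (mof p) (1 : multiplier D)) 1.
  have : bd (mten (mof p) (1 : multiplier D)) (rn p * 1).
    by apply: bd_mtens; rewrite ?rn_ge0//; [exact: bd_mof|exact: bd1].
  by rewrite /p (@rn_tk R M L) e1 !mulr1.
have b2 : bd (ext l12 XW) 1 by apply: unitary_bd; apply: ext_unitary => //; exact: WK_unitary.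
have b3 : bd (l13 w) (rn w) by exact: mor_bd.
have := bdM _ (bdM _ (bdM (rn_ge0 xi) b1 b2) b3) b4; rewrite !mulr1; apply; rewrite ?mulr_ge0 ?rn_ge0//.
Qed.

Lemma l13_pure k a : l13 (pu k a) = mten (mof k) (inr A A a).
Proof. by rewrite leg_pair13 tensor_pure. Qed.

Lemma XW_slice12 xi' eta :
  mten (mof (tk e xi')) 1 * ext l12 XW * mten (mof (tk eta e)) 1 = mten (mof p) (inl A A (sl (xi', eta))).
Proof.
have := congr1 (ext l12) (XW_slice e xi' eta); rewrite !(extM l12m).
have e12 m n : ext l12 (mten m n) = mten m (ext (inl A A) n).
  by rewrite leg_pair12 (tensor_mtens M mK (i1 A A)) ext_mof_id.
by rewrite !e12 (ext1 (i1 A A)) (ext_mof (i1 A A)) => ->.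
Qed.

Lemma compress_tk x y a : compress (pu (tk x y) a) = ip L e y *: mten (mof p) (mof (pu (sl (xi, x)) a)).
Proof.
have -> : compress (pu (tk x y) a) = mten (mof (tk e xi)) 1 * ext l12 XW * mten (mof (tk x e)) 1 *
    (ip L e y *: mten (1 : multiplier K) (inr A A a)).
  rewrite /compress l13_pure -!mulrA -mtensM mulr1 -mofM tk_tk; congr (_ * (_ * _)).
  by rewrite mofZ (linZ (mtens_linl M _)) scalemAr -mtensM mulr1 mul1r.
by rewrite XW_slice12 scalemAr -mtensM mulr1 -inl_inr.
Qed.

Lemma slice_map_ex : exists Gamma : K ⊗ A -> D, [/\ linear Gamma, bdd Gamma (rn xi),
  forall w, mten (mof p) (mof (Gamma w)) = compress w &
  forall x y a, Gamma (pu (tk x y) a) = ip L e y *: pu (sl (xi, x)) a].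
Proof.
pose s (q : (L * L) * A) := pu (tk q.1.1 q.1.2) q.2.
pose t (q : (L * L) * A) := ip L e q.1.2 *: pu (sl (xi, q.1.1)) q.2.
have st : total s by exact: (pure_total_of (@tk_total R M L) (@total_id R A)).
have tE l : mten (mof p) (mof (comb t l)) = compress (comb s l).
  rewrite (comb_lin _ _ compress_lin).
  have tl : linear (fun z : D => mten (mof p) (mof z)).
    by move=> c u v; rewrite mofD mofZ mtens_linr.
  apply: (etrans (comb_lin t l tl)); apply: eq_comb => -[[x y] a] /=.
  by rewrite compress_tk /t /= mofZ (linZ (mtens_linr M _)).
have rp : rn p = 1 by rewrite /p (@rn_tk R M L) e1 mulr1.
have [|Gamma [Gl Gb GE]] := @extend R _ _ _ s t (rn xi) (rn_ge0 _) st.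
  move=> l; have := mtens_mof M p (comb t l); rewrite tE => h.
  rewrite -[leLHS]mul1r -rp -(rn_pureE M); apply: mof_bd; first by rewrite mulr_ge0 ?rn_ge0.
  by rewrite -h; exact: compress_bd.
exists Gamma; split=> // [w|x y a]; last exact: (GE ((x, y), a)).
apply: multP => z.
have gl : linear (fun w => mten (mof p) (mof (Gamma w)) z).
  by move=> c u v; rewrite Gl mofD mofZ mtens_linr.
have cl : linear (fun w => compress w z) by move=> c u v; rewrite compress_lin.
apply: (total_eq st gl cl (t := rn xi * rn z) (t' := rn xi * rn z)).
- move=> u; rewrite mtens_mof mofE; apply: (le_trans (rnM _ _)).
  by rewrite rn_pureE rp mul1r mulrAC ler_wpM2r ?rn_ge0//; exact: Gb.
- by move=> u; rewrite mulrAC; exact: compress_bd.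
move=> q; rewrite GE; have := tE [:: (1, q)]; rewrite /comb !big_seq1 !scale1r => ->.
by [].
Qed.

Lemma ext13_XW : amp_r Delta XW = ext l12 XW * ext l13 XW.
Proof.
have c := leg_cp3 M K A A.
have -> : amp_r Delta XW = W@[@leg1 R M K A A ∘ be, inr K D ∘ Delta].
  rewrite /amp_r tensorE mcomp_mofr// /XW at_ampl//; apply: cp_prer => //; exact: cp_inlr.
rewrite at_W_split; last by apply: cp_prel => //; exact: cp_inlr.
by rewrite /XW !at_ampl//; [exact: leg_cp13|exact: leg_cp12].
Qed.

Lemma compress_XW eta y a : compress (XW (pu (tk eta y) a)) =
  ip L e y *: mten (mof p) (Delta (sl (xi, eta)) * inr A A a).
Proof.
have tD := tensor_is_mor M mK Dm.
have := congr1 (ext (tensor (@mof R K) Delta)) (XW_slice e xi eta).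
rewrite !(extM tD) !(tensor_mtens M mK Dm) !ext_mof_id (ext1 Dm) (ext_mof Dm) -/(amp_r Delta XW) ext13_XW.
rewrite -[in X in _ = X]/p => h.
have -> : mten (mof p) (Delta (sl (xi, eta)) * inr A A a) =
    mten (mof p) (Delta (sl (xi, eta))) * mten 1 (inr A A a) by rewrite -mtensM mulr1.
rewrite -h /compress -(ext_mul_mor l13m) l13_pure -!mulrA -!mtensM mulr1 mul1r -mofM tk_tk mulr1.
by rewrite mofZ (linZ (mtens_linl M _)) !scalemAr.
Qed.
End Density.

(** For slices this is [compress_XW]; the general case follows as [A ⊗ A] is closed in its
    multipliers. *)
Lemma Delta_inr (b a : A) : exists z : A ⊗ A, Delta b * inr A A a = mof z.
Proof.
have slc (q : L * L) : exists z : A ⊗ A, Delta (sl q) * inr A A a = mof z.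
  case: q => xi eta; have [Gm [_ _ GE _]] := slice_map_ex xi.
  exists (Gm (XW (pu (tk eta e) a))); apply: (mtens_p_inj e1).
  by rewrite GE compress_XW ip_e// scale1r.
apply: mof_closed => r r0.
have a1 : 0 < rn a + 1 by rewrite ltr_wpDl ?rn_ge0.
have [l hl] := @sl_total R M G b (r / (rn a + 1)) ltac:(by rewrite divr_gt0).
have /choice[z hz] := slc; exists (comb z l).
have -> : mof (comb z l) = Delta (comb (@sl R M G) l) * inr A A a.
  have ml : linear (@mof R (A ⊗ A)) by move=> c u v; rewrite mofD mofZ.
  have dl : linear (fun b => Delta b * inr A A a).
    by move=> c u v; rewrite (mor_lin Dm) mulrDl scalemAl.
  rewrite (comb_lin _ _ ml); symmetry; apply: (etrans (comb_lin (@sl R M G) l dl)).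
  by apply: eq_comb => q /=; rewrite hz.
rewrite -mulrBl -(linB (mor_lin Dm)).
apply: (@bd_le _ _ _ (rn (b - comb (@sl R M G) l) * rn a)).
  by apply: (le_trans (ler_wpM2r (rn_ge0 _) (ltW hl))); rewrite mulrAC ler_pdivrMr// ler_wpM2l ?(ltW r0)// lerDl.
by apply: bdM; [exact: rn_ge0|exact: mor_bd|apply: mor_bd; exact: i2].
Qed.

Lemma Delta_inr_total : exists z : A * A -> A ⊗ A,
  (forall q, Delta q.1 * inr A A q.2 = mof (z q)) /\ total z.
Proof.
have /choice[z hz] (q : A * A) : exists x, Delta q.1 * inr A A q.2 = mof x by exact: Delta_inr.
exists z; split=> //; have XU := WK_unitary G; have {}XU : XW * mstar XW = 1 by case: XU.
have [t0 _ tb] := bounded XW.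
(* Every [w] is [XW] applied to something, so its compression is approximated by those of [XW] at
   elementary tensors. *)
have key xi w Gm : linear Gm -> bdd Gm (rn xi) -> (forall w, mten (mof p) (mof (Gm w)) = compress xi w) ->
    inspan z (Gm w).
  move=> Gl Gb GE; have -> : w = XW (mstar XW w) by rewrite -mulmE XU.
  have FE (u : K ⊗ A) : rn (Gm (XW u)) <= rn xi * t0 * rn u.
    by apply: (le_trans (Gb _)); rewrite -mulrA ler_wpM2l ?rn_ge0.
  have Fl : linear (fun u => Gm (XW u)) by move=> c u v; rewrite mact_lin Gl.
  apply: (inspan_img (F := fun u => Gm (XW u)) Fl FE _
    (pure_total_of (@tk_total R M L) (@total_id R A) (mstar XW w))) => -[[eta y] a] /=.
  have -> : Gm (XW (pu (tk eta y) a)) = ip L e y *: z (sl (xi, eta), a).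
    apply: mof_inj; apply: (mtens_p_inj e1).
    by rewrite GE compress_XW mofZ (linZ (mtens_linr M _)) -(hz (_, _)).
  by apply: inspanZ; exact: inspan_gen.
apply: (total_trans (pure_total_of (@sl_total R M G) (@total_id R A))) => -[[xi x] d] /=.
have [Gm [Gl Gb GE Gtk]] := slice_map_ex xi.
have -> : pu (sl (xi, x)) d = Gm (pu (tk x e) d) by rewrite Gtk ip_e// scale1r.
exact: key.
Qed.

Lemma Delta_coaction : coaction Delta.
Proof.
split=> //; [exact: Delta_inj|exact: Delta_coassoc|].
have [z [hz zt]] := Delta_inr_total; rewrite -(opspan_mof zt); congr opspan.
apply/seteqP; split=> T /= [b]; first by move=> [a ->]; exists (b, a); exact: (congr1 (@mact _ _) (hz (b, a))).
by move=> ->; exists b.1, b.2; exact: (congr1 (@mact _ _) (esym (hz b))).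
Qed.
End RegularCoaction.

Lemma mof_range_total (R : realType) (D E : cstar R) S (s : S -> D) (Y : D -> multiplier E) c :
  total s -> linear Y -> 0 <= c -> (forall w, bd (Y w) (c * rn w)) -> (forall i, exists t, Y (s i) = mof t) ->
  exists N : D -> E, [/\ linear N, bdd N c & forall w, Y w = mof (N w)].
Proof.
move=> st Yl c0 Yb h; have /choice[t ht] := h.
have ml : linear (@mof R E) by move=> a u v; rewrite mofD mofZ.
have /choice[N hN] w : exists x, Y w = mof x.
  apply: mof_closed => r r0; have c1 : 0 < c + 1 by rewrite ltr_wpDl.
  have [l hl] := st w (r / (c + 1)) ltac:(by rewrite divr_gt0).
  exists (comb t l); have -> : mof (comb t l) = Y (comb s l).
    by rewrite (comb_lin _ _ ml) (comb_lin _ _ Yl); apply: eq_comb => i /=; rewrite ht.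
  rewrite -(linB Yl); apply: bd_le (Yb _).
  apply: (le_trans (ler_wpM2l c0 (ltW hl))); rewrite mulrCA ler_piMr ?(ltW r0)//.
  by rewrite ler_pdivrMr// mul1r lerDl.
exists N; split=> // [a u v|w].
  by apply: mof_inj; rewrite mofD mofZ -!hN Yl.
by apply: mof_bd; [rewrite mulr_ge0 ?rn_ge0|rewrite -hN].
Qed.

Lemma opspan_total (R : realType) (E P : cstar R) (I : Type) (emb : E -> multiplier P) (m : I -> multiplier P) :
  is_mor emb -> injective emb ->
  [set mact (emb x) | x in [set: E]] = opspan [set T | exists i, T = mact (m i)] ->
  exists s : I -> E, total s /\ forall i, emb (s i) = m i.
Proof.
move=> em ei sp; have /choice[s hs] (i : I) : exists x, emb x = m i.
  have : opspan [set T | exists i : I, T = mact (m i)] (mact (m i)).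
    apply/(opspan_approx (fun i : I => mact (m i))) => r r0; exists [:: (1, i)] => x.
    by rewrite big_seq1 scale1r subrr rn0 mulr_ge0 ?rn_ge0// ltW.
  rewrite -sp => -[x _ xE]; exists x; apply: multP => y; by rewrite xE.
exists s; split=> // x r r0; have : [set mact (emb x) | x in [set: E]] (mact (emb x)) by exists x.
rewrite sp => /(opspan_approx (fun i : I => mact (m i))) /(_ (r / 2) ltac:(by rewrite divr_gt0))[l hl].
exists l; apply: (@le_lt_trans _ _ (r / 2)); last by rewrite ltr_pdivrMr// ltr_pMr// ltr1n.
apply: (mor_inj_le em ei) => [|y]; first by rewrite divr_ge0// ltW.
have := hl y; rewrite (linB (mor_lin em)) submE; congr (rn (_ - _) <= _); symmetry.
apply: (etrans (comb_lin s l (mor_linr em y))); apply: eq_bigr => q _ /=.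
by rewrite hs.
Qed.

Section VectorSlice.
Variables (R : realType) (M : model R) (H : hilbert R) (B : cstar R).
Local Notation "A ⊗ B" := (mten (ctens M A B)) (at level 40, left associativity).
Local Notation pu := (pure (ctens M _ _)).
Local Notation K := (compact M H).
Local Notation tk := (@tk R M H).
Local Notation mten m n := (mtens M m n).

(** Realised by a rank-one compression whose result $p\otimes b$ has the norm of [b]; this supplies
    the bound. *)
Lemma vector_slice_ex (e eta : H) : rn e = 1 -> exists sl : K ⊗ B -> B,
  [/\ linear sl, bdd sl (rn eta) & forall k b, sl (pu k b) = ip H (kop k e) eta *: b].
Proof.
move=> e1; pose p := tk e e; have rp : rn p = 1 by rewrite /p (@rn_tk R M H) e1 mulr1.
pose Y (w : K ⊗ B) : multiplier (K ⊗ B) := mten (mof (tk e eta)) 1 * mof w * mten (mof p) 1.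
have Yl : linear Y by move=> a u v; rewrite /Y mofD mofZ mulrDr mulrDl scalemAr scalemAl.
have bdl (k : K) : bd (mten (mof k) (1 : multiplier B)) (rn k).
  by rewrite -[rn k]mulr1; apply: bd_mtens; rewrite ?rn_ge0//; [exact: bd_mof|exact: bd1].
have Yb w : bd (Y w) (rn eta * rn w).
  rewrite -[X in bd _ X]mulr1 -rp; apply: bdM; [by rewrite mulr_ge0 ?rn_ge0| |exact: bdl].
  apply: bdM; [exact: rn_ge0| |exact: bd_mof].
  by rewrite -[rn eta]mul1r -e1 -(@rn_tk R M H); exact: bdl.
pose s (q : K * B) := pu q.1 q.2; pose t (q : K * B) := ip H (kop q.1 e) eta *: q.2.
have Ys q : Y (s q) = mof (pu p (t q)).
  rewrite /Y /s -mtens_mof -!mtensM mulr1 mul1r -!mofM -cmulA mul_tk tk_tk mofZ.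
  by rewrite (linZ (mtens_linl M _)) -(linZ (mtens_linr M _)) -mofZ mtens_mof.
have tE l : Y (comb s l) = mof (pu p (comb t l)).
  have tl : linear (fun z : B => mof (pu p z)) by move=> a u v; rewrite pure_linr mofD mofZ.
  rewrite (comb_lin _ _ Yl); symmetry; apply: (etrans (comb_lin t l tl)).
  by apply: eq_comb => q /=; rewrite Ys.
have [|sl [sll slb slE]] := @extend R _ _ _ s t (rn eta) (rn_ge0 _) (pure_tot M K B).
  move=> l; rewrite -[leLHS]mul1r -rp -(rn_pureE M); apply: mof_bd; first by rewrite mulr_ge0 ?rn_ge0.
  by rewrite -tE.
by exists sl; split=> // k b; exact: (slE (k, b)).
Qed.
End VectorSlice.

(** * The universal dual *)

Section UniversalDual.
Variables (R : realType) (M : model R) (G : quantum_group M) (D : universal_dual G).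
Local Notation C := (cplx R).
Local Notation "A ⊗ B" := (mten (ctens M A B)) (at level 40, left associativity).
Local Notation pu := (pure (ctens M _ _)).
Local Notation A := (qA G).
Local Notation U := (uA D).
Local Notation V := (uV D).
Local Notation inl A B := (@inl_mor R M A B).
Local Notation inr A B := (@inr_mor R M A B).
Local Notation pair f g := (@pair_mor R M _ _ _ f g).
Local Notation tensor f g := (@tensor_mor R M _ _ _ _ f g).
Local Notation "g ∘ f" := (mcomp g f) (at level 45, right associativity).
Local Notation "X @[ f , g ]" := (ext (pair f g) X) (at level 1, left associativity, format "X @[ f ,  g ]").
Local Notation mten m n := (mtens M m n).
Local Notation Delta := (@qDelta R M G).
Local Notation cp := (cp M).
Local Notation cp3 := (cp3 M).

Lemma at_V1 (E : cstar R) (f : U -> multiplier E) (g h : A -> multiplier E) : cp3 f g h ->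
  V@[f, pair g h ∘ Delta] = V@[f, g] * V@[f, h].
Proof. by move=> c; apply: at_bi2 => //; [exact: qDelta_mor|exact: uV_corep]. Qed.
Lemma at_V2 (E : cstar R) (f g : U -> multiplier E) (h : A -> multiplier E) : cp3 f g h ->
  V@[pair f g ∘ @uDhat _ _ _ D, h] = V@[g, h] * V@[f, h].
Proof. by move=> c; apply: at_bi1 => //; [exact: uDhat_mor|exact: uDhat_V]. Qed.

(** [Phi] does not depend on [g]: a representation of the universal dual is recovered from its value
    on [V], one slice at a time. *)
Lemma slice_rep (H : hilbert R) (e : H) S x0 : rn e = 1 -> slice V S -> S = mof x0 ->
  exists Phi : multiplier (compact M H ⊗ A) -> H -> H -> C,
  forall g : rep M U H, is_mor g -> forall xi eta, ip H (mop (g x0) xi) eta = Phi (amp_l g V) xi eta.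
Proof.
move=> e1 [om [a [sg [[oml omc] [sgl sgc] sgE SE]]]] Sx.
have [to to0 ob] := @continuous_bdd R A (cplx_line R) om oml omc.
have [ts ts0 sb] := @continuous_bdd R _ _ sg sgl sgc.
have /choice[sl hsl] eta := @vector_slice_ex R M H A e eta e1.
exists (fun X xi eta => om (sl eta (X (pu (tk M xi e) a)))) => g gm xi eta.
have [sll slb slE] := hsl eta; set X := amp_l g V.
have mA := @mof_mor R A; have tm : is_mor (tensor g (@mof R A)) by exact: tensor_is_mor.
have [tX tX0 Xb] := bounded X.
pose f1 xi : cplx_line R := ip H (mop (g x0) xi) eta.
pose f2 xi : cplx_line R := om (sl eta (X (pu (tk M xi e) a))).
suff : f1 xi = f2 xi by [].
have rl (z : cplx_line R) : rn z = cn z by rewrite rn_line.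
apply: (@total_eq _ _ _ _ _ f1 f2 (rn x0 * rn eta) (to * (rn eta * (tX * rn a))) (rep_total gm)).
- by move=> c u v; rewrite /f1 mop_lin ipDl ipZl.
- by move=> c u v; rewrite /f2 tk_lin pure_linl mact_lin sll oml.
- move=> u; rewrite /f1 rn_line; apply: (le_trans (cauchy_schwarz _ _)).
  by rewrite mulrAC ler_wpM2r ?rn_ge0//; exact: rep_bdd.
- move=> u; apply: (le_trans (ob _)); rewrite -!mulrA; apply: ler_wpM2l => //.
  apply: (le_trans (slb _)); apply: ler_wpM2l; first exact: rn_ge0.
  apply: (le_trans (Xb _)); apply: ler_wpM2l => //.
  by rewrite rn_pureE (@rn_tk R M H) e1 mulr1 mulrC.
(* Nondegeneracy reduces to vectors of the form [mop (g x) h]; the extra [x] turns the multiplier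
   [V] into an element $V(x\otimes a)$ of the tensor product, which elementary tensors
   approximate. *)
move=> [x h]; rewrite /f1 /f2 /= -mopM -(morM gm).
pose k := tk M h e.
have kE y : mof (tk M (mop (g y) h) e) = g y * mof k by rewrite tk_mop.
pose Y (w : U ⊗ A) := tensor g (@mof R A) w * mten (mof k) (1 : multiplier A).
have Yp y b : Y (pu y b) = mof (pu (tk M (mop (g y) h) e) b).
  by rewrite /Y tensor_pure// -mtensM mulr1 -kE mtens_mof.
have Yl : linear Y by move=> c u v; rewrite /Y (mor_lin tm) mulrDl scalemAl.
have [|w|q|N [Nl Nb NE]] := mof_range_total (pure_tot M U A) Yl (c := rn k).
- exact: rn_ge0.
- rewrite mulrC; apply: bdM; [exact: rn_ge0|exact: mor_bd|].
  by rewrite -[rn k]mulr1; apply: bd_mtens; rewrite ?rn_ge0//; [exact: bd_mof|exact: bd1].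
- by rewrite Yp; eexists; reflexivity.
have Np y b : N (pu y b) = pu (tk M (mop (g y) h) e) b by apply: mof_inj; rewrite -NE Yp.
have -> : X (pu (tk M (mop (g x) h) e) a) = N (V (pu x a)).
  apply: mof_inj; rewrite mof_mact -Yp -NE /Y mulrA; congr (_ * _); exact: ext_mul_mor.
have -> : x0 ** x = sg (V (pu x a)) by rewrite -SE Sx.
set w := V _.
pose f3 w : cplx_line R := ip H (mop (g (sg w)) h) eta; pose f4 w : cplx_line R := om (sl eta (N w)).
suff : f3 w = f4 w by [].
apply: (@total_eq _ _ _ _ _ f3 f4 (ts * (rn h * rn eta)) (to * (rn eta * rn k)) (pure_tot M U A)).
- by move=> c u v; rewrite /f3 sgl (mor_lin gm) mop_linl ipDl ipZl.
- by move=> c u v; rewrite /f4 Nl sll oml.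
- move=> u; rewrite /f3 rn_line; apply: (le_trans (cauchy_schwarz _ _)).
  rewrite mulrA mulrAC ler_wpM2r ?rn_ge0// mulrAC.
  by apply: (le_trans (rep_bdd _ gm _)); rewrite ler_wpM2r ?rn_ge0.
- move=> u; apply: (le_trans (ob _)); rewrite -!mulrA; apply: ler_wpM2l => //.
  by apply: (le_trans (slb _)); apply: ler_wpM2l; [exact: rn_ge0|exact: Nb].
move=> [y b]; rewrite /f3 /f4 /= Np slE tkE ip_e// scale1r sgE (linZ (mor_lin gm)) mopZ ipZl.
have om0 : om 0 = 0 by have := oml (-1) 0 0; rewrite scaler0 addr0 mulN1r addNr.
by rewrite -[_ *: b]addr0 oml om0 addr0 mulrC.
Qed.

Lemma slices_total : exists (I : Type) (s : I -> U), total s /\ forall i, slice V (mof (s i)).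
Proof.
pose I := {S | slice V S}.
have eqI : [set mact S | S in slice V] = [set T | exists i : I, T = mact (sval i)].
  apply/seteqP; split=> T /=; first by move=> [S hS <-]; exists (exist _ S hS).
  by move=> [[S hS] ->]; exists S.
have sp := uA_span D; rewrite eqI in sp.
have [s [st hs]] := opspan_total (@mof_mor R U) (@mof_inj R U) sp.
by exists I, s; split=> // i; rewrite hs; exact: (svalP i).
Qed.

(** In a faithful representation of [B] the matrix coefficients of [f] and [g] at a slice are the
    same [Phi] at the same argument. *)
Lemma sep_uA (B : cstar R) (f g : U -> multiplier B) : is_mor f -> is_mor g ->
  amp_l f V = amp_l g V -> f = g.
Proof.
move=> fm gm h; have [H [th [thm thi]]] := gelfand_naimark M B.
have [I [s [st sS]]] := slices_total; apply: (mor_eq fm gm st) => i.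
have mA := @mof_mor R A.
have hE k : is_mor k -> amp_l (th ∘ k) V = amp_l th (amp_l k V).
  by move=> km; rewrite [RHS]amp_comp// mcomp_mofl.
apply: (ext_inj thm thi); apply: mop_inj => xi.
have [[e e1]|z] := @unit_or_zero R H; last by rewrite [LHS]z [RHS]z.
apply: ip_ext1 => eta; have [Phi hPhi] := slice_rep e1 (sS i) erefl.
have := hPhi _ (mcomp_mor thm fm) xi eta; have := hPhi _ (mcomp_mor thm gm) xi eta.
by rewrite !hE// h => -> ->.
Qed.
End UniversalDual.

(* Th maps a total family into the image of M(Q) under kap, hence factors through kap. *)
Lemma lift_mor (R : realType) (E Q P : cstar R) S (s : S -> E) (t : S -> multiplier Q)
  (kap : Q -> multiplier P) (Th : E -> multiplier P) :
  total s -> is_mor kap -> injective kap -> is_mor Th -> (forall i, Th (s i) = ext kap (t i)) ->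
  total (fun q : S * Q => t q.1 q.2) ->
  exists Psi : E -> multiplier Q, is_mor Psi /\ mcomp kap Psi = Th.
Proof.
move=> st km ki tm hs tt.
have /choice[T hT] q : exists T : E -> Q, [/\ linear T, bdd T (rn q) & forall i, T (s i) = t i q].
  apply: extend; [exact: rn_ge0|exact: st|] => l.
  have -> : comb (fun i => t i q) l = comb t l q.
    by rewrite -[RHS]/((fun m : multiplier Q => m q) _) comb_lin.
  rewrite mulrC; suff : bd (comb t l) (rn (comb s l)) by apply.
  apply: (ext_inj_bd km ki); first exact: rn_ge0.
  have -> : ext kap (comb t l) = Th (comb s l).
    rewrite (comb_lin t l (ext_lin km)) (comb_lin s l (mor_lin tm)).
    by apply: eq_comb => i; rewrite /= hs.
  exact: mor_bd.
have TE q x : kap (T q x) = Th x * kap q.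
  have [Tl Tb Ts] := hT q; apply: multP => z.
  apply: (@total_eq _ _ _ _ _ (fun x => kap (T q x) z) (fun x => Th x (kap q z)) (rn q * rn z) (rn (kap q z)) st).
  - by move=> c u v; rewrite Tl (mor_linr km).
  - by move=> c u v; rewrite (mor_linr tm).
  - move=> u; apply: (le_trans (mor_bd km _ _)); rewrite mulrAC ler_wpM2r ?rn_ge0//; exact: Tb.
  - exact: mor_bdd.
  by move=> i; rewrite Ts -(ext_mul_mor km) hs.
have Tadj x q q' : star (T q x) ** q' = star q ** T q' (star x).
  apply: ki; rewrite !(morM km) !(mor_star km) !TE (mor_star tm).
  by rewrite -[LHS]/(mstar (Th x * kap q) * kap q') adjM -mulrA.
pose Psi x := @Multiplier R Q (T^~ x) (T^~ (star x)) (Tadj x).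
have PE x : ext kap (Psi x) = Th x.
  by symmetry; apply: ext_uniq => // q z; rewrite /= TE.
exists Psi; split; last exact/funext.
have pl : linear Psi by move=> c u v; apply: (ext_inj km ki); rewrite (ext_lin km) !PE (mor_lin tm).
split.
- by move=> c u v z; rewrite pl.
- by move=> u v; apply: (ext_inj km ki); rewrite PE (morM tm) (extM km) !PE.
- by move=> u; apply: (ext_inj km ki); rewrite PE (mor_star tm) (ext_adj km) PE.
apply/clspan_total2; apply: (total_trans tt) => -[i q] /=; have [_ _ Ts] := hT q.
have -> : t i q = Psi (s i) q by rewrite /= Ts.
exact: (inspan_gen _ (s i, q)).
Qed.

Lemma ad_ext (R : realType) (A B E : cstar R) (f : A -> multiplier B) (k : B -> multiplier E) (u : multiplier B) :
  is_mor k -> mcomp k (fun a => u * f a * mstar u) = fun a => ext k u * mcomp k f a * mstar (ext k u).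
Proof. by move=> km; apply/funext => a; rewrite /mcomp !(extM km) (ext_adj km). Qed.

(** * Conjugation by the universal corepresentation in a covariant pair *)

Section CovariantPair.
Variables (R : realType) (M : model R) (G : quantum_group M) (D : universal_dual G).
Local Notation C := (cplx R).
Local Notation "A ⊗ B" := (mten (ctens M A B)) (at level 40, left associativity).
Local Notation A := (qA G).
Local Notation U := (uA D).
Local Notation V := (uV D).
Local Notation inl A B := (@inl_mor R M A B).
Local Notation inr A B := (@inr_mor R M A B).
Local Notation pair f g := (@pair_mor R M _ _ _ f g).
Local Notation tensor f g := (@tensor_mor R M _ _ _ _ f g).
Local Notation "g ∘ f" := (mcomp g f) (at level 45, right associativity).
Local Notation "X @[ f , g ]" := (ext (pair f g) X) (at level 1, left associativity, format "X @[ f ,  g ]").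
Local Notation mten m n := (mtens M m n).
Local Notation Delta := (@qDelta R M G).
Local Notation Dhat := (@uDhat _ _ _ D).
Local Notation cp := (cp M).
Local Notation cp3 := (cp3 M).

Lemma at_conjl (A1 A2 E : cstar R) (f : A1 -> multiplier E) (g : A2 -> multiplier E) (u : multiplier E) X :
  cp f g -> unitary u -> (forall a, u * g a = g a * u) ->
  cp (fun a => u * f a * mstar u) g /\ X@[fun a => u * f a * mstar u, g] = u * X@[f, g] * mstar u.
Proof.
move=> c uu ug; have [c' e] := at_conj (ext (@flip R M A1 A2) X) (cp_sym c) uu ug.
by split; [exact: cp_sym|rewrite -(at_flip c') e (at_flip (cp_sym c))].
Qed.

Lemma unitary_mul (E : cstar R) (u : multiplier E) : unitary u -> u * mstar u = 1 /\ mstar u * u = 1.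
Proof. by []. Qed.
Lemma unitary_star (E : cstar R) (u : multiplier E) : unitary u -> unitary (mstar u).
Proof. by move=> [h1 h2]; split; rewrite ?adjK. Qed.

Lemma V_unitary (E : cstar R) (f : U -> multiplier E) (g : A -> multiplier E) : cp f g -> unitary V@[f, g].
Proof. by move=> c; apply: at_unitary => //; exact: uV_unitary. Qed.

Section Covariance.
Variables (E : cstar R) (phi : A -> multiplier E) (rho : U -> multiplier E).
Hypotheses (phim : is_mor phi) (rhom : is_mor rho).
Hypothesis cov : forall a, amp_l phi (Delta a) = amp_l rho V * mten (phi a) 1 * mstar (amp_l rho V).
Let Dm : is_mor Delta := qDelta_mor G.

(** Covariance says that [w], that is [V] with its first leg represented by [rho], implements the
    comultiplication of [A] on [phi]. Inserted in the corepresentation property of [V] this becomes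
    the pentagon-like relation [key]. Read as a formula for the conjugate of [w] by [vP], [key]
    gives the comultiplication of the dual on [rho]; [sep_uA] allows the claim to be tested on
    [V]. *)
Lemma covariant_swap0 (x : U) : let v := V@[inl U E, inr U E ∘ phi] in
  mstar v * (inr U E ∘ rho) x * v = (pair (inr U E ∘ rho) (inl U E) ∘ Dhat) x.
Proof.
move=> v; have i1 X Y := @inl_is_mor R M X Y; have i2 X Y := @inr_is_mor R M X Y.
have uDm : is_mor Dhat := uDhat_mor D.
have c0 : cp (inl U E) (inr U E) := cp_inlr M U E.
have vU : unitary v by apply: V_unitary; exact: cp_prer.
have pm : is_mor (pair (inr U E ∘ rho) (inl U E)).
  by apply: cp_mor; apply: cp_prel => //; exact: cp_sym.
have rm : is_mor (inr U E ∘ rho) by exact: mcomp_mor.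
have cm := conj_mor rm (unitary_star vU); rewrite adjK in cm.
suff e : (fun x => mstar v * (inr U E ∘ rho) x * v) = pair (inr U E ∘ rho) (inl U E) ∘ Dhat.
  exact: (congr1 (@^~ x) e).
apply: (sep_uA cm (mcomp_mor pm uDm)).
pose P := inl (U ⊗ E) A; pose y3 := inr (U ⊗ E) A; pose y1 := P ∘ inl U E; pose y2 := P ∘ inr U E.
have Pm : is_mor P by exact: i1.
have Py3 : cp P y3 := cp_inlr M _ _.
have y12 : cp y1 y2 by exact: cp_post.
have p12 : pair y1 y2 = P by rewrite pair_split.
have c123 : cp3 y1 y2 y3 by apply: cp3_of => //; rewrite p12.
have y13 := cp3_13 c123; have y23 := cp3_23 c123.
have ampE k : is_mor k -> amp_l k V = V@[P ∘ k, y3] by move=> km; rewrite /amp_l tensorE mcomp_mofr//; exact: i2.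
rewrite !ampE//; last exact: mcomp_mor.
pose w := V@[y2 ∘ rho, y3]; pose vP := V@[y1, y2 ∘ phi].
have vPE : ext P v = vP by rewrite /v at_post// ?(mcompA phi Pm (i2 _ _))//; exact: cp_prer.
have wE : w = ext (pair y2 y3) (amp_l rho V) by rewrite at_ampl.
have wU : unitary w by apply: V_unitary; exact: cp_prel.
have vPU : unitary vP by rewrite -vPE; exact: ext_unitary.
have [ww1 ww2] := unitary_mul wU; have [vv1 vv2] := unitary_mul vPU.
have -> : P ∘ (fun x => mstar v * (inr U E ∘ rho) x * v) =
    (fun x => mstar vP * (y2 ∘ rho) x * mstar (mstar vP)).
  apply/funext => z; rewrite adjK -vPE /mcomp !(extM Pm) (ext_adj Pm) /y2.
  by rewrite -(ext_mcomp (rho z) Pm (i2 U E)).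
have vPy3 z : mstar vP * y3 z = y3 z * mstar vP.
  by rewrite -vPE -(ext_adj Pm) -(ext_mof (cp2 Py3) z) (cpC Py3).
have [_ ->] := at_conjl V (cp_prel y23 rhom) (unitary_star vPU) vPy3.
rewrite -/w adjK (mcompA Dhat Pm pm) (pair_post (cp_prel (cp_sym c0) rhom) Pm).
rewrite (mcompA rho Pm (i2 _ _)) -/y1 -/y2 at_V2; last first.
  by apply: cp3_pre1 => //; apply: cp3_rot; exact: cp3_swap23.
rewrite -/w.
have key : w * vP = vP * V@[y1, y3] * w.
  have : V@[y1, pair (y2 ∘ phi) y3 ∘ Delta] = vP * V@[y1, y3] by rewrite at_V1//; exact: cp3_pre2.
  have -> : pair (y2 ∘ phi) y3 ∘ Delta = fun a => w * (y2 ∘ phi) a * mstar w.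
    apply/funext => a; have y23m := cp_mor y23.
    have := congr1 (ext (pair y2 y3)) (cov a).
    rewrite !(extM y23m) (ext_adj y23m) -wE (cp_mtens y23) (ext1 (cp2 y23)) mulr1 => <-.
    by rewrite at_ampl.
  have wy1 z : w * y1 z = y1 z * w.
    by rewrite wE -(ext_mof (cp1 c123.2) z) (cpC c123.2).
  have [_ ->] := at_conj V (cp_prer y12 phim) wU wy1.
  by rewrite -/vP => <-; rewrite -!mulrA ww2 mulr1.
by rewrite -mulrA key !mulrA vv2 mul1r.
Qed.

Variables (F : cstar R) (x1 : U -> multiplier F) (j : E -> multiplier F).
Hypothesis x1j : cp x1 j.
Let v := V@[x1, j ∘ phi].

Lemma covariant_swap x : mstar v * (j ∘ rho) x * v = (pair (j ∘ rho) x1 ∘ Dhat) x.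
Proof.
have i1 := @inl_is_mor R M U E; have i2 := @inr_is_mor R M U E.
have pm := cp_mor x1j; have := congr1 (ext (pair x1 j)) (covariant_swap0 x).
rewrite !(extM pm) (ext_adj pm) at_post ?cp_inl ?(mcompA phi pm i2) ?cp_inr -/v//; last first.
  by apply: cp_prer => //; exact: cp_inlr.
rewrite -[ext _ ((_ ∘ rho) x)]/((pair x1 j ∘ (inr U E ∘ rho)) x) (mcompA rho pm i2) cp_inr// => ->.
rewrite -[LHS]/((pair x1 j ∘ (pair (inr U E ∘ rho) (inl U E) ∘ Dhat)) x) (mcompA Dhat pm).
  by rewrite pair_post ?(mcompA rho pm i2) ?cp_inr ?cp_inl//; apply: cp_prel => //; exact: cp_sym (cp_inlr M U E).
by apply: cp_mor; apply: cp_prel => //; exact: cp_sym (cp_inlr M U E).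
Qed.

Lemma v_unitary : unitary v. Proof. by apply: V_unitary; exact: cp_prer. Qed.

Variable Ru : multiplier (U ⊗ U).
Hypothesis HR : bicharacter Dhat Ru.

Lemma at_R1 (f g h : U -> multiplier F) : cp3 f g h -> Ru@[pair f g ∘ Dhat, h] = Ru@[g, h] * Ru@[f, h].
Proof. by case: HR => _ h1 _ c; apply: at_bi1 => //; exact: uDhat_mor. Qed.
Lemma at_R2 (f g h : U -> multiplier F) : cp3 f g h -> Ru@[f, pair g h ∘ Dhat] = Ru@[f, g] * Ru@[f, h].
Proof. by case: HR => _ _ h1 c; apply: at_bi2 => //; exact: uDhat_mor. Qed.

(** The conjugation turns the first leg into a comultiplied one, and the bicharacter property splits
    it into two factors, one of them with the new leg [x1]. *)
Lemma conj_R1 z : cp3 x1 j z -> mstar v * Ru@[j ∘ rho, z] * v = Ru@[x1, z] * Ru@[j ∘ rho, z].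
Proof.
move=> c; have cz := cp3_12_3 c; have c3 : cp3 x1 (j ∘ rho) z by exact: cp3_pre2.
have vz a : mstar v * z a = z a * mstar v.
  have -> : v = ext (pair x1 j) (amp_r phi V) by rewrite at_ampr.
  by rewrite -(ext_adj (cp_mor x1j)) -(ext_mof (cp2 cz) a) (cpC cz).
have [_] := at_conjl Ru (cp3_23 c3) (unitary_star v_unitary) vz; rewrite adjK => <-.
have -> : (fun a => mstar v * (j ∘ rho) a * v) = pair (j ∘ rho) x1 ∘ Dhat by apply/funext; exact: covariant_swap.
by rewrite at_R1//; apply: cp3_rot; exact: cp3_swap23.
Qed.

Lemma conj_R2 z : cp3 x1 j z -> mstar v * Ru@[z, j ∘ rho] * v = Ru@[z, j ∘ rho] * Ru@[z, x1].
Proof.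
move=> c; have cz := cp3_12_3 c; have c3 : cp3 x1 (j ∘ rho) z by exact: cp3_pre2.
have vz a : mstar v * z a = z a * mstar v.
  have -> : v = ext (pair x1 j) (amp_r phi V) by rewrite at_ampr.
  by rewrite -(ext_adj (cp_mor x1j)) -(ext_mof (cp2 cz) a) (cpC cz).
have [_] := at_conj Ru (cp_sym (cp3_23 c3)) (unitary_star v_unitary) vz; rewrite adjK => <-.
have -> : (fun a => mstar v * (j ∘ rho) a * v) = pair (j ∘ rho) x1 ∘ Dhat by apply/funext; exact: covariant_swap.
by rewrite at_R2//; apply: cp3_swap23; exact: cp3_rot.
Qed.
End Covariance.
End CovariantPair.

Lemma neq0_of_inj (R : realType) (A B : cstar R) (f : A -> multiplier B) (a : A) :
  injective f -> a != 0 -> exists b : B, b != 0.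
Proof.
move=> fi a0; apply: contrapT => h; have b0 (b : B) : b = 0 by apply: contrapT => /eqP bn; apply: h; exists b.
by move/eqP: a0; apply; apply: fi; apply: multP => z; rewrite [LHS]b0 [RHS]b0.
Qed.

(** * Twisted tensor products *)

Section Twisted.
Variables (R : realType) (M : model R) (G : quantum_group M) (D : universal_dual G).
Local Notation C := (cplx R).
Local Notation "A ⊗ B" := (mten (ctens M A B)) (at level 40, left associativity).
Local Notation pu := (pure (ctens M _ _)).
Local Notation A := (qA G).
Local Notation U := (uA D).
Local Notation V := (uV D).
Local Notation inl A B := (@inl_mor R M A B).
Local Notation inr A B := (@inr_mor R M A B).
Local Notation pair f g := (@pair_mor R M _ _ _ f g).
Local Notation tensor f g := (@tensor_mor R M _ _ _ _ f g).
Local Notation "g ∘ f" := (mcomp g f) (at level 45, right associativity).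
Local Notation "X @[ f , g ]" := (ext (pair f g) X) (at level 1, left associativity, format "X @[ f ,  g ]").
Local Notation mten m n := (mtens M m n).
Local Notation Delta := (@qDelta R M G).
Local Notation Dhat := (@uDhat _ _ _ D).
Local Notation cp := (cp M).
Local Notation cp3 := (cp3 M).
Let i1 X Y : is_mor (inl X Y) := @inl_is_mor R M X Y.
Let i2 X Y : is_mor (inr X Y) := @inr_is_mor R M X Y.

(** Interchange of the middle two of four legs. It makes [V] on the legs (1, first factor of the
    representation) commute with [V] on the legs (2, second factor). *)
Lemma cp4_shuffle (A1 A2 B E F : cstar R) (f : A1 -> multiplier F) (g : A2 -> multiplier F) (h : B ⊗ E -> multiplier F) :
  cp3 f g h -> cp (pair f (h ∘ inl B E)) (pair g (h ∘ inr B E)).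
Proof.
move=> [gh fgh]; have gm := cp1 gh; have hm := cp2 gh; have sm := cp_mor gh.
have c : cp3 (inl A2 (B ⊗ E)) (inr A2 (B ⊗ E) ∘ inl B E) (inr A2 (B ⊗ E) ∘ inr B E).
  by apply: cp3_split; exact: cp_inlr.
have c' : cp3 (inr A2 (B ⊗ E) ∘ inl B E) (inl A2 (B ⊗ E)) (inr A2 (B ⊗ E) ∘ inr B E).
  by apply: cp3_rot; exact: cp3_swap23.
have e : pair g h ∘ pair (inr A2 (B ⊗ E) ∘ inl B E) (pair (inl A2 (B ⊗ E)) (inr A2 (B ⊗ E) ∘ inr B E)) =
    pair (h ∘ inl B E) (pair g (h ∘ inr B E)).
  rewrite (pair_post c'.2 sm) (pair_post c'.1 sm).
  by rewrite !(mcompA _ sm (i2 _ _)) (cp_inl gh) (cp_inr gh).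
have c4 : cp3 f (h ∘ inl B E) (pair g (h ∘ inr B E)).
  split; last by rewrite -e; apply: cp_prer => //; exact: cp_mor c'.2.
  have := cp_post c'.2 sm; rewrite (pair_post c'.1 sm) !(mcompA _ sm (i2 _ _)).
  by rewrite (cp_inl gh) (cp_inr gh).
exact: cp3_12_3 c4.
Qed.

Lemma cov_at (X : gcstar G) (H : hilbert R) (phi : rep M X H) W' (rho : rep M U H) (P : cstar R)
  (p : compact M H -> multiplier P) (q : A -> multiplier P) (c : X) :
  covariant phi W' -> is_mor rho -> amp_l rho V = W' -> cp p q ->
  V@[p ∘ rho, q] * (p ∘ phi) c * mstar V@[p ∘ rho, q] = (gco c)@[p ∘ phi, q].
Proof.
move=> [phim _ cov] rhom UE pq; have pqm := cp_mor pq.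
rewrite -(at_ampl pq _ phim) cov !(extM pqm) (ext_adj pqm) -UE (at_ampl pq _ rhom).
by rewrite (cp_mtens pq) (ext1 (cp2 pq)) mulr1.
Qed.

Variable Ru : multiplier (U ⊗ U).
Hypothesis HR : bicharacter Dhat Ru.

Lemma R_unitary : unitary Ru. Proof. by case: HR. Qed.

(* The relation between the two embeddings of A in A ⊠ A; a pair satisfying it
   stands in for faithful covariant representations of all G-C*-algebras at once. *)
Definition R_heisenberg (F : cstar R) (a b : A -> multiplier F) :=
  [/\ is_mor a, is_mor b & forall (Q : cstar R) (x1 x2 : U -> multiplier Q) (k : F -> multiplier Q),
    cp3 x1 x2 k -> V@[x1, k ∘ a] * V@[x2, k ∘ b] = V@[x2, k ∘ b] * V@[x1, k ∘ a] * Ru@[x1, x2]].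

Definition regular (e : qL G) (e1 : rn e = 1) : gcstar G := GCstar (Delta_coaction e1).

Section Regular.
Variables (e : qL G) (e1 : rn e = 1) (E : cstar R) (i j : A -> multiplier E).
Hypothesis tw : @twisted_tensor R M G D Ru (regular e1) (regular e1) E i j.

(** In the defining representation [i] is $\varphi\otimes1$ and [j] is $1\otimes\psi$ conjugated by
    $S^*$, with [S] the represented $R^u$. With [v] and [v'] for [V] at the untwisted legs,
    [conj_R1] gives $Sv=vqS$ and [conj_R2] gives $qv'=v'qr$. As [v] and [v'] commute, moving [v]
    past $S^*v'S$ leaves exactly the factor $r=R^u_{12}$. *)
Lemma twisted_heisenberg : R_heisenberg i j.
Proof.
case: tw => H [H' [phi [W1 [psi [W2 [rho [rho' [emb]]]]]]]].
set Z := mstar (amp rho rho' Ru) => -[[cphi phii] [cpsi psii] [rhom rhoE] [rhom' rhoE'] [embm embi _ [im iE] [jm jE]]].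
have [phim _ covphi] := cphi; have [psim _ covpsi] := cpsi.
have cov1 a : amp_l phi (Delta a) = amp_l rho V * mten (phi a) 1 * mstar (amp_l rho V) by rewrite covphi -rhoE.
have cov2 a : amp_l psi (Delta a) = amp_l rho' V * mten (psi a) 1 * mstar (amp_l rho' V) by rewrite covpsi -rhoE'.
split=> // Q x1 x2 k c.
(* The standard legs suffice, since [triple x1 x2 k] maps them to any others. *)
suff base : let l1 := @leg1 R M U U E in let l2 := @leg2 R M U U E in let l3 := @leg3 R M U U E in
    V@[l1, l3 ∘ i] * V@[l2, l3 ∘ j] = V@[l2, l3 ∘ j] * V@[l1, l3 ∘ i] * Ru@[l1, l2].
  have tm := cp3_mor c; have := congr1 (ext (@triple R M _ _ _ _ x1 x2 k)) base.
  have c0 := leg_cp3 M U U E; have l3m := cp2 (leg_cp23 M U U E).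
  rewrite !(extM tm) !at_post ?(mcompA _ tm l3m) ?cp3_1 ?cp3_2 ?cp3_3//;
    by [exact: cp3_12 c0|apply: cp_prer => //; exact: cp3_23 c0|apply: cp_prer => //; exact: cp3_13 c0].
move=> l1 l2 l3; have mU := @mof_mor R U.
pose P := compact M H ⊗ compact M H'.
have t0m : is_mor (tensor (@mof R U) emb) by exact: tensor_is_mor.
have Tm : is_mor (tensor (@mof R U) (tensor (@mof R U) emb)) by exact: tensor_is_mor.
have Ti : injective (tensor (@mof R U) (tensor (@mof R U) emb)).
  by do ?[apply: tensor_inj => //]; exact: mof_inj.
pose k1 := @leg1 R M U U P; pose k2 := @leg2 R M U U P; pose t := @leg3 R M U U P.
have T1 : tensor (@mof R U) (tensor (@mof R U) emb) ∘ l1 = k1.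
  by rewrite /l1 /leg1 tensor_inl// mcomp_mofr//; exact: i1.
have T2 : tensor (@mof R U) (tensor (@mof R U) emb) ∘ l2 = k2.
  rewrite /l2 /leg2 mcompA// tensor_inr// -(mcompA _ (i2 _ _) t0m) tensor_inl//.
  by rewrite (mcomp_mofr (i1 _ _)).
have T3 : tensor (@mof R U) (tensor (@mof R U) emb) ∘ l3 = t ∘ emb.
  by rewrite /l3 /leg3 mcompA// tensor_inr// -(mcompA _ (i2 _ _) t0m) tensor_inr// (mcompA _ (i2 _ _) (i2 _ _)).
have {}c : cp3 l1 l2 l3 := leg_cp3 M U U E.
have d : cp3 k1 k2 t := leg_cp3 M U U P.
have l3m := cp2 c.1; have tm := cp2 d.1.
have c12 := cp3_12 c; have c13 := cp3_13 c; have c23 := cp3_23 c.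
have d12 := cp3_12 d; have d13 := cp3_13 d; have d23 := cp3_23 d.
clearbody l1 l2 l3 k1 k2 t.
apply: (ext_inj Tm Ti).
rewrite !(extM Tm) (at_post (cp_prer c13 im) _ Tm) (at_post (cp_prer c23 jm) _ Tm) (at_post c12 _ Tm).
rewrite !(mcompA _ Tm l3m) T1 T2 T3 -!(mcompA _ tm embm).
have -> : emb ∘ i = inl _ _ ∘ phi by apply/funext => a; rewrite [LHS]iE /mcomp ext_inl.
have -> : emb ∘ j = fun d => Z * (inr _ _ ∘ psi) d * mstar Z.
  by apply/funext => a; rewrite [LHS]jE /mcomp ext_inr.
rewrite (ad_ext _ _ tm) (mcompA phi tm (i1 _ _)) (mcompA psi tm (i2 _ _)).
pose j1 := t ∘ inl (compact M H) (compact M H'); pose j2 := t ∘ inr (compact M H) (compact M H').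
rewrite -/j1 -/j2; pose S := Ru@[j1 ∘ rho, j2 ∘ rho'].
have j12 : cp j1 j2 by apply: cp_post => //; exact: cp_inlr.
have SE : ext t (amp rho rho' Ru) = S.
  rewrite /S -(at_amp j12)// pair_split//.
have SU : unitary S by apply: at_unitary R_unitary; exact: cp_pre.
rewrite [ext t Z](ext_adj tm) SE.
have Sk2 a : mstar S * k2 a = k2 a * mstar S.
  by rewrite -SE -(ext_adj tm) -(ext_mof (cp1 d23) a) (cpC d23).
have cj1 : cp3 k1 j1 j2 by exact: cp3_split.
have cj2 : cp3 k2 j1 j2 by exact: cp3_split.
have [_ ->] := at_conj V (cp_prer (cp3_13 cj2) psim) (unitary_star SU) Sk2.
rewrite adjK.
have cA : cp3 k1 j1 (j2 ∘ rho') by exact: cp3_pre3.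
have cB : cp3 k2 j2 k1 by apply: cp3_rot; apply: cp3_rot; apply: cp3_pre3 => //; exact: i2.
have E1 := conj_R1 phim rhom cov1 (cp3_12 cA) HR cA.
have E2 := conj_R2 psim rhom' cov2 (cp3_12 cB) HR cB.
have vU := v_unitary phim (cp3_12 cA); have vU' := v_unitary psim (cp3_12 cB).
set v := V@[k1, j1 ∘ phi] in E1 vU *; set v' := V@[k2, j2 ∘ psi] in E2 vU' *.
rewrite -/S in E1; set q := Ru@[k1, j2 ∘ rho'] in E1 E2; set r := Ru@[k1, k2] in E2 *.
have E3 : v * v' = v' * v.
  have c4 := cp4_shuffle d; rewrite -/j1 -/j2 in c4.
  have := cpC c4 (amp_r phi V) (amp_r psi V); rewrite !at_ampr//; [exact: cp3_13 cj2|exact: cp3_12 cj1].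
have E4 : r * S = S * r by rewrite -SE (cpC (cp3_12_3 d)).
have [s1 s2] := unitary_mul SU; have [v1 v2] := unitary_mul vU; have [w1 w2] := unitary_mul vU'.
have F1 : S * v = v * q * S by rewrite -mulrA -E1 !mulrA v1 mul1r.
have F2 : q * v' = v' * q * r by rewrite -mulrA -E2 !mulrA w1 mul1r.
have F3 : mstar S * v * q = v * mstar S by rewrite -[LHS]mulr1 -s1 mulrA -(mulrA _ v) -(mulrA _ (v * q)) -F1 !mulrA s2 mul1r.
have -> : mstar S * v' * S * v * r = mstar S * (v' * v) * q * (r * S) by rewrite E4 -!mulrA (mulrA S) F1 !mulrA.
by rewrite -E3 -!mulrA (mulrA q) (mulrA v') (mulrA v' q) -F2 !mulrA F3.
Qed.

(** Embeddings of the form $x\mapsto x\otimes1$ into a tensor product with [E] are used for their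
    injectivity, which fails over the zero algebra. *)
Lemma twisted_neq0 : exists x : E, x != 0.
Proof.
case: tw => H [H' [phi [W1 [psi [W2 [rho [rho' [emb]]]]]]]] /=.
move=> -[[[phim _ _] phii] [_ psii] _ _ [embm embi _ [im iE] _]].
have [a a0] := A_neq0 e1; have [b b0] := neq0_of_inj psii a0.
apply: (@neq0_of_inj R A E i a) => // x y xy.
apply: phii; apply: (ext_inj (i1 _ _) (inl_inj b0)); rewrite !ext_inl.
by have := iE x; rewrite xy iE => ->.
Qed.
End Regular.
End Twisted.

(** * Twisted tensor products inside one common algebra *)

Section Embedding.
Variables (R : realType) (M : model R) (G : quantum_group M) (D : universal_dual G).
Local Notation C := (cplx R).
Local Notation "A ⊗ B" := (mten (ctens M A B)) (at level 40, left associativity).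
Local Notation pu := (pure (ctens M _ _)).
Local Notation A := (qA G).
Local Notation U := (uA D).
Local Notation V := (uV D).
Local Notation inl A B := (@inl_mor R M A B).
Local Notation inr A B := (@inr_mor R M A B).
Local Notation pair f g := (@pair_mor R M _ _ _ f g).
Local Notation tensor f g := (@tensor_mor R M _ _ _ _ f g).
Local Notation "g ∘ f" := (mcomp g f) (at level 45, right associativity).
Local Notation "X @[ f , g ]" := (ext (pair f g) X) (at level 1, left associativity, format "X @[ f ,  g ]").
Local Notation mten m n := (mtens M m n).
Local Notation cp := (cp M).
Local Notation cp3 := (cp3 M).
Let i1 X Y : is_mor (inl X Y) := @inl_is_mor R M X Y.
Let i2 X Y : is_mor (inr X Y) := @inr_is_mor R M X Y.
Variable Ru : multiplier (U ⊗ U).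
Hypothesis HR : bicharacter (@uDhat _ _ _ D) Ru.

Lemma gco_mor (X : gcstar G) : is_mor (@gco _ _ _ X).
Proof. by case: (gcoP X). Qed.

Section Common.
Variables (X Y : gcstar G) (E F : cstar R).
Definition slot1 (a : A -> multiplier F) : X -> multiplier ((X ⊗ Y) ⊗ F) :=
  pair (inl (X ⊗ Y) F ∘ inl X Y) (inr (X ⊗ Y) F ∘ a) ∘ @gco _ _ _ X.
Definition slot2 (b : A -> multiplier F) : Y -> multiplier ((X ⊗ Y) ⊗ F) :=
  pair (inl (X ⊗ Y) F ∘ inr X Y) (inr (X ⊗ Y) F ∘ b) ∘ @gco _ _ _ Y.

Lemma cp3_slots : cp3 (inl (X ⊗ Y) F ∘ inl X Y) (inl (X ⊗ Y) F ∘ inr X Y) (inr (X ⊗ Y) F).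
Proof.
by apply: cp3_of; [apply: cp_post => //; exact: cp_inlr|rewrite pair_split//; exact: cp_inlr].
Qed.
Lemma slot1_mor a : is_mor a -> is_mor (slot1 a).
Proof.
move=> am; apply: mcomp_mor; last exact: gco_mor.
by apply: cp_mor; apply: cp_prer => //; exact: cp3_13 cp3_slots.
Qed.
Lemma slot2_mor b : is_mor b -> is_mor (slot2 b).
Proof.
move=> bm; apply: mcomp_mor; last exact: gco_mor.
by apply: cp_mor; apply: cp_prer => //; exact: cp3_23 cp3_slots.
Qed.

(** Frees the span condition from the operators on the two Hilbert spaces: it becomes totality
    inside [E]. *)
Lemma twisted_total (i : X -> multiplier E) (j : Y -> multiplier E) :
  @twisted_tensor R M G D Ru X Y E i j ->
  exists s : X * Y -> E, total s /\ forall p, mof (s p) = i p.1 * j p.2.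
Proof.
case=> H [H' [phi [W1 [psi [W2 [rho [rho' [emb]]]]]]]].
set Z := mstar (amp rho rho' Ru) => -[_ _ _ _ [embm embi embr [im iE] [jm jE]]].
have embr' : [set mact (emb e) | e in [set: E]] = opspan [set T0 | exists p : X * Y,
    T0 = mact (mten (phi p.1) (mone (compact M H')) *M (Z *M mten (mone (compact M H)) (psi p.2) *M mstar Z))].
  rewrite embr; congr opspan; apply/seteqP; split=> t /=; first by move=> [x [y ->]]; exists (x, y).
  by move=> [[x y] ->]; exists x, y.
have [s [st sE]] := opspan_total embm embi embr'; exists s; split=> // p.
by apply: (ext_inj embm embi); rewrite ext_mof// sE (extM embm) iE jE.
Qed.

(* Conjugating emb(e) (x) 1 by T = U_{1 a} U'_{2 b} turns the Z-twist into the two coactions,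
   since U'_{2 b} U_{1 a} = T Z; as gamma and delta no longer involve the
   representations, this compares all twisted tensor products in one algebra. *)
Lemma twisted_embedding (i : X -> multiplier E) (j : Y -> multiplier E) (a b : A -> multiplier F) (f0 : F) :
  @twisted_tensor R M G D Ru X Y E i j -> R_heisenberg Ru a b -> f0 != 0 ->
  exists Psi : E -> multiplier ((X ⊗ Y) ⊗ F),
    [/\ is_mor Psi, injective Psi, Psi ∘ i = slot1 a & Psi ∘ j = slot2 b].
Proof.
move=> tw; case: (tw) => H [H' [phi [W1 [psi [W2 [rho [rho' [emb]]]]]]]].
set Z := mstar (amp rho rho' Ru) => -[[cphi phii] [cpsi psii] [rhom rhoE] [rhom' rhoE'] [embm embi _ [im iE] [jm jE]]].
have [phim _ _] := cphi; have [psim _ _] := cpsi.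
move=> [am bm heis] f00.
pose P0 := compact M H ⊗ compact M H'; pose P := inl P0 F.
have Pm : is_mor P by exact: i1.
pose p1 := P ∘ inl (compact M H) (compact M H'); pose p2 := P ∘ inr (compact M H) (compact M H').
pose p3 := inr P0 F.
have p12 : cp p1 p2 by apply: cp_post => //; exact: cp_inlr.
have pP : pair p1 p2 = P by rewrite pair_split.
have c : cp3 p1 p2 p3 by apply: cp3_of => //; rewrite pP; exact: cp_inlr.
have c13 := cp3_13 c; have c23 := cp3_23 c.
pose S := Ru@[p1 ∘ rho, p2 ∘ rho'].
have SE : ext P (amp rho rho' Ru) = S by rewrite -pP at_amp.
have SU : unitary S by apply: at_unitary; [exact: cp_pre|exact: R_unitary HR].
pose v1 := V@[p1 ∘ rho, p3 ∘ a]; pose v2 := V@[p2 ∘ rho', p3 ∘ b].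
have v1U : unitary v1 by apply: V_unitary; exact: cp_pre.
have v2U : unitary v2 by apply: V_unitary; exact: cp_pre.
have vE : v1 * v2 = v2 * v1 * S by apply: heis; apply: cp3_pre1 => //; exact: cp3_pre2.
have [s1 s2] := unitary_mul SU; have [v11 v12] := unitary_mul v1U; have [v21 v22] := unitary_mul v2U.
have [T TE] : exists T, T = v1 * v2 by eexists.
have TU : unitary T.
  split; rewrite TE adjM mmulE; first by rewrite -mulrA (mulrA v2) v21 mul1r v11.
  by rewrite -mulrA (mulrA (mstar v1)) v12 mul1r v22.
have [t1 t2] := unitary_mul TU.
pose Pe := P ∘ emb; have Pem : is_mor Pe by exact: mcomp_mor.
pose Th x := T * Pe x * mstar T.
have Thm : is_mor Th by exact: conj_mor.
have Thi : injective Th.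
  have Pi : injective Pe by apply: mcomp_inj => //; exact: inl_inj f00.
  move=> x y; rewrite /Th => /(congr1 (fun z => mstar T * z * T)).
  by rewrite -!mulrA t2 !mulr1 !mulrA t2 !mul1r => /Pi.
pose kap := tensor (tensor phi psi) (@mof R F).
have mF := @mof_mor R F.
have k0m : is_mor (tensor phi psi) by exact: tensor_is_mor.
have kapm : is_mor kap by exact: tensor_is_mor.
have kapi : injective kap by apply: tensor_inj => //; [exact: tensor_inj|exact: mof_inj].
pose q1 := inl (X ⊗ Y) F ∘ inl X Y; pose q2 := inl (X ⊗ Y) F ∘ inr X Y; pose q3 := inr (X ⊗ Y) F.
have kq1 : kap ∘ q1 = p1 ∘ phi.
  by rewrite /q1 mcompA// tensor_inl// -(mcompA _ (i1 _ _) k0m) tensor_inl// mcompA.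
have kq2 : kap ∘ q2 = p2 ∘ psi.
  by rewrite /q2 mcompA// tensor_inl// -(mcompA _ (i1 _ _) k0m) tensor_inr// mcompA.
have kq3 : kap ∘ q3 = p3 by rewrite /q3 tensor_inr// mcomp_mofr//; exact: i2.
have q123 : cp3 q1 q2 q3 := cp3_slots.
have k1 x : ext kap (slot1 a x) = (gco x)@[p1 ∘ phi, p3 ∘ a].
  rewrite /slot1 /mcomp at_post ?(mcompA a kapm (i2 _ _)) ?kq1 ?kq3//.
  by apply: cp_prer => //; exact: cp3_13 q123.
have k2 y : ext kap (slot2 b y) = (gco y)@[p2 ∘ psi, p3 ∘ b].
  rewrite /slot2 /mcomp at_post ?(mcompA b kapm (i2 _ _)) ?kq2 ?kq3//.
  by apply: cp_prer => //; exact: cp3_23 q123.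
have v1C y : v1 * (p2 ∘ psi) y = (p2 ∘ psi) y * v1.
  have c' : cp (pair p1 p3) p2 by apply: cp3_12_3; exact: cp3_swap23.
  have -> : v1 = ext (pair p1 p3) (amp rho a V) by rewrite at_amp.
  exact: (cpC c').
have v2C x : v2 * (p1 ∘ phi) x = (p1 ∘ phi) x * v2.
  have -> : v2 = ext (pair p2 p3) (amp rho' b V) by rewrite at_amp.
  by rewrite -[(p1 ∘ phi) x]/(ext p1 (phi x)) (cpC c.2).
have Thext m : ext Th m = T * ext Pe m * mstar T.
  by symmetry; apply: ext_uniq => // x y; rewrite /Th -!mulmE -!mulrA (mulrA (mstar T)) t2 mul1r -(ext_mul_mor Pem) !mulrA.
(* Only [v1] matters for [X], as [v2] commutes with [phi]; for [Y] the twist first reverses the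
   order of the two factors of [T]. Covariance then produces the coactions. *)
have Th1 x : ext Th (i x) = ext kap (slot1 a x).
  rewrite Thext /Pe ext_mcomp// iE k1 -(cov_at x cphi rhom rhoE (cp_prer c13 am)) -/v1.
  have -> : ext P (mten (phi x) (mone (compact M H'))) = (p1 ∘ phi) x.
    by rewrite -[mone _]/(1 : multiplier _) -ext_inl -(ext_mcomp _ Pm (i1 _ _)).
  by rewrite TE adjM -!mulrA (mulrA v2) v2C -!mulrA (mulrA v2) v21 mul1r.
have Th2 y : ext Th (j y) = ext kap (slot2 b y).
  rewrite Thext /Pe ext_mcomp// jE k2 -(cov_at y cpsi rhom' rhoE' (cp_prer c23 bm)) -/v2.
  have ZE : ext P (mstar Z) = mstar (ext P Z) by exact: ext_adj.
  rewrite !mmulE !(extM Pm) ZE.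
  have -> : ext P (mten (mone (compact M H)) (psi y)) = (p2 ∘ psi) y.
    by rewrite -[mone _]/(1 : multiplier _) -ext_inr -(ext_mcomp _ Pm (i2 _ _)).
  have TZ : T * ext P Z = v2 * v1 by rewrite (ext_adj Pm) SE TE vE -mulrA s1 mulr1.
  have ZT : mstar (ext P Z) * mstar T = mstar v1 * mstar v2 by rewrite -!adjM TZ.
  rewrite !mulrA TZ -!mulrA ZT; rewrite (mulrA v1) v1C -!mulrA (mulrA v1) v11 mul1r //.
have [s [st sE]] := twisted_total tw.
have am1 := slot1_mor am; have bm2 := slot2_mor bm.
have [||Psi [Psim PsiE]] := @lift_mor R E ((X ⊗ Y) ⊗ F) _ _ s (fun p => slot1 a p.1 * slot2 b p.2) kap Th st kapm kapi Thm.
- by move=> p; rewrite (extM kapm) -Th1 -Th2 -(extM Thm) -sE ext_mof.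
- apply: (total_trans (mor_total am1)) => -[x z] /=; have [u _ xu] := bounded (slot1 a x).
  apply: (inspan_img (mact_lin (slot1 a x)) xu _ (mor_total bm2 z)) => -[y w] /=.
  exact: (inspan_gen _ ((x, y), w)).
exists Psi; split=> //.
- by move=> x y xy; apply: Thi; rewrite -PsiE /mcomp xy.
- by apply/funext => x; apply: (ext_inj kapm kapi); rewrite -Th1 -PsiE ext_mcomp.
- by apply/funext => y; apply: (ext_inj kapm kapi); rewrite -Th2 -PsiE ext_mcomp.
Qed.
End Common.
End Embedding.

(** * Antisymmetry of R and of its universal lift *)

Section Antisymmetry.
Variables (R : realType) (M : model R) (G : quantum_group M) (D : universal_dual G).
Local Notation "A ⊗ B" := (mten (ctens M A B)) (at level 40, left associativity).
Local Notation pu := (pure (ctens M _ _)).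
Local Notation A := (qA G).
Local Notation U := (uA D).
Local Notation V := (uV D).
Local Notation inl A B := (@inl_mor R M A B).
Local Notation inr A B := (@inr_mor R M A B).
Local Notation pair f g := (@pair_mor R M _ _ _ f g).
Local Notation "g ∘ f" := (mcomp g f) (at level 45, right associativity).
Local Notation "X @[ f , g ]" := (ext (pair f g) X) (at level 1, left associativity, format "X @[ f ,  g ]").
Local Notation cp := (cp M).
Local Notation cp3 := (cp3 M).
Let i1 X Y : is_mor (inl X Y) := @inl_is_mor R M X Y.
Let i2 X Y : is_mor (inr X Y) := @inr_is_mor R M X Y.
Variables (Rm : multiplier (qAhat G ⊗ qAhat G)) (Ru : multiplier (U ⊗ U)).
Hypothesis HRu : universal_lift Rm Ru.
Let RmE : amp (@uLambda _ _ _ D) (@uLambda _ _ _ D) Ru = Rm. Proof. by case: HRu. Qed.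
Let HR : bicharacter (@uDhat _ _ _ D) Ru. Proof. by case: HRu. Qed.
Let Lm : is_mor (@uLambda _ _ _ D) := uLambda_mor D.

Lemma antisymmetric_reduce : mstar Ru = ext (@flip R M U U) Ru -> rmatrix_antisymmetric Rm.
Proof.
move=> h; rewrite /rmatrix_antisymmetric -RmE /amp.
have c := cp_inlr M (qAhat G) (qAhat G); have c' := cp_pre c Lm Lm.
rewrite tensorE -(at_adj c') h (at_flip c') -[RHS]at_id (at_flip c).
by rewrite -tensorE -/(amp (@uLambda _ _ _ D) (@uLambda _ _ _ D) Ru) (at_amp (cp_sym c)).
Qed.

(* Two successive conjugations recover R^u_12 from R, by the same
   formulas for R^u and for sigma(R^u)^*. *)
Lemma antisymmetric_lift (e : qL G) : rn e = 1 -> rmatrix_antisymmetric Rm -> mstar Ru = ext (@flip R M U U) Ru.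
Proof.
(* [Q] has two legs for the universal dual and two for operators on $\mathcal L$. Antisymmetry is
   known on the operator legs ([R0]), moves to one universal and one operator leg ([R1]), and then
   to the two universal legs ([R2]). *)
move=> e1 h; pose K := compact M (qL G); pose Q := (U ⊗ U) ⊗ (K ⊗ K).
pose phi := @piA R M G; pose rho : rep M U (qL G) := @piAhat R M G ∘ @uLambda _ _ _ D.
have phim : is_mor phi := piA_mor G; have bem : is_mor (@piAhat R M G) := piAhat_mor G.
have rhom : is_mor rho by exact: mcomp_mor.
have cov a : amp_l phi (qDelta a) = amp_l rho V * mtens M (phi a) 1 * mstar (amp_l rho V).
  have -> : amp_l rho V = XW G.
    by rewrite /XW -(uLambda_V D) /amp_l [RHS]amp_comp ?mcomp_mofl//; exact: mof_mor.
  exact: (covariant_al e1).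
have RU : unitary Ru by case: HR.
pose x1 : U -> multiplier Q := inl _ _ ∘ inl U U; pose x2 : U -> multiplier Q := inl _ _ ∘ inr U U.
pose j2 : K -> multiplier Q := inr _ _ ∘ inl K K; pose j3 : K -> multiplier Q := inr _ _ ∘ inr K K.
have cQ : cp (inl (U ⊗ U) (K ⊗ K)) (inr (U ⊗ U) (K ⊗ K)) := cp_inlr M _ _.
have x12 : cp x1 x2 by apply: cp_post; [exact: cp_inlr|exact: i1].
have pE : pair x1 x2 = inl (U ⊗ U) (K ⊗ K) by exact: pair_split (i1 _ _).
have c12 : cp3 x1 x2 (inr (U ⊗ U) (K ⊗ K)) by apply: cp3_of => //; rewrite pE.
have c1 : cp3 x1 j2 j3 by apply: cp3_split; exact: cp3_13 c12.
have c1r : cp3 x1 j2 (j3 ∘ rho) by exact: cp3_pre3.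
have c2 : cp3 x2 j3 x1 by apply: cp3_rot; apply: cp3_rot; exact: cp3_pre3.
have j23 := cp3_23 c1.
have R0 : Ru@[j2 ∘ rho, j3 ∘ rho] = mstar Ru@[j3 ∘ rho, j2 ∘ rho].
  have e2 (k l : K -> multiplier Q) : cp k l -> Ru@[k ∘ rho, l ∘ rho] = Rm@[k ∘ @piAhat R M G, l ∘ @piAhat R M G].
    move=> kl; have [km lm] : is_mor k /\ is_mor l by case: kl.
    rewrite -RmE (at_amp (cp_pre kl bem bem) _ Lm Lm).
    by rewrite -(mcompA _ km bem) -(mcompA _ lm bem).
  rewrite !e2//; last exact: cp_sym.
  by rewrite -(at_adj (cp_sym (cp_pre j23 bem bem))) h (at_flip (cp_sym (cp_pre j23 bem bem))).
have A1 := conj_R1 phim rhom cov (cp3_12 c1r) HR c1r.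
have A2 := conj_R2 phim rhom cov (cp3_12 c1r) HR c1r.
have B2 := conj_R2 phim rhom cov (cp3_12 c2) HR c2.
have B1 := conj_R1 phim rhom cov (cp3_12 c2) HR c2.
have x1j3 : cp x1 (j3 ∘ rho) := cp3_13 c1r.
(* By [R0] the left side of [A1] is the adjoint of that of [A2]; equating the right sides and
   cancelling the factor on the operator legs gives the claim. [B1] and [B2] give [R2] in the same
   way. *)
have R1 : Ru@[x1, j3 ∘ rho] = mstar Ru@[j3 ∘ rho, x1].
  have [_ u2] : unitary Ru@[j2 ∘ rho, j3 ∘ rho] by apply: at_unitary RU; exact: cp_pre.
  have := congr1 (@mstar _ _) A2; rewrite !adjM adjK mulrA -R0 A1 => e3.
  have {}u2 : Ru@[j2 ∘ rho, j3 ∘ rho] * mstar Ru@[j2 ∘ rho, j3 ∘ rho] = 1.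
    by have [] : unitary Ru@[j2 ∘ rho, j3 ∘ rho] by apply: at_unitary RU; exact: cp_pre.
  by have := congr1 (fun z => z * mstar Ru@[j2 ∘ rho, j3 ∘ rho]) e3; rewrite -!mulrA u2 !mulr1.
have R2 : Ru@[x1, x2] = mstar Ru@[x2, x1].
  have {}u2 : mstar Ru@[x1, j3 ∘ rho] * Ru@[x1, j3 ∘ rho] = 1.
    by have [] : unitary Ru@[x1, j3 ∘ rho] by apply: at_unitary RU.
  have := congr1 (@mstar _ _) B1; rewrite !adjM adjK mulrA -R1 B2 => e3.
  by have := congr1 (fun z => mstar Ru@[x1, j3 ∘ rho] * z) e3; rewrite !mulrA u2 !mul1r.
have pp : pu (tk M e e) (tk M e e) != 0 by rewrite -rn_eq0 rn_pureE !rn_tk e1 !mulr1 oner_eq0.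
apply: (ext_inj (i1 (U ⊗ U) (K ⊗ K)) (inl_inj pp)).
rewrite -pE (at_adj x12) R2 adjK (at_flip x12) //.
Qed.
End Antisymmetry.

(** * Braidings *)

Section FinalBraiding.
Variables (R : realType) (M : model R) (G : quantum_group M).
Variable D : universal_dual G.
Local Notation C := (cplx R).
Local Notation "A ⊗ B" := (mten (ctens M A B)) (at level 40, left associativity).
Local Notation A := (qA G).
Local Notation U := (uA D).
Local Notation V := (uV D).
Local Notation inl A B := (@inl_mor R M A B).
Local Notation inr A B := (@inr_mor R M A B).
Local Notation tensor f g := (@tensor_mor R M _ _ _ _ f g).
Local Notation pair f g := (@pair_mor R M _ _ _ f g).
Local Notation "X @[ f , g ]" := (ext (pair f g) X) (at level 1, left associativity, format "X @[ f ,  g ]").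
Variables (Rm : multiplier (qAhat G ⊗ qAhat G)) (Ru : multiplier (U ⊗ U)).
Hypothesis HRu : universal_lift Rm Ru.
Variable T : boxtensor Ru.
Let HR : bicharacter (@uDhat _ _ _ D) Ru. Proof. by case: HRu. Qed.
Implicit Types X Y Z : gcstar G.

Lemma tensor_comp (A1 A2 A3 B1 B2 B3 : cstar R) (f : A1 -> multiplier A2) (f' : A2 -> multiplier A3)
  (g : B1 -> multiplier B2) (g' : B2 -> multiplier B3) :
  is_mor f -> is_mor f' -> is_mor g -> is_mor g' ->
  mcomp (tensor f' g') (tensor f g) = tensor (mcomp f' f) (mcomp g' g).
Proof.
move=> fm fm' gm gm'; have i1 := @inl_is_mor R M A3 B3; have i2 := @inr_is_mor R M A3 B3.
have c := cp_tensor M fm' gm'; rewrite [tensor f' g']tensorE pair_tensor// ?tensorE ?mcompA//.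
- exact: cp1 c.
- exact: cp2 c.
- by case: c.
Qed.

(** Bundling makes associativity and the unit laws unconditional equations, so that diagrams can be
    chased by rewriting. *)
Record gmor X Y := GMor { gfun :> X -> multiplier Y; gmorP : is_gmor gfun }.
Arguments GMor {X Y gfun}.
Lemma gmor_eq X Y (f g : gmor X Y) : (f : X -> multiplier Y) = g -> f = g.
Proof. by case: f g => [f p] [g q] /= e; subst g; congr GMor; exact: Prop_irrelevance. Qed.
Lemma gmor_mor X Y (f : gmor X Y) : is_mor f. Proof. by case: f => f []. Qed.
Lemma gcomp_gmor X Y Z (g : gmor Y Z) (f : gmor X Y) : is_gmor (mcomp g f).
Proof.
have [gm ge] := gmorP g; have [fm fe] := gmorP f; have mA := @mof_mor R A.
split; first exact: mcomp_mor.
rewrite (mcompA f (gco_mor Z) gm) ge -(mcompA f (tensor_is_mor M gm mA) (gco_mor Y)) fe.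
rewrite (mcompA _ (tensor_is_mor M gm mA) (tensor_is_mor M fm mA)) tensor_comp// (mcomp_mofr mA) //.
Qed.
Definition gcomp X Y Z (g : gmor Y Z) (f : gmor X Y) : gmor X Z := GMor (gcomp_gmor g f).
Local Notation "g ∘ f" := (gcomp g f) (at level 45, right associativity).
Lemma gcompA X Y Z Z' (h : gmor Z Z') (g : gmor Y Z) (f : gmor X Y) : h ∘ (g ∘ f) = (h ∘ g) ∘ f.
Proof. by apply: gmor_eq; apply: mcompA; exact: gmor_mor. Qed.
Lemma gid_gmor X : is_gmor (@mof R X).
Proof.
have mA := @mof_mor R A; have mX := @mof_mor R X; have gX := gco_mor X.
split=> //; rewrite mcomp_mofr// tensorE mcomp_mofr ?mcomp_mofr; try by [exact: inl_is_mor|exact: inr_is_mor].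
by rewrite pair_inlr mcomp_mofl.
Qed.
Definition gid X : gmor X X := GMor (gid_gmor X).
Lemma gcomp1l X Y (f : gmor X Y) : gid Y ∘ f = f. Proof. by apply: gmor_eq; exact: mcomp_mofl. Qed.
Lemma gcomp1r X Y (f : gmor X Y) : f ∘ gid X = f.
Proof. by apply: gmor_eq; apply: mcomp_mofr; exact: gmor_mor. Qed.
(** Composites are kept nested to the right; this form rewrites a known composite at the head of a
    longer one. *)
Lemma gtail X Y Z Z' (h : gmor Y Z) (g : gmor X Y) (k : gmor X Z) (x : gmor Z' X) :
  h ∘ g = k -> h ∘ (g ∘ x) = k ∘ x.
Proof. by move=> <-; rewrite gcompA. Qed.

Local Notation "X ⊠ Y" := (box T X Y) (at level 40, left associativity).
Definition j1 X Y : gmor X (X ⊠ Y) := GMor (iota1_gmor T X Y).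
Definition j2 X Y : gmor Y (X ⊠ Y) := GMor (iota2_gmor T X Y).
Definition bmap X X' Y Y' (f : gmor X X') (g : gmor Y Y') : gmor (X ⊠ Y) (X' ⊠ Y') :=
  GMor (let: And3 h _ _ := boxmapP T (gmorP f) (gmorP g) in h).
Definition as_ X Y Z : gmor (X ⊠ (Y ⊠ Z)) (X ⊠ Y ⊠ Z) := GMor (assoc_gmor T X Y Z).
Definition av X Y Z : gmor (X ⊠ Y ⊠ Z) (X ⊠ (Y ⊠ Z)) := GMor (assocV_gmor T X Y Z).
Definition lun X : gmor (gunit T ⊠ X) X := GMor (lunit_gmor T X).
Definition run X : gmor (X ⊠ gunit T) X := GMor (runit_gmor T X).

Lemma bmap1 X X' Y Y' (f : gmor X X') (g : gmor Y Y') : bmap f g ∘ j1 X Y = j1 X' Y' ∘ f.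
Proof. by apply: gmor_eq; case: (boxmapP T (gmorP f) (gmorP g)). Qed.
Lemma bmap2 X X' Y Y' (f : gmor X X') (g : gmor Y Y') : bmap f g ∘ j2 X Y = j2 X' Y' ∘ g.
Proof. by apply: gmor_eq; case: (boxmapP T (gmorP f) (gmorP g)). Qed.
Lemma as1 X Y Z : as_ X Y Z ∘ j1 X (Y ⊠ Z) = j1 (X ⊠ Y) Z ∘ j1 X Y.
Proof. by apply: gmor_eq; case: (assoc_iota T X Y Z). Qed.
Lemma as2 X Y Z : as_ X Y Z ∘ (j2 X (Y ⊠ Z) ∘ j1 Y Z) = j1 (X ⊠ Y) Z ∘ j2 X Y.
Proof. by apply: gmor_eq; case: (assoc_iota T X Y Z). Qed.
Lemma as3 X Y Z : as_ X Y Z ∘ (j2 X (Y ⊠ Z) ∘ j2 Y Z) = j2 (X ⊠ Y) Z.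
Proof. by apply: gmor_eq; case: (assoc_iota T X Y Z). Qed.
Lemma avK X Y Z : av X Y Z ∘ as_ X Y Z = gid _.
Proof. by apply: gmor_eq; case: (assocK T X Y Z). Qed.
Lemma av1 X Y Z : av X Y Z ∘ (j1 (X ⊠ Y) Z ∘ j1 X Y) = j1 X (Y ⊠ Z).
Proof. by rewrite -as1 gcompA avK gcomp1l. Qed.
Lemma av2 X Y Z : av X Y Z ∘ (j1 (X ⊠ Y) Z ∘ j2 X Y) = j2 X (Y ⊠ Z) ∘ j1 Y Z.
Proof. by rewrite -as2 gcompA avK gcomp1l. Qed.
Lemma av3 X Y Z : av X Y Z ∘ j2 (X ⊠ Y) Z = j2 X (Y ⊠ Z) ∘ j2 Y Z.
Proof. by rewrite -as3 gcompA avK gcomp1l. Qed.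
Lemma lun1 X : lun X ∘ j2 (gunit T) X = gid X. Proof. by apply: gmor_eq; case: (lunitK T X). Qed.
Lemma lun2 X : j2 (gunit T) X ∘ lun X = gid _. Proof. by apply: gmor_eq; case: (lunitK T X). Qed.
Lemma run1 X : run X ∘ j1 X (gunit T) = gid X. Proof. by apply: gmor_eq; case: (runitK T X). Qed.
Lemma run2 X : j1 X (gunit T) ∘ run X = gid _. Proof. by apply: gmor_eq; case: (runitK T X). Qed.

(** Products of the two embeddings are total. The uniqueness statements and the diagrams for the
    exchange of the embeddings come down to this. *)
Lemma box_mor_eq X Y (E : cstar R) (f g : X ⊠ Y -> multiplier E) : is_mor f -> is_mor g ->
  mcomp f (j1 X Y) = mcomp g (j1 X Y) -> mcomp f (j2 X Y) = mcomp g (j2 X Y) -> f = g.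
Proof.
move=> fm gm e1 e2; have [s [st sE]] := twisted_total (box_twisted T X Y).
apply: (mor_eq fm gm st) => p; rewrite -(ext_mof fm) -(ext_mof gm) sE (extM fm) (extM gm).
have := congr1 (@^~ p.1) e1; have := congr1 (@^~ p.2) e2; rewrite /mcomp /= => -> ->.
by [].
Qed.
Lemma box_eq X Y Z (f g : gmor (X ⊠ Y) Z) : f ∘ j1 X Y = g ∘ j1 X Y -> f ∘ j2 X Y = g ∘ j2 X Y -> f = g.
Proof.
move=> /(congr1 (@gfun _ _)) e1 /(congr1 (@gfun _ _)) e2; apply: gmor_eq.
by apply: box_mor_eq => //; exact: gmor_mor.
Qed.

Lemma unit_gmor Y : is_gmor (fun z : gunit T => (z : C) *: (1 : multiplier Y)).
Proof.
have gY := gco_mor Y; set eta := (fun z : gunit T => _).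
have em : is_mor eta.
  split.
  - move=> c x y z; rewrite -[RHS]/((c *: eta x + eta y) z); congr (mact _ z).
    by rewrite /eta scalerA -scalerDl.
  - by move=> x y; rewrite /eta mmulE scalemAl scalemAr mulr1 scalerA.
  - by move=> x; rewrite /eta adjZ adj1.
  apply/clspan_total2 => y r r0; exists [:: (1, ((1 : C) : gunit T, y))].
  by rewrite /comb big_seq1 /eta /= !scale1r subrr rn0.
have tm := tensor_is_mor M em (@mof_mor R A).
split=> //; apply/funext => z; rewrite /mcomp /eta (linZ (ext_lin gY)) (ext1 gY).
by rewrite [gco z](_ : _ = (z : C) *: (1 : multiplier _))// (linZ (ext_lin tm)) (ext1 tm).
Qed.
Definition eta Y : gmor (gunit T) Y := GMor (unit_gmor Y).

(** * A braiding exchanges the embeddings *)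

Section FromBraiding.
Variable c : forall X Y, X ⊠ Y -> multiplier (Y ⊠ X).
Arguments c : clear implicits.
Hypothesis cb : braiding c.
Lemma br_gmor X Y : is_gmor (c X Y). Proof. by case: cb => h _ _ _; case: (h X Y). Qed.
Definition bc X Y : gmor (X ⊠ Y) (Y ⊠ X) := GMor (br_gmor X Y).
Lemma bc_inv X Y : exists d : gmor (Y ⊠ X) (X ⊠ Y), d ∘ bc X Y = gid _.
Proof.
case: cb => h _ _ _; case: (h X Y) => _ [d dg [e _]]; exists (GMor dg); exact: gmor_eq.
Qed.
Lemma bc_nat X X' Y Y' (f : gmor X X') (g : gmor Y Y') : bc X' Y' ∘ bmap f g = bmap g f ∘ bc X Y.
Proof. by apply: gmor_eq; case: cb => _ h _ _; apply: h; exact: gmorP. Qed.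
Lemma bc_hex1 X Y Z : av Y Z X ∘ (bc X (Y ⊠ Z) ∘ av X Y Z) =
  bmap (gid Y) (bc X Z) ∘ (av Y X Z ∘ bmap (bc X Y) (gid Z)).
Proof. by apply: gmor_eq; case: cb. Qed.
Lemma bc_hex2 X Y Z : as_ Z X Y ∘ (bc (X ⊠ Y) Z ∘ as_ X Y Z) =
  bmap (bc X Z) (gid Y) ∘ (as_ X Z Y ∘ bmap (gid X) (bc Y Z)).
Proof. by apply: gmor_eq; case: cb. Qed.

(** The braiding with the unit object, read as an endomorphism of [X] through the unit constraints.
    Naturality along [eta] shows that [bc X Y] acts on the embedded [X] through [t1 X], whatever [Y]
    is. *)
Definition t1 X := lun X ∘ (bc X (gunit T) ∘ j1 X (gunit T)).
Definition t2 Y := run Y ∘ (bc (gunit T) Y ∘ j2 (gunit T) Y).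
Lemma bc1 X Y : bc X Y ∘ j1 X Y = j2 Y X ∘ t1 X.
Proof.
have -> : j2 Y X = bmap (eta Y) (gid X) ∘ j2 (gunit T) X by rewrite bmap2 gcomp1r.
rewrite -gcompA /t1 (gcompA (j2 _ _)) lun2 gcomp1l gcompA -bc_nat -gcompA bmap1 gcomp1r //.
Qed.
Lemma bc2 X Y : bc X Y ∘ j2 X Y = j1 Y X ∘ t2 Y.
Proof.
have -> : j1 Y X = bmap (gid Y) (eta X) ∘ j1 Y (gunit T) by rewrite bmap1 gcomp1r.
rewrite -gcompA /t2 (gcompA (j1 _ _)) run2 gcomp1l gcompA -bc_nat -gcompA bmap2 gcomp1r //.
Qed.
(* The first hexagon at (X, C, C) makes t1 X idempotent, and it is left invertible. *)
Lemma t1_id X : t1 X = gid X.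
Proof.
have [d dE] := bc_inv X (gunit T).
pose u := run X ∘ (d ∘ j2 (gunit T) X).
have ut : u ∘ t1 X = gid X.
  by rewrite /u /t1 -!gcompA (gcompA (j2 _ _)) lun2 gcomp1l (gcompA d) dE gcomp1l run1.
have tt : t1 X ∘ t1 X = t1 X.
  have := congr1 (fun z => z ∘ (j1 (X ⊠ gunit T) (gunit T) ∘ j1 X (gunit T))) (bc_hex1 X (gunit T) (gunit T)).
  rewrite -!gcompA av1 bc1 (gtail _ (bmap1 _ _)) -!gcompA bc1 (gcompA (av _ _ _)) av3.
  rewrite (gcompA (j1 _ _)) (gcompA (av _ _ _)) av2 -!gcompA (gtail _ (bmap2 _ _)) -!gcompA (gtail _ (bc1 _ _)).
  move/(congr1 (fun z => lun X ∘ (lun _ ∘ z))).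
  by rewrite -!gcompA !(gtail _ (lun1 _)) !gcomp1l !(gtail _ (lun1 _)) !gcomp1l => <-.
by rewrite -[t1 X]gcomp1l -ut -gcompA tt.
Qed.
(** Mirror image of [t1_id], with the second hexagon at (C, C, Y). *)
Lemma t2_id Y : t2 Y = gid Y.
Proof.
have [d dE] := bc_inv (gunit T) Y.
pose u := lun Y ∘ (d ∘ j1 Y (gunit T)).
have ut : u ∘ t2 Y = gid Y.
  by rewrite /u /t2 -!gcompA (gcompA (j1 _ _)) run2 gcomp1l (gcompA d) dE gcomp1l lun1.
have tt : t2 Y ∘ t2 Y = t2 Y.
  have := congr1 (fun z => z ∘ (j2 (gunit T) (gunit T ⊠ Y) ∘ j2 (gunit T) Y)) (bc_hex2 (gunit T) (gunit T) Y).
  rewrite -!gcompA as3 bc2 (gtail _ (bmap2 _ _)) -!gcompA bc2 (gcompA (as_ _ _ _)) as1.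
  rewrite (gcompA (j2 _ _)) (gcompA (as_ _ _ _)) as2 -!gcompA (gtail _ (bmap1 _ _)) -!gcompA (gtail _ (bc2 _ _)).
  move/(congr1 (fun z => run Y ∘ (run _ ∘ z))).
  by rewrite -!gcompA !(gtail _ (run1 _)) !gcomp1l !(gtail _ (run1 _)) !gcomp1l => <-.
by rewrite -[t2 Y]gcomp1l -ut -gcompA tt.
Qed.
Lemma braiding_crossed X Y : bc X Y ∘ j1 X Y = j2 Y X /\ bc X Y ∘ j2 X Y = j1 Y X.
Proof. by rewrite bc1 bc2 t1_id t2_id !gcomp1r. Qed.
End FromBraiding.

(** If $\mathcal L$ were 0, then [A] would be 0 and the trivial coaction on the unit object could
    not be injective. *)
Lemma qL_unit : exists e : qL G, rn e = 1.
Proof.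
have [//|z] := @unit_or_zero R (qL G); exfalso.
have A0 (a : A) : a = 0.
  by apply: (@piA_inj R M G); apply: mop_inj => h; rewrite [LHS]z [RHS]z.
have m0 (m n : multiplier (cplx_cstar R ⊗ A)) : m = n.
  apply: ten_multP => x a; rewrite (A0 a) (lin0 (pure_linr M x)).
  by rewrite (lin0 (mact_lin m)) (lin0 (mact_lin n)).
have [_ ti _ _] := unitP T.
have /eqP := ti (0 : C) (1 : C) (m0 _ _); apply/negP; rewrite eq_sym; exact: (@oner_neq0 C).
Qed.

(** Equivariance is automatic: both composites are determined on the embedded factors, where they
    agree because the embeddings are equivariant. *)
Lemma crossed_gmor X Y (f : X ⊠ Y -> multiplier (Y ⊠ X)) : is_mor f ->
  mcomp f (j1 X Y) = j2 Y X -> mcomp f (j2 X Y) = j1 Y X -> is_gmor f.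
Proof.
move=> fm f1 f2; split=> //; have mA := @mof_mor R A; have tm := tensor_is_mor M fm mA.
have g1 := gco_mor (X ⊠ Y); have g2 := gco_mor (Y ⊠ X).
have eqv Z (p : gmor Z (X ⊠ Y)) (q : gmor Z (Y ⊠ X)) : mcomp f p = q ->
    mcomp (mcomp (@gco _ _ _ _) f) p = mcomp (mcomp (tensor f (@mof R A)) (@gco _ _ _ _)) p.
  move=> pq; have [pm pe] := gmorP p; have [_ qe] := gmorP q.
  rewrite -mcompA// pq qe -mcompA// pe mcompA//; last exact: tensor_is_mor.
  by rewrite tensor_comp// pq mcomp_mofr.
by apply: box_mor_eq; [exact: mcomp_mor|exact: mcomp_mor|exact: (eqv _ _ (j2 Y X))|exact: (eqv _ _ (j1 Y X))].
Qed.

(** * Exchanging the embeddings is a symmetric braiding *)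

Section CrossedBraiding.
Variable c : forall X Y, gmor (X ⊠ Y) (Y ⊠ X).
Arguments c : clear implicits.
Hypotheses (c1 : forall X Y, c X Y ∘ j1 X Y = j2 Y X) (c2 : forall X Y, c X Y ∘ j2 X Y = j1 Y X).
Lemma crossed_inv X Y : c Y X ∘ c X Y = gid _.
Proof. by apply: box_eq; rewrite -gcompA gcomp1l ?c1 ?c2. Qed.
Lemma crossed_is_iso X Y : crossed_iso (c X Y).
Proof.
split; [|exact: (congr1 (@gfun _ _) (c1 X Y))|exact: (congr1 (@gfun _ _) (c2 X Y))].
split; first exact: gmor_mor; exists (c Y X); first exact: gmor_mor.
by split; [exact: (congr1 (@gfun _ _) (crossed_inv X Y))|exact: (congr1 (@gfun _ _) (crossed_inv Y X))].
Qed.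
Lemma crossed_nat X X' Y Y' (f : gmor X X') (g : gmor Y Y') : c X' Y' ∘ bmap f g = bmap g f ∘ c X Y.
Proof.
apply: box_eq; rewrite -!gcompA ?bmap1 ?bmap2 ?(gtail _ (c1 _ _)) ?(gtail _ (c2 _ _)) ?c1 ?c2 ?bmap1 ?bmap2 //.
Qed.
Lemma crossed_hex1 X Y Z : av Y Z X ∘ (c X (Y ⊠ Z) ∘ av X Y Z) =
  bmap (gid Y) (c X Z) ∘ (av Y X Z ∘ bmap (c X Y) (gid Z)).
Proof.
apply: box_eq; first apply: box_eq; rewrite -!gcompA.
- rewrite av1 c1 av3 (gtail _ (bmap1 _ _)) -!gcompA c1 av2 (gtail _ (bmap2 _ _)) -!gcompA c1 //.
- rewrite av2 (gtail _ (c2 _ _)) av1 (gtail _ (bmap1 _ _)) -!gcompA c2 av1 bmap1 gcomp1r //.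
- rewrite av3 (gtail _ (c2 _ _)) av2 bmap2 gcomp1r av3 (gtail _ (bmap2 _ _)) -!gcompA c2 //.
Qed.
Lemma crossed_hex2 X Y Z : as_ Z X Y ∘ (c (X ⊠ Y) Z ∘ as_ X Y Z) =
  bmap (c X Z) (gid Y) ∘ (as_ X Z Y ∘ bmap (gid X) (c Y Z)).
Proof.
apply: box_eq; last apply: box_eq; rewrite -!gcompA.
- rewrite as1 (gtail _ (c1 _ _)) as2 bmap1 gcomp1r as1 (gtail _ (bmap1 _ _)) -!gcompA c1 //.
- rewrite as2 (gtail _ (c1 _ _)) as3 (gtail _ (bmap2 _ _)) -!gcompA c1 as3 bmap2 gcomp1r //.
- rewrite as3 c2 as1 (gtail _ (bmap2 _ _)) -!gcompA c2 as2 (gtail _ (bmap1 _ _)) -!gcompA c2 //.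
Qed.
Lemma crossed_symmetric : symmetric_braiding (fun X Y => c X Y : _ -> _).
Proof.
split; last by move=> X Y; exact: (congr1 (@gfun _ _) (crossed_inv X Y)).
split.
- move=> X Y; split; first exact: gmorP; exists (c Y X); first exact: gmorP.
  by split; [exact: (congr1 (@gfun _ _) (crossed_inv X Y))|exact: (congr1 (@gfun _ _) (crossed_inv Y X))].
- move=> X X' Y Y' f g fg gg; exact: (congr1 (@gfun _ _) (crossed_nat (GMor fg) (GMor gg))).
- move=> X Y Z; exact: (congr1 (@gfun _ _) (crossed_hex1 X Y Z)).
- move=> X Y Z; exact: (congr1 (@gfun _ _) (crossed_hex2 X Y Z)).
Qed.
End CrossedBraiding.

Section WithUnit.
Variables (e : qL G) (e1 : rn e = 1).
Local Notation GA := (regular e1).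
Local Notation F := (GA ⊠ GA).
Let i : A -> multiplier F := j1 GA GA.
Let j : A -> multiplier F := j2 GA GA.

Lemma box_heisenberg : R_heisenberg Ru i j.
Proof. exact: twisted_heisenberg (box_twisted T GA GA). Qed.
Lemma box_neq0 : exists x : F, x != 0.
Proof. exact: twisted_neq0 (box_twisted T GA GA). Qed.

Lemma crossed_antisymmetric (f : gmor (GA ⊠ GA) (GA ⊠ GA)) :
  f ∘ j1 GA GA = j2 GA GA -> f ∘ j2 GA GA = j1 GA GA -> mstar Ru = ext (@flip R M U U) Ru.
Proof.
move=> /(congr1 (@gfun _ _)) f1 /(congr1 (@gfun _ _)) f2.
have {}f1 : mcomp f i = j by []. have {}f2 : mcomp f j = i by [].
have [im jm heis] := box_heisenberg; have fm := gmor_mor f; have [x x0] := box_neq0.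
have c := leg_cp3 M U U F.
pose l1 := @leg1 R M U U F; pose l2 := @leg2 R M U U F; pose l3 := @leg3 R M U U F.
rewrite -/l1 -/l2 -/l3 in c.
have l3m := cp2 c.1; have c12 := cp3_12 c.
have H1 := heis _ _ _ _ (cp3_pre3 fm c).
(* [H2] is the relation on the legs (2, 1, 3), obtained by permuting [c], whereas [H1] is the one on
   (1, 2, 3) after [f]. Once [f] has exchanged [i] and [j], their sides match crosswise, which
   leaves $R^u_{21}R^u_{12}=1$. *)
have H2 := heis _ _ _ _ (cp3_rot (cp3_swap23 (cp3_rot (cp3_rot (cp3_rot c))))).
rewrite -!(mcompA _ l3m fm) f1 f2 in H1.
have RU : unitary Ru by case: HR.
have vU1 : unitary V@[l2, mcomp l3 i] := V_unitary (cp_prer (cp3_23 c) im).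
have vU2 : unitary V@[l1, mcomp l3 j] := V_unitary (cp_prer (cp3_13 c) jm).
have [v1 v2] := unitary_mul vU1; have [w1 w2] := unitary_mul vU2.
have rU : unitary Ru@[l1, l2] := at_unitary c12 RU.
have [r1 r2] := unitary_mul rU.
rewrite H2 -!mulrA in H1.
have cancel (Q : cstar R) (a b a' b' z : multiplier Q) : a' * a = 1 -> b' * b = 1 -> a * b = a * (b * z) -> z = 1.
  move=> aa bb ab; have := congr1 (fun z => b' * (a' * z)) ab.
  by rewrite /= 2!(mulrA a') aa !mul1r mulrA bb mul1r.
have e21 := cancel _ _ _ _ _ _ w2 v2 H1.
have e2 : mstar Ru@[l1, l2] = Ru@[l2, l1] by rewrite -[LHS]mul1r -e21 -mulrA r1 mulr1.
(* The equality found so far lives on two legs of a triple tensor product; it descends because the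
   third factor is nonzero. *)
have nm : is_mor (tensor (@mof R U) (inl U F)) by apply: tensor_is_mor; [exact: mof_mor|exact: inl_is_mor].
have ni : injective (tensor (@mof R U) (inl U F)).
  by apply: tensor_inj; [exact: mof_mor|exact: inl_is_mor|exact: mof_inj|exact: inl_inj x0].
apply: (ext_inj nm ni); rewrite -leg_pair12 -/l1 -/l2 (at_adj c12) (at_flip c12) //.
Qed.

Section Antisymmetric.
Hypothesis anti : mstar Ru = ext (@flip R M U U) Ru.

(** The relation of [i] and [j] with the two universal legs exchanged; antisymmetry lets the factor
    $R^u$ change sides. *)
Lemma heisenberg_swap : R_heisenberg Ru j i.
Proof.
have [im jm heis] := box_heisenberg; split=> // Q x1 x2 k c.
have c' : cp3 M x2 x1 k by apply: cp3_rot; exact: cp3_swap23.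
have c12 := cp3_12 c; have RU : unitary Ru by case: HR.
have [r1 r2] := unitary_mul (at_unitary c12 RU).
by rewrite (heis _ _ _ _ c') -mulrA -(at_flip c12) -anti (at_adj c12) r2 mulr1.
Qed.

Lemma crossed_exists X Y : exists f : X ⊠ Y -> multiplier (Y ⊠ X),
  [/\ is_mor f, mcomp f (j1 X Y) = j2 Y X & mcomp f (j2 X Y) = j1 Y X].
Proof.
have [x x0] := box_neq0; have [im jm _] := box_heisenberg.
have [P1 [m1 n1 P1i P1j]] := twisted_embedding HR (box_twisted T X Y) box_heisenberg x0.
have [P2 [m2 n2 P2i P2j]] := twisted_embedding HR (box_twisted T Y X) heisenberg_swap x0.
have mF := @mof_mor R F; have fm := @flip_is_mor R M Y X; have fm' := @flip_is_mor R M X Y.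
have tm := tensor_is_mor M fm mF; pose t := tensor (@flip R M Y X) (@mof R F).
have tinj : injective t.
  apply: tensor_inj => //; last exact: mof_inj.
  have c := cp_sym (cp_inlr M Y X).
  have fK : mcomp (@flip R M X Y) (@flip R M Y X) = @mof R _ by rewrite [X in mcomp X _]/flip (cp_flip c) pair_inlr.
  move=> p q pq; apply: mof_inj; rewrite -fK /mcomp pq //.
have tm2 : is_mor (mcomp t P2) by exact: mcomp_mor.
have tn2 : injective (mcomp t P2) by exact: mcomp_inj.
have k := cp3_slots X Y F; have k' := cp3_slots Y X F.
have ii1 := @inl_is_mor R M (Y ⊗ X) F; have ii2 := @inr_is_mor R M (Y ⊗ X) F.
have ii3 := @inl_is_mor R M (X ⊗ Y) F; have ii4 := @inr_is_mor R M (X ⊗ Y) F.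
have tl : mcomp t (inl (Y ⊗ X) F) = mcomp (inl (X ⊗ Y) F) (@flip R M Y X) by exact: tensor_inl.
have tr : mcomp t (inr (Y ⊗ X) F) = inr (X ⊗ Y) F by rewrite tensor_inr// mcomp_mofr.
have E1 : mcomp (mcomp t P2) (j1 Y X) = slot2 X j.
  rewrite -mcompA// P2i /slot1 /slot2 mcompA//; last exact: cp_mor (cp_prer (cp3_13 k') jm).
  rewrite (pair_post (cp_prer (cp3_13 k') jm) tm) !mcompA// tl tr -mcompA// flip_inl //.
have E2 : mcomp (mcomp t P2) (j2 Y X) = slot1 Y i.
  rewrite -mcompA// P2j /slot1 /slot2 mcompA//; last exact: cp_mor (cp_prer (cp3_23 k') im).
  rewrite (pair_post (cp_prer (cp3_23 k') im) tm) !mcompA// tl tr -mcompA// flip_inr //.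
have [s [st sE]] := twisted_total (box_twisted T X Y).
have P1m : is_mor P1 := m1.
(* [P1] takes the product of embedded elements of [X] and [Y] to the value of the second embedding
   at the corresponding product in [M(Y ⊠ X)], so it lifts through that embedding. *)
have [||f [fmor fE]] := @lift_mor R _ (Y ⊠ X) _ _ s (fun p => j2 Y X p.1 * j1 Y X p.2) (mcomp t P2) P1 st tm2 tn2 m1.
- move=> p; rewrite (extM tm2).
  rewrite -(ext_mof m1) sE (extM m1) -!(mcompE P1) P1i P1j -!(mcompE (mcomp t P2)) E1 E2 //.
- apply: (total_trans (mor_total (gmor_mor (j2 Y X)))) => -[x' z] /=; have [u _ xu] := bounded (j2 Y X x').
  apply: (inspan_img (mact_lin (j2 Y X x')) xu _ (mor_total (gmor_mor (j1 Y X)) z)) => -[y w] /=.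
  exact: (inspan_gen _ ((x', y), w)).
exists f; split=> //; apply/funext => y; apply: (ext_inj tm2 tn2).
- rewrite -!mcompE mcompA // fE P1i E2 //.
- rewrite -!mcompE mcompA // fE P1j E1 //.
Qed.
End Antisymmetric.
End WithUnit.

Lemma braiding_antisymmetric (c : forall X Y, X ⊠ Y -> multiplier (Y ⊠ X)) :
  braiding c -> rmatrix_antisymmetric Rm.
Proof.
move=> cb; have [e e1] := qL_unit; have [h1 h2] := braiding_crossed cb (regular e1) (regular e1).
by apply: (antisymmetric_reduce HRu); exact: crossed_antisymmetric h1 h2.
Qed.

Lemma antisymmetric_crossed : rmatrix_antisymmetric Rm -> exists c : forall X Y, gmor (X ⊠ Y) (Y ⊠ X),
  forall X Y, c X Y ∘ j1 X Y = j2 Y X /\ c X Y ∘ j2 X Y = j1 Y X.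
Proof.
move=> h; have [e e1] := qL_unit; have anti := antisymmetric_lift HRu e1 h.
have H X Y : exists f : gmor (X ⊠ Y) (Y ⊠ X), f ∘ j1 X Y = j2 Y X /\ f ∘ j2 X Y = j1 Y X.
  have [f [fm f1 f2]] := crossed_exists e1 anti X Y.
  by exists (GMor (crossed_gmor fm f1 f2)); split; exact: gmor_eq.
exists (fun X Y => projT1 (cid (H X Y))) => X Y; exact: projT2 (cid (H X Y)).
Qed.
End FinalBraiding.

Theorem proposition4p6 (R : realType) (M : model R) (G : quantum_group M)
    (Rm : multiplier (ctens M (qAhat G) (qAhat G)))
    (D : universal_dual G)
    (Ru : multiplier (ctens M (uA D) (uA D)))
    (HR : quasitriangular Rm) (HRu : universal_lift Rm Ru)
    (T : boxtensor Ru) :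
  [/\ (exists c, braiding (T := T) c) <-> rmatrix_antisymmetric Rm,
      (exists c, symmetric_braiding (T := T) c) <-> rmatrix_antisymmetric Rm &
      rmatrix_antisymmetric Rm ->
        exists c : forall X Y : gcstar G, box T X Y -> multiplier (box T Y X),
          [/\ symmetric_braiding c,
              forall c', braiding c' -> forall X Y, c' X Y = c X Y,
              forall X Y, crossed_iso (c X Y) &
              forall X Y (f : box T X Y -> multiplier (box T Y X)),
                crossed_iso f -> f = c X Y]].
Proof.
have main : rmatrix_antisymmetric Rm ->
        exists c : forall X Y : gcstar G, box T X Y -> multiplier (box T Y X),
          [/\ symmetric_braiding c,
              forall c', braiding c' -> forall X Y, c' X Y = c X Y,
              forall X Y, crossed_iso (c X Y) &
              forall X Y (f : box T X Y -> multiplier (box T Y X)),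
                crossed_iso f -> f = c X Y].
  move=> h; have [c cE] := antisymmetric_crossed HRu T h.
  have c1 X Y := (cE X Y).1; have c2 X Y := (cE X Y).2.
  exists (fun X Y => c X Y : _ -> _); split.
  - exact: crossed_symmetric c1 c2.
  (* Any braiding agrees with [c] on both embedded factors. *)
  - move=> c' cb X Y; have [e1 e2] := braiding_crossed cb X Y.
    suff -> : c X Y = bc cb X Y by [].
    by apply: box_eq; rewrite ?e1 ?e2 ?c1 ?c2.
  - exact: crossed_is_iso c1 c2.
  - move=> X Y f [[fm _] f1 f2].
    apply: box_mor_eq => //; first exact: gmor_mor.
      by rewrite f1; exact: (esym (congr1 (@gfun _ _ _ _ _) (c1 X Y))).
    by rewrite f2; exact: (esym (congr1 (@gfun _ _ _ _ _) (c2 X Y))).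
split=> //; split.
- by case=> c cb; exact: (braiding_antisymmetric HRu cb).
- by move=> /main[c [[cb _] _ _ _]]; exists c.
- by case=> c [cb _]; exact: (braiding_antisymmetric HRu cb).
- by move=> /main[c [cs _ _ _]]; exists c.
Qed.
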